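(* Let $k$ be an algebraically closed field of characteristic $p>0$ and let $e\in\mathbb{R}_{>0}^r$ be an exponent. Then the following inclusions hold: (1) the set of all $\operatorname{mld}(0;A,\mathfrak{a}^e)$, where $(A,0)$ is a smooth (closed) point on a surface over $k$ and $\mathfrak{a}^e$ is a multi-ideal on $A$ with exponent $e$, is contained in the set of all $\operatorname{mld}(0;A_{\mathbb{C}},\mathfrak{b}^e)$, where $(A_{\mathbb{C}},0)$ is a smooth (closed) point on a surface over $\mathbb{C}$ and $\mathfrak{b}^e$ is a multi-ideal on $A_{\mathbb{C}}$ with exponent $e$; (2) the set of all $\operatorname{lct}(0;A,\mathfrak{a}^e)$, where $(A,0)$ is a smooth (closed) point on a surface over $k$ and $\mathfrak{a}^e$ is a multi-ideal on $A$ with exponent $e$, is contained in the set of all $\operatorname{lct}(0;A_{\mathbb{C}},\mathfrak{b}^e)$, where $(A_{\mathbb{C}},0)$ is a smooth (closed) point on a surface over $\mathbb{C}$ and $\mathfrak{b}^e$ is a multi-ideal on $A_{\mathbb{C}}$ with exponent $e$.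
   Context: A prime divisor $E$ over a normal variety $A$ is an irreducible divisor $E$ on a normal variety $A'$ with a proper birational morphism $\varphi:A'\to A$, up to identification of divisors $E_1\subset A_1$, $E_2\subset A_2$ when the induced birational map $A_1\dashrightarrow A_2$ is a local isomorphism at their generic points (equivalently, the corresponding divisorial valuation $v_E$). $E$ is a prime divisor over $(A,P)$ if $P$ is the generic point of $\varphi(E)$. $k_E$ is the coefficient of $K_{A'/A}$ at $E$, and $v_E(\mathfrak{a}):=\min\{v_E(f)\mid f\in\mathfrak{a}\}$. A multi-ideal $\mathfrak{a}^e=\mathfrak{a}_1^{e_1}\cdots\mathfrak{a}_r^{e_r}$ is a formal product of non-zero coherent ideal sheaves with exponent $e=(e_1,\dots,e_r)\in\mathbb{R}_{>0}^r$; for $c>0$, $(\mathfrak{a}^e)^c=\mathfrak{a}_1^{ce_1}\cdots\mathfrak{a}_r^{ce_r}$. All notions are local at the smooth point. The log discrepancy is $a(E;A,\mathfrak{a}^e):=k_E+1-\sum_{i=1}^r e_i v_E(\mathfrak{a}_i)$. $(A,\mathfrak{a}^e)$ is log canonical at $P$ if $a(E;A,\mathfrak{a}^e)\ge0$ for every exceptional prime divisor $E$ over $A$ whose center contains $P$. For $\dim A\ge2$, $\operatorname{mld}(P;A,\mathfrak{a}^e):=\inf\{a(E;A,\mathfrak{a}^e)\mid E\text{ a prime divisor over }(A,P)\}$ (either $\ge0$ or $-\infty$). $\operatorname{lct}(P;A,\mathfrak{a}^e):=\sup\{c\in\mathbb{R}_{>0}\mid (A,(\mathfrak{a}^e)^c)\text{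 is log canonical at }P\}$. *)

(* Defs.v *)
From HB Require Import structures.
From mathcomp Require Import all_boot all_order all_algebra.
From mathcomp Require Import all_classical all_reals ereal.
From mathcomp Require Export complex.

Set Implicit Arguments.
Unset Strict Implicit.
Unset Printing Implicit Defensive.

Import Order.TTheory GRing.Theory Num.Theory.

Local Open Scope classical_set_scope.
Local Open Scope ring_scope.

(* Varieties over k are encoded as Zariski models (Chevalley schemata): an
   integral separated scheme of finite type over k with function field K is
   determined by the set of its local rings, all viewed as subrings of K.  A
   point of the variety is its local ring, the generic point is K itself, and
   birational maps are identities on K.  See Zariski-Samuel, Commutative
   Algebra II, VI.17, and EGA I, 8. *)

(* * Subrings of a field *)

Section Subrings.
Context (K : fieldType).
Implicit Types (O B I : set K).

Definition is_subring B :=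
  [/\ B 1, forall x y, B x -> B y -> B (x - y)
         & forall x y, B x -> B y -> B (x * y)].

Definition is_ideal B I :=
  [/\ I `<=` B, I 0, forall x y, I x -> I y -> I (x + y)
         & forall x y, B x -> I y -> I (x * y)].

Definition is_prime_ideal B I :=
  [/\ is_ideal B I, ~ I 1
    & forall x y, B x -> B y -> I (x * y) -> I x \/ I y].

Definition krull_chain B (n : nat) (c : nat -> set K) :=
  (forall i, (i <= n)%N -> is_prime_ideal B (c i)) /\
  (forall i, (i < n)%N -> c i `<` c i.+1).

Definition krull_dim B (n : nat) :=
  (exists c, krull_chain B n c) /\ ~ (exists c, krull_chain B n.+1 c).

Definition integrally_closed B :=
  forall (x : K) (f : {poly K}),
    f \is monic -> (forall i, B f`_i) -> root f x -> B x.

(* The extension I B_q of I to the localization of B at a prime ideal q;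
   taking I = B gives the local ring B_q. *)
Definition localize B (q I : set K) : set K :=
  [set z | exists x s, [/\ I x, B s, ~ q s & z = x / s]].

Definition unit_of O : set K := [set u | [/\ u != 0, O u & O u^-1]].

(* The maximal ideal, when O is local. *)
Definition max_ideal O : set K := [set x | O x /\ ~ unit_of O x].

Definition dominates O' O := O `<=` O' /\ max_ideal O' `&` O = max_ideal O.

Definition regular_local O :=
  exists d, krull_dim O d /\
    exists g : 'I_d -> K, max_ideal O =
      [set z | exists c : 'I_d -> K,
                 (forall i, O (c i)) /\ z = \sum_(i < d) c i * g i].

(* The valuation of f != 0 when O is a discrete valuation ring of K. *)
Definition ord O (f : K) : int :=
  xget 0 [set n | exists t u : K,
    [/\ max_ideal O = [set t * x | x in O], unit_of O u & f = u * t ^ n]].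

(* Zero elements of the ideal have order +oo, hence do not contribute. *)
Definition ord_ideal O I : int :=
  xget 0 [set n | (exists f, [/\ I f, f != 0 & ord O f = n]) /\
                  (forall f, I f -> f != 0 -> n <= ord O f)].

End Subrings.

Section Varieties.
Context (k K : fieldType) (iota : {rmorphism k -> K}).
Implicit Types (B O E P Q V I : set K) (X Y : set (set K)).

(* * Models of K over k *)

Definition is_subalg B := is_subring B /\ forall c, B (iota c).

Definition fin_gen B :=
  exists s : seq K,
    B = \bigcap_(C in [set C | is_subalg C /\ (forall x, x \in s -> C x)]) C.

Definition affine_model B :=
  [/\ is_subalg B, fin_gen B
    & forall x, exists a b, [/\ B a, B b, b != 0 & x = a / b]].

Definition Spec B : set (set K) :=
  [set P | exists2 q, is_prime_ideal B q & P = localize B q B].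

Definition valuation_ring V := is_subalg V /\ forall x, V x \/ V x^-1.

(* The second condition is separatedness, by the valuative criterion. *)
Definition variety X :=
  (exists n (B : 'I_n.+1 -> set K),
     (forall i, affine_model (B i)) /\ X = \bigcup_i Spec (B i)) /\
  (forall V P Q, valuation_ring V -> X P -> X Q ->
     dominates V P -> dominates V Q -> P = Q).

Definition normal_variety X :=
  variety X /\ forall P, X P -> integrally_closed P.

Definition variety_dim X (n : nat) :=
  (exists2 P, X P & krull_dim P n) /\
  (forall P m, X P -> krull_dim P m -> (m <= n)%N).

(* Q specializes to P, i.e. P lies in the closure of Q; for points of one
   variety this is inclusion of local rings. *)
Definition specializes Q P := P `<=` Q.

Definition closed_point X P :=
  X P /\ forall Q, X Q -> specializes P Q -> Q = P.

Definition smooth_surface_point X P :=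
  [/\ normal_variety X, variety_dim X 2, closed_point X P & regular_local P].

(* The identity of K induces a proper morphism Y -> X; properness is the
   valuative criterion. *)
Definition proper_birational Y X :=
  (forall P', Y P' -> exists2 P, X P & dominates P' P) /\
  (forall V P, valuation_ring V -> X P -> dominates V P ->
     exists2 P', Y P' & dominates V P').

(* * Prime divisors over X *)

(* A prime divisor is represented by the local ring of its generic point;
   divisors on different models are identified when these rings coincide. *)
Definition prime_divisor_over X E :=
  exists Y, [/\ normal_variety Y, proper_birational Y X, Y E & krull_dim E 1].

Definition center X E Q := X Q /\ dominates E Q.

(* The center Q of the divisor is not itself a divisor. *)
Definition exceptional_center Q := ~ krull_dim Q 1.

(* * Rational 2-forms and the relative canonical divisor *)

Record derivation := Derivation {
  der_fun :> K -> K;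
  derD : forall x y, der_fun (x + y) = der_fun x + der_fun y;
  derM : forall x y, der_fun (x * y) = x * der_fun y + y * der_fun x;
  der_const : forall c, der_fun (iota c) = 0 }.

(* When K is finitely generated over k, the rational 2-forms (the second
   exterior power of the Kaehler differentials of K / k) are the alternating
   K-bilinear forms on the derivations; a /\-form da /\ db is given by its
   values. *)
Definition dd (a b : K) : derivation -> derivation -> K :=
  fun D D' => D a * D' b - D b * D' a.

(* The image of the 2-forms of O in the rational 2-forms.  For O regular and
   essentially of finite type over a perfect field k, the 2-forms of O are
   torsion-free, so this is the stalk of the canonical sheaf. *)
Definition Omega2 O : set (derivation -> derivation -> K) :=
  [set w | exists n (c a b : 'I_n -> K),
     [/\ forall i, O (c i), forall i, O (a i), forall i, O (b i)
       & w = fun D D' => \sum_(i < n) c i * dd (a i) (b i) D D']].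

Definition generates2 O (w : derivation -> derivation -> K) :=
  Omega2 O = [set (fun D D' => c * w D D') | c in O].

(* k_E, where Q is the center of E: with w a generator of the canonical sheaf
   at Q, the divisor of w is the pullback of zero near Q, so the coefficient
   at E of K_Y - phi^* K_X is the order of w along E. *)
Definition canonical_coef Q E : int :=
  xget 0 [set n | exists w v (f : K),
    [/\ generates2 Q w, generates2 E v, f != 0,
        w = (fun D D' => f * v D D') & ord E f = n]].

(* * Multi-ideals and their invariants *)

(* An ideal sheaf is given by its stalks; only the stalks at points of X are
   relevant. *)
Definition coherent_ideal X (a : set K -> set K) :=
  forall B, affine_model B -> Spec B `<=` X ->
    exists2 I, is_ideal B I &
      forall q, is_prime_ideal B q -> a (localize B q B) = localize B q I.

Definition nonzero_ideal X (a : set K -> set K) :=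
  exists P x, [/\ X P, a P x & x != 0].

Definition multi_ideal X (r : nat) (a : 'I_r -> set K -> set K) :=
  forall i, coherent_ideal X (a i) /\ nonzero_ideal X (a i).

Section Invariants.
Context (R : realType) (r : nat).
Implicit Types (a : 'I_r -> set K -> set K) (e : 'I_r -> R).

(* Q is the center of E. *)
Definition log_discrepancy Q E a e : R :=
  (canonical_coef Q E)%:~R + 1 -
  \sum_(i < r) e i * (ord_ideal E (a i Q))%:~R.

Definition log_canonical X P a e :=
  forall E Q, prime_divisor_over X E -> center X E Q ->
    exceptional_center Q -> specializes Q P -> 0 <= log_discrepancy Q E a e.

Definition mld X P a e : \bar R :=
  ereal_inf [set (log_discrepancy P E a e)%:E |
              E in [set E | prime_divisor_over X E /\ center X E P]].

Definition lct X P a e : \bar R :=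
  ereal_sup [set c%:E |
    c in [set c : R | 0 < c /\ log_canonical X P a (fun i => c * e i)]].

End Invariants.
End Varieties.

Definition mld_set (k : fieldType) (R : realType) (r : nat) (e : 'I_r -> R) :
    set (\bar R) :=
  [set m | exists (K : fieldType) (iota : {rmorphism k -> K})
             (A : set (set K)) (P : set K) (a : 'I_r -> set K -> set K),
     [/\ smooth_surface_point iota A P, multi_ideal iota A a
       & m = mld iota A P a e]].

Definition lct_set (k : fieldType) (R : realType) (r : nat) (e : 'I_r -> R) :
    set (\bar R) :=
  [set m | exists (K : fieldType) (iota : {rmorphism k -> K})
             (A : set (set K)) (P : set K) (a : 'I_r -> set K -> set K),
     [/\ smooth_surface_point iota A P, multi_ideal iota A a
       & m = lct iota A P a e]].

(* Main.v *)
(* Let O be the local ring of a smooth point of a surface.  If the multi-ideal is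
   log canonical there, then in suitable coordinates x, y the log discrepancy of
   every divisor E over the point is bounded below by that of the weighted
   blow-up with weights proportional to (ord_E x, ord_E y).  Indeed, for weights
   p, q >= 2, if the strict transforms meet the exceptional curve at a free point
   with intersection number d (weighted by the exponents), then
   d p q <= sum e_i v(a_i) <= p + q, so d <= 1 and inversion of adjunction
   applies.  For weights (p, 1) the free points with d > 1 are removed one after
   the other by replacing x with x - P(y); this stops because the numbers
   sum e_i n_i do not accumulate at 1.  So the mld is the infimum over coprime
   weights of an expression in the sets of exponents occurring in the a_i, and
   the monomial ideals on the complex plane with these exponents have the same
   mld.  If the pair is not log canonical, both mlds are -oo.

   For the lct c, use the coordinates adapted to the exponent c e.  Unless
   c sum e_i m_i = 1 for some integers m_i, the discreteness of these sums makes
   them work for exponents slightly beyond c e as well, so the monomial ideals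
   have the same lct; in the exceptional case the ideals (x^m_i) do.

   A smooth point in characteristic p has the required local structure because,
   for q = p^s, O is spanned over O^q by the monomials x^i y^j with i, j < q,
   while a dimension count over K^q bounds the algebraic independence over k. *)

Require Import Defs.
From mathcomp Require Import all_boot all_order all_algebra.
From mathcomp Require Import all_classical all_reals.
From mathcomp Require Import ereal ring lra zify.
From mathcomp Require generic_quotient.

Set Implicit Arguments.
Unset Strict Implicit.
Unset Printing Implicit Defensive.

Import Order.TTheory GRing.Theory Num.Theory.

Local Open Scope classical_set_scope.
Local Open Scope ring_scope.

(** * Subrings and localization *)

(** The definitions know a variety only through subrings of its function field, so the geometry of a
    smooth point is distilled into the record [regpt]. Positive characteristic serves only to show
    that a smooth point satisfies it and that any three functions are algebraically dependent. The
    origin of the plane has the same two properties over every algebraically closed field, so the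
    arguments on divisors are free of the characteristic and apply to both sides.

    A second reduction replaces prime divisors centered at the point by [reach], the divisors
    obtained by repeatedly blowing up points. One direction is Zariski's argument with differential
    forms, the other constructs the blown-up varieties. From there on mld and log canonicity are
    matters of induction on blow-ups.

    Coefficients cannot be carried from k to the complex numbers; only sets of exponents can. This
    forces the search for coordinates in which the exponents determine everything. The comparison is
    stated for a second exponent e' beside e because the lct requires the same coordinates for all c
    e with c near the threshold. *)

Section Subrings.
Context (K : fieldType).
Implicit Types (A B C I L O P Q q : set K) (x y z t : K).

Lemma sr1 O : is_subring O -> O 1. Proof. by case. Qed.
Lemma srB O x y : is_subring O -> O x -> O y -> O (x - y).
Proof. by case=> _ h _; apply: h. Qed.
Lemma srM O x y : is_subring O -> O x -> O y -> O (x * y).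
Proof. by case=> _ _; apply. Qed.
Lemma sr0 O : is_subring O -> O 0.
Proof. by move=> h; rewrite -(subrr 1); apply: srB => //; apply: sr1. Qed.
Lemma srN O x : is_subring O -> O x -> O (- x).
Proof. by move=> h hx; rewrite -sub0r; apply: srB => //; apply: sr0. Qed.
Lemma srD O x y : is_subring O -> O x -> O y -> O (x + y).
Proof. by move=> h hx hy; rewrite -(opprK y); apply: srB => //; apply: srN. Qed.
Lemma srX O x n : is_subring O -> O x -> O (x ^+ n).
Proof.
move=> h hx; elim: n => [|n IH]; first exact: sr1.
by rewrite exprS; apply: srM.
Qed.
Lemma sr_sum O (T : Type) (s : seq T) (p : pred T) (F : T -> K) :
  is_subring O -> (forall i, p i -> O (F i)) -> O (\sum_(i <- s | p i) F i).
Proof. by move=> h hF; apply: big_ind => // [|a b]; [exact: sr0|exact: srD]. Qed.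

End Subrings.

Ltac fd := field; repeat (apply/andP; split); assumption.
(** [sr] proves membership in a subring from the membership of the atoms; many proofs below bring
    unnamed facts into the context only to feed it. *)
Ltac sr := repeat first [ assumption | match goal with
  | H : is_subring ?O |- ?O (_ + _) => apply: (srD H)
  | H : is_subring ?O |- ?O (_ * _) => apply: (srM H)
  | H : is_subring ?O |- ?O (- _) => apply: (srN H)
  | H : is_subring ?O |- ?O (_ ^+ _) => apply: (srX _ H)
  | H : is_subring ?O |- ?O 1 => exact: (sr1 H)
  | H : is_subring ?O |- ?O 0 => exact: (sr0 H)
  end ].

Section Localization.
Context (K : fieldType).
Implicit Types (A B C I L O P Q q : set K) (x y z t : K).

Lemma unit1 O : is_subring O -> unit_of O 1.
Proof. by move=> h; split; rewrite ?oner_eq0 ?invr1 //; sr. Qed.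
Lemma unitM O x y : is_subring O -> unit_of O x -> unit_of O y -> unit_of O (x * y).
Proof. by move=> h [x0 ? ?] [y0 ? ?]; split; rewrite ?mulf_neq0 // ?invfM; sr. Qed.
Lemma unitV O x : unit_of O x -> unit_of O x^-1.
Proof. by case=> x0 h1 h2; split; rewrite ?invr_eq0 // invrK. Qed.
Lemma unitX O x n : is_subring O -> unit_of O x -> unit_of O (x ^+ n).
Proof.
move=> h hx; elim: n => [|n IH]; first exact: unit1.
by rewrite exprS; apply: unitM.
Qed.
Lemma unit_sub B L x : B `<=` L -> unit_of B x -> unit_of L x.
Proof. by move=> BL [x0 h1 h2]; split=> //; apply: BL. Qed.
Lemma unit_divr O x y : is_subring O -> O x -> O y -> unit_of O (x * y) -> unit_of O x.
Proof.
move=> h hx hy [xy0 _ hi]; move: (xy0); rewrite mulf_eq0 negb_or => /andP[x0 y0].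
by split=> //; rewrite (_ : x^-1 = y * (x * y)^-1); [sr|fd].
Qed.

Definition is_local L := is_subring L /\
  forall x y, L x -> L y -> unit_of L (x + y) -> unit_of L x \/ unit_of L y.

Lemma max_sub L x : max_ideal L x -> L x. Proof. by case. Qed.
Lemma max_nunit L x : max_ideal L x -> ~ unit_of L x. Proof. by case. Qed.
Lemma max_idealD L x y : is_local L ->
  max_ideal L x -> max_ideal L y -> max_ideal L (x + y).
Proof.
move=> [h hl] [hx ux] [hy uy]; split; first by sr.
by move=> /hl []; auto.
Qed.
Lemma max_idealM L x y : is_subring L ->
  L x -> max_ideal L y -> max_ideal L (x * y).
Proof.
move=> h hx [hy uy]; split; first by sr.
by move=> u; apply: uy; apply: (@unit_divr _ y x) => //; rewrite mulrC.
Qed.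
Lemma max_ideal0 L : is_subring L -> max_ideal L 0.
Proof. by move=> h; split; [sr|case; rewrite eqxx]. Qed.
Lemma max_idealN L x : is_subring L -> max_ideal L x -> max_ideal L (- x).
Proof. by move=> h hx; rewrite -mulN1r; apply: max_idealM => //; sr. Qed.
Lemma max_ideal1 L : is_subring L -> ~ max_ideal L 1.
Proof. by move=> h [_]; apply; apply: unit1. Qed.
Lemma unit_or_max L x : L x -> unit_of L x \/ max_ideal L x.
Proof. by move=> hx; case: (EM (unit_of L x)); [left|right]. Qed.
Lemma max_prime L x y : is_subring L -> L x -> L y ->
  max_ideal L (x * y) -> max_ideal L x \/ max_ideal L y.
Proof.
move=> h hx hy [hxy nu]; case: (unit_or_max hx); last by left.
move=> ux; case: (unit_or_max hy); last by right.
by move=> uy; case: nu; apply: unitM.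
Qed.
Lemma unitD_max L x y : is_local L -> unit_of L x -> max_ideal L y -> unit_of L (x + y).
Proof.
move=> hl ux my; have [h _] := hl; have [_ hx _] := ux.
have hy := max_sub my.
have hxy : L (x + y) by sr.
case: (unit_or_max hxy) => // m; case: (max_nunit (L := L) (x := x)) => //.
by rewrite -(addrK y x); apply: max_idealD => //; apply: max_idealN.
Qed.

Lemma ideal_sub B I x : is_ideal B I -> I x -> B x. Proof. by case=> h _ _ _; apply: h. Qed.
Lemma ideal0 B I : is_ideal B I -> I 0. Proof. by case. Qed.
Lemma idealD B I x y : is_ideal B I -> I x -> I y -> I (x + y).
Proof. by case=> _ _ h _; apply: h. Qed.
Lemma idealM B I x y : is_ideal B I -> B x -> I y -> I (x * y).
Proof. by case=> _ _ _; apply. Qed.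
Lemma idealN B I x : is_subring B -> is_ideal B I -> I x -> I (- x).
Proof. by move=> h hI hx; rewrite -mulN1r; apply: (idealM hI) => //; sr. Qed.
Lemma idealB B I x y : is_subring B -> is_ideal B I -> I x -> I y -> I (x - y).
Proof. by move=> h hI hx hy; apply: (idealD hI) => //; apply: (idealN h hI). Qed.

Lemma prime_ideal_of B q : is_prime_ideal B q -> is_ideal B q. Proof. by case. Qed.
Lemma prime_neq0 B q s : is_prime_ideal B q -> ~ q s -> s != 0.
Proof. by move=> [hi _ _] qs; apply/eqP => s0; apply: qs; rewrite s0; apply: (ideal0 hi). Qed.
Lemma primeM B q s t : is_prime_ideal B q -> B s -> B t -> ~ q s -> ~ q t -> ~ q (s * t).
Proof. by move=> [_ _ hp] hs ht qs qt /hp []. Qed.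

Lemma localize_ideal_ring B q I : is_subring B -> is_prime_ideal B q -> is_ideal B I ->
  is_ideal (localize B q B) (localize B q I).
Proof.
move=> h hq hI; have [qi q1 qp] := hq; split.
- by move=> _ [x [s [hx hs qs ->]]]; exists x, s; split=> //; exact: ideal_sub hx.
- by exists 0, 1; split=> //; [exact: (ideal0 hI)|sr|rewrite mul0r].
- move=> _ _ [x [s [hx hs qs ->]]] [y [t [hy ht qt ->]]].
  have s0 := prime_neq0 hq qs; have t0 := prime_neq0 hq qt.
  exists (t * x + s * y), (s * t); split=> //; [|sr|exact: primeM hq _ _ _ _|by fd].
  by apply: (idealD hI); apply: (idealM hI).
- move=> _ _ [x [s [hx hs qs ->]]] [y [t [hy ht qt ->]]].
  have s0 := prime_neq0 hq qs; have t0 := prime_neq0 hq qt.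
  exists (x * y), (s * t); split=> //; [|sr|exact: primeM hq _ _ _ _|by fd].
  by apply: (idealM hI).
Qed.

Lemma ideal_self B : is_subring B -> is_ideal B B.
Proof. by move=> h; split=> //; [sr|move=> ? ? ? ?; sr|move=> ? ? ? ?; sr]. Qed.

Lemma localize_subring B q : is_subring B -> is_prime_ideal B q -> is_subring (localize B q B).
Proof.
move=> h hq; have hi := localize_ideal_ring h hq (ideal_self h); have [qi q1 qp] := hq.
have l1 : localize B q B 1 by exists 1, 1; split=> //; rewrite ?divr1 //; sr.
split=> //; last by move=> x y hx hy; apply: (idealM hi).
move=> x y hx hy; apply: (idealD hi) => //; rewrite -mulN1r; apply: (idealM hi) => //.
by exists (-1), 1; split=> //; rewrite ?divr1 //; sr.
Qed.

Lemma localize_sub B q : is_subring B -> is_prime_ideal B q -> B `<=` localize B q B.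
Proof. by move=> h [_ q1 _] x hx; exists x, 1; split=> //; rewrite ?divr1 //; sr. Qed.

Lemma localize_unit B q a : is_subring B -> is_prime_ideal B q -> B a ->
  unit_of (localize B q B) a <-> ~ q a.
Proof.
move=> h hq ha; have [qi q1 qp] := hq; split=> [[a0 _ [x [s [hx hs qs e]]]] qa|qa].
  apply: qs; rewrite (_ : s = x * a); first by apply: (idealM qi).
  have s0 : s != 0 by apply/eqP => s0; move: e; rewrite s0 invr0 mulr0 => /eqP; rewrite invr_eq0 (negbTE a0).
  by have -> : x = a^-1 * s; [rewrite e divfK|fd].
have a0 := prime_neq0 hq qa; split=> //; first exact: localize_sub.
by exists 1, a; split=> //; [sr|rewrite div1r].
Qed.

Lemma localize_local B q : is_subring B -> is_prime_ideal B q -> is_local (localize B q B).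
Proof.
move=> h hq; have hs := localize_subring h hq; split=> //.
have [qi _ _] := hq.
move=> _ _ [x [s [hx hs' qs ->]]] [y [t [hy ht qt ->]]] u.
have s0 := prime_neq0 hq qs; have t0 := prime_neq0 hq qt.
have us : unit_of (localize B q B) s by apply/localize_unit.
have ut : unit_of (localize B q B) t by apply/localize_unit.
case: (EM (q x)) => qx; last by left; apply: unitM => //; [apply/localize_unit|apply: unitV].
case: (EM (q y)) => qy; last by right; apply: unitM => //; [apply/localize_unit|apply: unitV].
have : unit_of (localize B q B) ((x / s + y / t) * (s * t)) by apply: unitM => //; apply: unitM.
rewrite (_ : _ * _ = t * x + s * y); last by fd.
have hb : B (t * x + s * y) by sr.
by move/(localize_unit h hq hb); case; apply: (idealD qi); apply: (idealM qi).
Qed.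

Lemma localize_max B q a : is_subring B -> is_prime_ideal B q -> B a ->
  max_ideal (localize B q B) a <-> q a.
Proof.
move=> h hq ha; split=> [[_ nu]|qa].
  by apply: contrapT => qa; apply: nu; apply/localize_unit.
by split; [exact: localize_sub|move/(localize_unit h hq ha)].
Qed.

Lemma Spec_local B P : is_subring B -> Spec B P -> is_local P.
Proof. by move=> h [q hq ->]; apply: localize_local. Qed.

Lemma dom_sub O' O : dominates O' O -> O `<=` O'. Proof. by case. Qed.
Lemma dom_max O' O x : dominates O' O -> max_ideal O x -> max_ideal O' x.
Proof. by move=> [_ <-] []. Qed.
Lemma dom_unit O' O x : dominates O' O -> O x -> unit_of O' x -> unit_of O x.
Proof.
move=> d hx u; case: (unit_or_max hx) => // /(dom_max d) /max_nunit; by case.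
Qed.
Lemma dominatesP O' O : O `<=` O' -> (forall x, max_ideal O x -> max_ideal O' x) -> dominates O' O.
Proof.
move=> s h; split=> //; rewrite eqEsubset; split=> x; last by move=> m; split; [exact: h|case: m].
move=> [[_ nu] hx]; split=> // u; apply: nu; exact: unit_sub u.
Qed.
Lemma dom_trans O1 O2 O3 : dominates O1 O2 -> dominates O2 O3 -> dominates O1 O3.
Proof.
move=> d1 d2; apply: dominatesP => [x /(dom_sub d2) /(dom_sub d1)//|x].
by move=> /(dom_max d2) /(dom_max d1).
Qed.
Lemma dom_refl O : dominates O O. Proof. exact: dominatesP. Qed.

(* The local ring of the center of L on Spec B. *)
Definition ctr B L := [set z | exists a s, [/\ B a, B s, unit_of L s & z = a / s]].

(** Domination makes an element of B a unit of Q exactly when it is a unit of L, so L alone decides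
    which denominators occur. This is the separatedness of an affine model. *)
Lemma ctr_eq B Q L : is_subring B -> Spec B Q -> dominates L Q -> Q = ctr B L.
Proof.
move=> h [q hq ->] d; rewrite eqEsubset; split=> _ [a [s [ha hs qs ->]]]; exists a, s; split=> //.
  by apply: unit_sub (dom_sub d) _; apply/localize_unit.
move=> /(localize_max h hq hs) /(dom_max d); by case.
Qed.

Lemma ctr_prime B L : is_subring B -> is_local L -> B `<=` L ->
  is_prime_ideal B (max_ideal L `&` B).
Proof.
move=> h hl BL; have [hL _] := hl; split.
- split; first by move=> x [].
  + by split; [apply: max_ideal0|sr].
  + by move=> x y [? ?] [? ?]; split; [apply: max_idealD|sr].
  + by move=> x y hx [? ?]; split; [apply: max_idealM => //; apply: BL|sr].
- by case=> /(max_ideal1 hL).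
- move=> x y hx hy [m _]; case: (max_prime hL (BL _ hx) (BL _ hy) m); by [left|right].
Qed.

Lemma ctrE B L : is_subring B -> is_local L -> B `<=` L ->
  ctr B L = localize B (max_ideal L `&` B) B.
Proof.
move=> h hl BL; rewrite eqEsubset; split=> _ [a [s [ha hs us ->]]]; exists a, s; split=> //.
  by move=> [] [_].
case: (unit_or_max (BL _ hs)) => // m; by case: us.
Qed.

Lemma Spec_ctr B L : is_subring B -> is_local L -> B `<=` L -> Spec B (ctr B L).
Proof. by move=> h hl BL; exists (max_ideal L `&` B); [exact: ctr_prime|exact: ctrE]. Qed.

Lemma ctr_sub B L : is_subring B -> is_local L -> B `<=` L -> B `<=` ctr B L.
Proof. by move=> h hl BL; rewrite ctrE //; apply: localize_sub => //; apply: ctr_prime. Qed.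

Lemma ctr_dom B L : is_subring B -> is_local L -> B `<=` L -> dominates L (ctr B L).
Proof.
move=> h hl BL; have [hL _] := hl.
have sub : ctr B L `<=` L by move=> _ [a [s [ha hs [_ _ us] ->]]]; apply: srM => //; apply: BL.
apply: dominatesP => // z hz; have [[a [s [ha hs us e]]] nu] := hz.
case: (unit_or_max (sub _ (proj1 hz))) => // u; case: nu; split; first by case: u.
  by case: hz.
have a0 : a != 0 by apply: contra_neq (let: And3 h _ _ := u in h) => a0; rewrite e a0 mul0r.
exists s, a; split=> //; last by rewrite e invfM invrK mulrC.
rewrite (_ : a = z * s); first exact: unitM.
by rewrite e divfK //; case: us.
Qed.

(** Elements of B' that are units of L are already units of the center on B. Charts are compared
    through this: a larger ring inside the local ring of the center sees the same point. *)
Lemma ctr_trans B B' L : is_subring B -> is_subring B' -> is_local L ->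
  B `<=` L -> B `<=` B' -> B' `<=` ctr B L -> ctr B' L = ctr B L.
Proof.
move=> h h' hl BL BB BC; have [hL _] := hl.
rewrite eqEsubset; split=> z [a [s [ha hs us ->]]]; last first.
  by exists a, s; split=> //; apply: BB.
have d := ctr_dom h hl BL.
have hc : is_subring (ctr B L) by rewrite ctrE //; apply: localize_subring => //; apply: ctr_prime.
apply: (srM hc); first exact: BC.
by have [] := dom_unit d (BC _ hs) us.
Qed.

Lemma ctr_self B Q : is_subring B -> Spec B Q -> Q = ctr B Q.
Proof. by move=> h hQ; apply: ctr_eq => //; apply: dom_refl. Qed.

Lemma Spec_sub B Q : is_subring B -> Spec B Q -> B `<=` Q.
Proof. by move=> h [q hq ->]; apply: localize_sub. Qed.

Lemma max_prime_ideal L : is_local L -> is_prime_ideal L (max_ideal L).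
Proof.
move=> hl; have := ctr_prime (proj1 hl) hl (@subset_refl _ L).
by rewrite (_ : max_ideal L `&` L = max_ideal L) // eqEsubset; split=> [x []|x []].
Qed.

End Localization.

(** * Adjoining one element to a subring *)

Section Adjoin.
Context (K : fieldType).
Implicit Types (A C : set K) (P Q : {poly K}) (x t c : K).

Definition pin A (P : {poly K}) := forall i, A P`_i.

Lemma pinC A c : is_subring A -> A c -> pin A c%:P.
Proof. by move=> h hc i; rewrite coefC; case: ifP => // _; sr. Qed.
Lemma pinX A : is_subring A -> pin A 'X.
Proof. by move=> h i; rewrite coefX; case: (i == 1%N); [exact: sr1|exact: sr0]. Qed.
Lemma pinXn A n : is_subring A -> pin A 'X^n.
Proof. by move=> h i; rewrite coefXn; case: (i == n); [exact: sr1|exact: sr0]. Qed.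
Lemma pinD A P Q : is_subring A -> pin A P -> pin A Q -> pin A (P + Q).
Proof. by move=> h hP hQ i; rewrite coefD; move: (hP i) (hQ i) => *; sr. Qed.
Lemma pinN A P : is_subring A -> pin A P -> pin A (- P).
Proof. by move=> h hP i; rewrite coefN; move: (hP i) => *; sr. Qed.
Lemma pinM A P Q : is_subring A -> pin A P -> pin A Q -> pin A (P * Q).
Proof.
move=> h hP hQ i; rewrite coefM; apply: sr_sum => // j _.
by move: (hP j) (hQ (i - j)%N) => *; sr.
Qed.
Lemma pinZ A c P : is_subring A -> A c -> pin A P -> pin A (c *: P).
Proof. by move=> h hc hP i; rewrite coefZ; move: (hP i) => *; sr. Qed.
Lemma pin_horner A P x : is_subring A -> pin A P -> A x -> A P.[x].
Proof.
move=> h hP hx; rewrite horner_coef; apply: sr_sum => // i _.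
by move: (hP i) => *; sr.
Qed.

Definition adj A t := [set z | exists2 P, pin A P & z = P.[t]].

Lemma adj_subring A t : is_subring A -> is_subring (adj A t).
Proof.
move=> h; split.
- by exists 1; rewrite ?hornerE //; apply: pinC => //; sr.
- move=> _ _ [P hP ->] [Q hQ ->]; exists (P - Q); rewrite ?hornerE //.
  by apply: pinD => //; apply: pinN.
- move=> _ _ [P hP ->] [Q hQ ->]; exists (P * Q); rewrite ?hornerE //.
  exact: pinM.
Qed.
Lemma adj_sub A t : is_subring A -> A `<=` adj A t.
Proof. by move=> h x hx; exists x%:P; rewrite ?hornerE //; apply: pinC. Qed.
Lemma adj_gen A t : is_subring A -> adj A t t.
Proof. by move=> h; exists 'X; rewrite ?hornerE //; apply: pinX. Qed.
Lemma adj_min A C t : is_subring C -> A `<=` C -> C t -> adj A t `<=` C.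
Proof. by move=> h sAC Ct _ [P hP ->]; apply: pin_horner => // i; apply: sAC. Qed.

End Adjoin.

(** * Regular local rings of dimension two *)

Section Derivations.
Context (k K : fieldType) (iota : {rmorphism k -> K}).
Implicit Types (D : derivation iota) (S O : set K) (x y z t : K).

Lemma der0 D : D 0 = 0.
Proof. by have := derD D 0 0; rewrite addr0 => /eqP; rewrite -subr_eq subrr => /eqP. Qed.
Lemma derN D x : D (- x) = - D x.
Proof. by apply/eqP; rewrite -addr_eq0 addrC -derD subrr der0. Qed.
Lemma derB D x y : D (x - y) = D x - D y.
Proof. by rewrite derD derN. Qed.
Lemma der1 D : D 1 = 0.
Proof. by rewrite -(rmorph1 iota) der_const. Qed.
Lemma der_div D x y : y != 0 -> D (x / y) = (D x - (x / y) * D y) / y.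
Proof.
move=> y0; have := derM D (x / y) y; rewrite divfK // => ->.
by field.
Qed.

(* The forms dx and dy generate the differentials of S. *)
Definition omega S x y := forall f, S f -> exists f1 f2, [/\ S f1, S f2
  & forall D, D f = f1 * D x + f2 * D y].

(** The Leibniz rule at work; thanks to it [omega] has to be checked on generators only. *)
Lemma omega_ring S x y : is_subring S -> is_subring [set f | S f /\ exists f1 f2,
  [/\ S f1, S f2 & forall D, D f = f1 * D x + f2 * D y]].
Proof.
move=> h.
split.
- split; first by sr.
  by exists 0, 0; split; try sr; move=> D; rewrite der1; ring.
- move=> a b [ha [a1 [a2 [? ? ea]]]] [hb [b1 [b2 [? ? eb]]]]; split; first by sr.
  exists (a1 - b1), (a2 - b2); split; try sr; move=> D.
  by rewrite derB ea eb; ring.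
- move=> a b [ha [a1 [a2 [? ? ea]]]] [hb [b1 [b2 [? ? eb]]]]; split; first by sr.
  exists (a * b1 + b * a1), (a * b2 + b * a2); split; try sr; move=> D.
  by rewrite derM ea eb; ring.
Qed.

(** In the chart x = t y one has dx = y dt + t dy, and the remaining elements are polynomials in t
    over O. *)
Lemma omega_adj O t y : is_subalg iota O -> O y -> omega O (t * y) y -> omega (adj O t) t y.
Proof.
move=> [h hc] hy ho; set A := adj O t.
have hA : is_subring A by apply: adj_subring.
have OA : O `<=` A by apply: adj_sub.
have At : A t by apply: adj_gen.
have Ay := OA _ hy.
pose C := [set f | A f /\ exists f1 f2, [/\ A f1, A f2
  & forall D, D f = f1 * D t + f2 * D y]].
suff: adj O t `<=` C by move=> s f /s [].
have hC : is_subring C := omega_ring t y hA.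
apply: adj_min => //.
- move=> f form; split; first exact: OA.
  have [f1 [f2 [h1 h2 e]]] := ho f form; have a1 := OA _ h1; have a2 := OA _ h2.
  exists (y * f1), (t * f1 + f2); split; try sr; move=> D.
  by rewrite e derM; ring.
- split=> //; exists 1, 0; split; try sr; move=> D; ring.
Qed.

Lemma omega_loc S S' x y : is_subring S' -> S `<=` S' ->
  (forall z, S' z -> exists a s, [/\ S a, S s, s != 0, S' s^-1 & z = a / s]) ->
  omega S x y -> omega S' x y.
Proof.
move=> h SS hS ho z /hS [a [s [ha hs s0 si e]]].
have [a1 [a2 [/SS ? /SS ? ea]]] := ho a ha.
have [s1 [s2 [/SS ? /SS ? es]]] := ho s hs.
have hz : S' z by rewrite e; apply: srM => //; apply: SS.
exists ((a1 - z * s1) / s), ((a2 - z * s2) / s); split; try sr.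
by move=> D; rewrite {1}e der_div // -e ea es; ring.
Qed.

Lemma omega_generates O x y : is_subring O -> O x -> O y -> omega O x y ->
  generates2 O (dd (iota := iota) x y).
Proof.
move=> h hx hy ho; rewrite /generates2 eqEsubset; split.
- move=> w [n [c [a [b [hc ha hb ->]]]]].
  have hab i : exists g, O g /\ forall D D', dd (a i) (b i) D D' = g * dd x y D D'.
    have [a1 [a2 [? ? ea]]] := ho _ (ha i); have [b1 [b2 [? ? eb]]] := ho _ (hb i).
    exists (a1 * b2 - a2 * b1); split; first by sr.
    by move=> D D'; rewrite /dd !ea !eb; ring.
  have /choice [g hg] := hab.
  exists (\sum_(i < n) c i * g i).
    by apply: sr_sum => // i _; apply: srM => //; case: (hg i).
  apply/funext => D; apply/funext => D'; rewrite mulr_suml; apply: eq_bigr => i _.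
  by have [_ ->] := hg i; rewrite mulrA.
- move=> _ [c hc <-]; exists 1%N, (fun=> c), (fun=> x), (fun=> y); split=> //.
  by apply/funext => D; apply/funext => D'; rewrite big_ord1.
Qed.

End Derivations.

(** * Powers of the maximal ideal and orders of elements *)

Section RegularPoints.
Context (k : closedFieldType) (K : fieldType) (iota : {rmorphism k -> K}).
Implicit Types (O : set K) (x y z t f g : K) (p q : {poly k}).

(* The n-th power of the ideal (x, y). *)
Fixpoint M O x y n : set K := if n is n'.+1
  then [set z | exists f g, [/\ M O x y n' f, M O x y n' g & z = x * f + y * g]]
  else O.

(* The form y^d p(x / y) of degree d. *)
Definition form d p x y := \sum_(i < d.+1) iota p`_i * x ^+ i * y ^+ (d - i).

(* O is a regular local ring with residue field k and fraction field K, and x, y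
   are local parameters: rp_ind says that the associated graded ring is
   k[x, y], rp_sep is Krull's intersection theorem, and by the last two fields
   dx, dy is a basis of the differentials. *)
Record regpt O x y : Prop := Regpt {
  rp_alg : is_subalg iota O;
  rp_x : O x;
  rp_y : O y;
  rp_res : forall f, O f -> exists c g h, [/\ O g, O h & f = iota c + x * g + y * h];
  rp_unit : forall g h, O g -> O h -> unit_of O (1 + x * g + y * h);
  rp_ind : forall d p, (size p <= d.+1)%N -> M O x y d.+1 (form d p x y) -> p = 0;
  rp_sep : forall f, O f -> f != 0 -> exists n, ~ M O x y n f;
  rp_frac : forall z, exists a b, [/\ O a, O b, b != 0 & z = a / b];
  rp_om : omega iota O x y;
  rp_dd : exists D D' : derivation iota, dd x y D D' != 0 }.

Lemma hfE d p x y : y != 0 -> (size p <= d.+1)%N ->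
  form d p x y = y ^+ d * (map_poly iota p).[x / y].
Proof.
move=> y0 sp; rewrite (@horner_coef_wide _ d.+1) ?size_map_poly // mulr_sumr.
apply: eq_bigr => i _; rewrite coef_map expr_div_n.
have yi : y ^+ i != 0 by rewrite expf_neq0.
have -> : y ^+ d = y ^+ (d - i) * y ^+ i by rewrite -exprD subnK // -ltnS.
fd.
Qed.

Section Powers.
Variables (O : set K) (x y : K).
Hypotheses (hO : is_subalg iota O) (hx : O x) (hy : O y).
Let h : is_subring O := proj1 hO.

Lemma M_D n f g : M O x y n f -> M O x y n g -> M O x y n (f + g).
Proof.
elim: n f g => [|n IH] f g /=; first exact: srD.
move=> [a [b [ha hb ->]]] [c [d [hc hd ->]]].
by exists (a + c), (b + d); split; [exact: IH|exact: IH|ring].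
Qed.
Lemma M_mulO n f g : O f -> M O x y n g -> M O x y n (f * g).
Proof.
move=> form; elim: n g => [|n IH] g /=; first exact: srM.
by move=> [a [b [ha hb ->]]]; exists (f * a), (f * b); split; [exact: IH|exact: IH|ring].
Qed.
Lemma M_N n f : M O x y n f -> M O x y n (- f).
Proof. by move=> form; rewrite -mulN1r; apply: M_mulO => //; sr. Qed.
Lemma M_B n f g : M O x y n f -> M O x y n g -> M O x y n (f - g).
Proof. by move=> form hg; apply: M_D => //; apply: M_N. Qed.
Lemma M_O n f : M O x y n f -> O f.
Proof.
elim: n f => [|n IH] f //= [a [b [/IH ha /IH hb ->]]]; sr.
Qed.
Lemma M_0 n : M O x y n 0.
Proof.
elim: n => [|n IH] /=; first exact: sr0.
by exists 0, 0; split=> //; ring.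
Qed.
Lemma M_S n f : M O x y n.+1 f -> M O x y n f.
Proof.
elim: n f => [|n IH] f; first exact: M_O.
by move=> [a [b [ha hb ->]]]; exists a, b; split=> //; apply: IH.
Qed.
Lemma M_le n l f : (n <= l)%N -> M O x y l f -> M O x y n f.
Proof.
move=> /subnK <-; elim: (l - n)%N => [|j IH] //; rewrite addSn => /M_S; exact: IH.
Qed.
Lemma M_sum n (T : Type) (s : seq T) (p : pred T) (F : T -> K) :
  (forall i, p i -> M O x y n (F i)) -> M O x y n (\sum_(i <- s | p i) F i).
Proof. by move=> hF; apply: big_ind => // [|a b]; [exact: M_0|exact: M_D]. Qed.
Lemma M_M n l f g : M O x y n f -> M O x y l g -> M O x y (n + l) (f * g).
Proof.
elim: n f => [|n IH] f; first exact: M_mulO.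
move=> [a [b [ha hb ->]]] hg; exists (a * g), (b * g).
by split; [exact: IH|exact: IH|ring].
Qed.
Lemma M_ct n c f : M O x y n f -> M O x y n (iota c * f).
Proof. by apply: M_mulO; apply: (proj2 hO). Qed.
Lemma M_x : M O x y 1 x.
Proof. by exists 1, 0; split; [exact: sr1|exact: sr0|ring]. Qed.
Lemma M_y : M O x y 1 y.
Proof. by exists 0, 1; split; [exact: sr0|exact: sr1|ring]. Qed.
Lemma M_X n f : M O x y 1 f -> M O x y n (f ^+ n).
Proof.
move=> form; elim: n => [|n IH]; first exact: sr1.
by rewrite exprS -add1n; apply: M_M.
Qed.
Lemma form_M d p : M O x y d (form d p x y).
Proof.
apply: M_sum => i _; rewrite -mulrA; apply: M_ct.
have le : (i <= d)%N by rewrite -ltnS.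
by rewrite -{1}(subnKC le); apply: M_M; apply: M_X; [exact: M_x|exact: M_y].
Qed.
End Powers.

Lemma M_incl O x y x' y' n f : is_subalg iota O -> O x -> O y ->
  M O x y 1 x' -> M O x y 1 y' -> M O x' y' n f -> M O x y n f.
Proof.
move=> hO hx hy mx my; elim: n f => [|n IH] f // [a [b [/IH ha /IH hb ->]]].
by apply: (M_D hO); rewrite -add1n; apply: (M_M hO).
Qed.

End RegularPoints.

Section RegularPoints2.
Context (k : closedFieldType) (K : fieldType) (iota : {rmorphism k -> K}).
Context (O : set K) (x y : K).
Hypothesis (rp : regpt iota O x y).
Implicit Types (z t f g : K) (p q : {poly k}).
Let hO : is_subalg iota O := rp_alg rp.
Let h : is_subring O := proj1 hO.
Let hx := rp_x rp.
Let hy := rp_y rp.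
Local Notation Mn := (M O x y).

Lemma rp_x0 : x != 0.
Proof.
have [D [D' d]] := rp_dd rp; apply: contra_neq d => ->.
by rewrite /dd !der0; ring.
Qed.
Lemma rp_y0 : y != 0.
Proof.
have [D [D' d]] := rp_dd rp; apply: contra_neq d => ->.
by rewrite /dd !der0; ring.
Qed.

Lemma rp_max z : max_ideal O z <-> Mn 1 z.
Proof.
split=> [[hz nu]|[f [g [form hg ->]]]].
  have [c [a [b [ha hb e]]]] := rp_res rp hz.
  have [c0|c0] := eqVneq c 0.
    by exists a, b; split=> //; rewrite e c0 rmorph0 add0r.
  have ic0 : iota c != 0 by rewrite fmorph_eq0.
  case: nu; rewrite (_ : z = iota c * (1 + x * (iota c^-1 * a) + y * (iota c^-1 * b))).
    apply: unitM => //; last by apply: (rp_unit rp); apply: srM => //; apply: (proj2 hO).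
    by split=> //; rewrite -?fmorphV; apply: (proj2 hO).
  by rewrite fmorphV e; fd.
split; first by rewrite /= in form hg; sr.
move=> u; have [_ _ hi] := u; set w := x * f + y * g in u hi.
have := rp_unit rp (g := - (f / w)) (h := - (g / w)).
rewrite (_ : 1 + _ + _ = 0); last first.
  have w0 : w != 0 by case: u.
  by rewrite -[1](mulfV w0) {1}/w; ring.
by case; rewrite ?eqxx //=; rewrite /= in form hg; sr.
Qed.

Lemma rp_local : is_local O.
Proof.
split=> // a b ha hb u; case: (unit_or_max ha); first by left.
case: (unit_or_max hb); first by right.
move=> /rp_max mb /rp_max ma; case: (@max_nunit _ O (a + b)) => //.
by apply/rp_max; apply: (M_D hO).
Qed.

Lemma form_step n p q : (size p <= n.+1)%N -> (size q <= n.+1)%N ->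
  form iota n.+1 ('X * p + q) x y = x * form iota n p x y + y * form iota n q x y.
Proof.
move=> sp sq; have y0 := rp_y0; rewrite !hfE //.
  rewrite rmorphD rmorphM /= map_polyX hornerD hornerM hornerX exprS; fd.
apply: leq_trans (size_polyD _ _) _; rewrite geq_max (leqW sq) andbT.
apply: leq_trans (size_polyMleq _ _) _; rewrite size_polyX; exact: sp.
Qed.

(** p is the initial form of f in degree n; since the residue field is k, its coefficients can be
    taken in k. *)
Lemma Msplit n f : Mn n f -> exists2 p : {poly k}, (size p <= n.+1)%N & Mn n.+1 (f - form iota n p x y).
Proof.
elim: n f => [|n IH] f.
  move=> hf'; have [c [a [b [ha hb e]]]] := rp_res rp hf'.
  exists c%:P; first by rewrite size_polyC; case: (c != 0).
  exists a, b; split=> //; rewrite /form big_ord1 coefC eqxx !mulr1 e; ring.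
move=> [a [b [ha hb ->]]]; have [p sp hp] := IH _ ha; have [q sq hq] := IH _ hb.
exists ('X * p + q).
  apply: leq_trans (size_polyD _ _) _; rewrite geq_max (leqW sq) andbT.
  by apply: leq_trans (size_polyMleq _ _) _; rewrite size_polyX.
by rewrite form_step //; exists (a - form iota n p x y), (b - form iota n q x y); split=> //; ring.
Qed.

Lemma form_mul n l p q : (size p <= n.+1)%N -> (size q <= l.+1)%N ->
  form iota (n + l) (p * q) x y = form iota n p x y * form iota l q x y.
Proof.
move=> sp sq; have y0 := rp_y0; rewrite !hfE //; last first.
  by apply: leq_trans (size_polyMleq _ _) _; lia.
by rewrite rmorphM /= hornerM exprD; ring.
Qed.

Lemma form_notM d p : (size p <= d.+1)%N -> p != 0 -> ~ Mn d.+1 (form iota d p x y).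
Proof. by move=> sp p0 /(rp_ind rp sp) e; rewrite e eqxx in p0. Qed.

Lemma M_lead n f p : (size p <= n.+1)%N -> Mn n.+1 (f - form iota n p x y) ->
  p = 0 <-> Mn n.+1 f.
Proof.
move=> sp m; split=> [p0|mf].
  by move: m; rewrite p0 /form big1 ?subr0 // => i _; rewrite coef0 rmorph0 !mul0r.
apply: (rp_ind rp sp); rewrite (_ : form _ _ _ _ _ = f - (f - form iota n p x y)); last by ring.
exact: (M_B hO).
Qed.

(** The associated graded ring k[x, y] is a domain, so initial forms multiply to a nonzero form. *)
Lemma M_mul_not n l f g : Mn n f -> ~ Mn n.+1 f -> Mn l g -> ~ Mn l.+1 g ->
  ~ Mn (n + l).+1 (f * g).
Proof.
move=> mf nf mg ng.
have [p sp hp] := Msplit mf; have [q sq hq] := Msplit mg.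
have pq : (size (p * q)%R <= (n + l).+1)%N by apply: leq_trans (size_polyMleq _ _) _; lia.
have e : Mn (n + l).+1 (f * g - form iota (n + l) (p * q) x y).
  rewrite form_mul // (_ : _ - _ = (f - form iota n p x y) * g +
    form iota n p x y * (g - form iota l q x y)); last by ring.
  apply: (M_D hO); first by rewrite -addSn; apply: (M_M hO).
  by rewrite -addnS; apply: (M_M hO) => //; exact: form_M.
move/(M_lead pq e)/eqP; rewrite mulf_eq0 => /orP[] /eqP e0.
  by apply: nf; apply/(M_lead sp hp).
by apply: ng; apply/(M_lead sq hq).
Qed.

Definition mult f n := Mn n f /\ ~ Mn n.+1 f.

Lemma mult_ex f : O f -> f != 0 -> exists n, mult f n.
Proof.
move=> form f0; have [n] := rp_sep rp form f0; elim: n => [|n IH] hn; first by case: hn.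
by case: (EM (Mn n f)) => // hn'; exists n.
Qed.
Lemma mult_le f n l : mult f n -> Mn l f -> (l <= n)%N.
Proof.
move=> [_ nf] m; rewrite leqNgt; apply/negP => lt; apply: nf; exact: (M_le hO hx hy lt m).
Qed.
Lemma mult_uniq f n l : mult f n -> mult f l -> n = l.
Proof.
by move=> a b; apply/eqP; rewrite eqn_leq (mult_le b (proj1 a)) (mult_le a (proj1 b)).
Qed.
Lemma mult_neq0 f n : mult f n -> f != 0.
Proof. by move=> [_ nf]; apply/eqP => f0; apply: nf; rewrite f0; exact: (M_0 _ _ hO). Qed.
Lemma mult_M f g n l : mult f n -> mult g l -> mult (f * g) (n + l).
Proof.
move=> [a b] [c d]; split; first by apply: (M_M hO).
exact: M_mul_not.
Qed.
Lemma mult_y : mult y 1.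
Proof.
split; first exact: (M_y _ _ hO).
have := @form_notM 1 1; rewrite size_poly1 oner_neq0 /form big_ord_recr big_ord1 /= !coefC /=.
by rewrite !rmorph0 rmorph1 !mul1r !mul0r addr0; apply.
Qed.
Lemma mult_x : mult x 1.
Proof.
split; first exact: (M_x _ _ hO).
have := @form_notM 1 'X; rewrite size_polyX polyX_eq0 /form big_ord_recr big_ord1 /= !coefX /=.
by rewrite !rmorph0 rmorph1 !mul1r !mul0r add0r mulr1; apply.
Qed.
Lemma mult_X f n j : mult f n -> mult (f ^+ j) (j * n).
Proof.
move=> m; elim: j => [|j IH]; last by rewrite exprS mulSn; apply: mult_M.
split; first exact: sr1.
by move=> /rp_max; apply: max_ideal1.
Qed.
Lemma mult_yn n : mult (y ^+ n) n. Proof. by rewrite -{2}(muln1 n); apply/mult_X/mult_y. Qed.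
Lemma mult_unit f : unit_of O f -> mult f 0.
Proof.
move=> u; split; first by case: u.
by move=> /rp_max; case.
Qed.
Lemma mult_div f g n l : mult f n -> O g -> mult (f * g) (n + l) -> mult g l.
Proof.
move=> mf hg mfg; have : g != 0.
  by move: (mult_neq0 mfg); rewrite mulf_eq0 negb_or => /andP[].
move=> /(mult_ex hg)[j mg]; have := mult_uniq mfg (mult_M mf mg).
by move/addnI => ->.
Qed.
Lemma M_divy n g : O g -> Mn n.+1 (y * g) -> Mn n g.
Proof.
move=> hg m; have [->|g0] := eqVneq g 0; first exact: (M_0 _ _ hO).
have [j mg] := mult_ex hg g0; have := mult_le (mult_M mult_y mg) m.
by rewrite add1n ltnS => le; apply: (M_le hO hx hy le); case: mg.
Qed.

End RegularPoints2.

(** * Changes of local parameters *)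

Section Coordinates.
Context (k : closedFieldType) (K : fieldType) (iota : {rmorphism k -> K}).
Implicit Types (O : set K) (x y z t f g : K) (p q : {poly k}).

Lemma omega_sub1 O x y x' y' : is_subring O ->
  (exists a b, [/\ O a, O b & forall D : derivation iota, D x = a * D x' + b * D y']) ->
  (exists a b, [/\ O a, O b & forall D : derivation iota, D y = a * D x' + b * D y']) ->
  omega iota O x y -> omega iota O x' y'.
Proof.
move=> h [a [b [ha hb ex]]] [c [d [hc hd ey]]] ho f /ho [f1 [f2 [h1 h2 e]]].
exists (f1 * a + f2 * c), (f1 * b + f2 * d); split; try sr.
by move=> D; rewrite e ex ey; ring.
Qed.

(** The only field that is not formal is [rp_ind]: over an algebraically closed field a binary form
    splits into linear factors, each of order 1 by the independence hypothesis, and orders add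
    up. *)
Lemma regpt_change O x y x' y' : regpt iota O x y ->
  M O x y 1 x' -> M O x y 1 y' -> M O x' y' 1 x -> M O x' y' 1 y ->
  (forall a b, M O x y 2 (iota a * x' + iota b * y') -> a = 0 /\ b = 0) ->
  omega iota O x' y' -> (exists D D' : derivation iota, dd x' y' D D' != 0) ->
  regpt iota O x' y'.
Proof.
move=> rp mx my [x1 [x2 [hx1 hx2 ex]]] [y1 [y2 [hy1 hy2 ey]]] hind ho hd.
have hO := rp_alg rp; have h := proj1 hO; have hx := rp_x rp; have hy := rp_y rp.
rewrite /= in hx1 hx2 hy1 hy2.
have hx' := M_O hO hx hy mx; have hy' := M_O hO hx hy my.
split=> //.
- move=> f form; have [c [a [b [ha hb e]]]] := rp_res rp form.
  exists c, (x1 * a + y1 * b), (x2 * a + y2 * b); split; try sr.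
  by rewrite e {1}ex {1}ey; ring.
- move=> a b ha hb; rewrite -addrA; apply: (unitD_max (rp_local rp)).
    exact: unit1.
  apply/(rp_max rp); apply: (M_D hO); rewrite mulrC; exact: (M_mulO hO).
- move=> d p sp m; apply/eqP; case: (eqVneq p 0) => // p0.
  have {}m := M_incl hO hx hy mx my m.
  have y'0 : y' != 0.
    have [D [D' d0]] := hd; apply: contra_neq d0 => ->.
    by rewrite /dd !der0; ring.
  have muy : mult O x y y' 1.
    split=> // m2; have := hind 0 1; rewrite rmorph0 rmorph1 mul0r add0r mul1r.
    by case=> // _ /eqP; rewrite oner_eq0.
  have muf (z : k) : mult O x y (x' - iota z * y') 1.
    split; first by apply: (M_B hO) => //; apply: (M_ct hO).
    move=> m2; have := hind 1 (- z); rewrite rmorph1 mul1r rmorphN mulNr.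
    by case=> // /eqP; rewrite oner_eq0.
  have [r er] := closed_field_poly_normal p.
  have sr_ : size p = (size r).+1.
    by rewrite er size_scale ?lead_coef_eq0 // size_prod_XsubC.
  suff mup : mult O x y (form iota d p x' y') d by case: mup.
  have -> : form iota d p x' y' =
      iota (lead_coef p) * y' ^+ (d - size r) * \prod_(z <- r) (x' - iota z * y').
    rewrite hfE // er [lead_coef (_ *: _)](_ : _ = lead_coef p); last by rewrite -er.
    rewrite map_polyZ hornerZ rmorph_prod horner_prod.
    have -> : y' ^+ d = y' ^+ (d - size r) * \prod_(z <- r) y'.
      rewrite big_const_seq count_predT iter_mulr_1 -exprD subnK //.
      by rewrite -ltnS -sr_.
    have -> : \prod_(z <- r) (x' - iota z * y') =
        (\prod_(z <- r) y') * \prod_(z <- r) (map_poly iota ('X - z%:P)).[x' / y'].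
      rewrite -big_split; apply: eq_bigr => z _.
      by rewrite rmorphB /= map_polyX map_polyC !hornerE; fd.
    ring.
  have muc : mult O x y (iota (lead_coef p)) 0.
    apply: (mult_unit rp); split; rewrite ?fmorph_eq0 ?lead_coef_eq0 //; first exact: (proj2 hO).
    by rewrite -fmorphV; apply: (proj2 hO).
  have mupr : mult O x y (\prod_(z <- r) (x' - iota z * y')) (size r).
    elim: (r) => [|z s IH]; first by rewrite big_nil; apply: (mult_unit rp); apply: unit1.
    by rewrite big_cons /= -add1n; apply: (mult_M rp).
  have := mult_M rp (mult_M rp muc (mult_X rp (d - size r) muy)) mupr.
  by rewrite muln1 add0n subnK // -ltnS -sr_.
- move=> f form f0; have [n nf] := rp_sep rp form f0; exists n => m; apply: nf.
  exact: (M_incl hO hx hy mx my m).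
- exact: (rp_frac rp).
Qed.

Lemma regpt_swap O x y : regpt iota O x y -> regpt iota O y x.
Proof.
move=> rp; have hO := rp_alg rp; have h := proj1 hO; have hx := rp_x rp; have hy := rp_y rp.
apply: (regpt_change rp).
- exact: (M_y _ _ hO).
- exact: (M_x _ _ hO).
- exact: (M_y _ _ hO).
- exact: (M_x _ _ hO).
- move=> a b m; have e : form iota 1 ('X * b%:P + a%:P) x y = iota a * y + iota b * x.
    by rewrite (form_step rp) ?size_polyC_leq1 // /form !big_ord1 !coefC /=; ring.
  have := rp_ind rp (d := 1) (p := 'X * b%:P + a%:P); rewrite e => /(_ _ m) => H.
  have {}H : 'X * b%:P + a%:P = 0.
    apply: H; apply: leq_trans (size_polyD _ _) _; rewrite geq_max.
    rewrite (leq_trans (size_polyC_leq1 a)) // andbT.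
    apply: leq_trans (size_polyMleq _ _) _; rewrite size_polyX.
    exact: size_polyC_leq1.
  have := congr1 (coefp 0) H; have := congr1 (coefp 1) H.
  by rewrite /= !coef0 !coefD !coefXM !coefC /= addr0 add0r.
- by apply: (omega_sub1 h _ _ (rp_om rp)); [exists 0, 1|exists 1, 0]; split; try sr; move=> D; ring.
- have [D [D' d]] := rp_dd rp; exists D', D.
  by rewrite (_ : dd y x D' D = dd x y D D') // /dd; ring.
Qed.

Lemma regpt_shift O x y g : regpt iota O x y -> O g -> regpt iota O (x + y * g) y.
Proof.
move=> rp hg; have hO := rp_alg rp; have h := proj1 hO; have hx := rp_x rp; have hy := rp_y rp.
have [g1 [g2 [hg1 hg2 eg]]] := rp_om rp hg.
(* 1 + y g1 is the Jacobian of the change, g1 being the coefficient of dx in dg. *)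
have u : unit_of O (1 + x * 0 + y * g1) by apply: (rp_unit rp) => //; sr.
rewrite mulr0 addr0 in u; have [u0 hu hui] := u.
have myg : M O x y 1 (y * g) by rewrite mulrC; apply: (M_mulO hO) => //; exact: (M_y _ _ hO).
have ed (D : derivation iota) : D (x + y * g) = (1 + y * g1) * D x + (g + y * g2) * D y :> K.
  by rewrite derD derM eg; ring.
apply: (regpt_change rp).
- by apply: (M_D hO) => //; exact: (M_x _ _ hO).
- exact: (M_y _ _ hO).
- exists 1, (- g); split; [exact: sr1|exact: srN|ring].
- exact: (M_y _ _ hO).
- move=> a b m; have [c [g3 [g4 [h3 h4 e]]]] := rp_res rp hg.
  have {}m : M O x y 2 (iota a * x + iota (a * c + b) * y).
    rewrite (_ : _ + _ = (iota a * (x + y * g) + iota b * y) - iota a * (y * (x * g3 + y * g4))); last first.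
      by rewrite e rmorphD rmorphM; ring.
    apply: (M_B hO) => //; apply: (M_ct hO); rewrite -[2%N]/(1 + 1)%N; apply: (M_M hO).
      exact: (M_y _ _ hO).
    by exists g3, g4.
  have e1 : form iota 1 ('X * a%:P + (a * c + b)%:P) x y = iota a * x + iota (a * c + b) * y.
    by rewrite (form_step rp) ?size_polyC_leq1 // /form !big_ord1 !coefC /=; ring.
  have := rp_ind rp (d := 1) (p := 'X * a%:P + (a * c + b)%:P); rewrite e1 => /(_ _ m) => H.
  have {}H : 'X * a%:P + (a * c + b)%:P = 0.
    apply: H; apply: leq_trans (size_polyD _ _) _; rewrite geq_max.
    rewrite (leq_trans (size_polyC_leq1 _)) // andbT.
    apply: leq_trans (size_polyMleq _ _) _; rewrite size_polyX.
    exact: size_polyC_leq1.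
  have := congr1 (coefp 0) H; have := congr1 (coefp 1) H.
  rewrite /= !coef0 !coefD !coefXM !coefC /= addr0 add0r => ->.
  by rewrite mul0r add0r.
- apply: (omega_sub1 h _ _ (rp_om rp)); [|by exists 0, 1; split; try sr; move=> D; ring].
  exists (1 + y * g1)^-1, (- (g + y * g2) / (1 + y * g1)); split; try sr.
  by move=> D; rewrite ed; fd.
- have [D [D' d]] := rp_dd rp; exists D, D'.
  have -> : dd (x + y * g) y D D' = (1 + y * g1) * dd x y D D'.
    by rewrite /dd !ed; ring.
  by rewrite mulf_neq0.
Qed.

Lemma M_change O x y x' y' f n : regpt iota O x y -> regpt iota O x' y' ->
  M O x y n f -> M O x' y' n f.
Proof.
move=> rp rp' m; have hO := rp_alg rp.
have mx z : M O x y 1 z -> M O x' y' 1 z by move/(rp_max rp)/(rp_max rp').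
exact: (M_incl hO (rp_x rp') (rp_y rp') (mx _ (M_x _ _ hO)) (mx _ (M_y _ _ hO)) m).
Qed.

Lemma mult_change O x y x' y' f n : regpt iota O x y -> regpt iota O x' y' ->
  mult O x y f n -> mult O x' y' f n.
Proof.
move=> rp rp' [m nm]; split; first exact: M_change m.
by move=> m'; apply: nm; apply: M_change m'.
Qed.

End Coordinates.

(** * Discrete valuation rings *)

Section DVR.
Context (K : fieldType).
Implicit Types (E : set K) (f g t u : K) (n m : int).

Definition dvr E := is_subring E /\ exists t, [/\ t != 0, max_ideal E t
  & forall f, f != 0 -> exists u n, unit_of E u /\ f = u * t ^ n].

Lemma unitXz E u n : is_subring E -> unit_of E u -> unit_of E (u ^ n).
Proof.
by move=> h hu; case: n => n; [exact: unitX|apply: unitV; exact: unitX].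
Qed.

Lemma unif_pow E t u n : is_subring E -> max_ideal E t -> unit_of E u ->
  unit_of E (u * t ^ n) -> n = 0.
Proof.
move=> h mt hu hn.
have {}hn : unit_of E (t ^ n).
  have u0 : u != 0 by case: hu.
  by rewrite (_ : t ^ n = u^-1 * (u * t ^ n)); [apply: unitM => //; apply: unitV|rewrite mulKf].
have no j : ~ unit_of E (t ^+ j.+1).
  by apply: max_nunit; rewrite exprSr; apply: max_idealM => //; apply: srX => //; case: mt.
case: n hn => [[|j] hn|j hn] //; first by case: (no j).
by case: (no j); move/unitV: hn; rewrite invrK.
Qed.

Lemma dvr_max E t : is_subring E -> max_ideal E t ->
  (forall f, f != 0 -> exists u n, unit_of E u /\ f = u * t ^ n) ->
  max_ideal E = [set t * x | x in E].
Proof.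
move=> h mt ht; rewrite eqEsubset; split=> [z mz|_ [x hx <-]]; last first.
  by rewrite mulrC; apply: max_idealM.
have [->|z0] := eqVneq z 0; first by exists 0; [sr|rewrite mulr0].
have [u [n [hu e]]] := ht z z0; have [_ hu1 _] := hu.
have hE := max_sub mt.
case: n e => [[|j]|j] e.
- by case: (max_nunit mz); rewrite e expr0z mulr1.
- by exists (u * t ^+ j); [sr|rewrite e -exprnP exprS; ring].
- case: (max_nunit (L := E) (x := u)) => //.
  have t0 : t != 0.
    by apply/eqP => t0; move: z0; rewrite e t0 NegzE -exprnN exprS mul0r invr0 mulr0 eqxx.
  rewrite (_ : u = t ^+ j.+1 * z); first by apply: max_idealM => //; sr.
  have tj : t ^+ j.+1 != 0 by rewrite expf_neq0.
  by rewrite e NegzE -exprnN mulrC divfK.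
Qed.

(** [ord] chooses some uniformizer and some representation; two uniformizers differ by a unit, so
    that every representation gives the value. *)
Lemma ord_unif E t u n : is_subring E -> t != 0 -> max_ideal E = [set t * x | x in E] ->
  unit_of E u -> ord E (u * t ^ n) = n.
Proof.
move=> h t0 em hu; rewrite /ord; case: xgetP => [m _ [t' [u' [em' hu' e]]]|/(_ n)]; last first.
  by case; exists t, u.
have mt : max_ideal E t by rewrite em; exists 1; [sr|rewrite mulr1].
have mt' : max_ideal E t' by rewrite em'; exists 1; [sr|rewrite mulr1].
have [a ha ea] : [set t * x | x in E] t' by rewrite -em.
have [b hb eb] : [set t' * x | x in E] t by rewrite -em'.
have ab : a * b = 1.
  by apply: (mulfI t0); rewrite mulrA ea eb mulr1.
have ua : unit_of E a.
  have a0 : a != 0 by apply: contra_eq_neq ab => ->; rewrite mul0r eq_sym oner_neq0.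
  split=> //; rewrite (_ : a^-1 = b) //; apply: (mulfI a0); by rewrite mulfV.
move: e; rewrite -ea expfzMl => e.
have [u'0 _ _] := hu'; have [u0 _ _] := hu; have [a0 _ _] := ua.
suff : n - m = 0 by move/eqP; rewrite subr_eq0 => /eqP ->.
apply: (@unif_pow E t (u * (u' * a ^ m)^-1)) => //.
  by apply: unitM => //; apply: unitV; apply: unitM => //; apply: unitXz.
have am0 : a ^ m != 0 by rewrite expfz_neq0.
have tm0 : t ^ m != 0 by rewrite expfz_neq0.
rewrite expfzDr // -invr_expz (_ : _ * _ = (u * t ^ n) / (u' * (t ^ m * a ^ m))); last by fd.
by rewrite e mulfV ?mulf_neq0 //; apply: unit1.
Qed.

Section Theory.
Variable E : set K.
Hypothesis hE : dvr E.
Let h : is_subring E := proj1 hE.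

Lemma dvr_ord_ex : exists t, [/\ t != 0, max_ideal E = [set t * x | x in E]
  & forall f, f != 0 -> exists u, unit_of E u /\ f = u * t ^ (ord E f)].
Proof.
have [_ [t [t0 mt ht]]] := hE; have em := dvr_max h mt ht.
exists t; split=> // f f0; have [u [n [hu e]]] := ht f f0.
by exists u; split=> //; rewrite {2}e ord_unif.
Qed.

Lemma ordM f g : f != 0 -> g != 0 -> ord E (f * g) = ord E f + ord E g.
Proof.
have [t [t0 em ht]] := dvr_ord_ex.
move=> /ht [u [hu eu]] /ht [v [hv ev]].
rewrite {1}eu {1}ev mulrACA -expfzDr // ord_unif //; exact: unitM.
Qed.
Lemma ord_unit u : unit_of E u -> ord E u = 0.
Proof.
have [t [t0 em ht]] := dvr_ord_ex => hu.
by rewrite -[u]mulr1 -(expr0z t) ord_unif.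
Qed.
Lemma ord1 : ord E 1 = 0. Proof. by apply: ord_unit; apply: unit1. Qed.
Lemma ordV f : f != 0 -> ord E f^-1 = - ord E f.
Proof.
move=> f0; apply/eqP; rewrite -addr_eq0 addrC -ordM ?invr_eq0 // mulfV //; exact/eqP/ord1.
Qed.
Lemma ord_div f g : f != 0 -> g != 0 -> ord E (f / g) = ord E f - ord E g.
Proof. by move=> f0 g0; rewrite ordM ?invr_eq0 // ordV. Qed.
Lemma ordX f (j : nat) : f != 0 -> ord E (f ^+ j) = j%:Z * ord E f.
Proof.
move=> f0; elim: j => [|j IH]; first by rewrite mul0r ord1.
by rewrite exprS ordM ?expf_neq0 // IH -addn1 PoszD; ring.
Qed.
Lemma ord_ge0 f : f != 0 -> (0 <= ord E f) <-> E f.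
Proof.
have [t [t0 em ht]] := dvr_ord_ex => f0; have [u [hu e]] := ht f f0.
have mt : max_ideal E t by rewrite em; exists 1; [sr|rewrite mulr1].
have [u0 hu1 hui] := hu; have ht1 := max_sub mt.
case: (ord E f) e => j e; split=> //.
  by move=> _; rewrite e -exprnP; sr.
move=> form; exfalso; apply: (max_nunit (L := E) (x := u)) => //.
have tj : t ^+ j.+1 != 0 by rewrite expf_neq0.
rewrite (_ : u = (f * t ^+ j) * t).
  by apply: max_idealM => //; sr.
by rewrite -mulrA -exprSr e NegzE -exprnN divfK.
Qed.
Lemma ord_unitP f : f != 0 -> (ord E f = 0) <-> unit_of E f.
Proof.
move=> f0; split=> [e|]; last exact: ord_unit.
have [t [t0 em ht]] := dvr_ord_ex; have [u [hu eu]] := ht f f0.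
by rewrite eu e expr0z mulr1.
Qed.
Lemma ord_gt0 f : f != 0 -> (0 < ord E f) <-> max_ideal E f.
Proof.
move=> f0; rewrite lt_neqAle; split=> [/andP[n0 /(ord_ge0 f0) form]|[form nu]].
  split=> // /(ord_unitP f0) e; by rewrite e eqxx in n0.
apply/andP; split; last exact/ord_ge0.
by apply/eqP => e; apply: nu; apply/(ord_unitP f0).
Qed.
Lemma ordD f g n : f != 0 -> g != 0 -> f + g != 0 -> n <= ord E f -> n <= ord E g ->
  n <= ord E (f + g).
Proof.
have [t [t0 em ht]] := dvr_ord_ex.
have tn0 j : t ^ j != 0 by rewrite expfz_neq0.
have key a : a != 0 -> n <= ord E a <-> E (a / t ^ n).
  move=> a0; rewrite -(ord_ge0 (f := a / t ^ n)) ?mulf_neq0 ?invr_eq0 //.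
  rewrite ord_div // -[t ^ n]mul1r ord_unif ?subr_ge0 //; exact: unit1.
move=> f0 g0 fg0 /(key _ f0) form /(key _ g0) hg; apply/(key _ fg0).
by rewrite mulrDl; sr.
Qed.
Lemma dvr_local : is_local E.
Proof.
split=> // x y hx hy u.
have [x0|x0] := eqVneq x 0; first by right; rewrite x0 add0r in u.
have [y0|y0] := eqVneq y 0; first by left; rewrite y0 addr0 in u.
case: (unit_or_max hx); first by left.
case: (unit_or_max hy); first by right.
have [_ [t [_ mt ht]]] := hE; have em := dvr_max h mt ht.
rewrite em => -[a ha ea] [b hb eb]; case: (max_nunit (L := E) (x := x + y)) => //.
by rewrite em; exists (b + a); [sr|rewrite mulrDr ea eb].
Qed.
Lemma ordD_lt f g : f != 0 -> g != 0 -> ord E f < ord E g ->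
  f + g != 0 /\ ord E (f + g) = ord E f.
Proof.
move=> f0 g0 lt.
have u : unit_of E (1 + g / f).
  have m : max_ideal E (g / f).
    by apply/ord_gt0; rewrite ?mulf_neq0 ?invr_eq0 // ord_div // subr_gt0.
  by apply: (unitD_max dvr_local) => //; apply: unit1.
have [u0 _ _] := u.
have e : f + g = f * (1 + g / f) by fd.
by rewrite e mulf_neq0 // ordM // (ord_unit u) addr0.
Qed.
Lemma dvr_total x : E x \/ E x^-1.
Proof.
have [->|x0] := eqVneq x 0; first by left; sr.
have [p|/ltW p] := lerP 0 (ord E x); [left|right]; first exact/ord_ge0.
by apply/ord_ge0; rewrite ?invr_eq0 // ordV // oppr_ge0.
Qed.
End Theory.

(** Discrete valuation rings are maximal for domination: the inverse of an element outside E lies in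
    the maximal ideal of E, hence in that of E'. *)
Lemma dvr_eq E E' : dvr E -> dvr E' -> dominates E' E -> E' = E.
Proof.
move=> hE hE' d; rewrite eqEsubset; split; last exact: dom_sub d.
move=> z hz; case: (dvr_total hE z) => // hzi.
have [->|z0] := eqVneq z 0; first by apply: sr0; case: hE.
case: (unit_or_max hzi); first by case=> _ _; rewrite invrK.
move=> /(dom_max d) m; case: (max_ideal1 (proj1 hE')).
by rewrite -(mulfV z0); apply: max_idealM => //; case: hE'.
Qed.

End DVR.

(** * Blowing up a point *)

Section QuadraticTransform.
Context (k : closedFieldType) (K : fieldType) (iota : {rmorphism k -> K}).
Implicit Types (O : set K) (x y z t f g a b s : K) (p q : {poly k}).

Definition ev t p := (map_poly iota p).[t].

Lemma evD t p q : ev t (p + q) = ev t p + ev t q.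
Proof. by rewrite /ev rmorphD hornerD. Qed.
Lemma evM t p q : ev t (p * q) = ev t p * ev t q.
Proof. by rewrite /ev rmorphM hornerM. Qed.
Lemma evB t p q : ev t (p - q) = ev t p - ev t q.
Proof. by rewrite /ev rmorphB hornerD hornerN. Qed.
Lemma evX t : ev t 'X = t.
Proof. by rewrite /ev map_polyX hornerX. Qed.
Lemma evC t c : ev t c%:P = iota c.
Proof. by rewrite /ev map_polyC hornerC. Qed.
Lemma ev1 t : ev t 1 = 1.
Proof. by rewrite -[1]/(1%:P) evC rmorph1. Qed.
Lemma ev0 t : ev t 0 = 0.
Proof. by rewrite /ev rmorph0 horner0. Qed.
Lemma evZ t c p : ev t (c *: p) = iota c * ev t p.
Proof. by rewrite -mul_polyC evM evC. Qed.
Lemma evXn t n : ev t 'X^n = t ^+ n.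
Proof. by rewrite /ev map_polyXn hornerXn. Qed.
Lemma ev_mem O t p : is_subalg iota O -> O t -> O (ev t p).
Proof.
move=> [h hc] ht; apply: pin_horner => // i.
by rewrite coef_map; apply: hc.
Qed.
Lemma poly_split p : exists q, p = (p`_0)%:P + 'X * q.
Proof.
exists (drop_poly 1 p); apply/polyP => i; rewrite coefD coefC coefXM coef_drop_poly.
by case: i => [|i]; rewrite ?addr0 // add0r addn1.
Qed.

Definition affch O x y := adj O (x / y).
Definition ydiv O x y z := exists2 b, affch O x y b & z = y * b.
(** The functions not vanishing at the origin of the chart, described through their restriction p to
    the exceptional line. *)
Definition inS O x y s := exists p b, [/\ affch O x y b, p`_0 != 0 & s = ev (x / y) p + y * b].
(* The local ring of the point of the blow-up of O at which x/y and y vanish. *)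
Definition qt O x y : set K :=
  [set z | exists a s, [/\ affch O x y a, inS O x y s & z = a / s]].
(* The local ring of the exceptional curve of the blow-up of O. *)
Definition ex O x y : set K :=
  [set z | exists a s, [/\ affch O x y a, affch O x y s, ~ ydiv O x y s & z = a / s]].

Section Fix.
Variables (O : set K) (x y : K).
Hypothesis (rp : regpt iota O x y).
Let hO : is_subalg iota O := rp_alg rp.
Let h : is_subring O := proj1 hO.
Let hx := rp_x rp.
Let hy := rp_y rp.
Let y0 := rp_y0 rp.
Local Notation Mn := (M O x y).
Local Notation A := (affch O x y).
Local Notation t := (x / y).
Local Notation yA := (ydiv O x y).
Local Notation S := (inS O x y).

Lemma A_ring : is_subring A. Proof. exact: adj_subring. Qed.
Let hA := A_ring.
Lemma OA : O `<=` A. Proof. exact: adj_sub. Qed.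
Lemma At : A t. Proof. exact: adj_gen. Qed.
Lemma Ay : A y. Proof. exact: OA. Qed.
Lemma A_alg : is_subalg iota A.
Proof. by split=> // c; apply: OA; apply: (proj2 hO). Qed.
Lemma A_ev p : A (ev t p). Proof. by apply: ev_mem; [exact: A_alg|exact: At]. Qed.
Let hAt := At.
Let hAy := Ay.

(** The chart is the part of degree zero of the Rees algebra of the maximal ideal with y
    inverted. *)
Lemma AM z : A z <-> exists n f, Mn n f /\ z = f / y ^+ n.
Proof.
split=> [[P hP ->]|[n [f [m ->]]]].
  exists (size P), (\sum_(i < size P) P`_i * (x ^+ i * y ^+ (size P - i))); split.
    apply: (M_sum hO) => i _; apply: (M_mulO hO) => //.
    have le : (i <= size P)%N by rewrite ltnW.
    by rewrite -{1}(subnKC le); apply: (M_M hO); apply: (M_X hO); [exact: (M_x _ _ hO)|exact: (M_y _ _ hO)].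
  rewrite horner_coef mulr_suml; apply: eq_bigr => i _; rewrite expr_div_n.
  have le : (i <= size P)%N by rewrite ltnW.
  have -> : y ^+ (size P) = y ^+ (size P - i) * y ^+ i by rewrite -exprD subnK.
  have y1 : y ^+ i != 0 by rewrite expf_neq0.
  have y2 : y ^+ (size P - i) != 0 by rewrite expf_neq0.
  fd.
elim: n f m => [|n IH] f m; first by rewrite divr1; apply: OA.
have [f1 [g1 [m1 m2 ->]]] := m.
have yn : y ^+ n != 0 by rewrite expf_neq0.
have -> : (x * f1 + y * g1) / y ^+ n.+1 = t * (f1 / y ^+ n) + g1 / y ^+ n.
  by rewrite exprS; fd.
by have := IH _ m1; have := IH _ m2 => *; sr.
Qed.

Lemma AM_div n f : Mn n f -> A (f / y ^+ n).
Proof. by move=> m; apply/AM; exists n, f. Qed.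

(** Together with [Aind] this identifies A / yA with the polynomial ring k[x / y], the coordinate
    ring of the exceptional line in this chart. *)
Lemma Ares z : A z -> exists p b, A b /\ z = ev t p + y * b.
Proof.
pose C := [set z | exists p b, A b /\ z = ev t p + y * b].
suff: A `<=` C by apply.
have hC : is_subring C.
  split.
  - by exists 1, 0; split; [sr|rewrite ev1; ring].
  - move=> _ _ [p [b [hb ->]]] [q [c [hc ->]]].
    by exists (p - q), (b - c); split; [sr|rewrite evB; ring].
  - move=> _ _ [p [b [hb ->]]] [q [c [hc ->]]]; have ? := A_ev p; have ? := A_ev q.
    by exists (p * q), (ev t p * c + b * ev t q + y * b * c); split; [sr|rewrite evM; ring].
apply: adj_min => //.
- move=> f form; have [c [g [l [hg hl e]]]] := rp_res rp form.
  have ? := OA hg; have ? := OA hl.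
  exists c%:P, (t * g + l); split; first by sr.
  by rewrite e evC; fd.
- by exists 'X, 0; split; [sr|rewrite evX; ring].
Qed.

Lemma Aind p : yA (ev t p) -> p = 0.
Proof.
move=> [b /AM[n [f [m ->]]] e]; pose d := (n + size p)%N.
have sp : (size p <= d.+1)%N by rewrite /d; lia.
apply: (rp_ind rp sp); rewrite hfE // -/(ev t p) e /d.
have -> : y ^+ (n + size p) * (y * (f / y ^+ n)) = y ^+ (size p).+1 * f.
  have yn : y ^+ n != 0 by rewrite expf_neq0.
  by rewrite exprD exprS; fd.
rewrite -addnS addnC; apply: (M_M hO) => //; apply: (M_X hO); exact: (M_y _ _ hO).
Qed.

Lemma yA_D a b : yA a -> yA b -> yA (a + b).
Proof. by move=> [a' ha ->] [b' hb ->]; exists (a' + b'); [sr|ring]. Qed.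
Lemma yA_M a b : A a -> yA b -> yA (a * b).
Proof. by move=> ha [b' hb ->]; exists (a * b'); [sr|ring]. Qed.
Lemma yA_resP p b : A b -> yA (ev t p + y * b) <-> p = 0.
Proof.
move=> hb; split=> [m|->]; last by rewrite ev0 add0r; exists b.
apply: Aind; rewrite (_ : ev t p = (ev t p + y * b) + (-1) * (y * b)); last by ring.
by apply: yA_D => //; apply: yA_M; [sr|exists b].
Qed.
Lemma yA_prime a b : A a -> A b -> yA (a * b) -> yA a \/ yA b.
Proof.
move=> /Ares [p [c [hc ->]]] /Ares [q [d [hd ->]]] m.
have ? := A_ev p; have ? := A_ev q.
have : p * q = 0.
  apply/(@yA_resP _ (ev t p * d + c * ev t q + y * c * d)); first by sr.
  by move: m; congr ydiv; rewrite evM; ring.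
by move/eqP; rewrite mulf_eq0 => /orP[]/eqP e; [left|right]; apply/yA_resP.
Qed.
Lemma yA1 : ~ yA 1.
Proof. by rewrite -(ev1 t) => /Aind /eqP; rewrite oner_eq0. Qed.

Lemma S_A s : S s -> A s.
Proof. by move=> [p [b [hb _ ->]]]; have ? := A_ev p; sr. Qed.
Lemma S_nyA s : S s -> ~ yA s.
Proof. by move=> [p [b [hb p0 ->]]] /yA_resP - /(_ hb) e; rewrite e coef0 eqxx in p0. Qed.
Lemma nyA_neq0 s : ~ yA s -> s != 0.
Proof. by move=> ns; apply/eqP => e; apply: ns; exists 0; [sr|rewrite mulr0]. Qed.
Lemma S_neq0 s : S s -> s != 0. Proof. by move/S_nyA/nyA_neq0. Qed.
Lemma S_1 : S 1.
Proof. by exists 1, 0; split; [sr|rewrite coef1 oner_neq0|rewrite ev1; ring]. Qed.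
Lemma S_M s s' : S s -> S s' -> S (s * s').
Proof.
move=> [p [b [hb p0 ->]]] [q [c [hc q0 ->]]]; have ? := A_ev p; have ? := A_ev q.
exists (p * q), (ev t p * c + b * ev t q + y * b * c); split; first by sr.
  by rewrite coef0M mulf_neq0.
by rewrite evM; ring.
Qed.
Lemma S_D s a b : S s -> A a -> A b -> S (s + t * a + y * b).
Proof.
move=> [p [c [hc p0 ->]]] /Ares [q [d [hd ->]]] hb; have ? := A_ev q.
exists (p + 'X * q), (c + t * d + b); split; first by sr.
  by rewrite coefD coefXM addr0.
by rewrite evD evM evX; ring.
Qed.
Lemma S_ct c : c != 0 -> S (iota c).
Proof.
by move=> c0; exists c%:P, 0; split; [sr|rewrite coefC|rewrite evC; ring].
Qed.

Local Notation O' := (qt O x y).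
Local Notation E := (ex O x y).

Lemma qt_ring : is_subring O'.
Proof.
split.
- by exists 1, 1; split; [sr|exact: S_1|rewrite divr1].
- move=> _ _ [a [s [ha hs ->]]] [b [r [hb hr ->]]].
  have s0 := S_neq0 hs; have r0 := S_neq0 hr; have ? := S_A hs; have ? := S_A hr.
  by exists (a * r - b * s), (s * r); split; [sr|exact: S_M|fd].
- move=> _ _ [a [s [ha hs ->]]] [b [r [hb hr ->]]].
  have s0 := S_neq0 hs; have r0 := S_neq0 hr.
  by exists (a * b), (s * r); split; [sr|exact: S_M|fd].
Qed.
Let hO' := qt_ring.
Lemma A_qt : A `<=` O'.
Proof. by move=> a ha; exists a, 1; split=> //; [exact: S_1|rewrite divr1]. Qed.
Lemma O_qt : O `<=` O'. Proof. by move=> z /OA /A_qt. Qed.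
Lemma qt_alg : is_subalg iota O'.
Proof. by split=> // c; apply: A_qt; apply: (proj2 A_alg). Qed.
Lemma S_unit s : S s -> unit_of O' s.
Proof.
move=> hs; split; [exact: S_neq0|apply: A_qt; exact: S_A|].
by exists 1, s; split; [sr|by []|rewrite div1r].
Qed.
Lemma yqt a s : A a -> S s -> (exists2 z, O' z & a / s = y * z) <-> yA a.
Proof.
move=> ha hs; have s0 := S_neq0 hs; split=> [[_ [b [r [hb hr ->]]] e]|[b hb ->]]; last first.
  by exists (b / s); [exists b, s|rewrite mulrA].
have r0 := S_neq0 hr; have hr' := S_A hr; have hs' := S_A hs.
have : yA (a * r).
  exists (b * s); first by sr.
  have := congr1 (fun z => z * (s * r)) e.
  have -> : a / s * (s * r) = a * r by fd.
  by move=> ->; fd.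
by case/(yA_prime ha hr') => // /(S_nyA hr).
Qed.
Definition yqtd z := exists2 w, O' w & z = y * w.
Lemma yqt_prime z w : O' z -> O' w -> yqtd (z * w) -> yqtd z \/ yqtd w.
Proof.
move=> [a [s [ha hs ->]]] [b [r [hb hr ->]]].
have s0 := S_neq0 hs; have r0 := S_neq0 hr.
have -> : a / s * (b / r) = (a * b) / (s * r) by fd.
have hab : A (a * b) by sr.
move/(yqt hab (S_M hs hr))/(yA_prime ha hb) => -[] m; [left|right]; exact/yqt.
Qed.
Lemma yqt_A a : A a -> yqtd a <-> yA a.
Proof.
move=> ha; rewrite -(yqt ha S_1) divr1; split; move=> [z ? ?]; by exists z.
Qed.
Lemma yqt_tn n : ~ yqtd (t ^+ n).
Proof.
rewrite -evXn => m; have {}m : yA (ev t 'X^n) by apply/yqt_A => //; exact: A_ev.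
by move/eqP: (Aind m); rewrite -size_poly_eq0 size_polyXn.
Qed.

Lemma qt_local1 g l : O' g -> O' l -> unit_of O' (1 + t * g + y * l).
Proof.
move=> [a [s [ha hs ->]]] [b [r [hb hr ->]]].
have s0 := S_neq0 hs; have r0 := S_neq0 hr; have hs' := S_A hs; have hr' := S_A hr.
have -> : 1 + t * (a / s) + y * (b / r) = (s * r + t * (a * r) + y * (b * s)) / (s * r) by fd.
apply: unitM => //; last by apply: unitV; apply: S_unit; exact: S_M.
by apply: S_unit; apply: S_D; [exact: S_M|sr|sr].
Qed.

Lemma M_tn n f : M O' t y n.+1 f -> exists a b, [/\ O' a, M O' t y n b & f = t ^+ n.+1 * a + y * b].
Proof.
elim: n f => [|n IH] f; first by move=> [a [b [ha hb ->]]]; exists a, b; rewrite expr1.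
move=> [f1 [g1 [/IH [a [b [ha hb ->]]] m2 ->]]].
exists a, (t * b + g1); split=> //; last by rewrite [t ^+ n.+2]exprS; ring.
by apply: (M_D qt_alg) => //; rewrite -add1n; apply: (M_M qt_alg) => //; exact: (M_x _ _ qt_alg).
Qed.

Lemma qt_omega : omega iota O' t y.
Proof.
have hom : omega iota A t y.
  by apply: omega_adj => //; rewrite divfK //; apply: (rp_om rp).
apply: (@omega_loc _ _ _ A) => //; first exact: A_qt.
move=> z [a [s [ha hs ->]]]; exists a, s; split=> //; [exact: S_A|exact: S_neq0|by case: (S_unit hs)].
Qed.

Lemma dd_qt (D D' : derivation iota) : dd x y D D' = y * dd t y D D'.
Proof.
have e (F : derivation iota) : F x = t * F y + y * F t by rewrite -(derM F) divfK.
by rewrite /dd !e; ring.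
Qed.

(** Modulo y, the leading coefficient times t^(d+1) would lie in the ideal of t^(d+2). As y is prime
    and divides no power of t, that coefficient vanishes; the rest is divisible by y, and cancelling
    y lowers the degree. *)
Lemma qt_ind d p : (size p <= d.+1)%N -> M O' t y d.+1 (form iota d p t y) -> p = 0.
Proof.
elim: d p => [|d IH] p sp m.
  move: m => [a [b [ha hb]]]; rewrite (size1_polyC sp) /form big_ord1 coefC eqxx !mulr1 => e.
  have [//|c0] := eqVneq (p`_0) 0; first by move=> ->; rewrite polyC0.
  have ic0 : iota p`_0 != 0 by rewrite fmorph_eq0.
  case: (max_nunit (L := O') (x := iota p`_0)); last by apply/S_unit/S_ct.
  rewrite /= in ha hb; split; first exact: (proj2 qt_alg).
  move=> [_ _ hi]; have := @qt_local1 (- a / iota p`_0) (- b / iota p`_0).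
  have -> : 1 + t * (- a / iota p`_0) + y * (- b / iota p`_0) = (iota p`_0 - (t * a + y * b)) / iota p`_0 by fd.
  by rewrite -e subrr mul0r => /(_ _ _)[]; rewrite ?eqxx //; sr.
have [a [b [ha hb e]]] := M_tn m.
pose p' := take_poly d.+1 p.
have ep : form iota d.+1 p t y = iota p`_d.+1 * t ^+ d.+1 + y * form iota d p' t y.
  rewrite /form big_ord_recr /= subnn mulr1 addrC mulr_sumr; congr (_ + _).
  apply: eq_bigr => i _; have le : (i <= d)%N by rewrite -ltnS.
  by rewrite coef_take_poly ltn_ord /= (subSn le) exprS; ring.
have pd : p`_d.+1 = 0.
  apply/eqP; case: eqVneq => // c0.
  have u : unit_of O' (iota p`_d.+1 - t * a).
    have ic0 : iota p`_d.+1 != 0 by rewrite fmorph_eq0.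
    have -> : iota p`_d.+1 - t * a = iota p`_d.+1 * (1 + t * (- a / iota p`_d.+1) + y * 0) by fd.
    apply: unitM => //; first exact/S_unit/S_ct.
    apply: qt_local1; last by sr.
    have [_ _ ?] := S_unit (S_ct c0); sr.
  have [u0 _ hui] := u.
  case: (@yqt_tn d.+1); exists ((b - form iota d p' t y) / (iota p`_d.+1 - t * a)).
    have ? := M_O qt_alg (A_qt At) (A_qt Ay) hb.
    have ? := M_O qt_alg (A_qt At) (A_qt Ay) (form_M t y qt_alg d p'); sr.
  apply: (mulIf u0).
  have -> : y * ((b - form iota d p' t y) / (iota p`_d.+1 - t * a)) * (iota p`_d.+1 - t * a) = y * (b - form iota d p' t y) by rewrite -[LHS]mulrA divfK.
  apply/eqP; rewrite -subr_eq0.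
  have e2 := e; rewrite ep in e2.
  have -> : t ^+ d.+1 * (iota p`_d.+1 - t * a) - y * (b - form iota d p' t y) =
     (iota p`_d.+1 * t ^+ d.+1 + y * form iota d p' t y) - (t ^+ d.+1 * (t * a) + y * b) by ring.
  by rewrite e2 exprSr; apply/eqP; ring.
have pp : p = p'.
  apply/polyP => i; rewrite coef_take_poly; case: ltnP => // le.
  have [->|ne] := eqVneq i d.+1; first exact: pd.
  by rewrite nth_default // (leq_trans sp) // ltn_neqAle eq_sym ne.
rewrite pp; apply: IH; first exact: size_take_poly.
have : yqtd (t ^+ d.+2 * a).
  exists (form iota d p' t y - b).
    have ? := M_O qt_alg (A_qt At) (A_qt Ay) hb.
    have ? := M_O qt_alg (A_qt At) (A_qt Ay) (form_M t y qt_alg d p'); sr.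
  by rewrite mulrBr; apply/eqP; rewrite eq_sym subr_eq -e ep pd rmorph0 mul0r add0r.
have ht : O' (t ^+ d.+2) by apply: srX => //; apply: A_qt; exact: At.
case/(yqt_prime ht ha) => [/yqt_tn//|[a' ha' ea]].
have -> : form iota d p' t y = t ^+ d.+2 * a' + b.
  apply: (mulfI y0); rewrite mulrDr; have := e; rewrite ep pd rmorph0 mul0r add0r => ->.
  by rewrite ea; ring.
apply: (M_D qt_alg) => //; rewrite (mulrC (t ^+ d.+2)); apply: (M_mulO qt_alg) => //.
exact: (M_le qt_alg (A_qt At) (A_qt Ay) (leqnSn _) (M_X qt_alg d.+2 (M_x _ _ qt_alg))).
Qed.

(* f / y^m is the local equation of the strict transform of f of multiplicity m. *)
Lemma strict f n : mult O x y f n -> A (f / y ^+ n) /\ ~ yA (f / y ^+ n).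
Proof.
move=> [m nm]; split; first exact: AM_div.
have yn : y ^+ n != 0 by rewrite expf_neq0.
move=> [b /AM[l [g [mg ->]]] e]; apply: nm.
have f0 : f = y * (g / y ^+ l) * y ^+ n by rewrite -e divfK.
have [ge|g0] := eqVneq g 0; first by rewrite f0 ge mul0r mulr0 mul0r; exact: (M_0 _ _ hO).
have yl : y ^+ l != 0 by rewrite expf_neq0.
have ef : y ^+ l * f = y ^+ n.+1 * g by rewrite f0 exprS; fd.
have hg := M_O hO hx hy mg.
have hf' := M_O hO hx hy m.
have [j mj] := mult_ex rp hg g0.
have lj := mult_le rp mj mg.
have mf := mult_div rp (mult_yn rp l) hf' (n := l) (l := (n.+1 + j - l)%N).
rewrite ef in mf; have := mult_M rp (mult_yn rp n.+1) mj.
rewrite -{1}(@subnKC l (n.+1 + j)); last by lia.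
move=> /mf [mm _]; apply: (M_le hO hx hy _ mm); lia.
Qed.

Lemma polyX_split p : p != 0 -> exists d r, [/\ p = 'X^d * r, r`_0 != 0 & (d < size p)%N].
Proof.
have [n] := ubnP (size p); elim: n p => // n IH p sp p0.
have [c0|c0] := eqVneq (p`_0) 0; last first.
  by exists 0%N, p; split=> //; [rewrite mul1r|rewrite size_poly_gt0].
have [q eq] := poly_split p; rewrite c0 polyC0 add0r in eq.
have q0 : q != 0 by apply: contra_neq p0 => q0; rewrite eq q0 mulr0.
have sq : size p = (size q).+1 by rewrite eq mulrC size_mulX.
have [|//|d [r [er r0 lt]]] := IH q; first by rewrite sq in sp.
by exists d.+1, r; split=> //; [rewrite eq er exprS mulrA|rewrite sq].
Qed.

Lemma S_ev (r : {poly k}) : r`_0 != 0 -> S (ev t r).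
Proof. by move=> r0; exists r, 0; split; [sr|by []|ring]. Qed.

(** On the exceptional line the strict transform restricts to the dehomogenized initial form of f; d
    is its order of vanishing at 0, which is at most its degree. *)
Lemma strict_icz f n : mult O x y f n ->
  exists d u g, [/\ (d <= n)%N, unit_of O' u, O' g & f / y ^+ n = u * t ^+ d + y * g].
Proof.
move=> muf; have [m nm] := muf; have [p sp hp] := Msplit rp m.
have p0 : p != 0 by apply/eqP => /(M_lead rp sp hp).
have [d [r [ep r0 lt]]] := polyX_split p0.
exists d, (ev t r), ((f - form iota n p x y) / y ^+ n.+1); split.
- by rewrite -ltnS (leq_trans lt).
- by apply: S_unit; apply: S_ev.
- by apply: A_qt; apply: AM_div.
- have yn : y ^+ n != 0 by rewrite expf_neq0.
  rewrite (mulrC (ev t r)) -(evXn t d) -evM -ep hfE // -/(ev t p) exprS.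
  move: (ev t p) => e; fd.
Qed.

Lemma qt_divy n w : O' w -> M O' t y n.+1 (y * w) -> M O' t y n w.
Proof.
move=> hw /M_tn [a [b [ha hb e]]].
have hb' := M_O qt_alg (A_qt At) (A_qt Ay) hb.
have : yqtd (t ^+ n.+1 * a).
  by exists (w - b); [sr|rewrite mulrBr e; ring].
have ht : O' (t ^+ n.+1) by apply: srX => //; apply: A_qt; exact: At.
case/(yqt_prime ht ha) => [/yqt_tn//|[a' ha' ea]].
have -> : w = a' * t ^+ n.+1 + b.
  by apply: (mulfI y0); rewrite e ea; ring.
apply: (M_D qt_alg) => //; apply: (M_mulO qt_alg) => //.
exact: (M_le qt_alg (A_qt At) (A_qt Ay) (leqnSn _) (M_X qt_alg n.+1 (M_x _ _ qt_alg))).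
Qed.

Lemma icz_notM d u g : unit_of O' u -> O' g -> ~ M O' t y d.+1 (u * t ^+ d + y * g).
Proof.
move=> hu hg /M_tn [a [b [ha hb e]]].
have hb' := M_O qt_alg (A_qt At) (A_qt Ay) hb.
have : yqtd (t ^+ d * (u - t * a)).
  exists (b - g); first by sr.
  apply/eqP; rewrite -subr_eq0.
  have -> : t ^+ d * (u - t * a) - y * (b - g) = (u * t ^+ d + y * g) - (t ^+ d * (t * a) + y * b) by ring.
  by rewrite e exprSr; apply/eqP; ring.
have ht : O' (t ^+ d) by apply: srX => //; apply: A_qt; exact: At.
have hu2 : unit_of O' (u - t * a).
  have [u0 hu1 hui] := hu.
  have -> : u - t * a = u * (1 + t * (- a / u) + y * 0) by fd.
  by apply: unitM => //; apply: qt_local1; sr.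
have [v0 hv hvi] := hu2.
case/(yqt_prime ht hv) => [/yqt_tn//|[c hc ec]].
apply: (@yqt_tn 0); exists (c / (u - t * a)); first by sr.
by rewrite mulrA -ec mulfV.
Qed.

(** Up to factors from O' the element is some F in O, and F = y^m (u t^d + y g) by [strict_icz].
    Cancelling y lowers the power of the ideal by one, and modulo y the last factor is a unit times
    t^d, so F lies outside the power d + 1 + m. *)
Lemma qt_sep f : O' f -> f != 0 -> exists n, ~ M O' t y n f.
Proof.
move=> [a [s [/AM[n [F [mF ea]]] hs ef]]] f0.
have yn : y ^+ n != 0 by rewrite expf_neq0.
have s0 := S_neq0 hs.
have F0 : F != 0 by apply: contra_neq f0 => F0; rewrite ef ea F0 !mul0r.
have [m muF] := mult_ex rp (M_O hO hx hy mF) F0.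
have [d [u [g [_ hu hg e]]]] := strict_icz muF.
have ym : y ^+ m != 0 by rewrite expf_neq0.
have eF : F = y ^+ m * (u * t ^+ d + y * g) by rewrite -e mulrC divfK.
exists (d.+1 + m)%N => mf.
have : M O' t y (d.+1 + m) F.
  have -> : F = (y ^+ n * s) * f by rewrite ef ea; fd.
  apply: (M_mulO qt_alg) => //; apply: srM => //; first by apply: srX => //; apply: A_qt; exact: Ay.
  by apply: A_qt; apply: S_A.
rewrite eF; have hw : O' (u * t ^+ d + y * g).
  by have := A_qt At; have := A_qt Ay; have [_ hu1 _] := hu => *; sr.
elim: (m) => [|j IH]; first by rewrite mul1r addn0; apply: icz_notM.
rewrite exprS -mulrA addnS => /qt_divy mm; apply: IH; apply: mm.
by have := A_qt Ay => ?; sr.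
Qed.

Lemma regpt_qt : regpt iota O' t y.
Proof.
split.
- exact: qt_alg.
- exact: (A_qt At).
- exact: (A_qt Ay).
- move=> _ [a [s [/Ares[p [b [hb ->]]] hs ->]]].
  have [q [c [hc q0 es]]] := hs; have s0 := S_neq0 hs; have hs' := S_A hs.
  have iq0 : iota q`_0 != 0 by rewrite fmorph_eq0.
  pose l := p`_0 / q`_0.
  have [r er] := poly_split (p - l *: q).
  have hA1 z : A z -> O' (z / s) by move=> hz; exists z, s.
  exists l, (ev t r / s), ((b - iota l * c) / s); split.
  + by apply: hA1; apply: A_ev.
  + by apply: hA1; apply: srB => //; apply: srM => //; apply: (proj2 A_alg).
  + have er' : ev t p - iota l * ev t q = t * ev t r.
      rewrite -evZ -evB er evD evM evX evC coefB coefZ /l divfK // subrr rmorph0; ring.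
    apply: (mulIf s0); rewrite divfK //.
    have -> : (iota l + t * (ev t r / s) + y * ((b - iota l * c) / s)) * s =
      iota l * s + t * ev t r + y * (b - iota l * c) by fd.
    by rewrite -er' es; ring.
- exact: qt_local1.
- exact: qt_ind.
- exact: qt_sep.
- move=> z; have [a [b [ha hb b0 e]]] := rp_frac rp z.
  by exists a, b; split=> //; exact: O_qt.
- exact: qt_omega.
- have [D [D' d]] := rp_dd rp; exists D, D'; apply: contra_neq d => d.
  by rewrite dd_qt d mulr0.
Qed.

Lemma qt_dom : dominates O' O.
Proof.
apply: dominatesP => [|z /(rp_max rp) [f [g [hf' hg' ->]]]]; first exact: O_qt.
apply/(rp_max regpt_qt); exists 0, (t * f + g); split; first by apply: sr0.
  by have := A_qt At; have := O_qt hf'; have := O_qt hg' => *; rewrite /=; sr.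
by rewrite mulr0 add0r; fd.
Qed.

Lemma ex_ring : is_subring E.
Proof.
have nm a b : A a -> A b -> ~ yA a -> ~ yA b -> ~ yA (a * b).
  by move=> ha hb na nb /(yA_prime ha hb) [].
split.
- by exists 1, 1; split; [sr|sr|exact: yA1|rewrite divr1].
- move=> _ _ [a [s [ha hs ns ->]]] [b [r [hb hr nr ->]]].
  have s0 := nyA_neq0 ns; have r0 := nyA_neq0 nr.
  by exists (a * r - b * s), (s * r); split; [sr|sr|exact: nm|fd].
- move=> _ _ [a [s [ha hs ns ->]]] [b [r [hb hr nr ->]]].
  have s0 := nyA_neq0 ns; have r0 := nyA_neq0 nr.
  by exists (a * b), (s * r); split; [sr|sr|exact: nm|fd].
Qed.
Let hE := ex_ring.
Lemma A_ex : A `<=` E.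
Proof. by move=> a ha; exists a, 1; split=> //; [sr|exact: yA1|rewrite divr1]. Qed.
Lemma ex_alg : is_subalg iota E.
Proof. by split=> // c; apply: A_ex; apply: (proj2 A_alg). Qed.
Lemma O_ex : O `<=` E. Proof. by move=> z /OA /A_ex. Qed.
Lemma ex_unit s : A s -> ~ yA s -> unit_of E s.
Proof.
move=> hs ns; split; [exact: nyA_neq0|exact: A_ex|].
by exists 1, s; split=> //; [sr|rewrite div1r].
Qed.
Lemma ex_max : max_ideal E y.
Proof.
split; first by apply: A_ex.
move=> [_ _ [a [s [ha hs ns e]]]]; have s0 := nyA_neq0 ns.
apply: ns; exists a => //.
by rewrite -[s]mul1r -(mulfV y0) e -mulrA divfK.
Qed.
Lemma strict_unit f n : mult O x y f n -> unit_of E (f / y ^+ n).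
Proof. by move=> /strict [? ?]; apply: ex_unit. Qed.
(** f / y^n is a unit for n the order of f, so the valuation of the exceptional curve is the order
    at the blown-up point. *)
Lemma ex_dvr : dvr E.
Proof.
split=> //; exists y; split=> //; first exact: ex_max.
move=> f f0; have [a [b [ha hb b0 e]]] := rp_frac rp f.
have a0 : a != 0 by apply: contra_neq f0 => a0; rewrite e a0 mul0r.
have [n mn] := mult_ex rp ha a0; have [m mm] := mult_ex rp hb b0.
exists ((a / y ^+ n) / (b / y ^+ m)), (n%:Z - m%:Z); split.
  by apply: unitM => //; [exact: strict_unit|apply: unitV; exact: strict_unit].
have yn : y ^+ n != 0 by rewrite expf_neq0.
have ym : y ^+ m != 0 by rewrite expf_neq0.
by rewrite e expfzDr // -invr_expz -!exprnP; fd.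
Qed.
Lemma ord_ex f n : mult O x y f n -> ord E f = n%:Z.
Proof.
move=> m; have u := strict_unit m.
have yn : y ^+ n != 0 by rewrite expf_neq0.
have em := dvr_max ex_ring ex_max.
have := ord_unif n%:Z ex_ring y0 _ u; rewrite -exprnP divfK //; apply.
apply: em => g g0.
have [_ [z [z0 mz hz]]] := ex_dvr.
have [a [b [ha hb b0 e]]] := rp_frac rp g.
have a0 : a != 0 by apply: contra_neq g0 => a0; rewrite e a0 mul0r.
have [i mi] := mult_ex rp ha a0; have [j mj] := mult_ex rp hb b0.
exists ((a / y ^+ i) / (b / y ^+ j)), (i%:Z - j%:Z); split.
  by apply: unitM => //; [exact: strict_unit|apply: unitV; exact: strict_unit].
have yi : y ^+ i != 0 by rewrite expf_neq0.
have yj : y ^+ j != 0 by rewrite expf_neq0.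
by rewrite e expfzDr // -invr_expz -!exprnP; fd.
Qed.
Lemma ex_dom : dominates E O.
Proof.
apply: dominatesP => [|z /(rp_max rp) [f [g [hf' hg' ->]]]]; first exact: O_ex.
have -> : x * f + y * g = (t * f + g) * y by fd.
apply: max_idealM => //; last exact: ex_max.
by have := A_ex At; have := O_ex hf'; have := O_ex hg' => *; sr.
Qed.
Lemma ex_omega : omega iota E t y.
Proof.
have hom : omega iota A t y.
  by apply: omega_adj => //; rewrite divfK //; apply: (rp_om rp).
apply: (@omega_loc _ _ _ A) => //; first exact: A_ex.
move=> z [a [s [ha hs ns ->]]]; exists a, s; split=> //; first exact: nyA_neq0.
by case: (ex_unit hs ns).
Qed.

End Fix.
End QuadraticTransform.

(** * Divisors and log discrepancies *)

Section Divisors.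
Context (k : closedFieldType) (K : fieldType) (iota : {rmorphism k -> K}).
Implicit Types (O E : set K) (x y z t f g a b s : K) (p q : {poly k}).
Local Notation derivation := (derivation iota).

Definition nonzero2 (v : derivation -> derivation -> K) := exists D D', v D D' != 0.

(* The last condition makes log discrepancies along E meaningful. *)
Definition admissible E := [/\ is_subalg iota E, dvr E
  & exists v, generates2 (iota := iota) E v /\ nonzero2 v].

(** The log discrepancy of E for the trivial multi-ideal, O being the center of E. *)
Definition logdisc O E : int := canonical_coef iota O E + 1.

Lemma Omega2_dd O x y : is_subring O -> O x -> O y -> Omega2 (iota := iota) O (dd x y).
Proof.
move=> h hx hy; exists 1%N, (fun=> 1), (fun=> x), (fun=> y); split=> //.
  by move=> _; sr.
by apply/funext => D; apply/funext => D'; rewrite big_ord1 mul1r.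
Qed.

Lemma gen_unit O w w' : is_subring O -> generates2 (iota := iota) O w ->
  generates2 (iota := iota) O w' -> nonzero2 w ->
  exists c, unit_of O c /\ w' = (fun D D' => c * w D D').
Proof.
move=> h gw gw' [D [D' w0]].
have [c hc ec] : [set (fun D D' => c * w D D') | c in O] w'.
  by rewrite -gw gw'; exists 1; [sr|apply/funext => ?; apply/funext => ?; rewrite mul1r].
have [c' hc' ec'] : [set (fun D D' => c * w' D D') | c in O] w.
  by rewrite -gw' gw; exists 1; [sr|apply/funext => ?; apply/funext => ?; rewrite mul1r].
exists c; split=> //.
have e1 : c' * c = 1.
  apply: (mulIf w0); rewrite mul1r -[in RHS]ec' -ec; ring.
have c0 : c != 0 by apply: contra_eq_neq e1 => ->; rewrite mulr0 eq_sym oner_neq0.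
by split=> //; rewrite (_ : c^-1 = c') //; apply: (mulIf c0); rewrite mulVf.
Qed.

(** [canonical_coef] is defined by choice. Two generators of the forms differ by a unit, both at O
    and at E, so that any pair of generators computes it. *)
Lemma canonical_eq O x y E v f : regpt iota O x y -> dvr E -> dominates E O ->
  generates2 (iota := iota) E v -> f != 0 ->
  dd (iota := iota) x y = (fun D D' => f * v D D') -> canonical_coef iota O E = ord E f.
Proof.
move=> rp hE d gv f0 e.
have [h _] := rp_alg rp.
have gw := omega_generates h (rp_x rp) (rp_y rp) (rp_om rp).
have nw : nonzero2 (dd x y) := rp_dd rp.
have nv : nonzero2 v.
  have [D [D' w0]] := nw; exists D, D'; apply: contra_neq w0 => v0.
  by rewrite e v0 mulr0.
rewrite /canonical_coef; case: xgetP => [m _ [w' [v' [f' [gw' gv' f'0 e' <-]]]]|/(_ (ord E f))]; last first.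
  by case; exists (dd x y), v, f; split.
have [c [uc ec]] := gen_unit h gw gw' nw.
have [c' [uc' ec']] := gen_unit (proj1 hE) gv gv' nv.
have {}uc : unit_of E c by apply: unit_sub uc; exact: dom_sub d.
have [D [D' v0]] := nv.
have e2 : f' * c' = c * f.
  apply: (mulIf v0).
  have := congr1 (fun w => w D D') e'; rewrite ec ec' => /= e3.
  have := congr1 (fun w => w D D') e => /= e4.
  by rewrite -mulrA -e3 e4; ring.
have [c0 _ _] := uc; have [c'0 _ _] := uc'.
have := congr1 (ord E) e2; rewrite !(ordM hE) // (ord_unit hE uc) (ord_unit hE uc').
by rewrite addr0 add0r.
Qed.

Lemma canonical_ex O x y E v : regpt iota O x y -> dvr E -> dominates E O ->
  generates2 (iota := iota) E v ->
  exists f, [/\ E f, f != 0, dd (iota := iota) x y = (fun D D' => f * v D D')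
    & canonical_coef iota O E = ord E f].
Proof.
move=> rp hE d gv.
have sub := dom_sub d.
have := Omega2_dd (proj1 hE) (sub _ (rp_x rp)) (sub _ (rp_y rp)).
rewrite gv => -[f form e]; exists f.
have f0 : f != 0.
  have [D [D']] := rp_dd rp; apply: contra_neq => f0.
  by rewrite -e f0 mul0r.
by split=> //; exact: (canonical_eq rp hE d gv f0 (esym e)).
Qed.

Lemma logdisc_ge1 O x y E : regpt iota O x y -> admissible E -> dominates E O -> 1 <= logdisc O E.
Proof.
move=> rp [_ hE [v [gv _]]] d.
have [f [form f0 _ e]] := canonical_ex rp hE d gv.
by rewrite /logdisc e lerDr; apply/ord_ge0.
Qed.

Lemma ex_admissible O x y : regpt iota O x y -> admissible (ex O x y).
Proof.
move=> rp; split; [exact: (ex_alg rp)|exact: (ex_dvr rp)|].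
exists (dd (x / y) y); split.
  apply: omega_generates; [exact: (ex_ring rp)| | |exact: (ex_omega rp)].
    by apply: (A_ex rp); exact: (At rp).
  by apply: (A_ex rp); exact: (Ay rp).
have [D [D' d]] := rp_dd rp; exists D, D'; apply: contra_neq d => d.
by rewrite (dd_qt rp) d mulr0.
Qed.

Lemma logdisc_ex O x y : regpt iota O x y -> logdisc O (ex O x y) = 2.
Proof.
move=> rp; have [_ hE [v [gv _]]] := ex_admissible rp.
have gt : generates2 (iota := iota) (ex O x y) (dd (x / y) y).
  apply: omega_generates; [exact: (ex_ring rp)| | |exact: (ex_omega rp)].
    by apply: (A_ex rp); exact: (At rp).
  by apply: (A_ex rp); exact: (Ay rp).
rewrite /logdisc (canonical_eq rp hE (ex_dom rp) gt (rp_y0 rp)).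
  by rewrite (ord_ex rp (mult_y rp)).
by apply/funext => D; apply/funext => D'; exact: (dd_qt rp).
Qed.

(** The Jacobian of the blow-up is y, because dx /\ dy = y d(x/y) /\ dy; it contributes its order
    along E. *)
Lemma logdisc_qt O x y E : regpt iota O x y -> admissible E -> dominates E (qt iota O x y) ->
  logdisc O E = logdisc (qt iota O x y) E + ord E y.
Proof.
move=> rp [_ hE [v [gv [D [D' v0]]]]] d.
have rp' := regpt_qt rp.
have d' : dominates E O by apply: dom_trans d _; exact: (qt_dom rp).
have [f [form f0 e c]] := canonical_ex rp hE d' gv.
have [f' [hf' f'0 e' c']] := canonical_ex rp' hE d gv.
rewrite /logdisc c c' addrAC -(ordM hE) // ?(rp_y0 rp) //; congr (ord E _ + 1).
apply: (mulIf v0); have := congr1 (fun w => w D D') e => /= <-.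
rewrite (dd_qt rp); have := congr1 (fun w => w D D') e' => /= ->; ring.
Qed.

Lemma dom_qt O x y E : regpt iota O x y -> is_subalg iota E -> dvr E ->
  dominates E O -> max_ideal E (x / y) -> dominates E (qt iota O x y).
Proof.
move=> rp hEa hE d mt; have hl := dvr_local hE; have [h _] := hE.
have sub := dom_sub d.
have Asub : affch O x y `<=` E by apply: adj_min => //; exact: max_sub mt.
have my : max_ideal E y by apply: (dom_max d); apply/(rp_max rp); exact: (M_y _ _ (rp_alg rp)).
have uS s : inS iota O x y s -> unit_of E s.
  move=> [p [b [hb p0 ->]]]; have [q ->] := poly_split p.
  rewrite evD evM evX evC -addrA; apply: (unitD_max hl).
    split; [by rewrite fmorph_eq0|exact: (proj2 hEa)|by rewrite -fmorphV; apply: (proj2 hEa)].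
  apply: (max_idealD hl); rewrite mulrC; apply: max_idealM => //; last exact: Asub.
  by apply: Asub; exact: (A_ev rp).
have sub' : qt iota O x y `<=` E.
  move=> _ [a [s [ha hs ->]]]; have [_ _ ?] := uS s hs; apply: srM => //; exact: Asub.
apply: dominatesP => // z /(rp_max (regpt_qt rp)) [f [g [/sub' form /sub' hg ->]]].
by apply: (max_idealD hl); rewrite mulrC; apply: max_idealM.
Qed.

Lemma dom_qt_lt O x y E : regpt iota O x y -> dvr E -> dominates E (qt iota O x y) ->
  ord E y < ord E x.
Proof.
move=> rp hE d.
have : max_ideal E (x / y).
  apply: (dom_max d); apply/(rp_max (regpt_qt rp)); exact: (M_x _ _ (qt_alg rp)).
have x0 := rp_x0 rp; have y0 := rp_y0 rp.
have t0 : x / y != 0 by rewrite mulf_neq0 ?invr_eq0.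
by move/(ord_gt0 hE t0); rewrite (ord_div hE) // subr_gt0.
Qed.

Lemma dom_ord O x y E : regpt iota O x y -> dvr E -> dominates E O ->
  0 < ord E x /\ 0 < ord E y.
Proof.
move=> rp hE d; split.
  apply/(ord_gt0 hE (rp_x0 rp)); apply: (dom_max d); apply/(rp_max rp).
  exact: (M_x _ _ (rp_alg rp)).
apply/(ord_gt0 hE (rp_y0 rp)); apply: (dom_max d); apply/(rp_max rp).
exact: (M_y _ _ (rp_alg rp)).
Qed.

(** If x / y + c is a non-unit for some c, the center is that point of the exceptional line.
    Otherwise every nonzero polynomial in x / y is a unit, as it splits into linear factors; then E
    dominates the ring of the exceptional curve and equals it. *)
Lemma center_le O x y E : regpt iota O x y -> is_subalg iota E -> dvr E ->
  dominates E O -> ord E y <= ord E x ->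
  E = ex O x y \/ exists c, dominates E (qt iota O (x + y * iota c) y).
Proof.
move=> rp hEa hE d le; have hl := dvr_local hE; have [h _] := hE.
have x0 := rp_x0 rp; have y0 := rp_y0 rp; have sub := dom_sub d.
have t0 : x / y != 0 by rewrite mulf_neq0 ?invr_eq0.
have ht : E (x / y) by apply/(ord_ge0 hE t0); rewrite (ord_div hE) // subr_ge0.
have Asub : affch O x y `<=` E by apply: adj_min.
have [[c mc]|nc] := EM (exists c, max_ideal E (x / y + iota c)).
  right; exists c; apply: dom_qt => //.
    by apply: regpt_shift => //; apply: (proj2 (rp_alg rp)).
  by rewrite (_ : _ / y = x / y + iota c) //; fd.
left; have my : max_ideal E y by apply/(ord_gt0 hE y0); case: (dom_ord rp hE d).
have uev p : p != 0 -> unit_of E (ev iota (x / y) p).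
  move=> p0; have [r ->] := closed_field_poly_normal p.
  rewrite evZ; apply: unitM => //.
    split; [by rewrite fmorph_eq0 lead_coef_eq0|exact: (proj2 hEa)|].
    by rewrite -fmorphV; apply: (proj2 hEa).
  elim: r => [|c r IH]; first by rewrite big_nil ev1; apply: unit1.
  rewrite big_cons evM; apply: unitM => //; rewrite evB evX evC -rmorphN.
  have hc : E (x / y + iota (- c)) by apply: srD => //; apply: (proj2 hEa).
  by case: (unit_or_max hc) => // m; case: nc; exists (- c).
apply: (dvr_eq (ex_dvr rp) hE).
have uA s : affch O x y s -> ~ ydiv O x y s -> unit_of E s.
  move=> /(Ares rp) [p [b [hb ->]]] ny; apply: (unitD_max hl).
    apply: uev; apply/eqP => p0; apply: ny; exact/(yA_resP rp).
  by rewrite mulrC; apply: max_idealM => //; apply: Asub.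
have sub' : ex O x y `<=` E.
  move=> _ [a [s [ha hs ns ->]]]; have [_ _ ?] := uA s hs ns; apply: srM => //; exact: Asub.
apply: dominatesP => // z mz.
have em := dvr_max (ex_ring rp) (ex_max rp).
have hd := ex_dvr rp.
have [z00|z0] := eqVneq z 0; first by rewrite z00; apply: max_ideal0.
have zo : 0 < ord (ex O x y) z by apply/(ord_gt0 hd z0).
have : ex O x y (z / y).
  have zy0 : z / y != 0 by rewrite mulf_neq0 ?invr_eq0.
  apply/(ord_ge0 hd zy0); rewrite (ord_div hd) // (ord_ex rp (mult_y rp)) subr_ge0.
  by rewrite -gtz0_ge1.
by move=> /sub' hz; rewrite -(divfK y0 z); apply: max_idealM.
Qed.

Lemma center_cases O x y E : regpt iota O x y -> is_subalg iota E -> dvr E ->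
  dominates E O ->
  [\/ E = ex O x y, exists c, dominates E (qt iota O (x + y * iota c) y)
    | dominates E (qt iota O y x)].
Proof.
move=> rp hEa hE d; have [le|lt] := lerP (ord E y) (ord E x).
  by have [->|[c hc]] := center_le rp hEa hE d le; [constructor 1|constructor 2; exists c].
constructor 3; apply: (dom_qt (regpt_swap rp)) => //.
have x0 := rp_x0 rp; have y0 := rp_y0 rp.
have t0 : y / x != 0 by rewrite mulf_neq0 ?invr_eq0.
by apply/(ord_gt0 hE t0); rewrite (ord_div hE) // subr_gt0.
Qed.

(* E is the exceptional curve of the last of finitely many blow-ups of points
   infinitely near to that of O. *)
Inductive reach E : set K -> Prop :=
| reach_ex O x y : regpt iota O x y -> E = ex O x y -> reach E O
| reach_qt O x y : regpt iota O x y -> reach E (qt iota O x y) -> reach E O.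

Lemma reach_admissible E O : reach E O -> admissible E /\ dominates E O.
Proof.
elim=> {O} [O x y rp ->|O x y rp _ [ha d]].
  by split; [exact: (ex_admissible rp)|exact: (ex_dom rp)].
by split=> //; apply: dom_trans d _; exact: (qt_dom rp).
Qed.

(* Zariski: H bounds the forms of E by those of O, and dividing H by the
   exceptional equation at each blow-up lowers its order, which stays >= 0. *)
Lemma zariski O x y E H : regpt iota O x y -> is_subalg iota E -> dvr E ->
  dominates E O -> H != 0 ->
  (forall z w, E z -> E w -> exists2 g, E g & forall D D' : derivation,
     H * dd z w D D' = g * dd x y D D') -> reach E O.
Proof.
move=> rp hEa hE.
have [n] : exists n : nat, ord E H < n%:Z.
  by exists (`|ord E H|%N.+1); rewrite (le_lt_trans (ler_norm _)) // -abszE ltz_nat.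
elim: n O x y H rp => [|n IH] O x y H rp lt d H0 hH.
  have sub := dom_sub d.
  have [g hg e] := hH x y (sub _ (rp_x rp)) (sub _ (rp_y rp)).
  have [D [D' d0]] := rp_dd rp; have eg : H = g by apply: (mulIf d0); rewrite e.
  have : 0 <= ord E H by apply/(ord_ge0 hE H0); rewrite eg.
  by rewrite leNgt lt.
have step x1 y1 : regpt iota O x1 y1 -> dominates E (qt iota O x1 y1) ->
    (forall z w, E z -> E w -> exists2 g, E g & forall D D' : derivation,
     H * dd z w D D' = g * dd x1 y1 D D') -> reach E O.
  move=> rp1 d1 hH1; have y10 := rp_y0 rp1; apply: (reach_qt rp1).
  have [_ oy] := dom_ord rp1 hE (dom_trans d1 (qt_dom rp1)).
  apply: (IH _ (x1 / y1) y1 (H / y1)) => //; first exact: (regpt_qt rp1).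
  - rewrite (ord_div hE) //; move: lt oy; lia.
  - by rewrite mulf_neq0 ?invr_eq0.
  - move=> z w hz hw; have [g hg e] := hH1 z w hz hw; exists g => // D D'.
    apply: (mulIf y10); rewrite mulrAC divfK // e (dd_qt rp1); ring.
have [->|[c hc]|hc] := center_cases rp hEa hE d.
- exact: reach_ex rp _.
- apply: (step (x + y * iota c) y) => //.
    by apply: regpt_shift => //; apply: (proj2 (rp_alg rp)).
  move=> z w hz hw; have [g hg e] := hH z w hz hw; exists g => // D D'.
  have ed (F : derivation) : F (x + y * iota c) = F x + iota c * F y.
    by rewrite derD derM der_const; ring.
  by rewrite e /dd !ed; ring.
- apply: (step y x) => //; first exact: regpt_swap.
  move=> z w hz hw; have [g hg e] := hH z w hz hw; exists (- g) => [|D D'].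
    by apply: srN => //; case: hE.
  by rewrite e /dd; ring.
Qed.

(** All forms of E are multiples of v, so the coefficient f of dx /\ dy with respect to v serves as
    the bound H of [zariski]. *)
Lemma admissible_reach O x y E : regpt iota O x y -> admissible E -> dominates E O -> reach E O.
Proof.
move=> rp [hEa hE [v [gv nv]]] d.
have [f [form f0 e _]] := canonical_ex rp hE d gv.
apply: (zariski rp hEa hE d f0) => z w hz hw.
have := Omega2_dd (proj1 hE) hz hw; rewrite gv => -[g hg eg]; exists g => // D D'.
have := congr1 (fun w => w D D') e => /= ->; rewrite -eg; ring.
Qed.

End Divisors.

(** * Inversion of adjunction *)

Section Intersection.
Context (k : closedFieldType) (K : fieldType) (iota : {rmorphism k -> K}).
Implicit Types (O E : set K) (x y z t f g a b u : K) (p q : {poly k}).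
Local Notation qt := (qt iota).

(* The local intersection number of f with the curve y = 0 is d. *)
Definition icz O x y f d := exists u g, [/\ unit_of O u, O g & f = u * x ^+ d + y * g].

Lemma icz_M O x y f g d e : is_subring O -> O x -> O y ->
  icz O x y f d -> icz O x y g e -> icz O x y (f * g) (d + e).
Proof.
move=> h hx hy [u [a [hu ha ->]]] [v [b [hv hb ->]]].
have [_ ? _] := hu; have [_ ? _] := hv.
exists (u * v), (u * x ^+ d * b + v * x ^+ e * a + y * a * b); split; [exact: unitM|sr|].
by rewrite exprD; ring.
Qed.

(** Were f in a power beyond d, the monomial x^d, whose coefficient has nonzero residue c, would
    occur in a vanishing initial form. *)
Lemma icz_le O x y f d n : regpt iota O x y -> icz O x y f d -> M O x y n f -> (n <= d)%N.
Proof.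
move=> rp [u [g [hu hg ef]]] m; rewrite leqNgt; apply/negP => lt.
have hO := rp_alg rp; have h := proj1 hO; have hx := rp_x rp; have hy := rp_y rp.
have {}m := M_le hO hx hy lt m; have [u0 hu1 _] := hu.
case: d ef m {lt} => [|d] ef m.
  case: (max_nunit (L := O) (x := u)) => //; apply/(rp_max rp).
  rewrite (_ : u = f - g * y); last by rewrite ef expr0; ring.
  by apply: (M_B hO) => //; apply: (M_mulO hO) => //; exact: (M_y _ _ hO).
have mg : M O x y d g.
  apply: (M_divy rp) => //; rewrite (_ : y * g = f - u * x ^+ d.+1); last by rewrite ef; ring.
  apply: (M_B hO); first exact: (M_S hO hx hy).
  by apply: (M_mulO hO) => //; apply: (M_X hO); exact: (M_x _ _ hO).
have [q sq hq] := Msplit rp mg.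
have [c [g1 [g2 [h1 h2 eu]]]] := rp_res rp hu1.
have c0 : c != 0.
  apply/eqP => c0; case: (max_nunit (L := O) (x := u)) => //; apply/(rp_max rp).
  by rewrite eu c0 rmorph0 add0r; exists g1, g2.
have sX : (size (c *: 'X^d)%R <= d.+1)%N by rewrite size_scale // size_polyXn.
have eX : form iota d (c *: 'X^d) x y = iota c * x ^+ d.
  rewrite /form big_ord_recr /= coefZ coefXn eqxx mulr1 subnn mulr1 big1 ?add0r // => i _.
  by rewrite coefZ coefXn (ltn_eqF (ltn_ord i)) mulr0 rmorph0 !mul0r.
have : M O x y d.+2 (form iota d.+1 ('X * (c *: 'X^d) + q) x y).
  rewrite (form_step rp) // eX.
  rewrite (_ : _ + _ = f - (x * g1 + y * g2) * x ^+ d.+1 - y * (g - form iota d q x y)); last first.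
    by rewrite ef eu exprS; ring.
  apply: (M_B hO); first apply: (M_B hO) => //.
    rewrite -add1n; apply: (M_M hO); first by exists g1, g2.
    by apply: (M_X hO); exact: (M_x _ _ hO).
  by rewrite -add1n; apply: (M_M hO) => //; exact: (M_y _ _ hO).
move/(rp_ind rp) => H; have {}H : 'X * (c *: 'X^d) + q = 0.
  apply: H; apply: leq_trans (size_polyD _ _) _; rewrite geq_max (leqW sq) andbT.
  by apply: leq_trans (size_polyMleq _ _) _; rewrite size_polyX.
have := congr1 (coefp d.+1) H; rewrite /= coef0 coefD coefXM /= coefZ coefXn eqxx mulr1.
by rewrite nth_default // addr0 => /eqP; rewrite (negbTE c0).
Qed.

Lemma icz_neq0 O x y f d : regpt iota O x y -> icz O x y f d -> f != 0.
Proof.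
move=> rp hi; apply/eqP => f0; have := icz_le rp hi (n := d.+1).
by rewrite f0 ltnn => /(_ (M_0 _ _ (rp_alg rp) _)).
Qed.

(** The point of the blow-up considered here lies on the strict transform y / x = 0 of the curve; as
    in Noether's formula, the intersection number drops by n. *)
Lemma icz_strict O x y f d n : regpt iota O x y -> icz O x y f d -> M O x y n f ->
  icz (qt O y x) x (y / x) (f / x ^+ n) (d - n).
Proof.
move=> rp hi m; have le := icz_le rp hi m; have [u [g [hu hg ef]]] := hi.
have hO := rp_alg rp; have h := proj1 hO; have hx := rp_x rp; have hy := rp_y rp.
have rp' := regpt_swap rp; have sub := O_qt rp'; have x0 := rp_x0 rp.
have hu' : unit_of (qt O y x) u by apply: unit_sub hu.
have xn : x ^+ n != 0 by rewrite expf_neq0.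
have [_ hu1 _] := hu.
have ed : x ^+ d = x ^+ (d - n) * x ^+ n by rewrite -exprD subnK.
case: n m le xn ed => [|n] m le xn ed.
  exists u, (x * g); split=> //; first by apply: sub; sr.
  by rewrite divr1 ef subn0; fd.
have mg : M O x y n g.
  apply: (M_divy rp) => //; rewrite (_ : y * g = f - u * x ^+ d); last by rewrite ef; ring.
  apply: (M_B hO) => //; apply: (M_mulO hO) => //.
  exact: (M_le hO hx hy le (M_X hO d (M_x _ _ hO))).
exists u, (g / x ^+ n); split=> //.
  by apply: (A_qt rp'); apply: (AM_div rp'); exact: (M_change rp rp' mg).
have xn' : x ^+ n != 0 by rewrite expf_neq0.
rewrite ef ed; move: (x ^+ (d - n.+1)) => w; rewrite exprS; fd.
Qed.

(** Multiples of y have no intersection number with the curve y = 0. Reading the order of the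
    restriction of f only up to N covers them as well. *)
Lemma icz_dichotomy O x y f N : regpt iota O x y -> O f ->
  (exists a b, [/\ O a, O b & f = x ^+ N * a + y * b]) \/ exists2 d, (d < N)%N & icz O x y f d.
Proof.
move=> rp form.
have hO := rp_alg rp; have h := proj1 hO; have hx := rp_x rp; have hy := rp_y rp.
elim: N => [|N [[a [b [ha hb e]]]|[d lt hd]]]; last by right; exists d => //; exact: ltnW.
  by left; exists f, 0; split; [by []|sr|rewrite expr0; ring].
have [c [g1 [g2 [h1 h2 ea]]]] := rp_res rp ha.
have [c0|c0] := eqVneq c 0; last first.
  right; exists N => //; exists a, b; split=> //; last by rewrite e mulrC.
  case: (unit_or_max ha) => // m; exfalso.
  have : max_ideal O (iota c).
    rewrite (_ : iota c = a - (x * g1 + y * g2)); last by rewrite ea; ring.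
    apply: (max_idealD (rp_local rp)) => //; apply: max_idealN => //.
    by apply/(rp_max rp); exists g1, g2.
  case=> _; apply; split; rewrite ?fmorph_eq0 //; first exact: (proj2 hO).
  by rewrite -fmorphV; exact: (proj2 hO).
left; exists g1, (b + x ^+ N * g2); split; try sr.
by rewrite e ea c0 rmorph0 exprSr; ring.
Qed.

Lemma icz_bound O x y f d N a b : regpt iota O x y -> icz O x y f d ->
  O a -> O b -> f = x ^+ N * a + y * b -> (N <= d)%N.
Proof.
move=> rp [u [g [hu hg ef]]] ha hb e; rewrite leqNgt; apply/negP => lt.
have hO := rp_alg rp; have h := proj1 hO; have hx := rp_x rp; have hy := rp_y rp.
have [_ hu1 _] := hu.
have : icz O x y 0 d.
  exists (u - x * (x ^+ (N - d.+1) * a)), (g - b); split; last 2 first.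
  - by sr.
  - have eN : x ^+ N = x ^+ d * (x * x ^+ (N - d.+1)) by rewrite -exprS -exprD; congr (_ ^+ _); lia.
    have : f - f = 0 by rewrite subrr.
    by rewrite {1}ef e eN => <-; ring.
  - apply: (unitD_max (rp_local rp)) => //; apply: max_idealN => //.
    rewrite mulrC; apply: max_idealM => //; first by sr.
    by apply/(rp_max rp); exact: (M_x _ _ hO).
by move/(icz_neq0 rp)/eqP.
Qed.

End Intersection.

Section Adjunction.
Context (R : realFieldType) (k : closedFieldType) (K : fieldType).
Context (iota : {rmorphism k -> K}).
Implicit Types (O E : set K) (x y z t f g a b u : K) (p q : {poly k}).
Local Notation qt := (qt iota).

Lemma icz_mult O x y f d : regpt iota O x y -> icz O x y f d ->
  exists m, (m <= d)%N /\ mult O x y f m.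
Proof.
move=> rp hi; have f0 := icz_neq0 rp hi.
have hO := rp_alg rp; have h := proj1 hO; have hx := rp_x rp; have hy := rp_y rp.
have form : O f.
  by have [u [g [[_ hu _] hg ->]]] := hi; sr.
have [m mm] := mult_ex rp form f0; exists m; split=> //.
by apply: (icz_le rp hi); case: mm.
Qed.

(* Inversion of adjunction for the curve y = 0, by induction on the number of
   blow-ups needed to reach E. *)
Lemma adjunction (n : nat) O x y E (l : seq (R * K * nat)) :
  regpt iota O x y -> admissible iota E -> dominates E O -> logdisc iota O E <= n%:Z ->
  (forall w, w \in l -> 0 <= w.1.1 /\ icz O x y w.1.2 w.2) ->
  \sum_(w <- l) w.1.1 * w.2%:R <= 1 ->
  (ord E y)%:~R + \sum_(w <- l) w.1.1 * (ord E w.1.2)%:~R <= (logdisc iota O E)%:~R :> R.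
Proof.
elim: n O x y l => [|n IH] O x y l rp ha d le hl hs.
  by have := logdisc_ge1 rp ha d; lia.
have [hEa hE _] := ha.
have [e|[c hc]|hc] := center_cases rp hEa hE d.
- rewrite e (logdisc_ex rp) (ord_ex rp (mult_y rp)).
  have {}hs : \sum_(w <- l) w.1.1 * (ord (ex O x y) w.1.2)%:~R <= 1 :> R.
    apply: le_trans hs; rewrite big_seq [leRHS]big_seq; apply: ler_sum => w wl.
    have [w0 hw] := hl w wl; have [m [md mm]] := icz_mult rp hw.
    by rewrite (ord_ex rp mm) ler_wpM2l // -pmulrn ler_nat.
  by move: hs; rewrite -[1%:~R]/1 -[2%:~R]/2; lra.
(* The center leaves the strict transform of the curve, and y = 0 now is the exceptional curve. The
   strict transforms in the list meet it with numbers at most their multiplicities, so induction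
   applies; the total multiplicity, at most 1, is absorbed by the Jacobian. *)
- set x1 := x + y * iota c in hc.
  have rp1 : regpt iota O x1 y by apply: regpt_shift => //; apply: (proj2 (rp_alg rp)).
  have rpq := regpt_qt rp1; have y0 := rp_y0 rp.
  have [_ oy] := dom_ord rp hE d.
  have hF (w : R * K * nat) : exists v : K * nat * nat, w \in l ->
      [/\ icz (qt O x1 y) (x1 / y) y v.1.1 v.1.2, (v.1.2 <= w.2)%N, (v.2 <= w.2)%N
       & ord E w.1.2 = ord E v.1.1 + v.2%:Z * ord E y].
    case: (boolP (w \in l)) => [wl|_]; last by exists (0, 0%N, 0%N).
    have [w0 hw] := hl w wl; have [m [md mm]] := icz_mult rp hw.
    have [d' [u [g [h1 h2 h3 h4]]]] := strict_icz rp1 (mult_change rp rp1 mm).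
    have ym : y ^+ m != 0 by rewrite expf_neq0.
    have f0 := mult_neq0 rp mm.
    exists (w.1.2 / y ^+ m, d', m) => _; split=> //=.
    - by exists u, g.
    - exact: leq_trans md.
    - by rewrite (ord_div hE) // (ordX hE) // subrK.
  have [F hF'] := choice hF.
  have := IH (qt O x1 y) (x1 / y) y [seq (w.1.1, (F w).1.1, (F w).1.2) | w <- l] rpq ha hc.
  rewrite (logdisc_qt rp1 ha hc) in le *; rewrite !big_map /=.
  have e1 : \sum_(w <- l) w.1.1 * (ord E w.1.2)%:~R =
     \sum_(w <- l) w.1.1 * (ord E (F w).1.1)%:~R + (\sum_(w <- l) w.1.1 * (F w).2%:R) * (ord E y)%:~R :> R.
    rewrite mulr_suml -big_split; apply: eq_big_seq => w wl.
    by have [_ _ _ ->] := hF' w wl; rewrite rmorphD rmorphM /= -pmulrn; ring.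
  have e2 : \sum_(w <- l) w.1.1 * (F w).2%:R <= 1 :> R.
    apply: le_trans hs; rewrite big_seq [leRHS]big_seq; apply: ler_sum => w wl.
    have [w0 _] := hl w wl; have [_ _ h _] := hF' w wl.
    by rewrite ler_wpM2l // ler_nat.
  have e3 : \sum_(w <- l) w.1.1 * (F w).1.2%:R <= 1 :> R.
    apply: le_trans hs; rewrite big_seq [leRHS]big_seq; apply: ler_sum => w wl.
    have [w0 _] := hl w wl; have [_ h _ _] := hF' w wl.
    by rewrite ler_wpM2l // ler_nat.
  move=> H; have {}H := H _ _ e3; rewrite e1 rmorphD /=.
  have {}H : (ord E y)%:~R + \sum_(w <- l) w.1.1 * (ord E (F w).1.1)%:~R
       <= (logdisc iota (qt O x1 y) E)%:~R :> R.
    apply: H; first by move: le oy; lia.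
    move=> w /mapP [v vl ->] /=; have [v0 _] := hl v vl; by have [? _ _ _] := hF' v vl.
  have oyR : 0 < (ord E y)%:~R :> R by rewrite ltr0z.
  have : (\sum_(w <- l) w.1.1 * (F w).2%:R) * (ord E y)%:~R <= (ord E y)%:~R :> R.
    by rewrite ler_piMl // ltW.
  by move: H; lra.
(* The center stays on the strict transform y / x = 0. The exceptional curve x = 0 joins the list
   with the total multiplicity s as its weight and intersection number 1; since each number drops by
   the multiplicity, the weighted total stays at most 1. *)
- have rp1 := regpt_swap rp.
  have rpq := regpt_swap (regpt_qt rp1); have x0 := rp_x0 rp; have y0 := rp_y0 rp.
  have [ox oy] := dom_ord rp hE d.
  have hF (w : R * K * nat) : exists v : K * nat, w \in l ->
      [/\ icz (qt O y x) x (y / x) v.1 (w.2 - v.2), (v.2 <= w.2)%N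
       & ord E w.1.2 = ord E v.1 + v.2%:Z * ord E x].
    case: (boolP (w \in l)) => [wl|_]; last by exists (0, 0%N).
    have [w0 hw] := hl w wl; have [m [md mm]] := icz_mult rp hw.
    have xm : x ^+ m != 0 by rewrite expf_neq0.
    have f0 := mult_neq0 rp mm.
    exists (w.1.2 / x ^+ m, m) => _; split=> //=.
    - by apply: icz_strict => //; case: mm.
    - by rewrite (ord_div hE) // (ordX hE) // subrK.
  have [F hF'] := choice hF.
  pose s := \sum_(w <- l) w.1.1 * (F w).2%:R : R.
  have s0 : 0 <= s.
    rewrite /s big_seq; apply: sumr_ge0 => w wl; have [w0 _] := hl w wl.
    by rewrite mulr_ge0.
  have := IH (qt O y x) x (y / x) ((s, x, 1%N) :: [seq (w.1.1, (F w).1, (w.2 - (F w).2)%N) | w <- l]) rpq ha hc.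
  rewrite (logdisc_qt rp1 ha hc) in le *; rewrite !big_cons !big_map /=.
  have e1 : \sum_(w <- l) w.1.1 * (ord E w.1.2)%:~R =
     \sum_(w <- l) w.1.1 * (ord E (F w).1)%:~R + s * (ord E x)%:~R :> R.
    rewrite mulr_suml -big_split; apply: eq_big_seq => w wl.
    by have [_ _ ->] := hF' w wl; rewrite rmorphD rmorphM /= -pmulrn; ring.
  have e3 : s * 1%:R + \sum_(w <- l) w.1.1 * (w.2 - (F w).2)%N%:R <= 1 :> R.
    apply: le_trans hs; rewrite mulr1 -big_split big_seq [leRHS]big_seq; apply: ler_sum => w wl.
    by have [_ h _] := hF' w wl; rewrite natrB // le_eqVlt; apply/orP; left; apply/eqP; rewrite /=; ring.
  move=> H; have {}H := H _ _ e3; rewrite e1 rmorphD /=.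
  have {}H : (ord E (y / x))%:~R + (s * (ord E x)%:~R + \sum_(w <- l) w.1.1 * (ord E (F w).1)%:~R)
       <= (logdisc iota (qt O y x) E)%:~R :> R.
    apply: H; first by move: le ox; lia.
    move=> w; rewrite inE => /orP[/eqP -> /=|/mapP [v vl ->] /=]; last first.
      by have [v0 _] := hl v vl; have [? _ _] := hF' v vl.
    split=> //; exists 1, 0; split; [exact: unit1 (proj1 (rp_alg rpq))|exact: sr0 (proj1 (rp_alg rpq))|].
    by rewrite mulr0 addr0 mul1r.
  by move: H; rewrite (ord_div hE) // rmorphB /=; lra.
Qed.

(** [adjunction] for the curve y = 0 and the single function x, which meets it with number 1. *)
Lemma logdisc_ge O x y E : regpt iota O x y -> admissible iota E -> dominates E O ->
  ord E x + ord E y <= logdisc iota O E.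
Proof.
move=> rp ha d; have := @adjunction `|logdisc iota O E|%N O x y E [:: (1, x, 1%N)] rp ha d.
rewrite !big_seq1 /= !mul1r -rmorphD /= ler_int addrC; apply=> //.
  by rewrite abszE ler_norm.
move=> w; rewrite inE => /eqP -> /=; split=> //; exists 1, 0.
have h := proj1 (rp_alg rp).
by split; [exact: unit1|sr|rewrite mulr0 addr0 mul1r].
Qed.

End Adjunction.

(** * Weighted blow-ups *)

Section Toric.
Context (k : closedFieldType) (K : fieldType) (iota : {rmorphism k -> K}).
Implicit Types (O E : set K) (x y z t f g a b u : K).
Local Notation qt := (qt iota).

Lemma M_ord O x y E n r : regpt iota O x y -> dvr E -> dominates E O ->
  M O x y n r -> r != 0 -> n%:Z <= ord E r.
Proof.
move=> rp hE d m r0; have h := proj1 hE; have sub := dom_sub d.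
have [t [t0 em ht]] := dvr_ord_ex hE.
have mx : max_ideal E x by apply: (dom_max d); apply/(rp_max rp); exact: (M_x _ _ (rp_alg rp)).
have my : max_ideal E y by apply: (dom_max d); apply/(rp_max rp); exact: (M_y _ _ (rp_alg rp)).
have [a ha ea] : [set t * x | x in E] x by rewrite -em.
have [b hb eb] : [set t * x | x in E] y by rewrite -em.
have [c hc ec] : exists2 c, E c & r = t ^+ n * c.
  elim: n r m {r0} => [|n IH] r; first by move=> /sub hr; exists r; rewrite ?mul1r.
  move=> [f [g [/IH [f' form ->] /IH [g' hg ->] ->]]].
  by exists (a * f' + b * g'); [sr|rewrite -ea -eb exprS; ring].
have tn : t ^+ n != 0 by rewrite expf_neq0.
have c0 : c != 0 by apply: contra_neq r0 => c0; rewrite ec c0 mulr0.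
have mt : max_ideal E t by rewrite em; exists 1; [sr|rewrite mulr1].
have t1 : 1 <= ord E t by rewrite -gtz0_ge1; apply/(ord_gt0 hE t0).
rewrite ec (ordM hE) // (ordX hE) //.
have : 0 <= ord E c by apply/(ord_ge0 hE c0).
by nia.
Qed.

(* E is the exceptional curve of the blow-up with weights p of x and q of y. *)
Inductive toric E : set K -> K -> K -> nat -> nat -> Prop :=
| toric1 O x y : regpt iota O x y -> E = ex O x y -> toric E O x y 1 1
| toricx O x y p q : regpt iota O x y -> toric E (qt O x y) (x / y) y p q -> toric E O x y (p + q) q
| toricy O x y p q : regpt iota O x y -> toric E (qt O y x) x (y / x) p q -> toric E O x y p (p + q).

Lemma toric_regpt E O x y p q : toric E O x y p q -> regpt iota O x y.
Proof. by case. Qed.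

Lemma toric_reach E O x y p q : toric E O x y p q -> reach iota E O.
Proof.
elim=> {O x y p q} [O x y rp e|O x y p q rp _ IH|O x y p q rp _ IH].
- exact: reach_ex rp e.
- exact: reach_qt rp IH.
- exact: reach_qt (regpt_swap rp) IH.
Qed.

Lemma toric_facts E O x y p q : toric E O x y p q ->
  [/\ ord E x = p%:Z, ord E y = q%:Z, logdisc iota O E = (p + q)%N%:Z & (0 < p)%N && (0 < q)%N].
Proof.
elim=> {O x y p q} [O x y rp ->|O x y p q rp ht [ex' ey el /andP[p0 q0]]|O x y p q rp ht [ex' ey el /andP[p0 q0]]].
- by rewrite (ord_ex rp (mult_x rp)) (ord_ex rp (mult_y rp)) (logdisc_ex rp).
- have [ha d] := reach_admissible (toric_reach ht); have [_ hE _] := ha.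
  move: ex'; rewrite (ord_div hE) ?(rp_x0 rp) ?(rp_y0 rp) // ey => ex'.
  rewrite (logdisc_qt rp ha d) el ey; by split=> //; lia.
- have [ha d] := reach_admissible (toric_reach ht); have [_ hE _] := ha.
  move: ey; rewrite (ord_div hE) ?(rp_x0 rp) ?(rp_y0 rp) // ex' => ey.
  rewrite (logdisc_qt (regpt_swap rp) ha d) el ex'; by split=> //; lia.
Qed.

Lemma toric_exists O x y p q : regpt iota O x y -> coprime p q -> (0 < p)%N -> (0 < q)%N ->
  exists E, toric E O x y p q.
Proof.
have [n] := ubnP (p + q)%N; elim: n O x y p q => // n IH O x y p q le rp cpq p0 q0.
have [e|lt|lt] := ltngtP p q.
- have cpq' : coprime p (q - p) by rewrite /coprime -(gcdnDl _ (q - p)) subnKC 1?ltnW.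
  have [E hE] : exists E, toric E (qt O y x) x (y / x) p (q - p).
    apply: IH => //; [lia|exact/regpt_swap/regpt_qt/regpt_swap|by rewrite subn_gt0].
  by exists E; rewrite -(subnKC (ltnW e)); apply: toricy.
- have cpq' : coprime (p - q) q by rewrite coprime_sym /coprime -(gcdnDl _ (p - q)) subnKC 1?ltnW // gcdnC.
  have [E hE] : exists E, toric E (qt O x y) (x / y) y (p - q) q.
    apply: IH => //; [lia|exact: regpt_qt|by rewrite subn_gt0].
  by exists E; rewrite -(subnK (ltnW lt)); apply: toricx.
- have p1 : p = 1%N by move: cpq; rewrite -lt /coprime gcdnn => /eqP.
  by exists (ex O x y); rewrite -lt p1; apply: toric1.
Qed.

Definition mono (c : nat * nat -> k) x y (s : seq (nat * nat)) :=
  \sum_(w <- s) iota (c w) * (x ^+ w.1 * y ^+ w.2).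

(** Each blow-up substitutes x = t y or y = t x, which sends distinct monomials to distinct
    monomials and only transforms the weights. At the last blow-up the monomials of least degree
    form a nonzero initial form. *)
Lemma toric_mono E O x y p q (s : seq (nat * nat)) (c : nat * nat -> k) n :
  toric E O x y p q -> uniq s -> (forall w : nat * nat, w \in s -> (n <= p * w.1 + q * w.2)%N) ->
  (exists2 w : nat * nat, w \in s & c w != 0 /\ (p * w.1 + q * w.2)%N = n) ->
  mono c x y s != 0 /\ ord E (mono c x y s) = n%:Z.
Proof.
move=> ht; elim: ht s c => {O x y p q} [O x y rp ->|O x y p q rp ht IH|O x y p q rp ht IH] s c us hs [w ws [cw ew]].
- have hO := rp_alg rp; have hx := rp_x rp; have hy := rp_y rp; have y0 := rp_y0 rp.
  pose P := \sum_(w <- s | (w.1 + w.2 == n)%N) c w *: 'X^(w.1) : {poly k}.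
  have sP : (size P <= n.+1)%N.
    apply: leq_trans (size_sum _ _ _) _; apply/bigmax_leqP_seq => v _ /eqP vn.
    by apply: leq_trans (size_scale_leq _ _) _; rewrite size_polyXn; lia.
  have mm : M O x y n.+1 (mono c x y s - form iota n P x y).
    have -> : form iota n P x y = \sum_(w <- s | (w.1 + w.2 == n)%N) iota (c w) * (x ^+ w.1 * y ^+ w.2).
      rewrite hfE // -/(ev iota (x / y) P) /P.
      rewrite (big_morph (ev iota (x / y)) (evD iota (x / y)) (ev0 iota (x / y))) mulr_sumr.
      apply: eq_bigr => v /eqP vn; rewrite evZ evXn expr_div_n -vn exprD.
      have yv : y ^+ v.1 != 0 by rewrite expf_neq0.
      by move: (iota _) => e; fd.
    rewrite /mono (bigID (fun w => (w.1 + w.2 == n)%N)) /= addrAC subrr add0r big_seq_cond.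
    apply: (@M_sum _ _ _ O x y hO n.+1) => v /andP[vs vn]; apply: (M_ct hO).
    have le : (n.+1 <= v.1 + v.2)%N by have := hs v vs; rewrite !mul1n ltn_neqAle eq_sym vn.
    apply: (M_le hO hx hy le); apply: (M_M hO).
      exact: (M_X hO _ (M_x _ _ hO)).
    exact: (M_X hO _ (M_y _ _ hO)).
  have P0 : P != 0.
    apply: contra_neq cw => P0; have := congr1 (coefp w.1) P0; rewrite /= coef0 => <-.
    rewrite /P coef_sum (big_rem w) //= -ew !mul1n eqxx coefZ coefXn eqxx mulr1.
    rewrite big_seq_cond big1 ?addr0 // => v /andP[vs /eqP vn].
    rewrite coefZ coefXn; case: eqP => [e|]; last by rewrite mulr0.
    move: vs; rewrite (mem_rem_uniq _ us) inE => /andP[/eqP nvw _]; case: nvw.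
    rewrite [v]surjective_pairing [w]surjective_pairing -e; congr (_, _).
    by apply/eqP; rewrite -(eqn_add2l v.1) vn -e.
  have mn : M O x y n (mono c x y s).
    rewrite -[mono _ _ _ _](subrK (form iota n P x y)); apply: (M_D hO); first exact: (M_S hO hx hy mm).
    exact: form_M.
  have mum : mult O x y (mono c x y s) n.
    by split=> // /(M_lead rp sP mm) e; rewrite e eqxx in P0.
  by rewrite (mult_neq0 rp mum) (ord_ex rp mum).
- have y0 := rp_y0 rp.
  have -> : mono c x y s = mono (fun w => c (w.1, w.2 - w.1)%N) (x / y) y [seq (w.1, w.1 + w.2)%N | w <- s].
    rewrite /mono big_map; apply: eq_bigr => v _; rewrite /= addKn -surjective_pairing expr_div_n exprD.
    have yv : y ^+ v.1 != 0 by rewrite expf_neq0.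
    by move: (iota _) => e; fd.
  apply: IH.
  + rewrite map_inj_uniq // => -[a b] [a' b'] /= [-> /addnI ->] //.
  + by move=> _ /mapP[v vs ->] /=; have := hs v vs; lia.
  + exists (w.1, w.1 + w.2)%N; first by apply/mapP; exists w.
    by rewrite /= addKn -surjective_pairing; split=> //; lia.
- have x0 := rp_x0 rp.
  have -> : mono c x y s = mono (fun w => c (w.1 - w.2, w.2)%N) x (y / x) [seq (w.1 + w.2, w.2)%N | w <- s].
    rewrite /mono big_map; apply: eq_bigr => v _; rewrite /= addnK -surjective_pairing expr_div_n exprD.
    have yv : x ^+ v.2 != 0 by rewrite expf_neq0.
    by move: (iota _) => e; fd.
  apply: IH.
  + rewrite map_inj_uniq // => -[a b] [a' b'] /= [/[swap] -> /addIn ->] //.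
  + by move=> _ /mapP[v vs ->] /=; have := hs v vs; lia.
  + exists (w.1 + w.2, w.2)%N; first by apply/mapP; exists w.
    by rewrite /= addnK -surjective_pairing; split=> //; lia.
Qed.

Definition tri N : seq (nat * nat) := [seq (i, d - i)%N | d <- seq.iota 0 N, i <- seq.iota 0 d.+1].

Lemma mem_tri N w : (w \in tri N) = (w.1 + w.2 < N)%N.
Proof.
apply/allpairsPdep/idP => [[d [i []]]|lt].
  by rewrite !mem_iota !add0n /= => dN id -> /=; rewrite subnKC.
exists (w.1 + w.2)%N, w.1; rewrite !mem_iota !add0n /= addKn -surjective_pairing.
by split=> //; lia.
Qed.
Lemma tri_uniq N : uniq (tri N).
Proof.
apply: allpairs_uniq_dep; [exact: iota_uniq|by move=> d _; exact: iota_uniq|].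
move=> _ _ /allpairsPdep[d [i [hd hi ->]]] /allpairsPdep[d' [i' [hd' hi' ->]]] /= [e1 e2].
move: hi hi'; rewrite !mem_iota => hi hi'.
have ed : d = d' by lia.
by rewrite e1 ed.
Qed.

(** c is the family of coefficients of the image of f in the completion k[[x, y]], expressed through
    truncations. *)
Definition expansion O x y f c := forall N, M O x y N (f - mono c x y (tri N)).

Lemma tri_S N c x y : mono c x y (tri N.+1) =
  mono c x y (tri N) + \sum_(i < N.+1) iota (c (i : nat, N - i)%N) * (x ^+ i * y ^+ (N - i)).
Proof.
rewrite /mono {1}/tri -[N.+1]addn1 iotaD map_cat flatten_cat big_cat /=; congr (_ + _).
rewrite cats0 add0n addn1 -[X in \sum_(i <- X) _]/[seq (i, (N - i)%N) | i <- seq.iota 0 N.+1].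
by rewrite big_map -[seq.iota 0 N.+1]/(index_iota 0 N.+1) big_mkord.
Qed.

Lemma expansion_ex O x y f : regpt iota O x y -> O f -> exists c, expansion O x y f c.
Proof.
move=> rp fO; have hO := rp_alg rp.
have hP2 N z : exists P : {poly k}, M O x y N z -> (size P <= N.+1)%N /\ M O x y N.+1 (z - form iota N P x y).
  have [m|] := EM (M O x y N z); last by exists 0.
  by have [P sP hP'] := Msplit rp m; exists P.
have /choice [F hF] : forall v : nat * K, exists P : {poly k},
  M O x y v.1 v.2 -> (size P <= v.1.+1)%N /\ M O x y v.1.+1 (v.2 - form iota v.1 P x y).
  by move=> [N z]; exact: hP2.
(* r n is what remains of f after its homogeneous parts of degree below n have been subtracted. *)
pose r := fix r n := if n is m.+1 then r m - form iota m (F (m, r m)) x y else f.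
have hr n : M O x y n (r n).
  elim: n => [|n IH] //=; by have [_] := hF (n, r n) IH.
pose c (w : nat * nat) := (F (w.1 + w.2, r (w.1 + w.2))%N)`_(w.1).
exists c => N; suff -> : f - mono c x y (tri N) = r N by [].
elim: N => [|N IH]; first by rewrite /mono /tri big_nil subr0.
rewrite tri_S opprD addrA IH /=; congr (_ - _).
apply: eq_bigr => i _; have le : (i <= N)%N by rewrite -ltnS.
by rewrite /c /= subnKC // mulrA.
Qed.

Lemma nat_min (P : nat -> Prop) : (exists n, P n) -> exists2 n, P n & forall m, P m -> (n <= m)%N.
Proof.
move=> [n]; have [m] := ubnP n; elim: m n => // m IH n lt hn.
have [[l hl ln]|no] := EM (exists2 l, P l & (l < n)%N).
  by apply: (IH l) => //; lia.
by exists n => // l hl; rewrite leqNgt; apply/negP => ln; apply: no; exists l.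
Qed.

(** As p and q are at least 1, weight n bounds the degree by n. Cutting the expansion after degree n
    thus keeps all monomials of least weight, and the remainder has order above n. *)
Lemma toric_ord E O x y p q f c : toric E O x y p q -> O f -> f != 0 -> expansion O x y f c ->
  exists n : nat, [/\ ord E f = n%:Z, forall w, c w != 0 -> (n <= p * w.1 + q * w.2)%N
    & exists w, c w != 0 /\ (p * w.1 + q * w.2)%N = n].
Proof.
move=> ht form f0 he; have rp := toric_regpt ht; have hO := rp_alg rp.
have [_ _ _ /andP[p0 q0]] := toric_facts ht.
have [[_ hE _] d] := reach_admissible (toric_reach ht).
have [|n [w [cw wn]] hn] := nat_min (P := fun n => exists w, c w != 0 /\ (p * w.1 + q * w.2)%N = n).
  apply: contrapT => no; have [N] := rp_sep rp form f0; apply.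
  have := he N; rewrite /mono big1 ?subr0 // => w _.
  have [->|cw] := eqVneq (c w) 0; first by rewrite rmorph0 mul0r.
  by case: no; exists (p * w.1 + q * w.2)%N, w.
have hn' v : c v != 0 -> (n <= p * v.1 + q * v.2)%N by move=> cv; apply: hn; exists v.
exists n; split=> //; last by exists w.
have eF : mono c x y (tri n.+1) = mono c x y [seq v <- tri n.+1 | c v != 0].
  rewrite /mono big_filter (bigID (fun v => c v != 0)) /= addrC big1 ?add0r //.
  by move=> v; rewrite negbK => /eqP ->; rewrite rmorph0 mul0r.
have [|||F0 oF] := toric_mono (s := [seq v <- tri n.+1 | c v != 0]) (c := c) (n := n) ht.
- by rewrite filter_uniq // tri_uniq.
- by move=> v; rewrite mem_filter => /andP[cv _]; exact: hn'.
- by exists w; rewrite // mem_filter cw mem_tri -wn /= ltnS leq_add // leq_pmull.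
rewrite -eF in F0 oF.
have m := he n.+1; set F := mono c x y (tri n.+1) in F0 oF m.
rewrite -[f](subrK F) addrC.
have [->|r0] := eqVneq (f - F) 0; first by rewrite addr0.
have le := M_ord rp hE d m r0.
have [] := ordD_lt hE F0 r0; last by move=> _ ->.
by rewrite oF; move: le; lia.
Qed.

End Toric.

(** * Adapted coordinates *)

Section SetOrders.
Context (k : closedFieldType) (K : fieldType) (iota : {rmorphism k -> K}).
Implicit Types (O E S : set K) (x y z t f g a b u : K).
Local Notation qt := (qt iota).

(** From here on an ideal matters only as a set of elements: multiplicities, orders and strict
    transforms are taken element by element, without generating ideals in the blown-up rings. *)
Definition nzset O S := S `<=` O /\ exists2 f, S f & f != 0.
Definition is_smult O x y S m := (forall f, S f -> M O x y m f) /\ exists2 f, S f & mult O x y f m.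
Definition smult O x y S : nat := xget 0%N [set m | is_smult O x y S m].
Definition sord E S (n : int) := (forall f, S f -> f != 0 -> n <= ord E f) /\
  exists f, [/\ S f, f != 0 & ord E f = n].
(* The strict transform of S, of multiplicity m, in a chart in which y is the
   exceptional equation. *)
Definition strictset y m S := [set f / y ^+ m | f in S].

Lemma is_smult_uniq O x y S m n : regpt iota O x y -> is_smult O x y S m -> is_smult O x y S n -> m = n.
Proof.
move=> rp [a [f Sf mf]] [b [g Sg mg]]; apply/eqP; rewrite eqn_leq.
by rewrite (mult_le rp mg (a _ Sg)) (mult_le rp mf (b _ Sf)).
Qed.

Lemma smultP O x y S : regpt iota O x y -> nzset O S -> is_smult O x y S (smult O x y S).
Proof.
move=> rp [SO [f Sf f0]]; rewrite /smult; apply: xgetPex.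
have [|m [g Sg mg] hm] := nat_min (P := fun m => exists2 g, S g & mult O x y g m).
  by have [m mm] := mult_ex rp (SO _ Sf) f0; exists m, f.
exists m; split; last by exists g.
move=> l Sl; have hO := rp_alg rp.
have [->|l0] := eqVneq l 0; first exact: (M_0 _ _ hO).
have [j mj] := mult_ex rp (SO _ Sl) l0.
apply: (M_le hO (rp_x rp) (rp_y rp) _ (proj1 mj)); apply: hm; by exists l.
Qed.

Lemma smultE O x y S m : regpt iota O x y -> is_smult O x y S m -> smult O x y S = m.
Proof.
move=> rp h; apply: (is_smult_uniq rp _ h); rewrite /smult; apply: xgetPex; by exists m.
Qed.

Lemma smult_change O x y x' y' S : regpt iota O x y -> regpt iota O x' y' -> nzset O S ->
  smult O x y S = smult O x' y' S.
Proof.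
move=> rp rp' nz; have [h1 [f Sf mf]] := smultP rp' nz; apply: (smultE rp); split.
  by move=> g /h1; exact: (M_change rp' rp).
by exists f => //; exact: (mult_change rp' rp mf).
Qed.

Lemma strictset_nz O x y S : regpt iota O x y -> nzset O S ->
  nzset (qt O x y) (strictset y (smult O x y S) S).
Proof.
move=> rp nz; have [h1 _] := smultP rp nz; have [_ [f Sf f0]] := nz.
have ym : y ^+ (smult O x y S) != 0 by rewrite expf_neq0 // (rp_y0 rp).
split; last by exists (f / y ^+ smult O x y S); [exists f|rewrite mulf_neq0 ?invr_eq0].
by move=> _ [g Sg <-]; apply: (A_qt rp); apply: (AM_div rp); apply: h1.
Qed.

Lemma sord_ex E O S : dvr E -> O `<=` E -> nzset O S -> exists n : nat, sord E S n%:Z.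
Proof.
move=> hE OE [SO [f Sf f0]].
have ge g : S g -> g != 0 -> exists n : nat, ord E g = n%:Z.
  move=> Sg g0; exists `|ord E g|%N; rewrite gez0_abs //; apply/(ord_ge0 hE g0)/OE/SO; exact: Sg.
have [|n [g [Sg g0 e]] hn] := nat_min (P := fun n : nat => exists g, [/\ S g, g != 0 & ord E g = n%:Z]).
  by have [n hn] := ge f Sf f0; exists n, f.
exists n; split; last by exists g.
move=> l Sl l0; have [j ej] := ge l Sl l0; rewrite ej lez_nat; apply: hn; by exists l.
Qed.

Lemma sord_uniq E S m n : sord E S m -> sord E S n -> m = n.
Proof.
move=> [h1 [f [Sf f0 ef]]] [h2 [g [Sg g0 eg]]]; apply/le_anti/andP; split.
  by rewrite -eg; apply: h1.
by rewrite -ef; apply: h2.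
Qed.

Lemma sord_strictset E S y m n : dvr E -> y != 0 -> sord E S n ->
  sord E (strictset y m S) (n - m%:Z * ord E y).
Proof.
move=> hE y0 [h1 [f [Sf f0 ef]]]; have ym : y ^+ m != 0 by rewrite expf_neq0.
split.
  move=> _ [g Sg <-]; rewrite mulf_eq0 invr_eq0 negb_or => /andP[g0 _].
  by rewrite (ord_div hE) // (ordX hE) // lerB // h1.
exists (f / y ^+ m); split; [by exists f|by rewrite mulf_neq0 ?invr_eq0|].
by rewrite (ord_div hE) // (ordX hE) // ef.
Qed.

Lemma sord_exc O x y S : regpt iota O x y -> nzset O S ->
  sord (ex O x y) S (smult O x y S)%:Z.
Proof.
move=> rp nz; have [h1 [f Sf mf]] := smultP rp nz; split.
  move=> g Sg g0; apply: (M_ord rp (ex_dvr rp) (ex_dom rp) _ g0); exact: h1.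
by exists f; split=> //; [exact: (mult_neq0 rp mf)|exact: (ord_ex rp mf)].
Qed.

(* true blows up the point, false exchanges the coordinates. *)
Fixpoint pathdiv O x y (s : seq bool) : set K :=
  if s is b :: s' then
    if b then pathdiv (qt O x y) (x / y) y s' else pathdiv O y x s'
  else ex O x y.

Fixpoint pathweight (s : seq bool) : nat * nat :=
  if s is b :: s' then
    let w := pathweight s' in if b then (w.1 + w.2, w.2)%N else (w.2, w.1)
  else (1, 1)%N.

Lemma pathweight_gt0 s : (0 < (pathweight s).1)%N && (0 < (pathweight s).2)%N.
Proof. by elim: s => [|[] s /andP[IH1 IH2]] //=; rewrite ?addn_gt0 IH1 IH2. Qed.

Lemma toric_swap E O x y p q : toric iota E O x y p q -> toric iota E O y x q p.
Proof.
elim=> {O x y p q} [O x y rp ->|O x y p q rp _ IH|O x y p q rp _ IH].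
(* Both parameters have order 1 along [ex O x y], whereas a center at a point of a chart would make
   the orders of two parameters differ. So the ring does not depend on the order of the
   coordinates. *)
- have rp' := regpt_swap rp; apply: toric1 => //.
  apply: (dvr_eq (ex_dvr rp') (ex_dvr rp)).
  have [e|[c hc]|hc] := center_cases rp' (ex_alg rp) (ex_dvr rp) (ex_dom rp).
  + by rewrite e; exact: dom_refl.
  + exfalso; set x1 := y + x * iota c in hc.
    have rp1 : regpt iota O x1 x by apply: regpt_shift => //; apply: (proj2 (rp_alg rp)).
    have := dom_qt_lt rp1 (ex_dvr rp) hc; rewrite (ord_ex rp (mult_x rp)).
    by rewrite (ord_ex rp (mult_change rp1 rp (mult_x rp1))) ltxx.
  + exfalso; have := dom_qt_lt rp (ex_dvr rp) hc.
    by rewrite (ord_ex rp (mult_x rp)) (ord_ex rp (mult_y rp)) ltxx.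
- by rewrite addnC; apply: toricy => //; exact: regpt_swap.
- by rewrite addnC; apply: toricx => //; exact: regpt_swap.
Qed.

Lemma pathdiv_toric O x y s : regpt iota O x y -> toric iota (pathdiv O x y s) O x y (pathweight s).1 (pathweight s).2.
Proof.
elim: s O x y => [|[] s IH] O x y rp /=; first exact: toric1.
- by apply: toricx => //; apply: IH; exact: regpt_qt.
- by apply: toric_swap; apply: IH; exact: regpt_swap.
Qed.

Lemma pathweight_ex p q : coprime p q -> (0 < p)%N -> (0 < q)%N -> exists s, pathweight s = (p, q).
Proof.
have [n] := ubnP (p + q)%N; elim: n p q => // n IH p q le cpq p0 q0.
have [e|lt|lt] := ltngtP p q.
- have [s es] : exists s, pathweight s = (p, (q - p)%N).
    apply: IH; rewrite ?subn_gt0 //; first by lia.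
    by rewrite /coprime -(gcdnDl _ (q - p)) subnKC 1?ltnW.
  by exists [:: false, true, false & s]; rewrite /= es /=; congr pair; lia.
- have [s es] : exists s, pathweight s = ((p - q)%N, q).
    apply: IH; rewrite ?subn_gt0 //; first by lia.
    by rewrite coprime_sym /coprime -(gcdnDl _ (p - q)) subnKC 1?ltnW // gcdnC.
  by exists [:: true & s]; rewrite /= es /=; congr pair; lia.
- have p1 : p = 1%N by move: cpq; rewrite -lt /coprime gcdnn => /eqP.
  by exists [::]; rewrite -lt p1.
Qed.

End SetOrders.

(** * Good points on exceptional curves and comparison with toric divisors *)

Section Goodness.
Context (R : realType) (r : nat) (k : closedFieldType) (K : fieldType).
Context (iota : {rmorphism k -> K}).
Implicit Types (O E S : set K) (x y z t f g : K) (a : 'I_r -> set K) (e : 'I_r -> R).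
Local Notation qt := (qt iota).

Definition strictfam O x y a := fun i => strictset y (smult O x y (a i)) (a i).

(* At the point of the exceptional curve N over the direction x = 0, the
   weak transform of the multi-ideal meets N with multiplicity at most 1. *)
Definition good e O x y a := exists (F : 'I_r -> K) (d : 'I_r -> nat),
  (forall i, strictfam O x y a i (F i) /\ icz (qt O x y) (x / y) y (F i) (d i)) /\
  \sum_(i < r) e i * (d i)%:R <= 1.

(* At the end of the path s the strict transforms are good at every free point of
   the last exceptional curve. *)
Fixpoint goodpath e a O x y (s : seq bool) : Prop :=
  if s is b :: s' then
    if b then goodpath e (strictfam O x y a) (qt O x y) (x / y) y s' else goodpath e a O y x s'
  else forall c, c != 0 -> good e O (x + y * iota c) y a.

Lemma center_eq O x y E : regpt iota O x y -> is_subalg iota E -> dvr E -> dominates E O ->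
  ord E x = ord E y ->
  E = ex O x y \/ exists2 c, c != 0 & dominates E (qt O (x + y * iota c) y).
Proof.
move=> rp hEa hE d e; have [|->|[c hc]] := center_le rp hEa hE d; first by rewrite e.
  by left.
right; exists c => //; apply/eqP => c0; move: hc.
by rewrite c0 rmorph0 mulr0 addr0 => /(dom_qt_lt rp hE); rewrite e ltxx.
Qed.

(** Each blow-up along the path changes both sides by the same amount, since the order of y along E
    is n times that along the toric divisor. At the end the orders of x and y agree, so E is the
    last exceptional curve or lies over a free point of it, where [adjunction] applies. Goodness for
    e enters only as a bound by 1 of a weighted sum, which the implication between e and e'
    transfers. *)
Lemma toric_domination e e' a O x y s E n : regpt iota O x y ->
  (forall i, nzset O (a i)) -> (forall i, 0 <= e' i) ->
  (forall m : 'I_r -> nat, \sum_(i < r) e i * (m i)%:R <= 1 -> \sum_(i < r) e' i * (m i)%:R <= 1) ->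
  goodpath e a O x y s -> admissible iota E -> dominates E O ->
  ord E x = (n * (pathweight s).1)%N%:Z -> ord E y = (n * (pathweight s).2)%N%:Z ->
  forall v w : 'I_r -> int, (forall i, sord E (a i) (v i)) ->
  (forall i, sord (pathdiv iota O x y s) (a i) (w i)) ->
  n%:R * ((logdisc iota O (pathdiv iota O x y s))%:~R - \sum_(i < r) e' i * (w i)%:~R)
    <= (logdisc iota O E)%:~R - \sum_(i < r) e' i * (v i)%:~R.
Proof.
move=> rp nz e'0 imp; elim: s a O x y rp nz => [|[] s IH] a O x y rp nz hg ha d ox oy v w hv hw.
- have [hEa hE _] := ha; rewrite /= ?muln1 in ox oy hw *.
  have ew i : w i = (smult O x y (a i))%:Z.
    by apply: sord_uniq (hw i) _; exact: (sord_exc rp).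
  rewrite (logdisc_ex rp).
  have [eE|[c c0 hc]] := center_eq rp hEa hE d (etrans ox (esym oy)).
    have n1 : n = 1%N by move: ox; rewrite eE (ord_ex rp (mult_x rp)) => -[].
    rewrite n1 eE (logdisc_ex rp) mul1r.
    rewrite le_eqVlt; apply/orP; left; apply/eqP; congr (_ - _).
    apply: eq_bigr => i _; congr (_ * _%:~R).
    by apply: sord_uniq (hw i) _; rewrite -eE.
  set x1 := x + y * iota c in hc.
  have rp1 : regpt iota O x1 y by apply: regpt_shift => //; apply: (proj2 (rp_alg rp)).
  have [F [dd_ [hF hd]]] := hg c c0; rewrite -/x1 in hF.
  have y0 := rp_y0 rp.
  have := @adjunction R _ _ iota `|logdisc iota (qt O x1 y) E|%N _ (x1 / y) y E
    [seq (e' i, F i, dd_ i) | i <- index_enum 'I_r] (regpt_qt rp1) ha hc.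
  rewrite !big_map /= => /(_ _ _ (imp _ hd)) adj.
  have {}adj : (ord E y)%:~R + \sum_(i < r) e' i * (ord E (F i))%:~R <= (logdisc iota (qt O x1 y) E)%:~R :> R.
    apply: adj; first by rewrite abszE ler_norm.
    by move=> u /mapP[i _ ->] /=; have [_ ?] := hF i.
  rewrite (logdisc_qt rp1 ha hc) oy (rmorphD _ (logdisc iota (qt O x1 y) E)) /=; rewrite oy in adj.
  have hs : \sum_(i < r) e' i * (v i)%:~R <=
      \sum_(i < r) e' i * (ord E (F i))%:~R + n%:R * \sum_(i < r) e' i * (w i)%:~R :> R.
    rewrite mulr_sumr -big_split; apply: ler_sum => i _.
    have [[f af ef] hic] := hF i.
    have F0 := icz_neq0 (regpt_qt rp1) hic.
    have ym : y ^+ smult O x1 y (a i) != 0 by rewrite expf_neq0.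
    have f0 : f != 0 by apply: contra_neq F0 => f0; rewrite -ef f0 mul0r.
    have := (hv i).1 f af f0.
    have -> : ord E f = ord E (F i) + n%:Z * w i.
      rewrite -ef (ord_div hE) // (ordX hE) // oy ew (smult_change rp1 rp (nz i)); ring.
    rewrite -(ler_int R) rmorphD rmorphM /= => /(ler_wpM2l (e'0 i)).
    by rewrite mulrDr; lra.
  rewrite -[2%:~R]/(2 : R); move: adj hs; rewrite -pmulrn; lra.
- have [hEa hE _] := ha; have y0 := rp_y0 rp; have x0 := rp_x0 rp.
  have rp1 := regpt_qt rp.
  have /andP[w1 w2] := pathweight_gt0 s; rewrite /= in ox oy hw hg *.
  have d1 : dominates E (qt O x y).
    apply: dom_qt => //; have t0 : x / y != 0 by rewrite mulf_neq0 ?invr_eq0.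
    apply/(ord_gt0 hE t0); rewrite (ord_div hE) // ox oy.
    have [o _] := dom_ord rp hE d; move: o; rewrite ox mulnDr; nia.
  have nz1 i : nzset (qt O x y) (strictfam O x y a i) by apply: strictset_nz.
  have ox1 : ord E (x / y) = (n * (pathweight s).1)%N%:Z.
    by rewrite (ord_div hE) // ox oy mulnDr; lia.
  have hT := pathdiv_toric s rp1; have [[_ hN _] dN] := reach_admissible (toric_reach hT).
  have [_ oNy _ _] := toric_facts hT.
  have := IH _ _ _ _ rp1 nz1 hg ha d1 ox1 oy
    (fun i => v i - (smult O x y (a i))%:Z * ord E y)
    (fun i => w i - (smult O x y (a i))%:Z * ord (pathdiv iota (qt O x y) (x / y) y s) y).
  move=> H; have {}H := H (fun i => sord_strictset _ hE y0 (hv i)) (fun i => sord_strictset _ hN y0 (hw i)).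
  have adN : admissible iota (pathdiv iota (qt O x y) (x / y) y s) by case: (reach_admissible (toric_reach hT)).
  rewrite (logdisc_qt rp ha d1) (logdisc_qt rp adN dN) oy oNy.
  rewrite oy oNy in H.
  have eS (u : 'I_r -> int) (j : int) : \sum_(i < r) e' i * (u i - (smult O x y (a i))%:Z * j)%:~R =
      \sum_(i < r) e' i * (u i)%:~R - (\sum_(i < r) e' i * (smult O x y (a i))%:R) * j%:~R :> R.
    rewrite mulr_suml -sumrB; apply: eq_bigr => i _; rewrite rmorphB rmorphM /= -pmulrn; ring.
  rewrite !eS in H; move: (logdisc _ _ (pathdiv _ _ _ _ _)) (logdisc _ _ E) H => LN LE H.
  rewrite !rmorphD /=; rewrite -!pmulrn natrM in H *.
  by move: H; lra.
- have := IH a O y x (regpt_swap rp) nz hg ha d oy ox v w hv; rewrite /= in hw *.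
  exact.
Qed.

End Goodness.

(** * Orders forced by the multiplicity at a free point *)

Section LeafMultiplicity.
Context (k : closedFieldType) (K : fieldType) (iota : {rmorphism k -> K}).
Implicit Types (O E S : set K) (x y z t f g a b u : K) (c : k).
Local Notation qt := (qt iota).

Lemma M_xn O x y n f : regpt iota O x y -> M O x y n f ->
  exists a b, [/\ O a, O b & f = x ^+ n * a + y * b].
Proof.
move=> rp m; have [h _] := rp_alg rp; have hx := rp_x rp; have hy := rp_y rp.
elim: n f m => [|n IH] f m.
  by exists f, 0; split; [by []|sr|rewrite expr0; ring].
move: m => [f1 [g1 [/IH [a [b [ha hb ->]]] m2 ->]]].
exists a, (x * b + g1); split; [by []| |by rewrite exprS; ring].
by have := M_O (rp_alg rp) hx hy m2 => ?; sr.
Qed.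

(* d is the multiplicity with which the strict transform of S meets, at the free
   point c, the last exceptional curve of the path s. *)
Fixpoint leaf S O x y (s : seq bool) c d : Prop :=
  if s is b :: s' then
    if b then leaf (strictset y (smult O x y S) S) (qt O x y) (x / y) y s' c d
    else leaf S O y x s' c d
  else let x1 := x + y * iota c in let S1 := strictset y (smult O x1 y S) S in
    (exists2 F, S1 F & icz (qt O x1 y) (x1 / y) y F d) /\
    (forall F, S1 F -> exists a b, [/\ qt O x1 y a, qt O x1 y b & F = (x1 / y) ^+ d * a + y * b]).

(** d is the least intersection number occurring in the strict transform; [icz_dichotomy] truncated
    at d gives the second clause for the remaining elements. *)
Lemma leaf_ex S O x y s c : regpt iota O x y -> nzset O S -> exists d, leaf S O x y s c d.
Proof.
elim: s S O x y => [|[] s IH] S O x y rp nz; last 2 first.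
- by apply: IH; [exact: regpt_qt|exact: strictset_nz].
- by apply: IH => //; exact: regpt_swap.
rewrite /=; set x1 := x + y * iota c.
have rp1 : regpt iota O x1 y by apply: regpt_shift => //; apply: (proj2 (rp_alg rp)).
set S1 := strictset _ _ _; have nz1 : nzset (qt O x1 y) S1 by apply: strictset_nz.
have [|d hd hmin] := nat_min (P := fun d => exists2 F, S1 F & icz (qt O x1 y) (x1 / y) y F d).
  have [_ [f Sf mf]] := smultP rp1 nz.
  have [d [u [g [_ hu hg e]]]] := strict_icz rp1 mf.
  by exists d, (f / y ^+ smult O x1 y S); [exists f|exists u, g].
exists d; split=> // F SF; have [SO _] := nz1.
have [//|[j lt hj]] := icz_dichotomy d (regpt_qt rp1) (SO _ SF).
by have := hmin j; rewrite leqNgt lt => H; have : ~~ true by apply: H; exists F.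
Qed.

(* If the strict transform meets the last exceptional curve N of the chain s
   with multiplicity d at a free point then its order along N is at least d p q. *)
Lemma leaf_bound S O x y s c d : regpt iota O x y -> nzset O S -> leaf S O x y s c d ->
  let p := (pathweight s).1 in let q := (pathweight s).2 in
  [/\ forall f, S f -> exists a b, [/\ O a, O b & f = x ^+ (d * q) * a + y * b],
      forall f, S f -> exists a b, [/\ O a, O b & f = y ^+ (d * p) * a + x * b]
    & forall v, sord (pathdiv iota O x y s) S v -> (d * p * q)%N%:Z <= v].
Proof.
elim: s S O x y => [|[] s IH] S O x y rp nz /=.
- set x1 := x + y * iota c; set S1 := strictset _ _ _ => -[_ h2].
  have rp1 : regpt iota O x1 y by apply: regpt_shift => //; apply: (proj2 (rp_alg rp)).
  have rps := regpt_swap rp; have [h _] := rp_alg rp.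
  have [h1 [f0 Sf0 mf0]] := smultP rp1 nz.
  have le : (d <= smult O x1 y S)%N.
    have [j [u [g [le hu hg e]]]] := strict_icz rp1 mf0.
    have [a [b [ha hb e2]]] : exists a b, [/\ qt O x1 y a, qt O x1 y b &
        f0 / y ^+ smult O x1 y S = (x1 / y) ^+ d * a + y * b] by apply: h2; exists f0.
    have hi : icz (qt O x1 y) (x1 / y) y (f0 / y ^+ smult O x1 y S) j by exists u, g.
    exact: leq_trans (icz_bound (regpt_qt rp1) hi ha hb e2) le.
  have hM f : S f -> M O x y d f.
    move=> /h1 m; apply: (M_le (rp_alg rp) (rp_x rp) (rp_y rp) le); exact: (M_change rp1 rp m).
  rewrite !muln1; split.
  + by move=> f /hM /(M_xn rp).
  + by move=> f /hM /(M_change rp rps) /(M_xn rps).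
  + move=> v [hv [f [Sf f0' <-]]].
    exact: (M_ord rp (ex_dvr rp) (ex_dom rp) (hM _ Sf) f0').
- move=> hl; have rp1 := regpt_qt rp; have nz1 := strictset_nz rp nz.
  have [b1 b2 b3] := IH _ _ _ _ rp1 nz1 hl.
  set m := smult O x y S in hl b1 b2 b3 nz1; set p := (pathweight s).1 in b1 b2 b3 *; set q := (pathweight s).2 in b1 b2 b3 *.
  have hO := rp_alg rp; have [h _] := hO; have hx := rp_x rp; have hy := rp_y rp.
  have [h1 [f0 Sf0 mf0]] := smultP rp nz; rewrite -/m in h1 mf0.
  have le : (d * q <= m)%N.
    have [j [u [g [le hu hg e]]]] := strict_icz rp mf0.
    have [a [b [ha hb e2]]] := b1 _ (ex_intro2 _ _ f0 Sf0 erefl).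
    have hi : icz (qt O x y) (x / y) y (f0 / y ^+ m) j by exists u, g.
    exact: leq_trans (icz_bound rp1 hi ha hb e2) le.
  split.
  + move=> f /h1 mf; exact: (M_xn rp (M_le hO hx hy le mf)).
  + move=> f Sf; have rps := regpt_swap rp.
    have [SO _] := nz.
    (* If f has an intersection number D with x = 0, its strict transform has D - m, which is at
       least d p by induction; with m at least d q this contradicts D below d (p + q). *)
    have [//|[D lt hD]] := icz_dichotomy (d * (p + q)) rps (SO _ Sf).
    have mf := M_change rp rps (h1 _ Sf).
    have leD := icz_le rps hD mf.
    have hst := icz_strict rps hD mf.
    have [a [b [ha hb e2]]] := b2 _ (ex_intro2 _ _ f Sf erefl).
    have := icz_bound (regpt_swap rp1) hst ha hb e2.
    by move: lt le leD; rewrite mulnDr; lia.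
  (* The multiplicity contributes m q to the order, at least d q^2, which turns d p q into d (p + q)
     q. *)
  + move=> v hv; have hT := pathdiv_toric s rp1; have [[_ hN _] dN] := reach_admissible (toric_reach hT).
    have [_ oNy _ _] := toric_facts hT.
    have := b3 _ (sord_strictset m hN (rp_y0 rp) hv); rewrite oNy -/q.
    by move: le; nia.
- move=> hl; have [b1 b2 b3] := IH _ _ _ _ (regpt_swap rp) nz hl; split=> //.
  by move=> v /b3; rewrite mulnAC.
Qed.

End LeafMultiplicity.

(** * Elimination of bad free points *)

Section FreePhase.
Context (R : realType) (r : nat) (k : closedFieldType) (K : fieldType).
Context (iota : {rmorphism k -> K}).
Implicit Types (O E S : set K) (x y z t f g : K) (a : 'I_r -> set K) (e : 'I_r -> R) (c : k).
Local Notation qt := (qt iota).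

Lemma goodpath_leaf e a O x y s : (forall c, c != 0 -> exists d : 'I_r -> nat,
    (forall i, leaf iota (a i) O x y s c (d i)) /\ \sum_(i < r) e i * (d i)%:R <= 1) ->
  goodpath iota e a O x y s.
Proof.
elim: s a O x y => [|[] s IH] a O x y h /=; try exact: IH.
move=> c /h [d [hd hs]]; have /choice [F hF] i : exists F, strictfam O (x + y * iota c) y a i F /\
    icz (qt O (x + y * iota c) y) ((x + y * iota c) / y) y F (d i).
  by have [[F SF hi] _] := hd i; exists F.
by exists F, d; split.
Qed.

Lemma goodpath_satellite e a O x y s (w : 'I_r -> int) : regpt iota O x y ->
  (forall i, nzset O (a i)) -> (forall i, 0 <= e i) ->
  (1 < (pathweight s).1)%N -> (1 < (pathweight s).2)%N ->
  (forall i, sord (pathdiv iota O x y s) (a i) (w i)) ->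
  \sum_(i < r) e i * (w i)%:~R <= ((pathweight s).1 + (pathweight s).2)%:R -> goodpath iota e a O x y s.
Proof.
move=> rp nz e0 p1 q1 hw hs; apply: goodpath_leaf => c _.
have /choice [d hd] i : exists d, leaf iota (a i) O x y s c d by exact: leaf_ex.
exists d; split=> //; set p := (pathweight s).1 in p1 hs; set q := (pathweight s).2 in q1 hs.
have pq : 0 < (p * q)%:R :> R by rewrite ltr0n; nia.
rewrite -(ler_pM2r pq) mul1r; apply: le_trans (_ : (p + q)%:R <= _); last by rewrite ler_nat; nia.
apply: le_trans hs; rewrite mulr_suml; apply: ler_sum => i _.
rewrite -mulrA ler_wpM2l // -natrM.
have [_ _ /(_ _ (hw i))] := leaf_bound rp (nz i) (hd i).
by rewrite -(ler_int R) -pmulrn -/p -/q mulnA.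
Qed.

Lemma smult_next O x y S : regpt iota O x y -> nzset O S ->
  (smult (qt O x y) (x / y) y (strictset y (smult O x y S) S) <= smult O x y S)%N.
Proof.
move=> rp nz; have [_ [f Sf mf]] := smultP rp nz.
have [d [u [g [le hu hg e]]]] := strict_icz rp mf.
have hi : icz (qt O x y) (x / y) y (f / y ^+ smult O x y S) d by exists u, g.
have [h1 _] := smultP (regpt_qt rp) (strictset_nz rp nz).
by apply: leq_trans le; apply: (icz_le (regpt_qt rp) hi); apply: h1; exists f.
Qed.

Lemma good_next e a O x y : regpt iota O x y -> (forall i, nzset O (a i)) ->
  (forall i, 0 <= e i) -> good iota e O x y a ->
  \sum_(i < r) e i * (smult (qt O x y) (x / y) y (strictfam O x y a i))%:R <= 1.
Proof.
move=> rp nz e0 [F [d [hF hs]]]; apply: le_trans hs; apply: ler_sum => i _.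
rewrite ler_wpM2l // ler_nat; have [SF hi] := hF i.
have [h1 _] := smultP (regpt_qt rp) (strictset_nz rp (nz i)).
by apply: (icz_le (regpt_qt rp) hi); apply: h1.
Qed.

Lemma small_good e a O x y : regpt iota O x y -> (forall i, nzset O (a i)) ->
  (forall i, 0 <= e i) -> \sum_(i < r) e i * (smult O x y (a i))%:R <= 1 ->
  good iota e O x y a.
Proof.
move=> rp nz e0 hs.
have hF i : exists w : K * nat, [/\ strictfam O x y a i w.1, icz (qt O x y) (x / y) y w.1 w.2
    & (w.2 <= smult O x y (a i))%N].
  have [_ [f Sf mf]] := smultP rp (nz i).
  have [d [u [g [le hu hg ee]]]] := strict_icz rp mf.
  by exists (f / y ^+ smult O x y (a i), d); split=> //=; [exists f|exists u, g].
have /choice [F hF'] := hF.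
exists (fun i => (F i).1), (fun i => (F i).2); split; first by move=> i; have [] := hF' i.
apply: le_trans hs; apply: ler_sum => i _; rewrite ler_wpM2l // ler_nat.
by have [] := hF' i.
Qed.

Lemma sum_smult_shift e a O x y g : regpt iota O x y -> (forall i, nzset O (a i)) -> O g ->
  \sum_(i < r) e i * (smult O (x + y * g) y (a i))%:R = \sum_(i < r) e i * (smult O x y (a i))%:R.
Proof.
move=> rp nz hg; apply: eq_bigr => i _.
by rewrite (smult_change (regpt_shift rp hg) rp (nz i)).
Qed.

Lemma small_goodpath e a O x y j : regpt iota O x y -> (forall i, nzset O (a i)) ->
  (forall i, 0 <= e i) -> \sum_(i < r) e i * (smult O x y (a i))%:R <= 1 ->
  goodpath iota e a O x y (nseq j true).
Proof.
elim: j a O x y => [|j IH] a O x y rp nz e0 hs /=.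
  move=> c _; have hc : O (iota c) by apply: (proj2 (rp_alg rp)).
  by apply: small_good => //; [exact: regpt_shift|rewrite sum_smult_shift].
apply: IH => //; [exact: regpt_qt|by move=> i; exact: strictset_nz|].
by apply: good_next => //; exact: small_good.
Qed.

Lemma icz_shift O x y g f d : is_subalg iota O -> O x -> O y -> O g ->
  icz O x y f d -> icz O (x + y * g) y f d.
Proof.
move=> hO hx hy hg [u [l [hu hl ->]]]; have [h _] := hO; have [_ ? _] := hu.
have [w hw ew] : exists2 w, O w & x ^+ d = (x + y * g) ^+ d + y * w.
  elim: d => [|d [w hw IH]]; first by exists 0; [sr|rewrite !expr0; ring].
  exists (x * w - g * (x + y * g) ^+ d); first by sr.
  by rewrite [x ^+ _]exprS [(x + _) ^+ _.+1]exprS IH; ring.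
by exists u, (u * w + l); split=> //; [sr|rewrite ew; ring].
Qed.

(** Shifting x by y^2 g moves x / y by y g, which vanishes at the point of the blow-up, so that the
    same point is described. *)
Lemma qt_shift_sub O x y g : regpt iota O x y -> O g ->
  qt O (x + y * (y * g)) y `<=` qt O x y.
Proof.
move=> rp hg; have [h hc] := rp_alg rp; have hy := rp_y rp; have y0 := rp_y0 rp.
have hyg : O (y * g) by sr.
have et : (x + y * (y * g)) / y = x / y + y * g by fd.
have hA := A_ring rp; have hAt := At rp; have hAg := OA rp hg; have hAy := Ay rp.
have Asub : affch O (x + y * (y * g)) y `<=` affch O x y.
  apply: adj_min => //; first exact: OA rp.
  by rewrite et; sr.
move=> _ [a [s [ha [p [b [hb p0 es]]] ->]]]; exists a, s; split=> //; first exact: Asub.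
have [q eq] := poly_split p.
have hev : affch O x y (ev iota (x / y + y * g) q).
  by apply: ev_mem; [exact: A_alg rp|sr].
have := S_D rp (S_ct rp p0) hev (b := g * ev iota (x / y + y * g) q + b).
have -> : iota p`_0 + x / y * ev iota (x / y + y * g) q + y * (g * ev iota (x / y + y * g) q + b) = s.
  rewrite es et [in RHS]eq evD evC evM evX; ring.
by apply; have := Asub _ hb => ?; sr.
Qed.

Lemma qt_shift O x y g : regpt iota O x y -> O g ->
  qt O (x + y * (y * g)) y = qt O x y.
Proof.
move=> rp hg; have [h _] := rp_alg rp; have hy := rp_y rp.
have rp1 : regpt iota O (x + y * (y * g)) y by apply: regpt_shift => //; sr.
rewrite eqEsubset; split; first exact: qt_shift_sub.
have := qt_shift_sub rp1 (srN h hg).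
by rewrite (_ : x + y * (y * g) + y * (y * - g) = x) //; ring.
Qed.

Lemma strictfam_shift a O x y g : regpt iota O x y -> (forall i, nzset O (a i)) -> O g ->
  strictfam O (x + y * g) y a = strictfam O x y a.
Proof.
move=> rp nz hg; apply/funext => i.
by rewrite /strictfam (smult_change (regpt_shift rp hg) rp (nz i)).
Qed.

Lemma good_shift e a O x y g : regpt iota O x y -> (forall i, nzset O (a i)) -> O g ->
  good iota e O x y a -> good iota e O (x + y * (y * g)) y a.
Proof.
move=> rp nz hg [F [d [hF hs]]]; have [h _] := rp_alg rp; have hy := rp_y rp.
have hyg : O (y * g) by sr.
exists F, d; split=> // i; have [SF hi] := hF i.
rewrite (strictfam_shift rp nz hyg) (qt_shift rp hg); split=> //.
rewrite (_ : (x + y * (y * g)) / y = x / y + y * g); last by have := rp_y0 rp => ?; fd.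
apply: icz_shift => //; [exact: qt_alg rp|exact: (A_qt rp (At rp))|exact: (A_qt rp (Ay rp))|].
exact: (O_qt rp hg).
Qed.

Lemma icz_res O x y f n d (p q : {poly k}) : regpt iota O x y -> (size p <= n.+1)%N ->
  M O x y n.+1 (f - form iota n p x y) -> p = 'X^d * q -> q`_0 != 0 ->
  icz (qt O x y) (x / y) y (f / y ^+ n) d.
Proof.
move=> rp sp hp ep q0; exists (ev iota (x / y) q), ((f - form iota n p x y) / y ^+ n.+1); split.
- by apply: (S_unit rp); apply: (S_ev rp).
- by apply: (A_qt rp); apply: (AM_div rp).
- have y0 := rp_y0 rp; have yn : y ^+ n != 0 by rewrite expf_neq0.
  rewrite (mulrC (ev iota (x / y) q)) -(evXn iota (x / y) d) -evM -ep hfE // -/(ev iota (x / y) p) exprS.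
  by move: (ev iota (x / y) p) => z; fd.
Qed.

(** Both intersection numbers are root multiplicities of the initial form of f: powers of X and of X
    + c are coprime and divide a polynomial of degree at most n. *)
Lemma two_points O x y f n c : regpt iota O x y -> mult O x y f n -> c != 0 ->
  exists d0 dc, [/\ (d0 + dc <= n)%N, icz (qt O x y) (x / y) y (f / y ^+ n) d0 &
    icz (qt O (x + y * iota c) y) ((x + y * iota c) / y) y (f / y ^+ n) dc].
Proof.
move=> rp muf c0; have [m nm] := muf; have [p sp hp] := Msplit rp m.
have y0 := rp_y0 rp; have hc : O (iota c) by apply: (proj2 (rp_alg rp)).
have rp1 := regpt_shift rp hc.
have p0 : p != 0 by apply/eqP => /(M_lead rp sp hp).
have [d0 [q [ep q0 lt]]] := polyX_split p0.
pose p1 := p \Po ('X - c%:P).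
have sp1 : size p1 = size p by rewrite /p1 size_comp_poly2 // size_XsubC.
have p10 : p1 != 0 by rewrite -size_poly_eq0 sp1 size_poly_eq0.
have [dc [q1 [ep1 q10 lt1]]] := polyX_split p10.
exists d0, dc; split.
- have e2 : p = ('X - (- c)%:P) ^+ dc * (q1 \Po ('X + c%:P)).
    have -> : p = p1 \Po ('X + c%:P).
      by rewrite /p1 -comp_polyA comp_polyB comp_polyX comp_polyC addrK comp_polyXr.
    by rewrite ep1 comp_polyM comp_Xn_poly polyCN opprK.
  have cop : coprimep ('X^d0) (('X - (- c)%:P) ^+ dc).
    apply/coprimep_expl/coprimep_expr; rewrite coprimep_XsubC rootE hornerX oppr_eq0.
    exact: c0.
  have : 'X^d0 * ('X - (- c)%:P) ^+ dc %| p.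
    by rewrite Gauss_dvdp // {1}ep dvdp_mulIl {1}e2 dvdp_mulIl.
  move/(dvdp_leq p0); rewrite size_monicM ?monicXn //; last first.
    by rewrite -size_poly_eq0 size_exp_XsubC.
  by rewrite size_polyXn size_exp_XsubC addSn addnS /= => /leq_trans /(_ sp).
- exact: (icz_res rp sp hp ep q0).
- apply: (icz_res rp1 _ _ ep1 q10); rewrite ?sp1 //.
  have -> : form iota n p1 (x + y * iota c) y = form iota n p x y.
    rewrite !hfE ?sp1 //; congr (_ * _).
    rewrite /p1 map_comp_poly rmorphB /= map_polyX map_polyC /= horner_comp !hornerE.
    by congr (_.[_]); fd.
  exact: (M_change rp rp1 hp).
Qed.

(** The other chart sees the coefficients of the initial form p in reverse order, so di is the
    amount by which the degree of p falls short of n. *)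
Lemma zero_infinity O x y f n : regpt iota O x y -> mult O x y f n ->
  exists d0 di, [/\ (d0 + di <= n)%N, icz (qt O x y) (x / y) y (f / y ^+ n) d0 &
    icz (qt O y x) (y / x) x (f / x ^+ n) di].
Proof.
move=> rp muf; have [m nm] := muf; have [p sp hp] := Msplit rp m.
have rp1 := regpt_swap rp.
have p0 : p != 0 by apply/eqP => /(M_lead rp sp hp).
have [d0 [q [ep q0 lt]]] := polyX_split p0.
pose p1 := \poly_(i < n.+1) p`_(n - i) : {poly k}.
have e1 : form iota n p1 y x = form iota n p x y.
  rewrite /form [RHS](reindex_inj rev_ord_inj) /=; apply: eq_bigr => i _.
  have le : (i <= n)%N by rewrite -ltnS.
  rewrite coef_poly ltn_ord subSS subKn //; ring.
have sp1 : (size p1 <= n.+1)%N by exact: size_poly.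
have hp1 : M O y x n.+1 (f - form iota n p1 y x) by rewrite e1; exact: (M_change rp rp1 hp).
have p10 : p1 != 0.
  apply/eqP => /(M_lead rp1 sp1 hp1) mf; apply: nm; exact: (M_change rp1 rp mf).
have [di [q1 [ep1 q10 lt1]]] := polyX_split p10.
exists d0, di; split; last 2 first.
- exact: (icz_res rp sp hp ep q0).
- exact: (icz_res rp1 sp1 hp1 ep1 q10).
have di_n : (di <= n)%N by lia.
have : p1`_di != 0 by rewrite ep1 coefXnM ltnn subnn.
rewrite coef_poly ltnS di_n ep coefXnM; case: ltnP; rewrite ?eqxx // => le _; lia.
Qed.

(** A total of at most 2 is shared by the two points, so one of them receives at most 1. Hence a bad
    point is unique among those of a chart. *)
Lemma good_two e a O x y c : regpt iota O x y -> (forall i, nzset O (a i)) ->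
  (forall i, 0 <= e i) -> \sum_(i < r) e i * (smult O x y (a i))%:R <= 2 -> c != 0 ->
  good iota e O x y a \/ good iota e O (x + y * iota c) y a.
Proof.
move=> rp nz e0 hs c0; have hc : O (iota c) by apply: (proj2 (rp_alg rp)).
have /choice [F hF] i : exists w : K * (nat * nat), [/\ strictfam O x y a i w.1,
    (w.2.1 + w.2.2 <= smult O x y (a i))%N, icz (qt O x y) (x / y) y w.1 w.2.1
    & icz (qt O (x + y * iota c) y) ((x + y * iota c) / y) y w.1 w.2.2].
  have [_ [f Sf mf]] := smultP rp (nz i).
  have [d0 [dc [le h0 h1]]] := two_points rp mf c0.
  by exists (f / y ^+ smult O x y (a i), (d0, dc)); split=> //=; exists f.
have le2 : \sum_(i < r) e i * (F i).2.1%:R + \sum_(i < r) e i * (F i).2.2%:R <= 2 :> R.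
  apply: le_trans hs; rewrite -big_split /=; apply: ler_sum => i _.
  by rewrite -mulrDr -natrD ler_wpM2l // ler_nat; have [] := hF i.
have [le|lt] := lerP (\sum_(i < r) e i * (F i).2.1%:R) (1 : R).
  left; exists (fun i => (F i).1), (fun i => (F i).2.1); split=> // i.
  by have [] := hF i.
right; exists (fun i => (F i).1), (fun i => (F i).2.2); split; last by lra.
by move=> i; rewrite (strictfam_shift rp nz hc); have [] := hF i.
Qed.

Lemma good_zero_infinity e a O x y : regpt iota O x y -> (forall i, nzset O (a i)) ->
  (forall i, 0 <= e i) -> \sum_(i < r) e i * (smult O x y (a i))%:R <= 2 ->
  good iota e O x y a \/ good iota e O y x a.
Proof.
move=> rp nz e0 hs; have rp1 := regpt_swap rp.
have /choice [F hF] i : exists w : (K * K) * (nat * nat), [/\ strictfam O x y a i w.1.1 /\ strictfam O y x a i w.1.2,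
    (w.2.1 + w.2.2 <= smult O x y (a i))%N, icz (qt O x y) (x / y) y w.1.1 w.2.1
    & icz (qt O y x) (y / x) x w.1.2 w.2.2].
  have [_ [f Sf mf]] := smultP rp (nz i).
  have [d0 [dc [le h0 h1]]] := zero_infinity rp mf.
  exists (f / y ^+ smult O x y (a i), f / x ^+ smult O x y (a i), (d0, dc)); split=> //=; split; first by exists f.
  by rewrite /strictfam (smult_change rp1 rp (nz i)); exists f.
have le2 : \sum_(i < r) e i * (F i).2.1%:R + \sum_(i < r) e i * (F i).2.2%:R <= 2 :> R.
  apply: le_trans hs; rewrite -big_split /=; apply: ler_sum => i _.
  by rewrite -mulrDr -natrD ler_wpM2l // ler_nat; have [] := hF i.
have [le|lt] := lerP (\sum_(i < r) e i * (F i).2.1%:R) (1 : R).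
  left; exists (fun i => (F i).1.1), (fun i => (F i).2.1); split=> // i.
  by have [[? _] _ ? _] := hF i.
right; exists (fun i => (F i).1.2), (fun i => (F i).2.2); split; last by lra.
by move=> i; have [[_ ?] _ _ ?] := hF i.
Qed.

Lemma sum_gap e : (forall i, 0 < e i) -> exists2 dl : R, 0 < dl &
  forall n : 'I_r -> nat, \sum_(i < r) e i * (n i)%:R = 1 \/ dl <= `|\sum_(i < r) e i * (n i)%:R - 1|.
Proof.
move=> e0.
have key (s : seq R) : exists2 dl : R, 0 < dl & forall z : R, z \in s -> z = 1 \/ dl <= `|z - 1|.
  elim: s => [|z s [dl dl0 hs]]; first by exists 1.
  have [->|z1] := eqVneq z 1.
    by exists dl => // w; rewrite inE => /orP[/eqP ->|/hs //]; left.
  exists (Num.min dl `|z - 1|); first by rewrite lt_min dl0 normr_gt0 subr_eq0.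
  move=> w; rewrite inE => /orP[/eqP ->|/hs [|le]]; [right|by left|right].
    by rewrite ge_min lexx orbT.
  by rewrite ge_min le.
(* As soon as some n_i exceeds B the sum is at least 2, so only finitely many sums come near 1. *)
have [B hB] : exists B : nat, forall i, 2 <= e i * B%:R.
  have /choice [b hb] i : exists b : nat, 2 <= e i * b%:R.
    exists (Num.bound (2 / e i)); have ei := e0 i.
    have : 2 / e i < (Num.bound (2 / e i))%:R.
      by apply: le_lt_trans (archi_boundP _); rewrite // divr_ge0 // ltW.
    by rewrite ltr_pdivrMr // mulrC => /ltW.
  exists (\max_i b i)%N => i; apply: le_trans (hb i) _; rewrite ler_wpM2l ?(ltW (e0 i)) // ler_nat.
  exact: leq_bigmax.
have [dl dl0 hdl] := key [seq \sum_(i < r) e i * (f i : nat)%:R | f : {ffun 'I_r -> 'I_B.+1}].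
exists (Num.min dl 1); first by rewrite lt_min dl0 ltr01.
move=> n; have [h|h] := EM (forall i, (n i < B.+1)%N).
  have [|//|le] := hdl (\sum_(i < r) e i * (n i)%:R).
  - apply/mapP; exists [ffun i => inord (n i)]; first by rewrite mem_enum.
    by apply: eq_bigr => i _; rewrite ffunE inordK.
  - by left.
  - by right; rewrite ge_min le.
right; have [i hi] : exists i, (B < n i)%N.
  by apply: contrapT => no; apply: h => i; rewrite ltnS leqNgt; apply/negP => lt; apply: no; exists i.
have s2 : 2 <= \sum_(i < r) e i * (n i)%:R.
  rewrite (bigD1 i) //=; apply: le_trans (hB i) _; rewrite -[leLHS]addr0; apply: lerD.
    by rewrite ler_wpM2l ?(ltW (e0 i)) // ler_nat ltnW.
  by apply: sumr_ge0 => j _; rewrite mulr_ge0 // ltW.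
by rewrite ge_min; apply/orP; right; rewrite ger0_norm; lra.
Qed.

(** The shifts are found over blown-up rings but have to lie in the original O; being polynomials in
    y over k, they do. *)
Definition kpoly y := [set z | exists p : {poly k}, z = ev iota y p].

Lemma kpoly_O O y g : is_subalg iota O -> O y -> kpoly y g -> O g.
Proof. by move=> hO hy [p ->]; exact: ev_mem. Qed.

(* Follow the unique bad free point as long as there is one: al is the log
   discrepancy of the last exceptional curve y = 0; it is nonnegative and drops
   by at least dl at each step. *)
Lemma free_phase e dl (n : nat) al a O x y : (forall i, 0 <= e i) -> 0 < dl ->
  (forall m : 'I_r -> nat, \sum_(i < r) e i * (m i)%:R = 1 \/
     dl <= `|\sum_(i < r) e i * (m i)%:R - 1|) ->
  regpt iota O x y -> (forall i, nzset O (a i)) ->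
  \sum_(i < r) e i * (smult O x y (a i))%:R <= 2 -> al < n%:R * dl ->
  (forall E v, admissible iota E -> dominates E O -> (forall i, sord E (a i) (v i)) ->
     0 <= (logdisc iota O E)%:~R - (1 - al) * (ord E y)%:~R - \sum_(i < r) e i * (v i)%:~R) ->
  exists g, [/\ kpoly y g, forall j, goodpath iota e a O (x + y * g) y (nseq j true)
    & (g = 0 /\ forall c, good iota e O (x + y * iota c) y a) \/
      ~ good iota e O (x + y * g) y a].
Proof.
move=> e0 dl0 gap.
have easy a' O' x' y' : regpt iota O' x' y' -> (forall i, nzset O' (a' i)) ->
    (forall c, good iota e O' (x' + y' * iota c) y' a') ->
    exists g, [/\ kpoly y' g, forall j, goodpath iota e a' O' (x' + y' * g) y' (nseq j true)
    & (g = 0 /\ forall c, good iota e O' (x' + y' * iota c) y' a') \/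
      ~ good iota e O' (x' + y' * g) y' a'].
  move=> rp nz hg; exists 0; split; [by exists 0; rewrite ev0| |by left].
  move=> [|j] /=; first by move=> c _; rewrite mulr0 addr0.
  rewrite mulr0 addr0; have g0 := hg 0; rewrite rmorph0 mulr0 addr0 in g0.
  by apply: small_goodpath => //; [exact: regpt_qt|move=> i; exact: strictset_nz|exact: good_next].
elim: n al a O x y => [|n IH] al a O x y rp nz h2 hal hlc;
  pose s := \sum_(i < r) e i * (smult O x y (a i))%:R;
  have al1 : 0 <= 1 + al - s by
    [have := hlc _ (fun i => (smult O x y (a i))%:Z) (ex_admissible rp) (ex_dom rp) (fun i => sord_exc rp (nz i));
     rewrite (logdisc_ex rp) (ord_ex rp (mult_y rp)) -[2%:~R]/(2 : R) mulr1 /s;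
     under eq_bigr => i _ do rewrite -pmulrn; lra].
  apply: easy => // c; have hc : O (iota c) by apply: (proj2 (rp_alg rp)).
  apply: small_good => //; first exact: regpt_shift.
  by rewrite sum_smult_shift // -/s; rewrite mul0r in hal; lra.
have [[c0 nc]|all_good] := EM (exists c, ~ good iota e O (x + y * iota c) y a); last first.
  by apply: easy => // c; apply: contrapT => ng; apply: all_good; exists c.
have hc0 : O (iota c0) by apply: (proj2 (rp_alg rp)).
have rp1 : regpt iota O (x + y * iota c0) y by exact: regpt_shift.
(* By [small_good] a bad point forces a total multiplicity above 1, and the gap makes it at least 1
   + dl. *)
have s1 : 1 + dl <= s.
  have [le|lt] := lerP s 1.
    by case: nc; apply: small_good => //; rewrite sum_smult_shift.
  have := gap (fun i => smult O x y (a i)); rewrite -/s => -[e1|]; first by rewrite e1 ltxx in lt.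
  by rewrite gtr0_norm ?subr_gt0 //; lra.
set x1 := x + y * iota c0 in rp1 nc.
have rpq := regpt_qt rp1; have y0 := rp_y0 rp.
have nz1 i : nzset (qt O x1 y) (strictfam O x1 y a i) by exact: strictset_nz.
have es : \sum_(i < r) e i * (smult O x1 y (a i))%:R = s by exact: sum_smult_shift.
(* 1 + al - s is the log discrepancy of the new exceptional curve, smaller than al by at least
   dl. *)
have [|||g1 [kg1 hg1 bad1]] := IH (1 + al - s) (strictfam O x1 y a) (qt O x1 y) (x1 / y) y rpq nz1.
- apply: le_trans h2; rewrite -/s -es; apply: ler_sum => i _.
  by rewrite ler_wpM2l // ler_nat; exact: smult_next.
- by move: hal; rewrite -addn1 natrD mulrDl; lra.
- move=> E v ha d hv; have [_ hE _] := ha.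
  have d' := dom_trans d (qt_dom rp1).
  have := hlc E (fun i => v i + (smult O x1 y (a i))%:Z * ord E y) ha d'.
  rewrite (logdisc_qt rp1 ha d) rmorphD /=.
  have -> : \sum_(i < r) e i * (v i + (smult O x1 y (a i))%:Z * ord E y)%:~R =
      \sum_(i < r) e i * (v i)%:~R + s * (ord E y)%:~R :> R.
    rewrite -es mulr_suml -big_split; apply: eq_bigr => i _.
    by rewrite rmorphD rmorphM /= -pmulrn; ring.
  move=> H; have {}H : 0 <= (logdisc iota (qt O x1 y) E)%:~R + (ord E y)%:~R - (1 - al) * (ord E y)%:~R -
     (\sum_(i < r) e i * (v i)%:~R + s * (ord E y)%:~R).
    apply: H => i; have [SO _] := nz i.
    have [m hm] := sord_ex hE (dom_sub d') (nz i).
    have := sord_uniq (hv i) (sord_strictset (smult O x1 y (a i)) hE y0 hm) => ->.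
    by rewrite subrK.
  by move: H; move: (logdisc _ _ _) => L; lra.
have hg1O : O g1 := kpoly_O (rp_alg rp) (rp_y rp) kg1.
have [hO _] := rp_alg rp; have hy := rp_y rp.
exists (iota c0 + y * g1).
have ex1 : x + y * (iota c0 + y * g1) = x1 + y * (y * g1) by rewrite /x1; ring.
rewrite ex1; split.
- by have [p ->] := kg1; exists (c0%:P + 'X * p); rewrite evD evM evX evC.
- move=> [|j] /=.
    move=> c cn0; have hc : O (iota c) by apply: (proj2 (rp_alg rp)).
    have -> : x1 + y * (y * g1) + y * iota c = x1 + y * iota c + y * (y * g1) by ring.
    apply: good_shift => //; first exact: regpt_shift.
    (* The point x1 / y = 0 is bad, so every other free point is good. *)
    have h21 : \sum_(i < r) e i * (smult O x1 y (a i))%:R <= 2 by rewrite es.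
    by have [|//] := good_two rp1 nz e0 h21 cn0.
  rewrite (strictfam_shift rp1 nz) ?(qt_shift rp1) //; last by sr.
  rewrite (_ : (x1 + y * (y * g1)) / y = x1 / y + y * g1); last by fd.
  exact: hg1.
- right=> hgood; apply: nc.
  have rp2 : regpt iota O (x1 + y * (y * g1)) y by apply: regpt_shift => //; sr.
  have := good_shift rp2 nz (srN hO hg1O) hgood.
  by rewrite (_ : x1 + y * (y * g1) + y * (y * - g1) = x1) //; ring.
Qed.

(* Every log canonical multi-ideal has coordinates in which the log discrepancy
   of an arbitrary divisor is bounded below by that of a toric one. *)
Theorem adapted_coordinates e a O x0 y0 : (forall i, 0 < e i) ->
  regpt iota O x0 y0 -> (forall i, nzset O (a i)) ->
  (forall E v, admissible iota E -> dominates E O -> (forall i, sord E (a i) (v i)) ->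
     0 <= (logdisc iota O E)%:~R - \sum_(i < r) e i * (v i)%:~R) ->
  exists x y, regpt iota O x y /\
   forall E, admissible iota E -> dominates E O -> exists p q n N,
    [/\ (0 < n)%N, coprime p q, toric iota N O x y p q,
        ord E x = (n * p)%N%:Z /\ ord E y = (n * q)%N%:Z
      & forall e' v w, (forall i, 0 <= e' i) ->
        (forall m : 'I_r -> nat, \sum_(i < r) e i * (m i)%:R <= 1 ->
           \sum_(i < r) e' i * (m i)%:R <= 1) ->
        (forall i, sord E (a i) (v i)) -> (forall i, sord N (a i) (w i)) ->
        n%:R * ((logdisc iota O N)%:~R - \sum_(i < r) e' i * (w i)%:~R)
          <= (logdisc iota O E)%:~R - \sum_(i < r) e' i * (v i)%:~R].
Proof.
move=> e0 rp0 nz hlc.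
have e0' i : 0 <= e i by apply: ltW.
have [dl dl0 gap] := sum_gap e0.
have mult2 x y : regpt iota O x y -> \sum_(i < r) e i * (smult O x y (a i))%:R <= 2.
  move=> rp; have := hlc _ (fun i => (smult O x y (a i))%:Z) (ex_admissible rp) (ex_dom rp) (fun i => sord_exc rp (nz i)).
  by rewrite (logdisc_ex rp) -[2%:~R]/(2 : R); under eq_bigr => i _ do rewrite -pmulrn; rewrite subr_ge0.
have phase x y : regpt iota O x y -> exists g, [/\ O g,
    forall j, goodpath iota e a O (x + y * g) y (nseq j true)
    & (g = 0 /\ forall c, good iota e O (x + y * iota c) y a) \/
      ~ good iota e O (x + y * g) y a].
  move=> rp; have [||g [kg h1 h2]] := @free_phase e dl (Num.bound dl^-1).+1 1 a O x y e0' dl0 gap rp nz (mult2 _ _ rp).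
  - rewrite mulrC -ltr_pdivrMl // mulr1 (lt_le_trans (archi_boundP _)) ?ler_nat //.
    by rewrite invr_ge0 ltW.
  - move=> E v ha d hv; rewrite subrr mul0r subr0; exact: hlc.
  - by exists g; split=> //; exact: kpoly_O (rp_alg rp) (rp_y rp) kg.
(* The weights (1, q) need the direction y = 0 to be good. If the direction x = 0 is bad, then it
   is, because the total multiplicity is at most 2. If x = 0 is good but y = 0 is bad, the phase is
   run again with the coordinates exchanged; it cannot end with all directions good. *)
have [x [y [rp gx goo]]] : exists x y, [/\ regpt iota O x y,
    forall j, goodpath iota e a O x y (nseq j true) & good iota e O y x a].
  have shiftok x y g : regpt iota O x y -> O g -> (forall j, goodpath iota e a O (x + y * g) y (nseq j true)) ->
      ~ good iota e O (x + y * g) y a -> exists x y, [/\ regpt iota O x y,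
    forall j, goodpath iota e a O x y (nseq j true) & good iota e O y x a].
    move=> rp hg hgl nb; have rp' := regpt_shift rp hg.
    exists (x + y * g), y; split=> //.
    by have [] := good_zero_infinity rp' nz e0' (mult2 _ _ rp').
  have [g [hg h1 [[g0 h2]|nb]]] := phase _ _ rp0; last exact: shiftok h1 nb.
  have [goo|nb] := EM (good iota e O y0 x0 a).
    exists x0, y0; split=> //.
    by move=> j; have := h1 j; rewrite g0 mulr0 addr0.
  have rp1 := regpt_swap rp0.
  have [g' [hg' h1' [[g0' h2']|nb']]] := phase _ _ rp1; last exact: shiftok rp1 hg' h1' nb'.
  by case: nb; have := h2' 0; rewrite rmorph0 mulr0 addr0.
exists x, y; split=> // E ha d; have [_ hE _] := ha.
have [ox oy] := dom_ord rp hE d.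
pose P := `|ord E x|%N; pose Q := `|ord E y|%N; pose n := gcdn P Q.
have P0 : (0 < P)%N by rewrite /P absz_gt0 gt_eqF.
have Q0 : (0 < Q)%N by rewrite /Q absz_gt0 gt_eqF.
have eP : ord E x = P%:Z by rewrite /P gez0_abs // ltW.
have eQ : ord E y = Q%:Z by rewrite /Q gez0_abs // ltW.
have n0 : (0 < n)%N by rewrite gcdn_gt0 P0.
have [p ep] : exists p, P = (n * p)%N by have /dvdnP[p ->] := dvdn_gcdl P Q; exists p; rewrite mulnC.
have [q eq] : exists q, Q = (n * q)%N by have /dvdnP[q ->] := dvdn_gcdr P Q; exists q; rewrite mulnC.
have p0 : (0 < p)%N by move: P0; rewrite ep muln_gt0 => /andP[].
have q0 : (0 < q)%N by move: Q0; rewrite eq muln_gt0 => /andP[].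
have cpq : coprime p q.
  by rewrite /coprime -(eqn_pmul2l n0) muln_gcdr -ep -eq muln1.
have wt1 j : pathweight (nseq j true) = (j.+1, 1)%N.
  by elim: j => //= j ->; rewrite addn1.
have [s [es hs]] : exists s, pathweight s = (p, q) /\ goodpath iota e a O x y s.
  have [q1|q1] := eqVneq q 1%N.
    by exists (nseq p.-1 true); split=> //; rewrite wt1 q1 prednK.
  have [p1|p1] := eqVneq p 1%N.
    have q2 : (1 < q)%N by rewrite ltn_neqAle eq_sym q1.
    exists (false :: nseq q.-1 true); split; first by rewrite /= wt1 p1 /= prednK.
    rewrite -(@prednK q.-1); last by rewrite -ltnS prednK.
    rewrite /=; have rp1 := regpt_swap rp.
    apply: small_goodpath => //; [exact: regpt_qt|by move=> i; exact: strictset_nz|exact: good_next].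
  have [s es] := pathweight_ex cpq p0 q0; exists s; split=> //.
  have hT := pathdiv_toric s rp; have [hN dN] := reach_admissible (toric_reach hT); have [_ hN' _] := hN.
  have /choice [w hw] i : exists w : int, sord (pathdiv iota O x y s) (a i) w.
    by have [w hw] := sord_ex hN' (dom_sub dN) (nz i); exists w%:Z.
  have [_ _ el _] := toric_facts hT.
  apply: (goodpath_satellite rp nz e0' _ _ hw); rewrite ?es /=.
  - by rewrite ltn_neqAle eq_sym p1.
  - by rewrite ltn_neqAle eq_sym q1.
  - by have := hlc _ _ hN dN hw; rewrite subr_ge0 el es /= -pmulrn.
exists p, q, n, (pathdiv iota O x y s).
have hT := pathdiv_toric s rp; rewrite es in hT.
split=> //; first by rewrite eP eQ ep eq.
move=> e' v w e'0 imp hv hw.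
by apply: (toric_domination rp nz e'0 imp hs ha d) => //; rewrite es /= ?eP ?eQ ?ep ?eq.
Qed.

End FreePhase.

(** * Arbitrarily negative log discrepancies *)

Section Divergence.
Context (R : realType) (r : nat) (k : closedFieldType) (K : fieldType).
Context (iota : {rmorphism k -> K}).
Implicit Types (O E S : set K) (x y z t f g : K).
Local Notation qt := (qt iota).

(** Over the point x / y = y = 0 of the last exceptional curve E, [Es s] is the blow-up with weight
    1 for x / y and s + 1 for the equation y of E. For fixed g its order is s + 1 times that along E
    up to a bounded error, and likewise for the log discrepancy, so that a negative discrepancy
    along E is amplified without bound. *)
Lemma diverging_divisors E O : reach iota E O -> exists Es : nat -> set K,
  [/\ forall s, reach iota (Es s) O,
      forall g s, O g -> g != 0 -> (s.+1)%:Z * ord E g <= ord (Es s) g,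
      forall g, O g -> g != 0 -> exists C s0 : nat, forall s, (s0 <= s)%N ->
        ord (Es s) g <= (s.+1)%:Z * ord E g + C%:Z
    & exists C s0 : nat, forall s, (s0 <= s)%N ->
        logdisc iota O (Es s) <= (s.+1)%:Z * logdisc iota O E + C%:Z].
Proof.
elim=> {O} [O x y rp ->|O x y rp hr [Es [h1 h2 h3 [C [s0 h4]]]]].
- have rp1 := regpt_qt rp; have y0 := rp_y0 rp.
  have hT s : exists E', toric iota E' (qt O x y) (x / y) y 1 s.+1.
    by apply: toric_exists; rewrite // coprime1n.
  have /choice [Es hEs] := hT; exists Es.
  have hdom s : admissible iota (Es s) /\ dominates (Es s) (qt O x y) by exact: reach_admissible (toric_reach (hEs s)).
  have str g (m : nat) s : O g -> mult O x y g m -> ord (Es s) g = (s.+1)%:Z * m%:Z + ord (Es s) (g / y ^+ m).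
    move=> hg mm; have [[_ hE _] _] := hdom s; have [_ oy _ _] := toric_facts (hEs s).
    have ym : y ^+ m != 0 by rewrite expf_neq0.
    by rewrite (ord_div hE) ?(mult_neq0 rp mm) // (ordX hE) // oy; ring.
  split.
  + by move=> s; apply: (reach_qt rp); exact: toric_reach (hEs s).
  + move=> g s hg g0; have [m mm] := mult_ex rp hg g0.
    rewrite (ord_ex rp mm) (str g m s hg mm) lerDl.
    have [[_ hE _] d] := hdom s; apply/(ord_ge0 hE).
      by rewrite mulf_neq0 ?invr_eq0 ?expf_neq0.
    by apply: (dom_sub d); apply: (A_qt rp); apply: (AM_div rp); case: mm.
  + move=> g hg g0; have [m mm] := mult_ex rp hg g0.
    have [d [u [l [_ hu hl e]]]] := strict_icz rp mm.
    exists d, d => s ds; rewrite (ord_ex rp mm) (str g m s hg mm) lerD2l.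
    have [[_ hE _] dm] := hdom s; have [ot oy _ _] := toric_facts (hEs s).
    have hu' : unit_of (Es s) u by apply: unit_sub hu; exact: dom_sub dm.
    have x0 := rp_x0 rp; have [u0 _ _] := hu'.
    have td0 : u * (x / y) ^+ d != 0 by rewrite mulf_neq0 // expf_neq0 // mulf_neq0 ?invr_eq0.
    have od : ord (Es s) (u * (x / y) ^+ d) = d%:Z.
      rewrite (ordM hE) // ?expf_neq0 ?mulf_neq0 ?invr_eq0 // (ord_unit hE hu') add0r.
      by rewrite (ordX hE) ?mulf_neq0 ?invr_eq0 // ot mulr1.
    have [l0|l0] := eqVneq l 0; first by rewrite e l0 mulr0 addr0 od.
    have ol : 0 <= ord (Es s) l by apply/(ord_ge0 hE l0)/(dom_sub dm).
    have [] := @ordD_lt _ _ hE (u * (x / y) ^+ d) (y * l) td0.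
    * by rewrite mulf_neq0.
    * by rewrite od (ordM hE) // oy; move: ol ds; lia.
    * by move=> _; rewrite -e od => ->.
  + exists 1%N, 0%N => s _; have [ha d] := hdom s; have [_ oy el _] := toric_facts (hEs s).
    by rewrite (logdisc_ex rp) (logdisc_qt rp ha d) oy el; lia.
- have y0 := rp_y0 rp; have hyO := rp_y rp; have sub := O_qt (iota := iota) rp.
  have [ha d] := reach_admissible hr.
  exists Es; split.
  + by move=> s; apply: (reach_qt rp).
  + by move=> g s hg; apply: h2; exact: sub.
  + by move=> g hg; apply: h3; exact: sub.
  + have [C' [s0' h5]] := h3 y (sub _ hyO) y0.
    exists (C + C')%N, (maxn s0 s0') => s; rewrite geq_max => /andP[ss ss'].
    have [ha' d'] := reach_admissible (h1 s).
    rewrite (logdisc_qt rp ha' d') (logdisc_qt rp ha d).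
    by have := h4 s ss; have := h5 s ss'; lia.
Qed.

Lemma negative_diverges (a : 'I_r -> set K) (e : 'I_r -> R) O E (v : 'I_r -> int) (B : R) :
  (forall i, nzset O (a i)) -> (forall i, 0 <= e i) -> reach iota E O ->
  (forall i, sord E (a i) (v i)) ->
  (logdisc iota O E)%:~R - \sum_(i < r) e i * (v i)%:~R < 0 ->
  exists E' w, [/\ reach iota E' O, forall i, sord E' (a i) (w i) &
    (logdisc iota O E')%:~R - \sum_(i < r) e i * (w i)%:~R < B].
Proof.
move=> nz e0 hr hv neg; have [Es [h1 h2 h3 [C [s0 h4]]]] := diverging_divisors hr.
set A := _ - _ in neg.
pose n := Num.bound `|(C%:R - B) / - A|.
pose s := maxn s0 n.
have [ha d] := reach_admissible (h1 s); have [_ hE _] := ha.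
have /choice [w hw] i : exists w : int, sord (Es s) (a i) w.
  by have [w hw] := sord_ex hE (dom_sub d) (nz i); exists w%:Z.
exists (Es s), w; split=> //.
have le1 : (logdisc iota O (Es s))%:~R <= (s.+1)%:R * (logdisc iota O E)%:~R + C%:R :> R.
  have := h4 s (leq_maxl _ _); move: (logdisc iota O (Es s)) (logdisc iota O E) => L1 L2.
  rewrite -(ler_int R) rmorphD rmorphM /= -!pmulrn; exact.
have le2 : (s.+1)%:R * (\sum_(i < r) e i * (v i)%:~R) <= \sum_(i < r) e i * (w i)%:~R :> R.
  rewrite mulr_sumr; apply: ler_sum => i _; rewrite mulrCA ler_wpM2l //.
  have [_ [f [Sf f0 <-]]] := hw i; have [SO _] := nz i.
  have := h2 f s (SO _ Sf) f0; rewrite -(ler_int R) rmorphM /= -pmulrn; apply: le_trans.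
  by rewrite ler_wpM2l // ler_int; apply: (hv i).1.
have nA : 0 < - A by rewrite oppr_gt0.
have le3 : C%:R - B < s.+1%:R * - A.
  rewrite -ltr_pdivrMr //; apply: (le_lt_trans (ler_norm _)).
  apply: lt_le_trans (archi_boundP (normr_ge0 _)) _.
  by rewrite ler_nat leqW // leq_maxr.
have : (s.+1)%:R * A + C%:R < B by move: le3; lra.
by apply: le_lt_trans; rewrite /A mulrBr; lra.
Qed.

End Divergence.

(** * Blow-ups of varieties *)

Section BlowUp.
Context (k : closedFieldType) (K : fieldType) (iota : {rmorphism k -> K}).
Implicit Types (A B C L O P Q V : set K) (X Y : set (set K)) (x y z t f g : K).
Local Notation qt := (qt iota).
Local Notation affine_model := (affine_model iota).

Lemma adj_alg B t : is_subalg iota B -> is_subalg iota (adj B t).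
Proof.
move=> [h hc]; split; first exact: adj_subring.
by move=> c; apply: adj_sub.
Qed.

Lemma adj_affine B t : affine_model B -> affine_model (adj B t).
Proof.
move=> [hB [s es] fr]; have [h hc] := hB; split; first exact: adj_alg.
- exists (t :: s); rewrite eqEsubset; split.
    move=> _ [P hP ->] C [[hC hCc] hs]; apply: pin_horner => //; last by apply: hs; rewrite inE eqxx.
    move=> i; have := hP i; rewrite es; apply; split=> // z zs; apply: hs.
    by rewrite inE zs orbT.
  move=> z; apply; split; first exact: adj_alg.
  move=> w; rewrite inE => /orP[/eqP ->|ws]; first exact: adj_gen.
  by apply: adj_sub => //; rewrite es => C [_ hs]; exact: hs.
- move=> z; have [a [b [ha hb b0 e]]] := fr z; exists a, b.
  by split=> //; exact: adj_sub.
Qed.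

Lemma Spec_loc B f P : is_subring B -> B f -> f != 0 ->
  Spec (adj B f^-1) P <-> Spec B P /\ unit_of P f.
Proof.
move=> h form f0; have h' := adj_subring f^-1 h; have sub := adj_sub f^-1 h.
split=> [hP|[hP u]].
- have hl := Spec_local h' hP; have [hPr _] := hl; have sP := Spec_sub h' hP.
  have u : unit_of P f by split=> //; apply: sP; [exact: sub|exact: adj_gen].
  have BP : B `<=` P by move=> z /sub /sP.
  split=> //; rewrite (ctr_self h' hP) (ctr_trans h h' hl BP sub); first exact: Spec_ctr.
  apply: adj_min; [by have [hc _] := Spec_local h (Spec_ctr h hl BP)|exact: ctr_sub|].
  by exists 1, f; split=> //; [sr|rewrite div1r].
- have hl := Spec_local h hP; have [hPr _] := hl; have BP := Spec_sub h hP; have [_ _ ?] := u.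
  have sP : adj B f^-1 `<=` P by apply: adj_min.
  rewrite (ctr_self h hP) -(ctr_trans h h' hl BP sub); first exact: Spec_ctr.
  by rewrite -(ctr_self h hP).
Qed.

(** Unlike [variety] this admits the empty cover, which makes finite unions and inductions on lists
    of charts uniform. *)
Definition covered X := exists n (B : nat -> set K),
  (forall i, (i < n)%N -> affine_model (B i)) /\
  X = [set P | exists2 i, (i < n)%N & Spec (B i) P].

Lemma covered0 : covered set0.
Proof.
exists 0%N, (fun=> set0); split=> //; rewrite eqEsubset; split=> //.
by move=> P [].
Qed.
Lemma covered1 B : affine_model B -> covered (Spec B).
Proof.
move=> hB; exists 1%N, (fun=> B); split=> //; rewrite eqEsubset; split=> P.
  by move=> hP; exists 0%N.
by case.
Qed.
Lemma coveredU X Y : covered X -> covered Y -> covered (X `|` Y).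
Proof.
move=> [n [B [hB ->]]] [m [B' [hB' ->]]].
exists (n + m)%N, (fun i => if (i < n)%N then B i else B' (i - n)%N); split.
  move=> i lt; case: ltnP => [|le]; first exact: hB.
  by apply: hB'; lia.
rewrite eqEsubset; split=> P.
  move=> [[i lt hP]|[i lt hP]].
    by exists i; rewrite ?lt // ltn_addr.
  by exists (n + i)%N; rewrite ?ltn_add2l // ltnNge leq_addr /= addKn.
move=> [i lt]; case: ltnP => [ltn hP|le hP]; first by left; exists i.
by right; exists (i - n)%N => //; lia.
Qed.
Lemma covered_bigU (T : Type) (l : seq T) (F : T -> set (set K)) :
  (forall i, covered (F i)) -> covered (foldr (fun i X => F i `|` X) set0 l).
Proof.
by move=> h; elim: l => [|i l IH] /=; [exact: covered0|exact: coveredU].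
Qed.

Lemma covered_variety X : covered X -> X !=set0 ->
  (forall V P Q, valuation_ring iota V -> X P -> X Q -> dominates V P -> dominates V Q -> P = Q) ->
  variety iota X.
Proof.
move=> [n [B [hB eX]]] [P XP] sep; split=> //.
have [m en] : exists m, n = m.+1.
  by move: XP; rewrite eX => -[i lt _]; exists n.-1; rewrite (ltn_predK lt).
exists m, (fun i : 'I_m.+1 => B i); split; first by move=> i; apply: hB; rewrite en.
rewrite eX eqEsubset; split=> Q.
  by move=> [i lt hQ]; rewrite en in lt; exists (Ordinal lt).
by move=> [i _ hQ]; exists (i : nat) => //; rewrite en.
Qed.

Lemma valuation_local V : valuation_ring iota V -> is_local V.
Proof.
move=> [[h hc] ht]; split=> // a b ha hb u.
have key a' b' : V a' -> V b' -> unit_of V (a' + b') -> V (a' / b') -> b' != 0 -> unit_of V b'.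
  move=> ha' hb' u' hab b0; apply: (unit_divr (y := a' / b' + 1)) => //; first by sr.
  by rewrite mulrDr mulr1 mulrC divfK.
have [a0|a0] := eqVneq a 0; first by right; rewrite a0 add0r in u.
have [b0|b0] := eqVneq b 0; first by left; rewrite b0 addr0 in u.
case: (ht (a / b)) => hab; first by right; apply: (key a b).
by left; apply: (key b a) => //; rewrite 1?addrC // -invf_div.
Qed.

(* Minus a closed point, an affine variety is covered by the complements of the
   zero sets of the functions b - c, where c is the value of the generator b. *)
Lemma covered_minus B O : affine_model B -> Spec B O ->
  (forall f, B f -> exists c, max_ideal O (f - iota c)) ->
  covered (Spec B `\ O).
Proof.
move=> hBm hO res; have [[h hc] [s es] fr] := hBm.
have hlO := Spec_local h hO; have BO := Spec_sub h hO.
have Bs z : z \in s -> B z by move=> zs; rewrite es => C [_ hs]; exact: hs.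
have hF z : exists c, B z -> max_ideal O (z - iota c).
  by have [/res [c hc']|nb] := EM (B z); [exists c|exists 0].
have [cc hcc] := choice hF.
pose F z : set (set K) := [set P | z - iota (cc z) != 0 /\ B z /\ Spec (adj B (z - iota (cc z))^-1) P].
have -> : Spec B `\ O = foldr (fun i X => F i `|` X) set0 s.
  have mem P : foldr (fun i X => F i `|` X) set0 s P <-> exists2 z, z \in s & F z P.
    elim: (s) => [|z l IH] /=; first by split=> // -[].
    split=> [[hz|/IH [w wl hw]]|[w]].
    - by exists z; rewrite ?inE ?eqxx.
    - by exists w; rewrite ?inE ?wl ?orbT.
    - by rewrite inE => /orP[/eqP ->|wl hw]; [left|right; apply/IH; exists w].
  rewrite eqEsubset; split=> P; last first.
    move=> /mem [z zs [f0 [Bz]]]; have form : B (z - iota (cc z)) by apply: srB.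
    move=> /(Spec_loc P h form f0) [hP u]; split=> // e; rewrite /= in e.
    by apply: (max_nunit (hcc z Bz)); rewrite -e.
  move=> [hP neq]; apply/mem; apply: contrapT => no.
  have hlP := Spec_local h hP; have BP := Spec_sub h hP.
  have mP z : z \in s -> max_ideal P (z - iota (cc z)).
    move=> zs; have form : B (z - iota (cc z)) by apply: srB => //; exact: Bs.
    case: (unit_or_max (BP _ form)) => // u; case: no; exists z => //.
    have f0 : z - iota (cc z) != 0 by case: u.
    by split=> //; split; [exact: Bs|apply/Spec_loc].
  (* If no such function is a unit at P, then P and O give every element of B the same value in k,
     hence invert the same elements. *)
  have key f : B f -> exists c, max_ideal P (f - iota c) /\ max_ideal O (f - iota c).
    pose C := [set f | B f /\ exists c, max_ideal P (f - iota c) /\ max_ideal O (f - iota c)].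
    suff : B `<=` C by move=> sub /sub [].
    have hPr := proj1 hlP; have hOr := proj1 hlO.
    have hC : is_subring C.
      split.
      - split; first by sr.
        by exists 1; rewrite rmorph1 subrr; split; exact: max_ideal0.
      - move=> a b [ha [c [c1 c2]]] [hb [d [d1 d2]]]; split; first by sr.
        exists (c - d); rewrite rmorphB.
        have -> : a - b - (iota c - iota d) = (a - iota c) - (b - iota d) by ring.
        by split; apply: max_idealD => //; apply: max_idealN.
      - move=> a b [ha [c [c1 c2]]] [hb [d [d1 d2]]]; split; first by sr.
        exists (c * d); rewrite rmorphM.
        have -> : a * b - iota c * iota d = b * (a - iota c) + iota c * (b - iota d) by ring.
        by split; apply: max_idealD => //; apply: max_idealM => //; auto.
    rewrite [X in X `<=` _]es; move=> f' hf'; apply: hf'; split.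
      split=> // c; split=> //; exists c; rewrite subrr.
      by split; exact: max_ideal0.
    move=> z zs; have Bz := Bs _ zs; split=> //; exists (cc z).
    by split; [exact: mP|exact: hcc].
  apply: neq; rewrite /= (ctr_self h hP) (ctr_self h hO).
  have uc L c : is_local L -> (forall c, L (iota c)) -> c != 0 -> unit_of L (iota c).
    by move=> hl hcl c0; split; rewrite ?fmorph_eq0 // -fmorphV.
  have uu f L c : is_local L -> B `<=` L -> max_ideal L (f - iota c) -> unit_of L f <-> c != 0.
    move=> hl BL m; split=> [u|c0].
      apply/eqP => c0; move: m; rewrite c0 rmorph0 subr0 => m; exact: max_nunit m u.
    by rewrite -(subrK (iota c) f) addrC; apply: unitD_max => //; apply: uc => // d; apply: BL.
  rewrite eqEsubset; split=> _ [a [b [ha hb ub ->]]]; exists a, b; split=> //;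
    have [c [c1 c2]] := key b hb.
    by apply/(uu b O c hlO BO c2)/(uu b P c hlP BP c1).
  by apply/(uu b P c hlP BP c1)/(uu b O c hlO BO c2).
apply: covered_bigU => z.
have [[f0 Bz]|no] := EM (z - iota (cc z) != 0 /\ B z).
  have -> : F z = Spec (adj B (z - iota (cc z))^-1).
    by rewrite eqEsubset; split=> P; [case=> _ []|].
  by apply: covered1; exact: adj_affine.
have -> : F z = set0; last exact: covered0.
by rewrite eqEsubset; split=> // P [f0 [Bz _]]; case: no.
Qed.

Lemma clear_den B O (l : seq K) : is_subring B -> is_local O -> B `<=` O -> O = ctr B O ->
  (forall z, z \in l -> O z) ->
  exists w, [/\ B w, unit_of O w & forall z, z \in l -> adj B w^-1 z].
Proof.
move=> h hl BO e; elim: l => [|z l IH] hz.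
  by exists 1; split; [sr|apply: unit1; case: hl|].
have [|w [hw uw hwl]] := IH; first by move=> u ul; apply: hz; rewrite inE ul orbT.
have [a [s [ha hs us ez]]] : ctr B O z by rewrite -e; apply: hz; rewrite inE eqxx.
have w0 : w != 0 by case: uw. have s0 : s != 0 by case: us.
have hA := adj_subring (w * s)^-1 h; have sub := adj_sub (w * s)^-1 h.
have hg := adj_gen (w * s)^-1 h; have ? := sub _ hw; have ? := sub _ hs; have ? := sub _ ha.
exists (w * s); split; [by sr|exact: (unitM (proj1 hl) uw us)|].
move=> u; rewrite inE => /orP[/eqP ->|/hwl].
  have -> : z = a * w * (w * s)^-1 by rewrite ez; fd.
  by sr.
apply: adj_min => //; have -> : w^-1 = s * (w * s)^-1 by fd.
by sr.
Qed.

(* An affine neighborhood of O on which x and y generate the ideal of O. *)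
Lemma good_chart X O x y : variety iota X -> X O -> regpt iota O x y ->
  exists B, [/\ affine_model B, Spec B O, Spec B `<=` X, B x /\ B y
    & forall f, B f -> exists c a b, [/\ B a, B b & f = iota c + x * a + y * b]].
Proof.
move=> [[n [B [hB eX]]] _] XO rp; have hl := rp_local rp.
have hO := rp_alg rp; have hOr := proj1 hO.
have [i hOi] : exists i, Spec (B i) O by move: XO; rewrite eX => -[i _ hi]; exists i.
have [[h hc] [s es] fr] := hB i; have BO := Spec_sub h hOi; have eO := ctr_self h hOi.
have Bs z : z \in s -> B i z by move=> zs; rewrite es => C [_ hs]; exact: hs.
have hF z : exists w : k * (K * K), B i z -> [/\ O w.2.1, O w.2.2 & z = iota w.1 + x * w.2.1 + y * w.2.2].
  have [/BO /(rp_res rp) [c [a [b H]]]|nb] := EM (B i z); first by exists (c, (a, b)).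
  by exists (0, (0, 0)).
have [F hF'] := choice hF.
have [|w [hw uw hwl]] := @clear_den (B i) O (x :: y :: map (fun z => (F z).2.1) s ++ map (fun z => (F z).2.2) s) h hl BO eO.
  move=> z; rewrite !inE mem_cat => /or3P[/eqP ->|/eqP ->|/orP[] /mapP [u us ->]]; [exact: rp_x rp|exact: rp_y rp| |];
  by have [] := hF' u (Bs _ us).
have w0 : w != 0 by case: uw.
set B1 := adj (B i) w^-1 in hwl; have hB1 : affine_model B1 by exact: adj_affine.
have [[h1 hc1] _ _] := hB1; have sub : B i `<=` B1 by exact: adj_sub.
have B1x : B1 x by apply: hwl; rewrite !inE eqxx.
have B1y : B1 y by apply: hwl; rewrite !inE eqxx orbT.
have S1 : Spec B1 O by apply/Spec_loc.
have B1O := Spec_sub h1 S1.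
exists B1; split=> //.
  by move=> P /(Spec_loc P h hw w0) [hP _]; rewrite eX; exists i.
pose C := [set f | B1 f /\ exists c a b, [/\ B1 a, B1 b & f = iota c + x * a + y * b]].
suff : B1 `<=` C by move=> sub' f /sub' [].
have hC : is_subring C.
  split.
  - by split; [sr|exists 1, 0, 0; split; try sr; rewrite rmorph1; ring].
  - move=> f g [form [c [a [b [? ? ef]]]]] [hg [c' [a' [b' [? ? eg]]]]]; split; first by sr.
    by exists (c - c'), (a - a'), (b - b'); split; try sr; rewrite ef eg rmorphB; ring.
  - move=> f g [form [c [a [b [? ? ef]]]]] [hg [c' [a' [b' [? ? eg]]]]]; split; first by sr.
    have ? := hc1 c; exists (c * c'), (iota c * a' + a * g), (iota c * b' + b * g); split; try sr.
    by rewrite rmorphM ef; rewrite [in LHS]eg; rewrite eg; ring.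
have BC : B i `<=` C.
  rewrite [X in X `<=` _]es => f; apply; split.
    by split=> // c; split=> //; exists c, 0, 0; split; try sr; ring.
  move=> z zs; have Bz := Bs _ zs; split; first exact: sub.
  have [_ _ ez] := hF' z Bz; exists (F z).1, (F z).2.1, (F z).2.2; split=> //.
    by apply: hwl; rewrite !inE mem_cat (map_f (fun z => (F z).2.1)) ?orbT.
  by apply: hwl; rewrite !inE mem_cat (map_f (fun z => (F z).2.2)) ?orbT.
apply: adj_min => //.
have [_ [c [a [b [ha hb ew]]]]] := BC _ hw.
have hwi : B1 w^-1 by exact: adj_gen.
(* w is a unit at O, so its constant term c is nonzero, and 1 / w = 1 / c - (w - c) / (c w) has the
   required form. *)
have c0 : c != 0.
  apply/eqP => c0; case: (max_nunit (L := O) (x := w)) => //; apply/(rp_max rp).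
  by rewrite ew c0 rmorph0 add0r; exists a, b; split=> //; exact: B1O.
have ic0 : iota c != 0 by rewrite fmorph_eq0.
have ? := hc1 c^-1; split=> //; exists c^-1, (- a * iota c^-1 * w^-1), (- b * iota c^-1 * w^-1); split; try sr.
rewrite fmorphV; have -> : x * (- a / iota c / w) = - (x * a) / iota c / w by ring.
have -> : y * (- b / iota c / w) = - (y * b) / iota c / w by ring.
have -> : x * a = w - iota c - y * b by rewrite {1}ew; ring.
by fd.
Qed.

End BlowUp.

(** * Integral equations and denominators *)

Section IntegralScaling.
Context (K : fieldType).
Implicit Types (Q : set K) (u v y z : K).

(** Scaling z by u multiplies the coefficient of degree i by u^(d - i); for i < d this contains the
    factor u that brings the coefficient into Q. *)
Lemma integral_scale Q z u (f : {poly K}) : is_subring Q -> f \is monic -> root f z ->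
  Q u -> (forall i, (i < (size f).-1)%N -> Q (u * f`_i)) ->
  exists g : {poly K}, [/\ g \is monic, forall i, Q g`_i & root g (u * z)].
Proof.
move=> h mf rf hu hc; pose d := (size f).-1.
have sf : size f = d.+1 by rewrite /d prednK // size_poly_gt0 monic_neq0.
have leaf : f`_d = 1 by move/monicP: mf.
pose g := \poly_(i < d.+1) (f`_i * u ^+ (d - i)).
have gd : g`_d = 1 by rewrite coef_poly ltnS leqnn subnn expr0 mulr1.
have sg : size g = d.+1.
  by rewrite size_poly_eq // subnn expr0 mulr1 leaf oner_neq0.
exists g; split.
- by rewrite monicE /lead_coef sg /= gd.
- move=> i; rewrite coef_poly; case: ltnP => [|_]; last by sr.
  rewrite ltnS leq_eqVlt => /orP[/eqP ->|lt]; first by rewrite subnn expr0 mulr1 leaf; sr.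
  have -> : (d - i)%N = (d - i.+1).+1 by lia.
  rewrite exprS mulrA (mulrC f`_i); have := hc i lt => ?; sr.
- apply/rootP; rewrite horner_coef sg.
  have -> : \sum_(i < d.+1) g`_i * (u * z) ^+ i = u ^+ d * \sum_(i < d.+1) f`_i * z ^+ i.
    rewrite mulr_sumr; apply: eq_bigr => i _; have le : (i <= d)%N by rewrite -ltnS.
    rewrite coef_poly ltn_ord exprMn.
    have -> : u ^+ d = u ^+ (d - i) * u ^+ i by rewrite -exprD subnK.
    ring.
  by move/rootP: rf; rewrite horner_coef sf => ->; rewrite mulr0.
Qed.

(** Factors y are removed one at a time: if z is integral over Q and y z lies in Q, the equation of
    z multiplied by y^d shows that y divides (y z)^d, and y being prime it divides y z. *)
Lemma integral_prime Q y v N (f : {poly K}) : is_subring Q -> Q y -> y != 0 ->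
  (forall a b, Q a -> Q b -> (exists2 c, Q c & a * b = y * c) ->
     (exists2 c, Q c & a = y * c) \/ (exists2 c, Q c & b = y * c)) ->
  f \is monic -> (forall i, Q f`_i) -> root f v -> Q (y ^+ N * v) -> Q v.
Proof.
move=> h hy y0 pr mf form rf.
elim: N => [|N IH] hN; first by rewrite mul1r in hN.
apply: IH; set z := y ^+ N * v.
have hyN : Q (y ^+ N) by sr.
have [|g [mg hg rg]] := integral_scale h mf rf hyN.
  by move=> i _; have := form i => ?; sr.
rewrite -/z in rg.
have hr : Q (y * z) by rewrite /z mulrA -exprS.
clearbody z.
pose d := (size g).-1.
have sg : size g = d.+1 by rewrite /d prednK // size_poly_gt0 monic_neq0.
have lg : g`_d = 1 by move/monicP: mg.
have yz : exists2 c, Q c & (y * z) ^+ d = y * c.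
  case: d sg lg => [|d] sg lg.
    by move/rootP: rg; rewrite horner_coef sg big_ord1 lg !mulr1 => /eqP; rewrite oner_eq0.
  exists (- \sum_(i < d.+1) g`_i * (y * z) ^+ i * y ^+ (d - i)).
    by apply: srN => //; apply: sr_sum => // i _; have := hg i => ?; sr.
  move/rootP: rg; rewrite horner_coef sg big_ord_recr /= lg mul1r => /eqP.
  rewrite addrC addr_eq0 => /eqP e; rewrite exprMn e mulrN mulrN; congr (- _).
  rewrite !mulr_sumr; apply: eq_bigr => i _; have le : (i <= d)%N by rewrite -ltnS.
  have -> : y ^+ d.+1 = y * (y ^+ (d - i) * y ^+ i) by rewrite -exprD subnK // exprS.
  rewrite exprMn; ring.
have [c hc ec] : exists2 c, Q c & y * z = y * c.
  elim: d yz {sg lg} => [|j IHj] [c hc ec].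
    exists (c * (y * z)); first by sr.
    by rewrite mulrA -ec expr0 mul1r.
  rewrite exprS in ec; have hj : Q ((y * z) ^+ j) by sr.
  by case: (pr _ _ hr hj (ex_intro2 _ _ c hc ec)) => //; exact: IHj.
by rewrite (mulfI y0 ec).
Qed.

End IntegralScaling.

(** * Charts of a blow-up *)

Section BlowUpChart.
Context (k : closedFieldType) (K : fieldType) (iota : {rmorphism k -> K}).
Context (B O : set K) (x y : K).
Hypotheses (rp : regpt iota O x y) (hB : is_subalg iota B) (SO : Spec B O).
Hypotheses (Bx : B x) (By : B y).
Hypothesis hq : forall f, B f -> exists c a b, [/\ B a, B b & f = iota c + x * a + y * b].
Implicit Types (Q L : set K).
Let h : is_subring B := proj1 hB.
Let hl : is_local O := rp_local rp.
Let BO : B `<=` O := Spec_sub h SO.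
Let y0 := rp_y0 rp.
Local Notation t := (x / y).
Local Notation B' := (adj B t).
Let h' : is_subring B' := adj_subring t h.
Let BB : B `<=` B' := adj_sub t h.

Lemma chart_sub_A : B' `<=` affch O x y.
Proof.
apply: adj_min; [exact: A_ring rp| |exact: At rp].
by move=> z /BO /(OA rp).
Qed.

(** By [hq], where x and y vanish an element of B is a unit exactly when its constant term is
    nonzero, so O is the only such point. *)
Lemma chart_center L : is_local L -> B `<=` L -> max_ideal L x -> max_ideal L y -> ctr B L = O.
Proof.
move=> hL BL mx my; rewrite (ctr_self h SO).
have uc M c : is_local M -> B `<=` M -> c != 0 -> unit_of M (iota c).
  move=> hM BM c0; split; rewrite ?fmorph_eq0 //; first by apply: BM; apply: (proj2 hB).
  by rewrite -fmorphV; apply: BM; apply: (proj2 hB).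
have uu f c a b M : is_local M -> B `<=` M -> max_ideal M x -> max_ideal M y -> B a -> B b ->
    f = iota c + x * a + y * b -> unit_of M f <-> c != 0.
  move=> hM BM mx' my' ha hb e; have hMr := proj1 hM.
  have m : max_ideal M (x * a + y * b).
    by apply: max_idealD => //; rewrite mulrC; apply: max_idealM => //; apply: BM.
  rewrite e -addrA; split=> [u|c0]; last by apply: unitD_max => //; apply: uc.
  by apply/eqP => c0; move: u; rewrite c0 rmorph0 add0r; apply: max_nunit.
have mxO : max_ideal O x by apply/(rp_max rp); exact: (M_x _ _ (rp_alg rp)).
have myO : max_ideal O y by apply/(rp_max rp); exact: (M_y _ _ (rp_alg rp)).
rewrite eqEsubset; split=> _ [a [b [ha hb ub ->]]]; exists a, b; split=> //;
  have [c [a' [b' [ha' hb' e]]]] := hq hb.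
  by apply/(uu b c a' b' O hl BO mxO myO ha' hb' e)/(uu b c a' b' L hL BL mx my ha' hb' e).
by apply/(uu b c a' b' L hL BL mx my ha' hb' e)/(uu b c a' b' O hl BO mxO myO ha' hb' e).
Qed.

(** If y were not a unit of Q, then x = t y would vanish too and the center would be O. So y is a
    unit, and t already lies in the local ring of the center. *)
Lemma chart_away Q : Spec B' Q -> ctr B Q <> O -> Q = ctr B Q.
Proof.
move=> hQ ne; have hlQ := Spec_local h' hQ; have sQ := Spec_sub h' hQ.
have hQr := proj1 hlQ; have BQ : B `<=` Q by move=> z /BB /sQ.
have tQ : Q t by apply: sQ; exact: adj_gen.
case: (unit_or_max (BQ _ By)) => [uy|my].
  rewrite {1}(ctr_self h' hQ); apply: ctr_trans => //.
  apply: adj_min; [exact: proj1 (Spec_local h (Spec_ctr h hlQ BQ))|exact: ctr_sub|].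
  by exists x, y.
have mx : max_ideal Q x by rewrite -(divfK y0 x); apply: max_idealM.
by case: ne; apply: chart_center.
Qed.

Lemma chart_dom Q : Spec B' Q -> dominates Q (ctr B Q).
Proof.
move=> hQ; have hlQ := Spec_local h' hQ; apply: ctr_dom => // z /BB.
exact: Spec_sub.
Qed.

Lemma chart_over Q : Spec B' Q -> ctr B Q = O -> O `<=` Q /\ max_ideal Q y.
Proof.
move=> hQ e; have d := chart_dom hQ; rewrite e in d.
split; first exact: dom_sub d.
by apply: (dom_max d); apply/(rp_max rp); exact: (M_y _ _ (rp_alg rp)).
Qed.

(** Elements of B outside the ideal of O are units of Q, so B[x / y] and O[x / y] have the same
    local ring there. *)
Lemma chart_loc Q : Spec B' Q -> ctr B Q = O -> Q = ctr (affch O x y) Q.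
Proof.
move=> hQ e; have [OQ my] := chart_over hQ e.
have hlQ := Spec_local h' hQ; have sQ := Spec_sub h' hQ.
rewrite {1}(ctr_self h' hQ); apply/esym/ctr_trans => //; last 2 first.
- exact: chart_sub_A.
- apply: adj_min; [exact: proj1 (Spec_local h' (Spec_ctr h' hlQ sQ))| |].
    move=> z; rewrite {1}(ctr_self h SO) => -[a [s [ha hs us ->]]].
    exists a, s; split; [exact: BB|exact: BB| |by []].
    exact: unit_sub OQ us.
  by apply: ctr_sub => //; exact: adj_gen.
- exact: A_ring rp.
Qed.

(** A unit s of Q and a power of y turn an element integral over Q into one integral over O, which
    lies in O by normality. The power of y is then removed by [integral_prime], as y remains prime
    in Q. *)
Lemma chart_normal Q : Spec B' Q -> ctr B Q = O -> integrally_closed O -> integrally_closed Q.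
Proof.
move=> hQ e nO; have [OQ my] := chart_over hQ e.
have hlQ := Spec_local h' hQ; have hQr := proj1 hlQ; have eQ := chart_loc hQ e.
have hA := A_ring rp.
have AQ : affch O x y `<=` Q.
  apply: adj_min => //; apply: (Spec_sub h' hQ); exact: adj_gen.
have rep z : Q z -> exists a s, [/\ affch O x y a, affch O x y s, unit_of Q s & z = a / s].
  by rewrite {1}eQ.
have pr a b : Q a -> Q b -> (exists2 c, Q c & a * b = y * c) ->
     (exists2 c, Q c & a = y * c) \/ (exists2 c, Q c & b = y * c).
  move=> /rep [a1 [s [ha hs us ->]]] /rep [b1 [s' [hb hs' us' ->]]] [_ /rep [c1 [u [hc hu uu ->]]] ec].
  have [s0 _ si] := us; have [s'0 _ s'i] := us'; have [u0 _ _] := uu.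
  have : ydiv O x y ((a1 * b1) * u).
    exists (c1 * s * s'); first by sr.
    have := congr1 (fun z => z * (s * s' * u)) ec.
    have -> : a1 / s * (b1 / s') * (s * s' * u) = a1 * b1 * u by fd.
    by move=> ->; fd.
  have hab : affch O x y (a1 * b1) by sr.
  case/(yA_prime rp hab hu) => [/(yA_prime rp ha hb) [] [w hw ->]|[w hw ew]].
  - by left; exists (w / s); [have := AQ _ hw => ?; sr|rewrite mulrA].
  - by right; exists (w / s'); [have := AQ _ hw => ?; sr|rewrite mulrA].
  - case: (max_nunit (L := Q) (x := u)) => //; rewrite ew mulrC.
    by apply: max_idealM => //; exact: AQ.
move=> z f mf form rf.
pose d := (size f).-1.
have [s [hs us hsf]] : exists s, [/\ affch O x y s, unit_of Q s &
    forall i, (i < d)%N -> affch O x y (s * f`_i)].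
  elim: (d) => [|j [s [hs us hsf]]]; first by exists 1; split=> //; [sr|exact: unit1].
  have [a [s' [ha hs' us' ef]]] := rep _ (form j).
  have s'0 : s' != 0 by case: us'.
  exists (s * s'); split; [sr|exact: unitM|move=> i].
  rewrite ltnS leq_eqVlt => /orP[/eqP ->|/hsf hi].
    by have -> : s * s' * f`_j = s * a by [rewrite ef; fd|]; sr.
  by rewrite mulrAC; sr.
have yO : O y := rp_y rp; have hOr := proj1 (rp_alg rp).
have down w : affch O x y w -> exists N0 : nat, forall N, (N0 <= N)%N -> O (y ^+ N * w).
  move=> /(AM rp) [n [F [m ->]]]; exists n => N le.
  have yn : y ^+ n != 0 by rewrite expf_neq0.
  have := M_O (rp_alg rp) (rp_x rp) (rp_y rp) m => hF.
  have -> : y ^+ N * (F / y ^+ n) = y ^+ (N - n) * F by rewrite -{1}(subnK le) exprD; fd.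
  by sr.
have [N [hN1 hN2]] : exists N, O (y ^+ N * s) /\ forall i, (i < d)%N -> O (y ^+ N * s * f`_i).
  have [N1 h1] := down s hs.
  have [N2 h2] : exists N0 : nat, forall N, (N0 <= N)%N -> forall i, (i < d)%N -> O (y ^+ N * (s * f`_i)).
    elim: (d) hsf => [|j IH] hsf; first by exists 0%N.
    have [|N2 h2] := IH; first by move=> i ij; apply: hsf; exact: ltnW.
    have [N3 h3] := down _ (hsf j (ltnSn j)).
    exists (maxn N2 N3) => N; rewrite geq_max => /andP[l2 l3] i.
    rewrite ltnS leq_eqVlt => /orP[/eqP ->|lt]; [exact: h3|exact: h2].
  exists (maxn N1 N2); split; first by apply: h1; exact: leq_maxl.
  by move=> i lt; rewrite -mulrA; apply: h2 => //; exact: leq_maxr.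
have [g [mg hg rg]] := integral_scale hOr mf rf hN1 hN2.
have hw := nO _ _ mg hg rg.
have [s0 hs1 si] := us.
have [|g' [mg' hg' rg']] := integral_scale hQr mf rf hs1.
  by move=> i _; have := form i => ?; sr.
have : Q (s * z).
  apply: (integral_prime hQr (max_sub my) y0 pr mg' hg' rg' (N := N)).
  by apply: OQ; rewrite mulrA.
move=> hsz; have -> : z = s^-1 * (s * z) by fd.
by sr.
Qed.

Lemma chart_mem L : is_local L -> affch O x y `<=` L -> dominates L O ->
  (forall z, L z -> exists a s, [/\ affch O x y a, affch O x y s, unit_of L s & z = a / s]) ->
  Spec B' L.
Proof.
move=> hL AL d rep; have hA := A_ring rp.
have sL : B' `<=` L by move=> z /chart_sub_A /AL.
suff -> : L = ctr B' L by exact: Spec_ctr.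
have -> : ctr B' L = ctr (affch O x y) L.
  apply/esym/ctr_trans => //; first exact: chart_sub_A.
  apply: adj_min; [exact: proj1 (Spec_local h' (Spec_ctr h' hL sL))| |].
    move=> z; rewrite {1}(ctr_self h SO) => -[a [s [ha hs us ->]]].
    exists a, s; split; [exact: BB|exact: BB| |by []].
    exact: unit_sub (dom_sub d) us.
  by apply: ctr_sub => //; exact: adj_gen.
rewrite eqEsubset; split=> z; first exact: rep.
move=> [a [s [ha hs [_ _ us] ->]]]; apply: srM (AL _ ha) us; exact: proj1 hL.
Qed.

Lemma chart_qt : Spec B' (qt iota O x y).
Proof.
apply: chart_mem; [exact: rp_local (regpt_qt rp)|exact: A_qt rp|exact: qt_dom rp|].
move=> z [a [s [ha hs ->]]]; exists a, s; split=> //; [exact: (S_A rp)|exact: (S_unit rp)].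
Qed.

Lemma chart_ex : Spec B' (ex O x y).
Proof.
apply: chart_mem; [exact: dvr_local (ex_dvr rp)|exact: A_ex rp|exact: ex_dom rp|].
move=> z [a [s [ha hs ns ->]]]; exists a, s; split=> //; exact: (ex_unit rp).
Qed.

End BlowUpChart.

(** * Blowing up a point of a variety *)

Section BlowUpVariety.
Context (k : closedFieldType) (K : fieldType) (iota : {rmorphism k -> K}).
Implicit Types (A B C L O P Q V E : set K) (X Y Z : set (set K)) (x y z t f g : K).

Lemma krull_dvr E : dvr E -> krull_dim E 1.
Proof.
move=> hE; have hl := dvr_local hE; have h := proj1 hE.
have [t [t0 em ht]] := dvr_ord_ex hE.
have mt : max_ideal E t by rewrite em; exists 1; [sr|rewrite mulr1].
have pr p z : is_prime_ideal E p -> p z -> z != 0 -> p t.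
  move=> [hi p1 pp] pz z0; have [u [hu e]] := ht z z0.
  have Ez := ideal_sub hi pz; have : 0 <= ord E z by apply/(ord_ge0 hE z0).
  have [u0 hu1 hui] := hu; have ht1 := max_sub mt.
  case: (ord E z) e => // n e _.
  have : p (t ^+ n) by rewrite (_ : t ^+ n = u^-1 * z); [apply: (idealM hi)|rewrite e mulKf].
  elim: n {e} => [|n IH]; first by move/p1.
  by rewrite exprS => /pp [] //; sr.
split.
  exists (fun i => if i is 0%N then [set 0] else max_ideal E); split.
    move=> [_|i _]; last exact: max_prime_ideal.
    split; [split| |].
    - by move=> _ ->; sr.
    - by [].
    - by move=> a b -> ->; rewrite addr0.
    - by move=> a b _ ->; rewrite mulr0.
    - by move/eqP; rewrite oner_eq0.
    - by move=> a b _ _ /eqP; rewrite mulf_eq0 => /orP[]/eqP; [left|right].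
  move=> [|//] _; split; first by move=> _ ->; exact: max_ideal0.
  by move=> /(_ t mt) /eqP; rewrite (negbTE t0).
move=> [c [cp cs]].
have [s1 /existsNP [z1 /not_implyP [c1 n1]]] := cs 0%N isT.
have [s2 /existsNP [z2 /not_implyP [c2 n2]]] := cs 1%N isT.
have z10 : z1 != 0.
  by apply/eqP => e; apply: n1; rewrite e; apply: (ideal0 (prime_ideal_of (cp 0%N isT))).
have tc := pr _ _ (cp 1%N isT) c1 z10.
have [hi2 c21 _] := cp 2%N isT; have [hi1 _ _] := cp 1%N isT.
apply: n2; case: (unit_or_max (ideal_sub hi2 c2)) => [[z20 _ ui]|].
  by case: c21; rewrite -(mulVf z20); apply: (idealM hi2).
by rewrite em => -[a ha <-]; rewrite mulrC; apply: (idealM hi1).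
Qed.

Lemma proper_trans Z Y X : proper_birational iota Z Y -> proper_birational iota Y X ->
  proper_birational iota Z X.
Proof.
move=> [p1 v1] [p2 v2]; split.
  move=> P /p1 [Q /p2 [P' XP' d2] d1]; exists P' => //; exact: dom_trans d1 d2.
move=> V P hV XP d; have [Q YQ dQ] := v2 _ _ hV XP d; exact: v1 hV YQ dQ.
Qed.

(** The point O is taken out of X, and the charts B[x / y] and B[y / x] over an affine neighborhood
    B are added; away from O they bring in only points of X, so the overlap does no harm. *)
Lemma blow_up X O x y : normal_variety iota X -> X O -> regpt iota O x y ->
  exists Y, [/\ normal_variety iota Y, proper_birational iota Y X,
     Y (qt iota O x y) & Y (ex O x y)].
Proof.
move=> [hX nX] XO rp; have rps := regpt_swap rp.
have [B [hBm SO BX [Bx By] hq]] := good_chart hX XO rp.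
have hqs f : B f -> exists c a b, [/\ B a, B b & f = iota c + y * a + x * b].
  by move=> /hq [c [a [b [ha hb ->]]]]; exists c, b, a; split=> //; ring.
have [hB _ _] := hBm; have h := proj1 hB.
pose Bt := adj B (x / y); pose Bs := adj B (y / x).
have hBt : affine_model iota Bt by exact: adj_affine.
have hBs : affine_model iota Bs by exact: adj_affine.
have [[ht _] _ _] := hBt; have [[hs _] _ _] := hBs.
pose X0 := [set P | X P /\ P <> O].
pose Y := (X0 `|` Spec Bt) `|` Spec Bs.
have [[n [C [hC eX]]] sepX] := hX.
have x0 := rp_x0 rp; have y0 := rp_y0 rp.
have subt : B `<=` Bt by exact: adj_sub.
have subs : B `<=` Bs by exact: adj_sub.
have ctrX Q : is_local Q -> B `<=` Q -> X (ctr B Q).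
  by move=> hQ BQ; apply: BX; exact: Spec_ctr.
have img Q : Y Q -> exists P, [/\ X P, dominates Q P &
    (P <> O -> Q = P) /\ (P = O -> Spec Bt Q \/ Spec Bs Q)].
  case=> [[[XQ ne]|hQ]|hQ].
  - by exists Q; split=> //; exact: dom_refl.
  - have hl := Spec_local ht hQ; have sQ := Spec_sub ht hQ.
    exists (ctr B Q); split; [by apply: ctrX => // z /subt /sQ|exact: chart_dom hB _ hQ|].
    by split; [exact: (chart_away rp hB SO Bx By hq hQ)|left].
  - have hl := Spec_local hs hQ; have sQ := Spec_sub hs hQ.
    exists (ctr B Q); split; [by apply: ctrX => // z /subs /sQ|exact: chart_dom hB _ hQ|].
    by split; [exact: (chart_away rps hB SO By Bx hqs hQ)|right].
(* V contains x / y and y / x, so both centers equal the center of V on B[x / y, y / x]. *)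
have glue V P Q : valuation_ring iota V -> Spec Bt P -> Spec Bs Q -> dominates V P -> dominates V Q -> P = Q.
  move=> hV hP hQ dP dQ; have hl := valuation_local hV; have [hVr _] := hl.
  have sP : Bt `<=` V by move=> z /(Spec_sub ht hP) /(dom_sub dP).
  have sQ : Bs `<=` V by move=> z /(Spec_sub hs hQ) /(dom_sub dQ).
  rewrite (ctr_eq ht hP dP) (ctr_eq hs hQ dQ).
  have Vt : V (x / y) by apply: sP; exact: adj_gen.
  have Vs : V (y / x) by apply: sQ; exact: adj_gen.
  pose B2 := adj Bt (y / x); have h2 : is_subring B2 by exact: adj_subring.
  have ut : unit_of V (x / y) by split; rewrite ?mulf_neq0 ?invr_eq0 // invf_div.
  have us : unit_of V (y / x) by split; rewrite ?mulf_neq0 ?invr_eq0 // invf_div.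
  have t2 : Bt `<=` B2 by exact: adj_sub.
  have s2 : Bs `<=` B2 by apply: adj_min => //; [move=> z /subt /t2|exact: adj_gen].
  rewrite -(ctr_trans ht h2 hl sP t2); last first.
    apply: adj_min; [exact: proj1 (Spec_local ht (Spec_ctr ht hl sP))|exact: ctr_sub|].
    exists 1, (x / y); split=> //; [by sr|exact: adj_gen|by rewrite div1r invf_div].
  rewrite -(ctr_trans hs h2 hl sQ s2) //.
  have hcs := proj1 (Spec_local hs (Spec_ctr hs hl sQ)).
  apply: adj_min => //; last by apply: ctr_sub => //; exact: adj_gen.
  apply: adj_min => //; first by move=> z /subs; exact: ctr_sub.
  exists 1, (y / x); split=> //; [by sr|exact: adj_gen|by rewrite div1r invf_div].
have YX : proper_birational iota Y X.
  split; first by move=> Q /img [P [XP d _]]; exists P.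
  move=> V P hV XP d; have [eP|ne] := EM (P = O); last by exists P => //; left; left.
  rewrite eP in d; have hl := valuation_local hV; have [hVr _] := hl.
  have BV : B `<=` V by move=> z /(Spec_sub h SO) /(dom_sub d).
  have [Vt|] := proj2 hV (x / y).
    have sV : Bt `<=` V by apply: adj_min.
    by exists (ctr Bt V); [left; right; exact: Spec_ctr|exact: ctr_dom].
  rewrite invf_div => Vs; have sV : Bs `<=` V by apply: adj_min.
  by exists (ctr Bs V); [right; exact: Spec_ctr|exact: ctr_dom].
have Yqt : Y (qt iota O x y) by left; right; exact: chart_qt rp hB SO.
have Yex : Y (ex O x y) by left; right; exact: chart_ex rp hB SO.
exists Y; split=> //; split.
  apply: covered_variety; last 2 first.
  - by exists (ex O x y).
  - move=> V P Q hV /img [P0 [XP0 dP [nP eP]]] /img [Q0 [XQ0 dQ [nQ eQ]]] dVP dVQ.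
    have e : P0 = Q0 by apply: (sepX V) => //; [exact: dom_trans dVP dP|exact: dom_trans dVQ dQ].
    have [eO|ne] := EM (P0 = O); last by rewrite (nP ne) (nQ _) -?e.
    case: (eP eO) => hP; case: (eQ (etrans (esym e) eO)) => hQ.
    + by rewrite (ctr_eq ht hP dVP) (ctr_eq ht hQ dVQ).
    + exact: glue hV hP hQ dVP dVQ.
    + by apply/esym; exact: glue hV hQ hP dVQ dVP.
    + by rewrite (ctr_eq hs hP dVP) (ctr_eq hs hQ dVQ).
  apply: coveredU; [apply: coveredU|]; [|exact: covered1|exact: covered1].
  have res f : O f -> exists c, max_ideal O (f - iota c).
    move=> /(rp_res rp) [c [a [b [ha hb e]]]]; exists c; apply/(rp_max rp); exists a, b.
    by split=> //; rewrite e; ring.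
  pose D (i : nat) : set (set K) := if insub i is Some j then Spec (C j) `\ O else set0.
  have -> : X0 = foldr (fun i X => D i `|` X) set0 (seq.iota 0 n.+1).
    have mem l P : foldr (fun i X => D i `|` X) set0 l P <-> exists2 i, i \in l & D i P.
      elim: l => [|z l IH] /=; first by split=> // -[].
      split=> [[hz|/IH [w wl hw]]|[w]].
      - by exists z; rewrite ?inE ?eqxx.
      - by exists w; rewrite ?inE ?wl ?orbT.
      - by rewrite inE => /orP[/eqP ->|wl hw]; [left|right; apply/IH; exists w].
    rewrite eqEsubset; split=> P.
      move=> [XP ne]; apply/mem; move: XP; rewrite eX => -[i _ hi].
      by exists (i : nat); rewrite ?mem_iota ?ltn_ord //= /D valK.
    move=> /mem [i _]; rewrite /D; case: insubP => // j _ _ [hP ne]; split=> //.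
    by rewrite eX; exists j.
  apply: covered_bigU => i; rewrite /D; case: insubP => [j _ _|_]; last exact: covered0.
  have [hO|nO] := EM (Spec (C j) O).
    apply: (covered_minus (hC j) hO) => f; have [[hCj _] _ _] := hC j.
    by move=> /(Spec_sub hCj hO) /res.
  have -> : Spec (C j) `\ O = Spec (C j).
    by rewrite eqEsubset; split=> P; [case|move=> hP; split=> // e; apply: nO; rewrite -e].
  exact: covered1.
move=> P YP; have [[[XP _]|hP]|hP] := YP; first exact: nX.
- have [e|ne] := EM (ctr B P = O); last first.
    rewrite (chart_away rp hB SO Bx By hq hP ne); apply: nX; apply: ctrX; first exact: Spec_local ht hP.
    by move=> z /subt /(Spec_sub ht hP).
  by apply: (chart_normal rp hB SO hP e); exact: nX.
- have [e|ne] := EM (ctr B P = O); last first.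
    rewrite (chart_away rps hB SO By Bx hqs hP ne); apply: nX; apply: ctrX; first exact: Spec_local hs hP.
    by move=> z /subs /(Spec_sub hs hP).
  by apply: (chart_normal rps hB SO hP e); exact: nX.
Qed.

Lemma reach_prime_divisor E O X : reach iota E O -> normal_variety iota X -> X O ->
  prime_divisor_over iota X E.
Proof.
move=> hr; elim: hr X => {O} [O x y rp e|O x y rp hr IH] X nX XO;
  have [Y [nY pY Yq Ye]] := blow_up nX XO rp.
  by exists Y; split=> //; rewrite e //; apply: krull_dvr; exact: ex_dvr rp.
have [Z [nZ pZ ZE kE]] := IH Y nY Yq.
by exists Z; split=> //; exact: proper_trans pZ pY.
Qed.

End BlowUpVariety.

(** * Noetherian rings and prime divisors *)

Section Noetherian.
Context (K : fieldType).
Implicit Types (A B E I J : set K) (P Q : {poly K}) (x y z t f g a b c : K) (l : seq K).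

(** The A-linear combinations of the list. Besides rings, A will be the field of constants, a ring
    of q-th powers, or a mere additive set of q-th powers. *)
Fixpoint idl A l : set K := if l is a :: l'
  then [set z | exists b w, [/\ A b, idl A l' w & z = b * a + w]] else [set 0].

Lemma idlD A l z w : is_subring A -> idl A l z -> idl A l w -> idl A l (z + w).
Proof.
move=> h; elim: l z w => [|a l IH] z w /=; first by move=> -> ->; rewrite addr0.
move=> [b [u [hb hu ->]]] [c [v [hc hv ->]]]; exists (b + c), (u + v).
by split; [sr|exact: IH|ring].
Qed.
Lemma idlM A l c z : is_subring A -> A c -> idl A l z -> idl A l (c * z).
Proof.
move=> h hc; elim: l z => [|a l IH] z /=; first by move=> ->; rewrite mulr0.
move=> [b [u [hb hu ->]]]; exists (c * b), (c * u).
by split; [sr|exact: IH|ring].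
Qed.
Lemma idl0 A l : is_subring A -> idl A l 0.
Proof.
move=> h; elim: l => [|a l IH] //=; exists 0, 0; split=> //; [sr|ring].
Qed.
Lemma idl_mem A l z : is_subring A -> z \in l -> idl A l z.
Proof.
move=> h; elim: l => //= a l IH; rewrite inE => /orP[/eqP ->|/IH hz].
  by exists 1, 0; split; [sr|exact: idl0|ring].
by exists 0, z; split; [sr|by []|ring].
Qed.
Lemma idl_in A I l z : (forall a b, I a -> I b -> I (a + b)) -> (forall a b, A a -> I b -> I (a * b)) ->
  I 0 -> (forall a, a \in l -> I a) -> idl A l z -> I z.
Proof.
move=> hD hM h0; elim: l z => [|a l IH] z hl /=; first by move=> ->.
move=> [b [u [hb hu ->]]]; apply: hD; first by apply: hM => //; apply: hl; rewrite inE eqxx.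
by apply: IH hu => v vl; apply: hl; rewrite inE vl orbT.
Qed.
Lemma idl_ind A (S : set K) l z : S 0 -> (forall a b, S a -> S b -> S (a + b)) ->
  (forall a t, A a -> t \in l -> S (a * t)) -> idl A l z -> S z.
Proof.
move=> h0 hD; elim: l z => [|t l IH] z hl /=; first by move=> ->.
move=> [b [u [hb hu ->]]]; apply: hD; first by apply: hl => //; rewrite inE eqxx.
by apply: IH hu => a v ha vl; apply: hl; rewrite // inE vl orbT.
Qed.
Lemma idl0a A l : A 0 -> idl A l 0.
Proof.
move=> h; elim: l => [|a l IH] //=; exists 0, 0; split=> //; ring.
Qed.
Lemma idlDa A l z w : (forall a b, A a -> A b -> A (a + b)) -> idl A l z -> idl A l w -> idl A l (z + w).
Proof.
move=> h; elim: l z w => [|a l IH] z w /=; first by move=> -> ->; rewrite addr0.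
move=> [b [u [hb hu ->]]] [c [v [hc hv ->]]]; exists (b + c), (u + v).
by split; [exact: h|exact: IH|ring].
Qed.
Lemma idlMa A B l c z : (forall a, A a -> B (c * a)) -> idl A l z -> idl B l (c * z).
Proof.
move=> h; elim: l z => [|a l IH] z /=; first by move=> ->; rewrite mulr0.
move=> [b [u [hb hu ->]]]; exists (c * b), (c * u).
by split; [exact: h|exact: IH|ring].
Qed.
Lemma idl_sub A B l l' z : is_subring B -> A `<=` B -> {subset l <= l'} -> idl A l z -> idl B l' z.
Proof.
move=> h AB ll; apply: idl_in.
- by move=> a b; exact: idlD.
- by move=> a b /AB; exact: idlM.
- exact: idl0.
- by move=> a /ll; exact: idl_mem.
Qed.

Definition noeth A := forall I, is_ideal A I -> exists l, (forall z, z \in l -> I z) /\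
  forall z, I z -> idl A l z.

Lemma noeth_max A (F : set (set K)) : noeth A -> (forall I, F I -> is_ideal A I) -> F !=set0 ->
  exists I, F I /\ forall J, F J -> I `<=` J -> J `<=` I.
Proof.
move=> hn hF [I0 FI0]; apply: contrapT => no.
have hnext I : exists J, F I -> [/\ F J, I `<=` J & exists2 z, J z & ~ I z].
  have [FI|nF] := EM (F I); last by exists I.
  apply: contrapT => nJ; apply: no; exists I; split=> // J FJ IJ z Jz.
  by apply: contrapT => nz; apply: nJ; exists J => _; split=> //; exists z.
have [nx hnx] := choice hnext.
pose s n := iter n nx I0.
have Fs n : F (s n) by elim: n => //= n IH; have [] := hnx _ IH.
have ss n m : (n <= m)%N -> s n `<=` s m.
  move=> /subnK <-; elim: (m - n)%N => [|j IH] //=; apply: subset_trans IH _.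
  by have [] := hnx _ (Fs (j + n)%N).
pose U := [set z | exists n, s n z].
have hU : is_ideal A U.
  split.
  - by move=> z [n hz]; exact: ideal_sub (hF _ (Fs n)) hz.
  - by exists 0%N; exact: ideal0 (hF _ (Fs _)).
  - move=> a b [n ha] [m hb]; exists (maxn n m); apply: (idealD (hF _ (Fs _))).
      exact: ss (leq_maxl _ _) _ ha.
    exact: ss (leq_maxr _ _) _ hb.
  - by move=> a b ha [n hb]; exists n; apply: (idealM (hF _ (Fs _))).
have [l [hl goodpath]] := hn U hU.
have [N hN] : exists N, forall z, z \in l -> s N z.
  elim: l hl {goodpath} => [|a l IH] hl; first by exists 0%N.
  have [|N hN] := IH; first by move=> z zl; apply: hl; rewrite inE zl orbT.
  have [m hm] : U a by apply: hl; rewrite inE eqxx.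
  exists (maxn N m) => z; rewrite inE => /orP[/eqP ->|/hN hz].
    exact: ss (leq_maxr _ _) _ hm.
  exact: ss (leq_maxl _ _) _ hz.
have [_ _ [z hz nz]] := hnx _ (Fs N); apply: nz.
have hi := hF _ (Fs N).
apply: (idl_in (A := A) (I := s N) (l := l)) => //.
- by move=> a b; exact: (idealD hi).
- by move=> a b; exact: (idealM hi).
- exact: ideal0 hi.
- by apply: goodpath; exists N.+1.
Qed.

Lemma pin_sum A (T : Type) (s : seq T) (p : pred T) (F : T -> {poly K}) :
  is_subring A -> (forall i, p i -> pin A (F i)) -> pin A (\sum_(i <- s | p i) F i).
Proof.
move=> h hF; apply: big_ind => //; first by move=> i; rewrite coef0; sr.
by move=> P Q; exact: pinD.
Qed.
Lemma pin_prod A (T : Type) (s : seq T) (p : pred T) (F : T -> {poly K}) :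
  is_subring A -> (forall i, p i -> pin A (F i)) -> pin A (\prod_(i <- s | p i) F i).
Proof.
move=> h hF; apply: big_ind => //; first by apply: pinC => //; sr.
by move=> P Q; exact: pinM.
Qed.

(** Hilbert's basis theorem for a possibly algebraic t: the ideal is pulled back to A[X], [L d] is
    its ideal of coefficients in degree d, and beyond D these ideals are constant. *)
Lemma noeth_adj A t : is_subring A -> noeth A -> noeth (adj A t).
Proof.
move=> h hn I hI; have h' := adj_subring t h; have sub := adj_sub t h.
pose good d P := [/\ pin A P, (size P <= d.+1)%N & I P.[t]].
pose L d := [set a | exists P, good d P /\ P`_d = a].
have gD d P Q : good d P -> good d Q -> good d (P + Q).
  move=> [p1 p2 p3] [q1 q2 q3]; split; [exact: pinD| |by rewrite hornerD; apply: (idealD hI)].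
  by apply: leq_trans (size_polyD _ _) _; rewrite geq_max p2.
have gZ d c P : A c -> good d P -> good d (c *: P).
  move=> hc [p1 p2 p3]; split; [exact: pinZ|exact: leq_trans (size_scale_leq _ _) p2|].
  by rewrite hornerZ; apply: (idealM hI) => //; exact: sub.
have g0 d : good d 0.
  split; [by move=> i; rewrite coef0; sr|by rewrite size_poly0|by rewrite horner0; exact: ideal0 hI].
have gS d P : good d P -> good d.+1 (P * 'X).
  move=> [p1 p2 p3]; split; first by apply: pinM => //; exact: pinX.
    by apply: leq_trans (size_polyMleq _ _) _; rewrite size_polyX addn2.
  by rewrite hornerM hornerX mulrC; apply: (idealM hI) => //; exact: adj_gen.
have hL d : is_ideal A (L d).
  split.
  - by move=> _ [P [[p1 _ _] <-]].
  - by exists 0; rewrite coef0.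
  - move=> _ _ [P [gP <-]] [Q [gQ <-]]; exists (P + Q); rewrite coefD; split=> //; exact: gD.
  - move=> c _ hc [P [gP <-]]; exists (c *: P); rewrite coefZ; split=> //; exact: gZ.
have LS d m : (d <= m)%N -> L d `<=` L m.
  move=> /subnK <-; elim: (m - d)%N => [|j IH] // a /IH [P [gP <-]].
  by exists (P * 'X); split; [rewrite addSn; exact: gS|rewrite addSn coefMX].
pose LL := [set a | exists d, L d a].
have hLL : is_ideal A LL.
  split.
  - by move=> a [d ha]; exact: ideal_sub (hL d) ha.
  - by exists 0%N; exact: ideal0 (hL _).
  - move=> a b [n ha] [m hb]; exists (maxn n m); apply: (idealD (hL _)).
      exact: LS (leq_maxl _ _) _ ha.
    exact: LS (leq_maxr _ _) _ hb.
  - by move=> a b ha [n hb]; exists n; apply: (idealM (hL _)).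
have [ll [hll gll]] := hn _ hLL.
have [D hD] : exists D, forall z, z \in ll -> L D z.
  elim: ll hll {gll} => [|a l IH] hl; first by exists 0%N.
  have [|N hN] := IH; first by move=> z zl; apply: hl; rewrite inE zl orbT.
  have [m hm] : LL a by apply: hl; rewrite inE eqxx.
  exists (maxn N m) => z; rewrite inE => /orP[/eqP ->|/hN hz].
    exact: LS (leq_maxr _ _) _ hm.
  exact: LS (leq_maxl _ _) _ hz.
have DL d : L d `<=` L D.
  move=> a ha; apply: (idl_in (A := A) (l := ll)) (gll a _); last by exists d.
  - by move=> u v; exact: (idealD (hL D)).
  - by move=> u v; exact: (idealM (hL D)).
  - exact: ideal0 (hL D).
  - exact: hD.
have hG d : exists lP : seq {poly K}, (forall P, P \in lP -> good d P) /\
    forall a, L d a -> idl A (map (fun P => P`_d) lP) a.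
  have [l [hl goodpath]] := hn _ (hL d).
  suff [lP [h1 h2]] : exists lP : seq {poly K}, (forall P, P \in lP -> good d P) /\ map (fun P => P`_d) lP = l.
    by exists lP; rewrite h2.
  elim: l hl {goodpath} => [|a l IH] hl; first by exists [::].
  have [|lP [h1 h2]] := IH; first by move=> z zl; apply: hl; rewrite inE zl orbT.
  have [P [gP eP]] : L d a by apply: hl; rewrite inE eqxx.
  exists (P :: lP); rewrite /= eP h2; split=> // Q; rewrite inE => /orP[/eqP ->|/h1 //].
  exact: gP.
have [G hG'] := choice hG.
pose gens := flatten [seq [seq P.[t] | P <- G d] | d <- seq.iota 0 D.+1].
have gens_in d P : (d <= D)%N -> P \in G d -> P.[t] \in gens.
  move=> le PG; apply/flattenP; exists [seq P.[t] | P <- G d]; last exact: map_f.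
  by apply/mapP; exists d; rewrite // mem_iota.
have comb d a : (d <= D)%N -> L d a -> exists Q, [/\ good d Q, Q`_d = a & idl (adj A t) gens Q.[t]].
  move=> le /(hG' d).2; have := (hG' d).1.
  have : forall P, P \in G d -> P.[t] \in gens by move=> P; exact: gens_in.
  elim: (G d) a => [|P l IH] a hg hgd /=.
    by move=> ->; exists 0; rewrite coef0 horner0; split=> //; exact: idl0.
  move=> [b [w [hb hw ->]]].
  have [||Q [q1 q2 q3]] := IH w _ _ hw.
  - by move=> S Sl; apply: hg; rewrite inE Sl orbT.
  - by move=> S Sl; apply: hgd; rewrite inE Sl orbT.
  have gP : good d P by apply: hgd; rewrite inE eqxx.
  exists (b *: P + Q); split; first by apply: gD => //; exact: gZ.
    by rewrite coefD coefZ q2.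
  rewrite hornerD hornerZ; apply: idlD => //; apply: idlM => //; first exact: sub.
  by apply: idl_mem => //; apply: hg; rewrite inE eqxx.
exists gens; split.
  move=> _ /flattenP [_ /mapP [d _ ->] /mapP [P PG ->]].
  by have [_ _] := (hG' d).1 P PG.
move=> z Iz; have [P hP ez] := ideal_sub hI Iz; rewrite ez in Iz *.
have [n] := ubnP (size P); elim: n P hP Iz {z ez} => // n IH P hP Iz sP.
have [P0|P0] := eqVneq P 0; first by rewrite P0 horner0; exact: idl0.
pose d := (size P).-1.
have sd : size P = d.+1 by rewrite /d prednK // size_poly_gt0.
have gP : good d P by split=> //; rewrite sd.
have [Q [gQ eQ hQ]] : exists Q, [/\ good d Q, Q`_d = P`_d & idl (adj A t) gens Q.[t]].
  have Ld : L d P`_d by exists P.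
  have [le|lt] := leqP d D; first exact: comb.
  have [Q [gQ eQ hQ]] := comb D _ (leqnn D) (DL d _ Ld).
  exists (Q * 'X^(d - D)); split.
  - rewrite -{1}(subnKC (ltnW lt)); elim: (d - D)%N => [|j IHj]; first by rewrite addn0 mulr1.
    by rewrite exprSr mulrA addnS; exact: gS.
  - by rewrite coefMXn ltnNge leq_subr /= subKn // ltnW.
  - by rewrite hornerM mulrC; apply: idlM => //; rewrite hornerXn; apply: srX => //; exact: adj_gen.
have -> : P.[t] = (P - Q).[t] + Q.[t] by rewrite hornerD hornerN subrK.
apply: idlD => //; have [q1 q2 q3] := gQ; apply: IH.
- by apply: pinD => //; exact: pinN.
- by rewrite hornerD hornerN; apply: (idealB h' hI).
- apply: leq_trans (_ : d.+1 <= n)%N; last by rewrite -sd -ltnS.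
  apply/leq_sizeP => j; rewrite leq_eqVlt => /orP[/eqP <-|lt].
    by rewrite coefB eQ subrr.
  by rewrite coefB !nth_default ?subrr // ?sd // (leq_trans q2).
Qed.

Lemma noeth_localize B q : is_subring B -> is_prime_ideal B q -> noeth B -> noeth (localize B q B).
Proof.
move=> h hq hn I hI; have hE := localize_subring h hq; have sub := localize_sub h hq.
have hJ : is_ideal B (I `&` B).
  split.
  - by move=> z [].
  - by split; [exact: ideal0 hI|sr].
  - by move=> a b [? ?] [? ?]; split; [exact: (idealD hI)|sr].
  - by move=> a b ha [? ?]; split; [apply: (idealM hI) => //; exact: sub|sr].
have [l [hl goodpath]] := hn _ hJ; exists l; split; first by move=> z /hl [].
move=> z Iz; have [a [s [ha hs qs ez]]] := ideal_sub hI Iz.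
have s0 := prime_neq0 hq qs; have us : unit_of (localize B q B) s by apply/localize_unit.
have ea : a = s * z by rewrite ez mulrC divfK.
have : idl B l a by apply: goodpath; split=> //; rewrite ea; apply: (idealM hI) => //; exact: sub.
have -> : z = s^-1 * a by rewrite ez mulrC.
by move=> hh; apply: idlM => //; [by case: us|exact: idl_sub hh].
Qed.

Lemma char_poly_pin A n (m : 'M[K]_n) : is_subring A -> (forall i j, A (m i j)) ->
  pin A (char_poly m).
Proof.
move=> h hm; rewrite /char_poly /determinant; apply: pin_sum => // s _.
apply: pinM => //.
  case: (perm.odd_perm s); rewrite ?expr1 ?expr0; last by apply: pinC => //; sr.
  by apply: pinN => //; apply: pinC => //; sr.
apply: pin_prod => // i _; rewrite !mxE; apply: pinD => //; last first.
  by apply: pinN => //; exact: pinC.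
by case: (_ == _); [rewrite mulr1n; exact: pinX|move=> j; rewrite mulr0n coef0; sr].
Qed.

(** The determinant trick: z is an eigenvalue of a matrix over E, whose characteristic polynomial is
    an integral equation for z. *)
Lemma integral_idl E l z : is_subring E -> integrally_closed E ->
  (exists2 a, a \in l & a != 0) -> (forall a, a \in l -> idl E l (z * a)) -> E z.
Proof.
move=> h hi [a0 a0l a00] hl; pose n := size l; pose v := \row_(j < n) l`_j.
have hrow (i : 'I_n) : exists c : 'I_n -> K, (forall j, E (c j)) /\ z * l`_i = \sum_j c j * l`_j.
  have : idl E l (z * l`_i) by apply: hl; exact: mem_nth.
  move: (z * l`_i) => w {i v}; rewrite /n; elim: (l) w => [|a l' IH] w /=.
    by move=> ->; exists (fun=> 0); split; [move=> j; sr|rewrite big_ord0].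
  move=> [b [u [hb /IH [c [hc ec]] ->]]].
  exists (fun j => if unlift ord0 j is Some i then c i else b); split.
    by move=> j; case: unliftP.
  by rewrite big_ord_recl unlift_none ec; congr (_ + _); apply: eq_bigr => j _; rewrite liftK.
have [c hc] := choice hrow.
pose m := \matrix_(j < n, i < n) c i j.
have ev : eigenvalue m z.
  apply/eigenvalueP; exists v.
    apply/rowP => i; rewrite !mxE (hc i).2; apply: eq_bigr => j _; rewrite !mxE mulrC //.
  have [i lt ei] := nthP 0 a0l; apply/eqP => v0.
  by move/rowP/(_ (Ordinal lt)): v0; rewrite !mxE /= ei => /eqP; rewrite (negbTE a00).
apply: (hi z (char_poly m)); first exact: char_poly_monic.
  by apply: char_poly_pin => // j i; rewrite mxE; exact: (hc i).1.
by rewrite -eigenvalue_root_char.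
Qed.

Lemma zero_prime E : is_subring E -> is_prime_ideal E [set 0].
Proof.
move=> h; split; [split| |].
- by move=> _ ->; sr.
- by [].
- by move=> a b -> ->; rewrite addr0.
- by move=> a b _ ->; rewrite mulr0.
- by move/eqP; rewrite oner_eq0.
- by move=> a b _ _ /eqP; rewrite mulf_eq0 => /orP[]/eqP; [left|right].
Qed.

Lemma dim1_prime E p a : is_local E -> krull_dim E 1 -> is_prime_ideal E p -> p a -> a != 0 ->
  max_ideal E `<=` p.
Proof.
move=> hl [_ no] hp pa a0; have h := proj1 hl; apply: contrapT => nsub; apply: no.
exists (fun i => if i is j.+1 then (if j is 0%N then p else max_ideal E) else [set 0]); split.
  move=> [_|[_|i _]] //; [exact: zero_prime|exact: max_prime_ideal].
have [hi p1 _] := hp.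
move=> [|[|//]] _; split.
- by move=> _ ->; exact: ideal0 hi.
- by move=> /(_ a pa) /eqP; rewrite (negbTE a0).
- move=> z pz; split; first exact: ideal_sub hi pz.
  move=> [z0 _ zi]; apply: p1; rewrite -(mulVf z0); exact: (idealM hi).
- exact: nsub.
Qed.

Lemma dim1_nonzero E : is_local E -> krull_dim E 1 -> exists2 a, max_ideal E a & a != 0.
Proof.
move=> hl [[c [cp cs]] _]; have h := proj1 hl.
have [_ /existsNP [z /not_implyP [cz nz]]] := cs 0%N isT; exists z.
  have [hi c1 _] := cp 1%N isT; split; first exact: ideal_sub hi cz.
  move=> [z0 _ zi]; apply: c1; rewrite -(mulVf z0); exact: (idealM hi).
by apply/eqP => e; apply: nz; rewrite e; exact: ideal0 (prime_ideal_of (cp 0%N isT)).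
Qed.

(** A maximal ideal of the form (a : b) with b outside (a) is prime and nonzero, hence is the
    maximal ideal m. So z = b / a satisfies z m in E. If z m were in m, z would be integral and b a
    multiple of a; hence z c is a unit for some c in m, and c generates m. *)
Lemma noeth_dvr E : is_local E -> noeth E -> integrally_closed E -> krull_dim E 1 ->
  (forall z, exists a b, [/\ E a, E b, b != 0 & z = a / b]) -> dvr E.
Proof.
move=> hl hn hi kd fr; have h := proj1 hl.
have [a ma a0] := dim1_nonzero hl kd; have ha := max_sub ma.
pose D b := exists2 c, E c & b = a * c.
pose F := [set I | exists b, [/\ E b, ~ D b & I = [set c | E c /\ D (c * b)]]].
have DD b c : D b -> D c -> D (b + c).
  by move=> [u hu ->] [v hv ->]; exists (u + v); [sr|ring].
have DM b c : E b -> D c -> D (b * c).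
  by move=> hb [v hv ->]; exists (b * v); [sr|ring].
have hF I : F I -> is_ideal E I.
  move=> [b [hb nb ->]]; split.
  - by move=> z [].
  - by split; [sr|exists 0; [sr|ring]].
  - by move=> u v [? ?] [? ?]; split; [sr|rewrite mulrDl; exact: DD].
  - by move=> u v hu [? ?]; split; [sr|rewrite -mulrA; exact: DM].
have [|p [[b [hb nb ep]] pmax]] := noeth_max hn hF.
  exists [set c | E c /\ D (c * 1)], 1; split=> //; first by sr.
  move=> [c hc e]; apply: (max_nunit ma); split=> //.
  by rewrite (_ : a^-1 = c) //; apply: (mulfI a0); rewrite -e mulfV.
have hpI := hF p (ex_intro _ b (And3 hb nb ep)).
have hp : is_prime_ideal E p.
  split=> //; first by rewrite ep => -[_]; rewrite mul1r.
  move=> u v hu hv; rewrite ep => -[_ huv].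
  have [Du|nDu] := EM (D (u * b)); first by left.
  right; have := pmax [set c | E c /\ D (c * (u * b))].
  rewrite ep => H; apply: H.
  - by exists (u * b); split=> //; sr.
  - by move=> c [hc Dc]; split=> //; rewrite mulrCA; exact: DM.
  - by split=> //; rewrite mulrA (mulrC v).
have pa : p a by rewrite ep; split=> //; exists b.
have mp := dim1_prime hl kd hp pa a0.
pose z := b / a.
have zm c : max_ideal E c -> E (z * c).
  move=> /mp; rewrite ep => -[hc [d hd ed]]; rewrite (_ : z * c = d) //.
  by rewrite /z mulrAC (mulrC b) ed mulrC mulKf.
have nz : ~ E z by move=> hz; apply: nb; exists z => //; rewrite /z mulrC divfK.
have [c mc nc] : exists2 c, max_ideal E c & ~ max_ideal E (z * c).
  apply: contrapT => no; apply: nz.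
  have [l [hl1 hl2]] := hn _ (prime_ideal_of (max_prime_ideal hl)).
  apply: (integral_idl (l := l)) => //.
    apply: contrapT => nol; move/eqP: a0; apply.
    apply: (idl_in (I := [set 0]) (A := E) (l := l)) (hl2 a ma) => //.
    - by move=> u v -> ->; rewrite addr0.
    - by move=> u v _ ->; rewrite mulr0.
    - by move=> u ul; apply/eqP; case: eqVneq => // u0; case: nol; exists u.
  move=> u ul; apply: hl2; apply: contrapT => nu; apply: no; exists u => //; exact: hl1.
have uzc : unit_of E (z * c) by case: (unit_or_max (zm _ mc)).
have [zc0 _ zci] := uzc.
have c0 : c != 0 by apply: contra_neq zc0 => ->; rewrite mulr0.
have z0 : z != 0 by apply: contra_neq zc0 => ->; rewrite mul0r.
have hc := max_sub mc.
have mE g : max_ideal E g -> exists2 g', E g' & g = c * g'.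
  move=> mg; exists (z * g * (z * c)^-1); first by have := zm _ mg => ?; sr.
  by fd.
(* Among the ideals (g) with f = g c^n a maximal one is the unit ideal, since a non-unit g could be
   divided by c once more. *)
have key f : E f -> f != 0 -> exists u (n : nat), unit_of E u /\ f = u * c ^+ n.
  move=> form f0; pose G := [set I | exists g, [/\ E g, g != 0, (exists n : nat, f = g * c ^+ n) & I = [set w | exists2 v, E v & w = g * v]]].
  have [||I [[g [hg g0 [n en] eI]] Imax]] := @noeth_max E G hn.
  - move=> I [g [hg _ _ ->]]; split.
    + by move=> _ [v hv ->]; sr.
    + by exists 0; [sr|ring].
    + by move=> _ _ [v hv ->] [w hw ->]; exists (v + w); [sr|ring].
    + by move=> w _ hw [v hv ->]; exists (w * v); [sr|ring].
  - by exists [set w | exists2 v, E v & w = f * v], f; split=> //; exists 0%N; rewrite mulr1.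
  case: (unit_or_max hg) => [ug|/mE [g' hg' eg]]; first by exists g, n.
  have g'0 : g' != 0 by apply: contra_neq g0 => e; rewrite eg e mulr0.
  have := Imax [set w | exists2 v, E v & w = g' * v].
  rewrite eI => H; have [v hv ev] : [set w | exists2 v, E v & w = g * v] g'.
    apply: H.
    - by exists g'; split=> //; exists n.+1; rewrite en eg exprS; ring.
    - by move=> _ [v hv ->]; exists (c * v); [sr|rewrite eg; ring].
    - by exists 1; [sr|ring].
  case: (max_nunit mc); split=> //; rewrite (_ : c^-1 = v) //.
  apply: (mulfI c0); rewrite mulfV //; apply: (mulfI g'0); rewrite mulr1 {1}ev eg; ring.
split=> //; exists c; split=> // f f0.
have [u [v [hu hv v0 e]]] := fr f.
have u0 : u != 0 by apply: contra_neq f0 => u0; rewrite e u0 mul0r.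
have [u1 [n [hu1 eu]]] := key u hu u0; have [v1 [m [hv1 ev]]] := key v hv v0.
exists (u1 / v1), (n%:Z - m%:Z); split; first by apply: unitM => //; exact: unitV.
have cn : c ^+ m != 0 by rewrite expf_neq0.
have [v10 _ _] := hv1.
by rewrite expfzDr // -invr_expz -!exprnP e eu ev; fd.
Qed.

End Noetherian.

(** * Prime divisors are reached by blow-ups *)

Section PrimeDivisors.
Context (k : closedFieldType) (K : fieldType) (iota : {rmorphism k -> K}).
Implicit Types (A B C E O : set K) (X Y : set (set K)) (x y z t f g h : K).

(** [fin_gen] speaks of an intersection of subalgebras; this replaces it by adjoining generators one
    at a time to the constants. *)
Lemma fin_gen_ind (Pr : set K -> Prop) : Pr (range iota) ->
  (forall A t, is_subalg iota A -> Pr A -> Pr (adj A t)) ->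
  forall B, fin_gen iota B -> Pr B.
Proof.
move=> P0 PS B [s es].
suff [A [hA PA hs mA]] : exists A, [/\ is_subalg iota A, Pr A, (forall z, z \in s -> A z) &
    forall C, is_subalg iota C -> (forall z, z \in s -> C z) -> A `<=` C].
  suff -> : B = A by [].
  rewrite es eqEsubset; split; first by move=> z; apply.
  by move=> z Az C [hC hCs]; exact: mA Az.
elim: {es} s => [|t s [A [hA PA hs mA]]].
  exists (range iota); split=> //; last by move=> C [_ hC] _ _ [c _ <-].
  split; last by move=> c; exists c.
  split.
  - by exists 1; rewrite ?rmorph1.
  - by move=> _ _ [a _ <-] [b _ <-]; exists (a - b); rewrite ?rmorphB.
  - by move=> _ _ [a _ <-] [b _ <-]; exists (a * b); rewrite ?rmorphM.
have [h hc] := hA; exists (adj A t); split.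
- exact: adj_alg.
- exact: PS.
- move=> z; rewrite inE => /orP[/eqP ->|/hs hz]; [exact: adj_gen|exact: adj_sub].
- move=> C hC hCs; apply: adj_min; [exact: proj1 hC| |by apply: hCs; rewrite inE eqxx].
  by apply: mA => // z zs; apply: hCs; rewrite inE zs orbT.
Qed.

Lemma affine_noeth B : affine_model iota B -> noeth B.
Proof.
move=> [_ fg _]; apply: fin_gen_ind fg; last by move=> A t [h _]; exact: noeth_adj.
move=> I hI; have [[z Iz z0]|no] := EM (exists2 z, I z & z != 0); last first.
  exists [::]; split=> // z Iz /=; apply/eqP; case: eqVneq => // z0.
  by case: no; exists z.
exists [:: z]; split; first by move=> w; rewrite inE => /eqP ->.
have [c _ ec] := ideal_sub hI Iz.
move=> w /(ideal_sub hI) [d _ <-]; exists (iota d / iota c), 0; split=> //.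
  by exists (d / c); rewrite ?fmorph_div.
by rewrite addr0 -ec divfK // ec.
Qed.

Lemma point_dvr Y E : normal_variety iota Y -> Y E -> krull_dim E 1 ->
  is_subalg iota E /\ dvr E.
Proof.
move=> [[[n [B [hB eY]]] _] nY] YE kd; have := YE; rewrite eY => -[i _ hE].
have [hBi _ fr] := hB i; have [h hc] := hBi; have hl := Spec_local h hE; have BE := Spec_sub h hE.
split; first by split; [exact: proj1 hl|move=> c; exact: BE].
apply: noeth_dvr => //; last 2 first.
- exact: nY.
- move=> z; have [a [b [ha hb b0 e]]] := fr z; exists a, b; split=> //; exact: BE.
by have [q hq ->] := hE; apply: noeth_localize => //; exact: affine_noeth.
Qed.

(** E is a localization of a finitely generated algebra, so one element hh clears the denominators
    of all df written in dx and dy; then hh^2 bounds the 2-forms as [zariski] requires. *)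
Lemma prime_divisor_reach X E O x y : prime_divisor_over iota X E -> regpt iota O x y ->
  dominates E O -> reach iota E O.
Proof.
move=> [Y [nY _ YE kd]] rp d; have [hEa hE] := point_dvr nY YE kd.
have [[[n [B [hB eY]]] _] _] := nY; have := YE; rewrite eY => -[i _ SE].
have [hBi [s es] fr] := hB i; have [h hc] := hBi; have BE := Spec_sub h SE.
have hEr := proj1 hE; have hl := dvr_local hE.
have Bs z : z \in s -> B i z by move=> zs; rewrite es => C [_ hs]; exact: hs.
have omK z : exists w : K * K, forall D : derivation iota, D z = w.1 * D x + w.2 * D y.
  have [a [b [ha hb b0 ->]]] := rp_frac rp z.
  have [a1 [a2 [_ _ ea]]] := rp_om rp ha; have [b1 [b2 [_ _ eb]]] := rp_om rp hb.
  exists ((a1 - a / b * b1) / b, (a2 - a / b * b2) / b) => D.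
  by rewrite der_div // ea eb /=; ring.
have [w hw] := choice omK.
have [hh [Eh h0 hclear]] : exists hh, [/\ E hh, hh != 0 & forall z, z \in s -> E (hh * (w z).1) /\ E (hh * (w z).2)].
  elim: (s) => [|z l [h1 [Eh1 h10 hl1]]]; first by exists 1; split; [sr|exact: oner_neq0|].
  have hden u : exists2 v, E v /\ v != 0 & E (v * u).
    have [a [b [ha hb b0 ->]]] := fr u; exists b; first by split=> //; exact: BE.
    by rewrite mulrC divfK //; exact: BE.
  have [v1 [hv1 v10] hv1w] := hden (w z).1; have [v2 [hv2 v20] hv2w] := hden (w z).2.
  exists (h1 * v1 * v2); split; [by sr|by rewrite !mulf_neq0|].
  move=> u; rewrite inE => /orP[/eqP ->|/hl1 [e1 e2]].
    split; first by rewrite (_ : _ * _ = h1 * v2 * (v1 * (w z).1)); [sr|ring].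
    by rewrite (_ : _ * _ = h1 * v1 * (v2 * (w z).2)); [sr|ring].
  split; first by rewrite (_ : _ * _ = v1 * v2 * (h1 * (w u).1)); [sr|ring].
  by rewrite (_ : _ * _ = v1 * v2 * (h1 * (w u).2)); [sr|ring].
have tameB f : B i f -> exists f1 f2, [/\ E f1, E f2 & forall D : derivation iota, hh * D f = f1 * D x + f2 * D y].
  pose C := [set f | B i f /\ exists f1 f2, [/\ E f1, E f2 & forall D : derivation iota, hh * D f = f1 * D x + f2 * D y]].
  suff : B i `<=` C by move=> sub /sub [].
  have hC : is_subring C.
    split.
    - by split; [sr|exists 0, 0; split; try sr; move=> D; rewrite der1; ring].
    - move=> a b [ha [a1 [a2 [? ? ea]]]] [hb [b1 [b2 [? ? eb]]]]; split; first by sr.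
      exists (a1 - b1), (a2 - b2); split; try sr; move=> D.
      by rewrite derB mulrBr ea eb; ring.
    - move=> a b [ha [a1 [a2 [? ? ea]]]] [hb [b1 [b2 [? ? eb]]]]; split; first by sr.
      have ? := BE _ ha; have ? := BE _ hb.
      exists (a * b1 + b * a1), (a * b2 + b * a2); split; try sr; move=> D.
      have -> : hh * D (a * b) = a * (hh * D b) + b * (hh * D a) by rewrite derM; ring.
      by rewrite ea eb; ring.
  rewrite [X in X `<=` _]es => f'; apply; split.
    by split=> // c; split=> //; exists 0, 0; split; try sr; move=> D; rewrite der_const; ring.
  move=> z zs; split; first exact: Bs.
  have [e1 e2] := hclear z zs; exists (hh * (w z).1), (hh * (w z).2); split=> // D.
  by rewrite hw; ring.
have tameE f : E f -> exists f1 f2, [/\ E f1, E f2 & forall D : derivation iota, hh * D f = f1 * D x + f2 * D y].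
  rewrite {1}(ctr_self h SE) => -[a [u [ha hu [u0 _ ui] ->]]].
  have [a1 [a2 [? ? ea]]] := tameB a ha; have [u1 [u2 [? ? eu]]] := tameB u hu.
  have ? := BE _ ha.
  exists ((a1 - a / u * u1) / u), ((a2 - a / u * u2) / u); split; try sr.
  move=> D; rewrite der_div //.
  have -> : hh * ((D a - a / u * D u) / u) = (hh * D a - a / u * (hh * D u)) / u by ring.
  by rewrite ea eu; ring.
apply: (zariski rp hEa hE d (H := hh * hh)); first by rewrite mulf_neq0.
move=> f g /tameE [f1 [f2 [? ? ef]]] /tameE [g1 [g2 [? ? eg]]].
exists (f1 * g2 - f2 * g1); first by sr.
move=> D D'; rewrite /dd.
have -> : hh * hh * (D f * D' g - D g * D' f) = (hh * D f) * (hh * D' g) - (hh * D g) * (hh * D' f) by ring.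
by rewrite !ef !eg; ring.
Qed.

End PrimeDivisors.

(** * Algebraic dependence by counting *)

Section LinearSpans.
Context (k : closedFieldType) (K : fieldType) (iota : {rmorphism k -> K}).
Implicit Types (A B C O : set K) (x y z t f g v : K) (L T fs w : seq K) (c : k).

Definition sp L := idl (range iota) L.

Lemma ct_ring : is_subring (range iota).
Proof.
split.
- by exists 1; rewrite ?rmorph1.
- by move=> _ _ [a _ <-] [b _ <-]; exists (a - b); rewrite ?rmorphB.
- by move=> _ _ [a _ <-] [b _ <-]; exists (a * b); rewrite ?rmorphM.
Qed.
Let hk := ct_ring.

Lemma spZ L c z : sp L z -> sp L (iota c * z).
Proof. by apply: idlM => //; exists c. Qed.

Lemma sp_dep (I : eqType) (s : seq I) (u : I -> K) L : uniq s -> (size L < size s)%N ->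
  (forall a, a \in s -> sp L (u a)) ->
  exists c : I -> k, (exists2 a, a \in s & c a != 0) /\ \sum_(a <- s) iota (c a) * u a = 0.
Proof.
elim: L s u => [|l L IH] s u us sz hu.
  case: s us sz hu => // a s us _ hu; exists (fun=> 1); split.
    by exists a; rewrite ?inE ?eqxx ?oner_eq0.
  by apply: big1_seq => b /= /hu ->; rewrite mulr0.
have hu' a : exists c : k, a \in s -> sp L (u a - iota c * l).
  have [as_|ns] := boolP (a \in s); last by exists 0.
  have [_ [w [[c _ <-] hw e]]] := hu a as_.
  by exists c => _; rewrite e addrC addKr.
have [c hc] := choice hu'.
have [[a0 a0s c0]|no] := EM (exists2 a, a \in s & c a != 0); last first.
  apply: IH => //; first exact: ltnW sz.
  move=> a as_; have := hc a as_; rewrite (_ : c a = 0) ?rmorph0 ?mul0r ?subr0 //.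
  by apply/eqP; case: eqVneq => // ca; case: no; exists a.
have [||a as'|c' [[a1 a1s c1] e']] := IH (rem a0 s) (fun a => u a - iota (c a / c a0) * u a0).
- exact: rem_uniq.
- by rewrite size_rem //; move: sz => /=; lia.
- have as_ := mem_rem as'.
  rewrite (_ : _ - _ = (u a - iota (c a) * l) - iota (c a / c a0) * (u a0 - iota (c a0) * l)).
    by apply: idlD => //; [exact: hc|rewrite -mulNr -rmorphN; apply: spZ; exact: hc].
  by rewrite rmorphM fmorphV /=; field; rewrite fmorph_eq0.
exists (fun a => if a == a0 then - \sum_(b <- rem a0 s) c' b * (c b / c a0) else c' a); split.
  have ne : a1 != a0 by apply: contraTneq a1s => ->; rewrite mem_rem_uniq // inE eqxx.
  by exists a1; [exact: mem_rem a1s|rewrite (negbTE ne)].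
rewrite (perm_big _ (perm_to_rem a0s)) big_cons eqxx.
rewrite (eq_big_seq (fun a => iota (c' a) * (u a - iota (c a / c a0) * u a0) + iota (c' a * (c a / c a0)) * u a0)).
  rewrite big_split /= e' add0r -mulr_suml -mulrDl rmorphN rmorph_sum addNr mul0r //.
move=> a ar; have ne : a != a0 by apply: contraTneq ar => ->; rewrite mem_rem_uniq // inE eqxx.
by rewrite (negbTE ne) !rmorphM; ring.
Qed.

Fixpoint idx d N : seq (seq nat) := if d is d'.+1
  then [seq i :: a | i <- seq.iota 0 N, a <- idx d' N] else [:: [::]].
Fixpoint mon fs (a : seq nat) : K := match fs, a with
  | f :: fs', i :: a' => f ^+ i * mon fs' a' | _, _ => 1 end.
Definition msum fs N (c : seq nat -> k) := \sum_(a <- idx (size fs) N) iota (c a) * mon fs a.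
(* The members of fs are algebraically dependent over k. *)
Definition kdep fs := exists N (c : seq nat -> k), (exists2 a, a \in idx (size fs) N & c a != 0) /\ msum fs N c = 0.

Lemma size_idx d N : size (idx d N) = (N ^ d)%N.
Proof. by elim: d => //= d IH; rewrite size_allpairs size_iota IH expnS. Qed.
Lemma uniq_idx d N : uniq (idx d N).
Proof.
elim: d => //= d IH; apply: allpairs_uniq => //; first exact: iota_uniq.
by move=> [i a] [j b] _ _ [-> ->].
Qed.
Lemma msum_cons f fs N (c : seq nat -> k) :
  msum (f :: fs) N c = \sum_(i < N) f ^+ i * msum fs N (fun a => c ((i : nat) :: a)).
Proof.
rewrite /msum /= big_allpairs_dep -[X in seq.iota 0 X](subn0 N) -/(index_iota 0 N) big_mkord.
by apply: eq_bigr => i _; rewrite mulr_sumr; apply: eq_bigr => a _; rewrite mulrCA.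
Qed.

(* The k-span of the monomials in w with all exponents at most n. *)
Fixpoint Sp w n : set K := if w is a :: w'
  then [set z | exists P : {poly K}, [/\ (size P <= n.+1)%N, forall i, Sp w' n P`_i & z = P.[a]]]
  else range iota.

Lemma Sp0 w n : Sp w n 0.
Proof.
elim: w => [|a w IH] /=; first by exists 0; rewrite ?rmorph0.
by exists 0; rewrite horner0 size_poly0; split=> // i; rewrite coef0.
Qed.
Lemma Sp_ct w n c : Sp w n (iota c).
Proof.
elim: w => [|a w IH] /=; first by exists c.
exists (iota c)%:P; rewrite hornerC; split=> //; first by rewrite size_polyC; case: eqP.
by move=> i; rewrite coefC; case: ifP => // _; exact: Sp0.
Qed.
Lemma SpD w n z t : Sp w n z -> Sp w n t -> Sp w n (z + t).
Proof.
elim: w z t => [|a w IH] z t; first exact: srD.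
move=> [P [sP hP ->]] [Q [sQ hQ ->]]; exists (P + Q); split; rewrite ?hornerD //.
  by apply: leq_trans (size_polyD _ _) _; rewrite geq_max sP.
by move=> i; rewrite coefD; apply: IH; [exact: hP|exact: hQ].
Qed.
Lemma Sp_sum w n (I : Type) (s : seq I) (p : pred I) (F : I -> K) :
  (forall i, p i -> Sp w n (F i)) -> Sp w n (\sum_(i <- s | p i) F i).
Proof. by move=> hF; apply: big_ind => //; [exact: Sp0|exact: SpD]. Qed.
Lemma SpM w n l z t : Sp w n z -> Sp w l t -> Sp w (n + l) (z * t).
Proof.
elim: w z t => [|a w IH] z t; first exact: srM.
move=> [P [sP hP ->]] [Q [sQ hQ ->]]; exists (P * Q); split; rewrite ?hornerM //.
  by apply: leq_trans (size_polyMleq _ _) _; lia.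
by move=> i; rewrite coefM; apply: Sp_sum => j _; apply: IH; [exact: hP|exact: hQ].
Qed.
Lemma Sp_le w n l z : (n <= l)%N -> Sp w n z -> Sp w l z.
Proof. by move=> /subnKC <- hz; rewrite -[z]mulr1 -(rmorph1 iota); apply: SpM => //; exact: Sp_ct. Qed.
Lemma SpX w n z l : Sp w n z -> Sp w (n * l) (z ^+ l).
Proof.
move=> hz; elim: l => [|l IH]; first by rewrite ?expr0 -(rmorph1 iota); exact: Sp_ct.
by rewrite exprS mulnS; exact: SpM.
Qed.
Lemma Sp_cons a w n i z : Sp w n z -> (i <= n)%N -> Sp (a :: w) n (z * a ^+ i).
Proof.
move=> hz le; exists (z *: 'X^i); split; last by rewrite hornerZ hornerXn.
  by apply: leq_trans (size_scale_leq _ _) _; rewrite size_polyXn.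
move=> j; rewrite coefZ coefXn; case: (j == i); rewrite ?mulr1 ?mulr0 //; exact: Sp0.
Qed.
Lemma Sp_mem w a : a \in w -> Sp w 1 a.
Proof.
elim: w => // b w IH; rewrite inE => /orP[/eqP ->|/IH ha].
  by have := Sp_cons b (Sp_ct w 1 1) (leqnn 1); rewrite rmorph1 mul1r expr1.
by have := Sp_cons b ha (leq0n 1); rewrite expr0 mulr1.
Qed.
Lemma Sp_sub w n C : is_subalg iota C -> (forall a, a \in w -> C a) -> Sp w n `<=` C.
Proof.
move=> hC; elim: w => [|a w IH] hw z; first by move=> [c _ <-]; exact: (proj2 hC).
move=> [P [_ hP ->]]; apply: pin_horner; first exact: proj1 hC.
  by move=> i; apply: IH (hP i) => b bw; apply: hw; rewrite inE bw orbT.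
by apply: hw; rewrite inE eqxx.
Qed.
Lemma Sp_gen B : is_subalg iota B -> fin_gen iota B ->
  exists w, (forall n, Sp w n `<=` B) /\ forall z, B z -> exists n, Sp w n z.
Proof.
move=> hB [v eB]; exists v; split.
  by move=> n; apply: Sp_sub => // a av; rewrite eB => C [_]; apply.
move=> z; rewrite eB => /(_ [set z | exists n, Sp v n z]); apply; split; last by move=> x /Sp_mem; exists 1%N.
split; last by move=> c; exists 0%N; exact: Sp_ct.
split; first by exists 0%N; rewrite -(rmorph1 iota); exact: Sp_ct.
- move=> x y [n hx] [l hy]; exists (n + l)%N; apply: SpD; first by apply: Sp_le hx; exact: leq_addr.
  rewrite -mulN1r -(rmorph1 iota) -rmorphN; apply: (Sp_le (leq_addl n l)).
  by rewrite -[l]add0n; apply: SpM hy; exact: Sp_ct.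
- by move=> x y [n hx] [l hy]; exists (n + l)%N; exact: SpM.
Qed.
Lemma Sp_list w B (l : seq K) : (forall z, B z -> exists n, Sp w n z) ->
  (forall z, z \in l -> B z) -> exists n, forall z, z \in l -> Sp w n z.
Proof.
move=> hB; elim: l => [|a l IH] hl; first by exists 0%N.
have [|n hn] := IH; first by move=> z zl; apply: hl; rewrite inE zl orbT.
have [|m hm] := hB a; first by apply: hl; rewrite inE eqxx.
exists (n + m)%N => z; rewrite inE => /orP[/eqP ->|/hn hz].
  exact: Sp_le (leq_addl _ _) hm.
exact: Sp_le (leq_addr _ _) hz.
Qed.
Lemma Sp_span w n : exists L, [/\ (size L = n.+1 ^ size w)%N,
  forall l, l \in L -> Sp w n l & forall z, Sp w n z -> sp L z].
Proof.
elim: w => [|a w [L [sL iL hL]]].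
  exists [:: 1]; split=> //; first by move=> l; rewrite inE => /eqP ->; exists 1; rewrite ?rmorph1.
  by move=> z hz; exists z, 0; split=> //; rewrite mulr1 addr0.
exists [seq l * a ^+ i | l <- L, i <- seq.iota 0 n.+1]; split.
- by rewrite size_allpairs size_iota sL /= expnS mulnC.
- move=> _ /allpairsPdep [l [i [lL ii ->]]]; apply: Sp_cons; first exact: iL.
  by move: ii; rewrite mem_iota add0n ltnS.
move=> z [P [sP hP ->]]; rewrite (horner_coef_wide _ sP).
apply: big_ind => //; [exact: idl0|by move=> x y; exact: idlD|move=> i _].
have /hL := hP i; move: (P`_i) => v hv; set LL := [seq _ | l <- L, i <- _].
apply: (idl_ind (S := [set v | sp LL (v * a ^+ i)])) hv.
- by rewrite /= mul0r; exact: idl0.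
- by move=> x y /=; rewrite mulrDl; exact: idlD.
- move=> b l hb lL /=; rewrite -mulrA; apply: idlM => //; apply: idl_mem => //.
  by apply/allpairsPdep; exists l, (i : nat); rewrite mem_iota /=.
Qed.

Section Frobenius.
Variable q : nat.
Hypotheses (q1 : (1 < q)%N) (fr : forall a b : K, (a + b) ^+ q = a ^+ q + b ^+ q).
Let q0 : (0 < q)%N := ltnW q1.

Definition Fr A := [set z ^+ q | z in A].

Lemma Fr_ring A : is_subring A -> is_subring (Fr A).
Proof.
move=> h; split.
- by exists 1; [sr|rewrite expr1n].
- move=> _ _ [a ha <-] [b hb <-]; exists (a - b); first by sr.
  by apply/eqP; rewrite eq_sym subr_eq -fr subrK.
- by move=> _ _ [a ha <-] [b hb <-]; exists (a * b); [sr|rewrite exprMn].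
Qed.
Lemma ct_root c : exists c' : k, iota c = iota c' ^+ q.
Proof.
have /closed_rootP [z] : size ('X^q - c%:P : {poly k}) != 1%N.
  by rewrite size_XnsubC // eqSS -lt0n.
rewrite rootE hornerD hornerN hornerC hornerXn subr_eq0 => /eqP e; exists z.
by rewrite -e rmorphXn.
Qed.

Lemma Fr_Sp_D w n a b : Fr (Sp w n) a -> Fr (Sp w n) b -> Fr (Sp w n) (a + b).
Proof. by move=> [u hu <-] [v hv <-]; exists (u + v); [exact: SpD|exact: fr]. Qed.
Lemma Fr_Sp_0 w n : Fr (Sp w n) 0.
Proof. by exists 0; [exact: Sp0|rewrite expr0n gtn_eqF]. Qed.

Lemma Sp_frob w n z : Sp w (q * n) z ->
  exists l : seq (K * K), (forall b : K * K, b \in l -> Sp w n b.1 /\ Sp w q b.2) /\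
    z = \sum_(b <- l) b.1 ^+ q * b.2.
Proof.
elim: w z => [|a w IH] z.
  move=> hz; exists [:: (1, z)]; rewrite big_seq1 expr1n mul1r; split=> // b.
  by rewrite inE => /eqP ->; split=> //; rewrite -(rmorph1 iota); exists 1.
move=> [P [sP hP ->]]; rewrite (horner_coef_wide _ sP).
pose FS z := exists l : seq (K * K), (forall b : K * K, b \in l -> Sp (a :: w) n b.1 /\ Sp (a :: w) q b.2) /\
    z = \sum_(b <- l) b.1 ^+ q * b.2.
apply: (big_ind FS).
- by exists [::]; rewrite big_nil.
- move=> x y [l [hl ->]] [l' [hl' ->]]; exists (l ++ l'); rewrite big_cat; split=> // b.
  by rewrite mem_cat => /orP[/hl|/hl'].
move=> i _; have [l [hl ->]] := IH _ (hP i).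
exists [seq (b.1 * a ^+ (i %/ q), b.2 * a ^+ (i %% q)) | b <- l]; split.
  move=> _ /mapP [b /hl [b1 b2] ->]; split; apply: Sp_cons => //.
    by apply: leq_trans (leq_div2r q (_ : i <= q * n)%N) _; rewrite ?mulKn // -ltnS.
  by rewrite ltnW // ltn_mod.
rewrite big_map mulr_suml; apply: eq_bigr => b _ /=.
by rewrite {1}(divn_eq i q) exprD exprM exprMn; ring.
Qed.

(** [Sp w q] is spanned by finitely many elements over the constants, which are q-th powers; so a
    single D accommodates all coefficients. *)
Lemma frob_bound B T w : is_subring B -> (forall n, Sp w n `<=` B) ->
  (forall z, B z -> exists n, Sp w n z) -> (forall z, B z -> idl (Fr B) T z) ->
  exists D, forall v, Sp w q v -> idl (Fr (Sp w D)) T v.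
Proof.
move=> h sB gB hT.
have up n m z : (n <= m)%N -> idl (Fr (Sp w n)) T z -> idl (Fr (Sp w m)) T z.
  move=> le; rewrite -{2}[z]mul1r; apply: idlMa => a [b hb <-]; exists b; rewrite ?mul1r //.
  exact: Sp_le hb.
have one z : B z -> exists D, idl (Fr (Sp w D)) T z.
  move=> /hT; elim: (T) z up => [|t T' IH] z up; first by exists 0%N.
  have up' n m z' : (n <= m)%N -> idl (Fr (Sp w n)) T' z' -> idl (Fr (Sp w m)) T' z'.
    move=> le; rewrite -{2}[z']mul1r; apply: idlMa => a [b hb <-]; exists b; rewrite ?mul1r //.
    exact: Sp_le hb.
  move=> [b [v [[c /gB [n hc] <-] /(IH _ up') [D hD] ->]]].
  exists (n + D)%N, (c ^+ q), v; split=> //; last exact: up' (leq_addl _ _) hD.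
  by exists c => //; apply: Sp_le hc; exact: leq_addr.
have [L [_ iL hL]] := Sp_span w q.
have [D hD] : exists D, forall l, l \in L -> idl (Fr (Sp w D)) T l.
  have : forall l, l \in L -> B l by move=> l /iL; exact: sB.
  elim: (L) => [|a l IH] hl; first by exists 0%N.
  have [|n hn] := IH; first by move=> z zl; apply: hl; rewrite inE zl orbT.
  have [|m hm] := one a; first by apply: hl; rewrite inE eqxx.
  exists (n + m)%N => z; rewrite inE => /orP[/eqP ->|/hn hz].
    exact: up (leq_addl _ _) hm.
  exact: up (leq_addr _ _) hz.
exists D => v /hL; apply: idl_ind.
- by apply: idl0a; exact: Fr_Sp_0.
- by move=> a b; apply: idlDa; exact: Fr_Sp_D.
- move=> _ l [c _ <-] /hD hl; have [c' ->] := ct_root c.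
  move: hl; apply: idlMa => _ [b hb <-]; exists (iota c' * b); last by rewrite exprMn.
  by rewrite -[D]add0n; apply: SpM => //; exact: Sp_ct.
Qed.

(** One Frobenius step multiplies the bound for the dimension by the size of T. *)
Lemma Sp_step w n D L T : (forall v, Sp w q v -> idl (Fr (Sp w D)) T v) ->
  (forall z, Sp w (n + D) z -> sp L z) ->
  forall z, Sp w (q * n) z -> sp [seq e ^+ q * t | e <- L, t <- T] z.
Proof.
move=> hT hL z /Sp_frob [l [hl ->]].
rewrite big_seq; apply: big_ind => //; [exact: idl0|by move=> x y; exact: idlD|].
set LL := [seq _ | e <- L, t <- T].
move=> b /hl [b1 /hT]; move: (b.1) (b.2) b1 => u v hu.
apply: (idl_ind (S := [set v | sp LL (u ^+ q * v)])).
- by rewrite /= mulr0; exact: idl0.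
- by move=> x y /=; rewrite mulrDr; exact: idlD.
move=> _ t [c hc <-] tT /=; rewrite mulrA -exprMn.
have : sp L (u * c) by apply: hL; exact: SpM.
apply: (idl_ind (S := [set v | sp LL (v ^+ q * t)])).
- by rewrite /= expr0n gtn_eqF // mul0r; exact: idl0.
- by move=> x y /=; rewrite fr mulrDl; exact: idlD.
move=> _ e [c' _ <-] eL /=; rewrite exprMn -rmorphXn -mulrA; apply: spZ; apply: idl_mem => //.
by apply/allpairsPdep; exists e, t.
Qed.

(** Bernoulli's inequality gives (1 + 1/a)^s >= 1 + s/a, and s = a s0 makes this exceed s0. *)
Lemma exp_beats (a Q s0 : nat) : (a < Q)%N -> exists s, (a ^ s * s0 < Q ^ s)%N.
Proof.
move=> lt; have [a0|a0] := posnP a.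
  by exists 1%N; rewrite a0 !expn1 mul0n; lia.
have bern s : ((a + s) * a ^ s <= a * a.+1 ^ s)%N.
  elim: s => [|s IH]; first by rewrite !expn0 addn0.
  rewrite !expnS; move: IH; move: (a ^ s)%N (a.+1 ^ s)%N => u v; nia.
exists (a * s0)%N; apply: (@leq_trans (a.+1 ^ (a * s0))); last by case: (posnP (a * s0)) => [->|e0]; rewrite ?expn0 // leq_exp2r.
have : (0 < a ^ (a * s0))%N by rewrite expn_gt0 a0.
by move: (bern (a * s0)%N); move: (a ^ _)%N (a.+1 ^ _)%N => u v; nia.
Qed.

Lemma Sp_mon w fs D N a : (forall f, f \in fs -> Sp w D f) -> a \in idx (size fs) N ->
  Sp w (D * N * size fs) (mon fs a).
Proof.
elim: fs a => [|f fs IH] a form /=; first by move=> _; rewrite -(rmorph1 iota); exact: Sp_ct.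
move=> /allpairsPdep [i [b [hi hb ->]]]; rewrite mulnS; apply: SpM; last first.
  by apply: IH => // g gf; apply: form; rewrite inE gf orbT.
move: hi; rewrite mem_iota add0n /= => lt; apply: (@Sp_le _ (D * i)); first by rewrite leq_mul2l ltnW ?orbT.
by apply: SpX; apply: form; rewrite inE eqxx.
Qed.

(** The monomials in fs with exponents below q^s number q^(s size fs), while they lie in a space of
    dimension at most a constant times (size T)^s. *)
Lemma counting B T fs : is_subalg iota B -> fin_gen iota B -> (forall z, B z -> idl (Fr B) T z) ->
  (size T < q ^ size fs)%N -> (forall f, f \in fs -> B f) -> kdep fs.
Proof.
move=> hB fB hT sT form; have [w [sB gB]] := Sp_gen hB fB.
have [D hD] := frob_bound (proj1 hB) sB gB hT.
have [D1 hD1] := Sp_list gB form.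
pose C := (D1 * size fs)%N.
have [L0 [_ _ hL0]] := Sp_span w (C + 2 * D).
(* The summand 2 D reproduces itself: for n = C q^s + D, the step uses n + D = C q^s + 2 D and
   yields q n >= C q^(s+1) + 2 D, as q >= 2. *)
have grow s : exists L, (size L = size T ^ s * size L0)%N /\
    forall z, Sp w (C * q ^ s + 2 * D) z -> sp L z.
  elim: s => [|s [L [sL hL]]]; first by exists L0; rewrite expn0 muln1 mul1n.
  exists [seq e ^+ q * t | e <- L, t <- T]; rewrite size_allpairs sL; split; first by rewrite expnS; lia.
  move=> z hz; apply: (Sp_step (n := (C * q ^ s + D)%N) hD).
    by move=> y hy; apply: hL; apply: Sp_le hy; lia.
  by apply: Sp_le hz; rewrite expnS; move: (q ^ s)%N => u; nia.
have [s hs] := exp_beats (size L0) sT; have [L [sL hL]] := grow s.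
have [|a ha|c hc] := @sp_dep _ (idx (size fs) (q ^ s)) (mon fs) L (uniq_idx _ _).
- by rewrite size_idx sL -expnM (mulnC s) expnM.
- apply: hL; apply: Sp_le (Sp_mon hD1 ha); rewrite /C; lia.
by exists (q ^ s)%N, c.
Qed.

Lemma adj_clear A t z : is_subring A -> A t^-1 -> adj A t z -> exists N : nat, A (z * t^-1 ^+ N).
Proof.
move=> h ht [P hP ->]; have [->|t0] := eqVneq t 0.
  by exists 0%N; rewrite mulr1 horner_coef0; exact: hP.
exists (size P); rewrite horner_coef mulr_suml; apply: sr_sum => // i _.
rewrite (_ : t^-1 ^+ size P = t^-1 ^+ i * t^-1 ^+ (size P - i)); last by rewrite -exprD subnKC // ltnW.
by rewrite mulrA -(mulrA (P`_i)) -exprMn mulfV // expr1n mulr1; have := hP i => ?; sr.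
Qed.

(* K^q-dimension controls the transcendence degree: the filtration Sp of a
   finitely generated algebra satisfies Sp (q n) = sum_t Sp (n + D)^q t, so its
   dimension grows at most like n to the power log_q (size T). *)
Theorem frob_dep B0 L0 T fs : affine_model iota B0 -> (forall z, B0 z -> idl (Fr B0) L0 z) ->
  (forall z, idl (Fr setT) T z) -> (size T < q ^ size fs)%N -> kdep fs.
Proof.
move=> hB0 hL0 hT sT; have [[h hc] fg frac] := hB0.
have hKr : is_subring (@setT K) by [].
have hK : is_local (@setT K).
  split=> // x y _ _ [xy0 _ _]; have [x0|x0] := eqVneq x 0; last by left.
  by right; split=> //; move: xy0; rewrite x0 add0r.
have eK : @setT K = ctr B0 setT.
  rewrite eqEsubset; split=> // z _; have [a [b [ha hb b0 ->]]] := frac z.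
  by exists a, b.
have idl_lift (l : seq K) : exists l' : seq K, forall A, is_subring A -> (forall z, z \in l' -> A z) ->
    forall z, z \in l -> idl (Fr A) T z.
  elim: l => [|a l [l' IH]]; first by exists [::].
  have [la hla] : exists la : seq K, forall A, is_subring A -> (forall z, z \in la -> A z) -> idl (Fr A) T a.
    have := hT a; elim: (T) a => [|t T' IHT] a; first by exists [::].
    move=> [_ [v [[b _ <-] /IHT [la hla] ->]]]; exists (b :: la) => A hA hl.
    exists (b ^+ q), v; split=> //; first by exists b => //; apply: hl; rewrite inE eqxx.
    by apply: hla => // z zl; apply: hl; rewrite inE zl orbT.
  exists (la ++ l') => A hA hl z; rewrite inE => /orP[/eqP ->|zl].
    by apply: hla => // y yl; apply: hl; rewrite mem_cat yl.
  by apply: IH => // y yl; apply: hl; rewrite mem_cat yl orbT.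
have [l' hl'] := idl_lift L0.
(* After inverting u, the coefficients that express L0 through T are available, so T generates the
   ring over its own q-th powers, and fs lies in it. *)
have [u [Bu [u0 _ _] hu]] := @clear_den K B0 setT (l' ++ fs) h hK (fun _ _ => I) eK (fun _ _ => I).
have hB : affine_model iota (adj B0 u^-1) by apply: adj_affine.
have [hBa fB _] := hB; have hBr := proj1 hBa; have sub := adj_sub u^-1 h; have gen := adj_gen u^-1 h.
apply: (counting (B := adj B0 u^-1) (T := T)) => //; last by move=> f ff; apply: hu; rewrite mem_cat ff orbT.
move=> z hz; have := hz; rewrite -{1}(invrK u) => hz'.
have [|N] := adj_clear (t := u^-1) h _ hz; rewrite invrK // => hN.
have hb : B0 (z * u ^+ (N * q)).
  rewrite (_ : z * _ = (z * u ^+ N) * u ^+ (N * q.-1)); first by sr.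
  by rewrite -mulrA -exprD -{2}[N]muln1 -mulnDr add1n prednK.
rewrite (_ : z = (u^-1 ^+ N) ^+ q * (z * u ^+ (N * q))); last first.
  by rewrite mulrCA -exprM -exprMn mulVf // expr1n mulr1.
have hFr := Fr_ring hBr.
apply: idlM => //; first by exists (u^-1 ^+ N) => //; sr.
have : idl (Fr (adj B0 u^-1)) L0 (z * u ^+ (N * q)).
  apply: idl_sub (hL0 _ hb) => //; by move=> _ [a ha <-]; exists a => //; exact: sub.
apply: idl_ind; [exact: idl0|by move=> x y; exact: idlD|].
move=> a l ha lL; apply: idlM => //; apply: (hl' _ hBr) lL => y yl.
by apply: hu; rewrite mem_cat yl.
Qed.

End Frobenius.

End LinearSpans.

(** * The Nullstellensatz *)

Section Nullstellensatz.
Context (k : closedFieldType) (K : fieldType) (iota : {rmorphism k -> K}).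
Implicit Types (A B Q q : set K) (b z a : K) (P f g h u r : {poly K}) (c la : k) (psi : K -> k).

(** A homomorphism from A to k over k, encoded as a total function on K of which only the values on
    A matter. *)
Definition ratpoint A psi := [/\ forall c, psi (iota c) = c,
  forall a b, A a -> A b -> psi (a + b) = psi a + psi b
  & forall a b, A a -> A b -> psi (a * b) = psi a * psi b].
Definition pe psi la P := (\poly_(i < size P) psi P`_i).[la].
(** All primes q and all functions z outside q are included so that the property passes to A[b]: the
    step asks for a point of A at which leading coefficients do not vanish. *)
Definition has_ratpoint A := forall q z, is_prime_ideal A q -> A z -> ~ q z ->
  exists psi, [/\ ratpoint A psi, forall a, q a -> psi a = 0 & psi z != 0].

Section Points.
Variables (A : set K) (psi : K -> k).
Hypotheses (hA : is_subalg iota A) (hpsi : ratpoint A psi).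
Let h : is_subring A := proj1 hA.

Lemma kpt0 : psi 0 = 0.
Proof. by have [hc _ _] := hpsi; rewrite -(rmorph0 iota) hc. Qed.
Lemma coef_ratpoint P i : (\poly_(i < size P) psi P`_i)`_i = psi P`_i.
Proof. by rewrite coef_poly; case: ltnP => // le; rewrite nth_default // kpt0. Qed.
Lemma peD la P g : pin A P -> pin A g -> pe psi la (P + g) = pe psi la P + pe psi la g.
Proof.
have [hc hD hM] := hpsi; move=> hP hg; rewrite -hornerD; congr _.[la]; apply/polyP => i.
by rewrite coefD !coef_ratpoint coefD hD.
Qed.
Lemma peM la P g : pin A P -> pin A g -> pe psi la (P * g) = pe psi la P * pe psi la g.
Proof.
have [hc hD hM] := hpsi; move=> hP hg; rewrite -hornerM; congr _.[la]; apply/polyP => i.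
rewrite coefM coef_ratpoint coefM.
have psum n (F : 'I_n -> K) : (forall j, A (F j)) -> psi (\sum_(j < n) F j) = \sum_(j < n) psi (F j).
  move=> hF; pose S x y := A x /\ psi x = y.
  suff [] : S (\sum_(j < n) F j) (\sum_(j < n) psi (F j)) by [].
  apply: (big_rec2 S); first by split; [sr|exact: kpt0].
  by move=> j y1 y2 _ [h1 <-]; split; [have := hF j => ?; sr|rewrite hD].
rewrite psum; last by move=> j; have := hP j; have := hg (i - j)%N => ? ?; sr.
by apply: eq_bigr => j _; rewrite !coef_ratpoint hM.
Qed.
Lemma peC la a : pe psi la a%:P = psi a.
Proof.
rewrite /pe (_ : \poly_(i < _) _ = (psi a)%:P) ?hornerC //.
by apply/polyP => i; rewrite coef_ratpoint !coefC; case: eqP; rewrite ?kpt0.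
Qed.
Lemma pe_in la P q : (forall a, q a -> psi a = 0) -> (forall i, q P`_i) -> pe psi la P = 0.
Proof.
move=> hq hP; rewrite /pe (_ : \poly_(i < _) _ = 0) ?horner0 //.
by apply/polyP => i; rewrite coef_ratpoint coef0 hq.
Qed.

(** The value at P.[b] is read off a chosen polynomial; by [hext] the choice has no influence. *)
Lemma ratpoint_extend b Q la : is_ideal (adj A b) Q ->
  (forall P, pin A P -> Q P.[b] -> pe psi la P = 0) ->
  exists psi', [/\ ratpoint (adj A b) psi', forall z, Q z -> psi' z = 0
    & forall P, pin A P -> psi' P.[b] = pe psi la P].
Proof.
move=> hQ hext.
have hrep z : exists P, adj A b z -> pin A P /\ z = P.[b].
  by have [[P hP ->]|no] := EM (adj A b z); [exists P|exists 0].
have [rep hrep'] := choice hrep.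
have key P : pin A P -> pe psi la (rep P.[b]) = pe psi la P.
  move=> hP; have [h1 e] := hrep' P.[b] (ex_intro2 _ _ P hP erefl).
  apply/eqP; rewrite -subr_eq0.
  have -> : pe psi la (rep P.[b]) - pe psi la P = pe psi la (rep P.[b] + (- 1)%:P * P).
    have [hc _ _] := hpsi; have p1 : pin A (-1)%:P by apply: pinC => //; sr.
    rewrite peD ?peM ?peC //; last exact: pinM.
    by rewrite -(rmorph1 iota) -rmorphN hc mulN1r.
  apply/eqP/hext; last by rewrite hornerD hornerM hornerC -e mulN1r subrr; exact: ideal0 hQ.
  by apply: pinD => //; apply: pinM => //; apply: pinC => //; sr.
exists (fun z => pe psi la (rep z)); split; last exact: key.
- split.
  + move=> c; rewrite -(hornerC (iota c) b) key ?peC; first by have [] := hpsi.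
    by apply: pinC => //; exact: (proj2 hA).
  + move=> _ _ [P hP ->] [g hg ->]; rewrite -hornerD !key ?peD //; exact: pinD.
  + move=> _ _ [P hP ->] [g hg ->]; rewrite -hornerM !key ?peM //; exact: pinM.
- move=> z Qz; have [P hP e] := ideal_sub hQ Qz.
  by rewrite e key // hext // -e.
Qed.

End Points.

Lemma pseudo_div A P f : is_subring A -> pin A P -> pin A f -> f != 0 ->
  exists m u, pin A u /\ (size (lead_coef f ^+ m *: P - u * f)%R < size f)%N.
Proof.
move=> h hP form f0; have [n] := ubnP (size P); elim: n P hP => // n IH P hP sP.
have [lt|le] := ltnP (size P) (size f).
  by exists 0%N, 0; rewrite scale1r mul0r subr0; split=> // i; rewrite coef0; sr.
pose d := (size P - size f)%N; pose w := lead_coef P *: 'X^d.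
have sf : (0 < size f)%N by rewrite size_poly_gt0.
have hw : pin A w by apply: pinZ => //; [exact: hP|exact: pinXn].
have [||m [u [hu su]]] := IH (lead_coef f *: P - w * f).
- apply: pinD => //; first by apply: pinZ => //; exact: form.
  by apply: pinN => //; exact: pinM.
- apply: leq_trans (_ : size P <= n)%N; last by rewrite -ltnS.
  have sPp : size P = (size P).-1.+1 by rewrite prednK // (leq_trans sf).
  rewrite sPp ltnS; apply/leq_sizeP => j lj; rewrite coefB coefZ /w -scalerAl coefZ mulrC coefXnM.
  rewrite ltnNge (_ : d <= j)%N /=; last by rewrite /d; lia.
  move: lj; rewrite leq_eqVlt => /orP[/eqP <-|lt].
    by rewrite (_ : _ - d = (size f).-1)%N -?lead_coefE ?subrr // /d; lia.
  have lt' : (size P <= j)%N by rewrite sPp.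
  rewrite !nth_default; rewrite ?mulr0 ?mul0r ?subrr // /d.
  by move: le lt'; clear; move: (size P) (size f) => a1 a2; lia.
exists m.+1, (u + lead_coef f ^+ m *: w); split.
  by apply: pinD => //; apply: pinZ => //; apply: srX => //; exact: form.
rewrite (_ : _ - _ = lead_coef f ^+ m *: (lead_coef f *: P - w * f) - u * f) //.
by rewrite exprSr -!mul_polyC !rmorphM /=; ring.
Qed.

(** Polynomials over A / q are represented by polynomials over A whose leading coefficient lies
    outside q. *)
Lemma truncate A q r : is_subring A -> is_ideal A q -> pin A r ->
  exists r', [/\ pin A r', (size r' <= size r)%N, forall i, q (r - r')`_i &
    r' = 0 \/ ~ q (lead_coef r')].
Proof.
move=> h hq; have [n] := ubnP (size r); elim: n r => // n IH r sr_ hr.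
have [r0|r0] := eqVneq r 0.
  exists 0; rewrite size_poly0 r0; split=> //; try by left.
    by move=> i; rewrite coef0; sr.
  by move=> i; rewrite subrr coef0; exact: ideal0 hq.
have [ql|nq] := EM (q (lead_coef r)); last first.
  by exists r; split=> //; [move=> i; rewrite subrr coef0; exact: ideal0 hq|right].
pose w := lead_coef r *: 'X^((size r).-1).
have sw : (size (r - w)%R < size r)%N.
  rewrite -[X in (_ < X)%N]prednK ?size_poly_gt0 // ltnS; apply/leq_sizeP => j lj.
  rewrite coefB coefZ coefXn; move: lj; rewrite leq_eqVlt => /orP[/eqP <-|lt].
    by rewrite eqxx mulr1 -lead_coefE subrr.
  rewrite nth_default ?gtn_eqF ?mulr0 ?subrr //.
  by rewrite -(prednK (_ : 0 < size r)%N) // size_poly_gt0.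
have [||r' [p1 p2 p3 p4]] := IH (r - w).
- exact: leq_trans sw _.
- by apply: pinD => //; apply: pinN => //; apply: pinZ => //; [exact: hr|exact: pinXn].
exists r'; split=> //; first exact: leq_trans p2 (ltnW sw).
move=> i; rewrite (_ : r - r' = (r - w - r') + w); last by rewrite addrAC subrK.
rewrite coefD; apply: (idealD hq) => //; rewrite coefZ coefXn.
by case: (i == _); rewrite /= ?mulr1 ?mulr0 //; exact: (ideal0 hq).
Qed.

Lemma adj_in A b Q P : is_subring A -> is_ideal (adj A b) Q -> (forall i, Q P`_i) -> Q P.[b].
Proof.
move=> h hQ hP; rewrite horner_coef; apply: big_ind; [exact: ideal0 hQ|by move=> x y; exact: (idealD hQ)|move=> i _].
rewrite mulrC; apply: (idealM hQ) => //; apply: srX; [exact: adj_subring|exact: adj_gen].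
Qed.

(* If b is algebraic modulo Q, its equation f has a root at every point of A where
   the leading coefficient does not vanish, and a multiple of z lies in A
   modulo Q. *)
Lemma has_ratpoint_adj A b : is_subalg iota A -> has_ratpoint A -> has_ratpoint (adj A b).
Proof.
move=> hA kA Q z hQ hz nz; have [h hc] := hA; have [Qi Q1 Qp] := hQ.
have h' := adj_subring b h; have sub := adj_sub b h.
pose q := [set a | A a /\ Q a].
have hq : is_prime_ideal A q.
  split; [split| |].
  - by move=> a [].
  - by split; [sr|exact: ideal0 Qi].
  - by move=> x y [? ?] [? ?]; split; [sr|exact: (idealD Qi)].
  - by move=> x y hx [? ?]; split; [sr|apply: (idealM Qi) => //; exact: sub].
  - by move=> [_ /Q1].
  - by move=> x y hx hy [_ /(Qp _ _ (sub _ hx) (sub _ hy)) []]; [left|right].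
have hqi := prime_ideal_of hq.
have [g hg ez] := hz.
have evA P : pin A P -> adj A b P.[b] by move=> hP; exists P.
(* b is transcendental modulo Q in the first case: any la at which the image of g does not vanish
   gives a point. *)
have [strictfam|ntr] := EM (forall P, pin A P -> Q P.[b] -> forall i, Q P`_i).
  have [i gi] : exists i, ~ Q g`_i.
    apply: contrapT => no; apply: nz; rewrite ez; apply: (adj_in h Qi) => i.
    by apply: contrapT => ni; apply: no; exists i.
  have [||psi [hpsi psiq psi0]] := kA q g`_i hq; [exact: hg|by case|].
  have g0 : \poly_(j < size g) psi g`_j != 0.
    apply/eqP => /polyP/(_ i); rewrite (coef_ratpoint hpsi) coef0 => e.
    by rewrite e eqxx in psi0.
  have /closed_nonrootP [la nr] := g0.
  have [|psi' [k1 k2 k3]] := ratpoint_extend hA hpsi Qi (la := la).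
    by move=> P hP QP; apply: (pe_in hpsi la psiq) => j; split; [exact: hP|exact: strictfam].
  by exists psi'; split=> //; rewrite ez k3.
pose proper P := pin A P /\ ~ q (lead_coef P).
have trunc r : pin A r -> exists r', [/\ proper r' \/ r' = 0, (size r' <= size r)%N,
    forall i, q (r - r')`_i & Q (r.[b] - r'.[b])].
  move=> hr; have [r' [p1 p2 p3 p4]] := truncate h hqi hr; exists r'; split=> //.
    by case: p4 => [->|nq]; [right|left].
  by rewrite -hornerN -hornerD; apply: (adj_in h Qi) => i; have [] := p3 i.
have propN0 P : proper P -> P != 0.
  move=> [_ nq]; apply/eqP => P0; apply: nq; rewrite P0 lead_coef0; exact: ideal0 hqi.
have QB x y : Q x -> Q (x - y) -> Q y.
  by move=> hx hxy; rewrite -(subKr x y); apply: (idealB h' Qi).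
have hmin (S : set {poly K}) : S !=set0 -> exists2 f, S f & forall g, S g -> (size f <= size g)%N.
  move=> [P SP]; have [|n [f Sf <-] mn] := @nat_min (fun n => exists2 f, S f & size f = n).
    by exists (size P), P.
  by exists f => // g' Sg; apply: mn; exists g'.
have [|f [pf Qf] minf] := hmin [set P | proper P /\ Q P.[b]].
  apply: contrapT => no; apply: ntr => P hP QP i; apply: contrapT => nPi.
  have [r' [[pr|r0] _ p3 p4]] := trunc P hP.
    by apply: no; exists r'; split=> //; exact: QB p4.
  by apply: nPi; have [_] := p3 i; rewrite r0 subr0.
have [form nlf] := pf; have f0 := propN0 _ pf.
(* J is the ideal generated by Q and z. In it an element hh of least degree in b is sought, with
   leading coefficient outside q. *)
pose J := [set x | exists2 v, adj A b v & Q (x - z * v)].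
have JD x y : J x -> J (x + y) <-> J y.
  move=> [v hv e]; split=> -[w hw e'].
    exists (w - v); first by sr.
    by rewrite (_ : _ - _ = (x + y - z * w) - (x - z * v)); [exact: (idealB h' Qi)|ring].
  exists (v + w); first by sr.
  by rewrite (_ : _ - _ = (x - z * v) + (y - z * w)); [exact: (idealD Qi)|ring].
have JM x y : adj A b x -> J y -> J (x * y).
  move=> hx [v hv e]; exists (x * v); first by sr.
  by rewrite (_ : _ - _ = x * (y - z * v)); [exact: (idealM Qi)|ring].
have JQ x : Q x -> J x by move=> hx; exists 0; [sr|rewrite mulr0 subr0].
have Jz : J z by exists 1; [sr|rewrite mulr1 subrr; exact: ideal0 Qi].
have JB x y : J x -> Q (x - y) -> J y.
  move=> hx hxy; have [v hv e] := hx; exists v => //.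
  by rewrite (_ : y - _ = (x - z * v) - (x - y)); [exact: (idealB h' Qi)|ring].
have [|hh [ph Jh] minh] := hmin [set P | proper P /\ J P.[b]].
  have [r' [[pr|r0] _ p3 p4]] := trunc g hg.
    by exists r'; split=> //; apply: JB p4; rewrite -ez.
  by case: nz; move: p4; rewrite r0 horner0 subr0 -ez.
have [hhp nlh] := ph; have h0 := propN0 _ ph.
have primeX x m : A x -> ~ q x -> ~ q (x ^+ m).
  move=> hx nx; elim: m => [|m IH]; first by rewrite expr0; have [_ ? _] := hq.
  rewrite exprS; apply: (primeM hq hx _ nx IH); sr.
have lfA := form (size f).-1; have lhA := hhp (size hh).-1.
rewrite -lead_coefE in lfA; rewrite -lead_coefE in lhA.
(* If hh had positive degree and were not in Q, then f would be a multiple of hh modulo q, with a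
   cofactor in Q of smaller degree than f. If hh lies in Q, dividing g by f contradicts the
   minimality of hh or z outside Q. *)
have sh : size hh = 1%N.
  apply: contrapT => sh1; have sh2 : (1 < size hh)%N.
    by rewrite ltn_neqAle eq_sym size_poly_gt0 h0 andbT; apply/eqP.
  have [Qh|nQh] := EM (Q hh.[b]).
    have le := minf hh (conj ph Qh).
    have [m [u [hu su]]] := pseudo_div h hg form f0.
    set r := _ - _ in su; have hr : pin A r.
      apply: pinD => //; first by apply: pinZ => //; exact: srX.
      by apply: pinN => //; exact: pinM.
    have er : r.[b] = lead_coef f ^+ m * z - u.[b] * f.[b].
      by rewrite hornerD hornerN hornerZ hornerM -ez.
    have Qt : Q (u.[b] * f.[b]) by apply: (idealM Qi) => //; exact: evA.
    have Alf : adj A b (lead_coef f ^+ m) by apply: sub; exact: srX.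
    have [r' [[pr|r0] sr' p3 p4]] := trunc r hr.
      have := minh r'; rewrite leqNgt (leq_ltn_trans sr') ?(leq_trans su) // => H.
      have : false by apply: H; split=> //; apply: JB p4; rewrite er; apply/JD;
        [exact: JM|apply: JQ; rewrite -mulN1r; apply: (idealM Qi) => //; sr].
      by [].
    have : Q (lead_coef f ^+ m * z).
      move: p4; rewrite r0 horner0 subr0 er => Qr; rewrite -(subrK (u.[b] * f.[b]) (_ * z)).
      exact: (idealD Qi).
    move/(Qp _ _ Alf hz) => [Qa|//]; apply: (primeX _ m lfA nlf); split=> //; exact: srX.
  have [m [u [hu su]]] := pseudo_div h form hhp h0.
  set r := _ - _ in su; have hr : pin A r.
    apply: pinD => //; first by apply: pinZ => //; exact: srX.
    by apply: pinN => //; exact: pinM.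
  have er : r.[b] = lead_coef hh ^+ m * f.[b] - u.[b] * hh.[b].
    by rewrite hornerD hornerN hornerZ hornerM.
  have Alh : adj A b (lead_coef hh ^+ m) by apply: sub; exact: srX.
  have Qf' : Q (lead_coef hh ^+ m * f.[b]) by exact: (idealM Qi).
  have [r' [pr sr' p3 p4]] := trunc r hr; have r0 : r' = 0.
    case: pr => // pr; have := minh r'; rewrite leqNgt (leq_ltn_trans sr') // => H.
    have : false by apply: H; split=> //; apply: JB p4; rewrite er; apply/JD;
      [exact: JQ|rewrite -mulNr; apply: JM => //; have := evA _ hu => ?; sr].
    by [].
  have qr i : q r`_i by have := p3 i; rewrite r0 subr0.
  have Qu : Q u.[b].
    have : Q (u.[b] * hh.[b]).
      rewrite -(subKr (lead_coef hh ^+ m * f.[b]) (_ * _)) -er; apply: (idealB h' Qi) => //.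
      by move: p4; rewrite r0 horner0 subr0.
    by move/(Qp _ _ (evA _ hu) (evA _ hhp)) => [].
  have ehf : lead_coef hh ^+ m *: f = u * hh + r by rewrite /r addrC subrK.
  have lmf : ~ q (lead_coef hh ^+ m * lead_coef f).
    by apply: primeM hq _ lfA (primeX _ m lhA nlh) nlf; exact: srX.
  have [u' [[pu|u0] su' p3' p4']] := trunc u hu.
    have := minf u' (conj pu (QB _ _ Qu p4')); rewrite leqNgt => /negP; apply.
    apply: leq_ltn_trans su' _; have [u00|u00] := eqVneq u 0; first by rewrite u00 size_poly0 size_poly_gt0.
    have : (size (u * hh)%R <= maxn (size f) (size hh).-1)%N.
      rewrite (_ : u * hh = lead_coef hh ^+ m *: f - r); last by rewrite ehf addrK.
      apply: leq_trans (size_polyD _ _) _; rewrite size_polyN geq_max !leq_max.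
      have -> : (size r <= (size hh).-1)%N by rewrite -ltnS prednK // size_poly_gt0.
      by rewrite size_scale_leq orbT.
    rewrite size_mul //; have := size_poly_gt0 u; rewrite u00.
    move: (size u) (size f) (size hh) sh2 => a1 a2 a3; lia.
  case: lmf; rewrite [lead_coef f]lead_coefE -coefZ ehf coefD; apply: (idealD hqi) => //.
  rewrite coefM; apply: big_ind; [exact: ideal0 hqi|by move=> x y; exact: (idealD hqi)|move=> j _]; rewrite mulrC; apply: (idealM hqi) => //.
  by have := p3' j; rewrite u0 subr0.
have eh : hh = (lead_coef hh)%:P by rewrite lead_coefE sh; apply: size1_polyC; rewrite sh.
have Jl : J (lead_coef hh) by move: Jh; rewrite {1}eh hornerC.
have [v hv Qv] := Jl.
have [||psi [hpsi psiq]] := kA q (lead_coef hh * lead_coef f) hq; [by sr|exact: primeM hq _ _ _ _|].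
have [psc psD psM] := hpsi; rewrite psM // mulf_eq0 negb_or => /andP[psh psf].
have sf : size (\poly_(i < size f) psi f`_i) = size f.
  apply/eqP; rewrite eqn_leq size_poly -[X in (X <= _)%N]prednK ?size_poly_gt0 //.
  by rewrite ltnNge; apply/negP => /leq_sizeP/(_ _ (leqnn _)); rewrite (coef_ratpoint hpsi) -lead_coefE => e; rewrite e eqxx in psf.
have /closed_rootP [la /rootP rla] : size (\poly_(i < size f) psi f`_i) != 1%N.
  rewrite sf; apply/eqP => s1; apply: nlf; split=> //.
  by move: Qf; rewrite (size1_polyC (_ : size f <= 1)%N) ?s1 // hornerC lead_coefC.
(* Up to a power of the leading coefficient of f, which psi does not kill, every relation of b is a
   multiple of f modulo q; so its image vanishes at la. *)
have [P hP QP|psi' [k1 k2 k3]] := ratpoint_extend hA hpsi Qi (la := la).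
  have [m [u [hu su]]] := pseudo_div h hP form f0.
  set r := _ - _ in su; have hr : pin A r.
    apply: pinD => //; first by apply: pinZ => //; exact: srX.
    by apply: pinN => //; exact: pinM.
  have Qr : Q r.[b].
    rewrite hornerD hornerN hornerZ hornerM; apply: (idealB h' Qi); apply: (idealM Qi) => //.
      by apply: sub; exact: srX.
    exact: evA.
  have [r' [pr sr' p3 p4]] := trunc r hr; have r0 : r' = 0.
    case: pr => // pr; have := minf r'; rewrite leqNgt (leq_ltn_trans sr') // => H.
    have : false by apply: H; split=> //; exact: QB p4.
    by [].
  have e : pe psi la ((lead_coef f ^+ m)%:P * P) = pe psi la (u * f + r).
    by congr pe; rewrite mul_polyC /r addrC subrK.
  have lm : A (lead_coef f ^+ m) by exact: srX.
  have pm : psi (lead_coef f ^+ m) != 0.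
    elim: m {su r hr Qr sr' p3 p4 e lm} => [|m IH].
      by rewrite expr0 -(rmorph1 iota) psc oner_eq0.
    by rewrite exprS psM ?mulf_neq0 //; exact: srX.
  move: e; rewrite (peM hA hpsi) //; last by apply: pinC.
  rewrite (peC hpsi) (peD hpsi) //; last by exact: pinM.
  rewrite (peM hA hpsi) // [pe psi la f]rla mulr0 add0r [pe psi la r](pe_in hpsi la psiq); last first.
    by move=> i; have := p3 i; rewrite r0 subr0.
  by move/eqP; rewrite mulf_eq0 (negbTE pm) => /eqP.
exists psi'; split=> //; have [c1 c2 c3] := k1.
apply: contraNneq psh => e; have := k3 (lead_coef hh)%:P (pinC h lhA); rewrite hornerC (peC hpsi) => <-.
rewrite -(subrK (z * v) (lead_coef hh)) c2 //; last 2 first.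
- exact: ideal_sub Qi Qv.
- by sr.
by rewrite (k2 _ Qv) add0r c3 // e mul0r.
Qed.

Theorem nullstellensatz B : is_subalg iota B -> fin_gen iota B -> has_ratpoint B.
Proof.
move=> _; apply: (fin_gen_ind (Pr := has_ratpoint)); last exact: has_ratpoint_adj.
move=> q z hq [c _ ez] nz.
have qi := prime_ideal_of hq.
have inj : injective iota := fmorph_inj iota.
have hpsi a : exists d, range iota a -> a = iota d.
  by have [[d _ <-]|no] := EM (range iota a); [exists d|exists 0].
have [psi hp] := choice hpsi.
have pc d : psi (iota d) = d by apply: inj; rewrite -(hp (iota d)) //; exists d.
exists psi; split.
- by split=> // _ _ [a _ <-] [b _ <-]; rewrite ?pc -?rmorphD -?rmorphM pc.
- move=> a qa; have [d _ ed] := ideal_sub qi qa; rewrite -ed pc; apply/eqP; case: eqVneq => // d0.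
  have [_ q1 _] := hq; case: q1; rewrite -(rmorph1 iota) -(mulVf d0) rmorphM ed.
  by apply: (idealM qi) => //; exists d^-1.
- rewrite -ez pc; apply: contra_notN nz => /eqP c0; rewrite -ez c0 rmorph0; exact: ideal0 qi.
Qed.

(** The kernel of a rational point on the zero set of q is a prime containing q, hence q itself. *)
Lemma closed_residue B q : affine_model iota B -> is_prime_ideal B q ->
  (forall q', is_prime_ideal B q' -> q `<=` q' -> q' `<=` q) ->
  forall a, B a -> exists c, q (a - iota c).
Proof.
move=> [hB fg _] hq qmax f form; have [h hc] := hB; have [qi q1 qp] := hq.
have [||psi [hpsi psiq _]] := nullstellensatz hB fg hq (z := 1); [by sr|by []|].
have [pc pD pM] := hpsi.
pose q' := [set a | B a /\ psi a = 0].
have hq' : is_prime_ideal B q'.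
  split; [split| |].
  - by move=> a [].
  - by split; [sr|rewrite -(rmorph0 iota) pc].
  - by move=> x y [? ex] [? ey]; split; [sr|rewrite pD // ex ey addr0].
  - by move=> x y hx [? ey]; split; [sr|rewrite pM // ey mulr0].
  - by move=> [_ /eqP]; rewrite -(rmorph1 iota) pc oner_eq0.
  - by move=> x y hx hy [_ /eqP]; rewrite pM // mulf_eq0 => /orP[]/eqP; [left|right].
exists (psi f); apply: (qmax q' hq'); first by move=> a qa; split; [exact: ideal_sub qi qa|exact: psiq].
have hn : B (- iota (psi f)) by have := hc (psi f) => ?; sr.
split; first by have := hc (psi f) => ?; sr.
by rewrite pD // -rmorphN pc subrr.
Qed.

End Nullstellensatz.

(** * Smooth points in positive characteristic *)

Section ChainsAndFrobenius.
Context (k : closedFieldType) (K : fieldType) (iota : {rmorphism k -> K}).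
Implicit Types (A B O : set K) (x y z t f g h w : K) (L T fs : seq K) (la : k).

Lemma msum_mem B fs N (c : seq nat -> k) : is_subalg iota B -> (forall f, f \in fs -> B f) ->
  B (msum iota fs N c).
Proof.
move=> [hB hc] form; apply: sr_sum => // a _; apply: srM => //.
elim: fs a form => [|f fs IH] [|i a] form /=; try sr.
  by apply: form; rewrite inE eqxx.
by apply: IH => // g gf; apply: form; rewrite inE gf orbT.
Qed.

Lemma msum_lowest f fs N (c : seq nat -> k) j B : is_subalg iota B ->
  (forall g, g \in f :: fs -> B g) -> (j < N)%N ->
  (forall i a, (i < j)%N -> a \in idx (size fs) N -> c (i :: a) = 0) ->
  exists2 w, B w & msum iota (f :: fs) N c = f ^+ j * (msum iota fs N (fun a => c (j :: a)) + f * w).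
Proof.
move=> hB form jN hlow; have hBr := proj1 hB.
have Bf : B f by apply: form; rewrite inE eqxx.
have hfs g : g \in fs -> B g by move=> gf; apply: form; rewrite inE gf orbT.
pose v i := msum iota fs N (fun a => c (i :: a)).
have hv i : B (v i) by exact: msum_mem.
exists (\sum_(j.+1 <= i < N) f ^+ (i - j.+1) * v i).
  by apply: sr_sum => // i _; have := hv i => ?; sr.
have -> : msum iota (f :: fs) N c = \sum_(0 <= i < N) f ^+ i * v i by rewrite msum_cons big_mkord.
rewrite -/(v j); 
rewrite (big_cat_nat (n := j) (leq0n j) (ltnW jN)) .
rewrite [X in X + _ = _]big_nat [X in X + _ = _]big1 ?add0r; last first.
  move=> i /andP[_ lt]; rewrite /v /msum big1_seq ?mulr0 // => a ha.
  by rewrite hlow ?rmorph0 ?mul0r.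
rewrite big_ltn // mulrDr; congr (_ + _); rewrite mulrA -exprSr mulr_sumr.
apply: eq_big_nat => i /andP[le _]; by rewrite mulrA -exprD subnKC.
Qed.

(* A relation between elements of the successive differences of a chain of
   primes is killed by looking at its lowest coefficient. *)
Lemma chain_indep B d c : is_subalg iota B -> krull_chain B d c -> exists fs, size fs = d /\ ~ kdep iota fs.
Proof.
move=> hB hch; have [h hc] := hB.
suff [fs [sf _ hfs]] : exists fs, [/\ size fs = d, forall f, f \in fs -> B f &
    forall N (co : seq nat -> k), c 0%N (msum iota fs N co) -> forall a, a \in idx d N -> co a = 0].
  exists fs; split=> // -[N [co [[a ha nz] e]]]; move: nz.
  rewrite (hfs N co) ?eqxx -?sf // e; apply: ideal0; apply: prime_ideal_of.
  exact: (proj1 hch).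
elim: d c hch => [|d IH] c [cp cs].
  exists [::]; split=> // N co; rewrite /msum big_seq1 mulr1 => hco a; rewrite inE => /eqP ->.
  have [ci c1 _] := cp 0%N isT; apply/eqP; case: eqVneq => // nz; case: c1.
  rewrite -(rmorph1 iota) -(mulVf nz) rmorphM; exact: (idealM ci).
have [|fs [sf Bf hfs]] := IH (fun i => c i.+1).
  by split=> i; [exact: (cp i.+1)|exact: (cs i.+1)].
have [sub /existsNP [f /not_implyP [f1 f0]]] := cs 0%N isT.
have form : B f by apply: ideal_sub f1; apply: prime_ideal_of; exact: (cp 1%N).
have hff g : g \in f :: fs -> B g by rewrite inE => /orP[/eqP ->|/Bf].
exists (f :: fs); rewrite /= sf; split=> // N co hco.
have h0 := cp 0%N isT; have h1 := cp 1%N isT; have [c0i c01 c0p] := h0; have [c1i _ _] := h1.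
suff H : forall j i a, (i < j)%N -> (i < N)%N -> a \in idx d N -> co (i :: a) = 0.
  move=> _ /allpairsPdep [i [a [hi ha ->]]]; apply: (H i.+1) => //.
  by move: hi; rewrite mem_iota.
elim=> // j IHj i a; rewrite ltnS leq_eqVlt => /orP[/eqP -> jN|lt]; last exact: IHj.
move: a; apply: hfs.
have [|w Bw e] := @msum_lowest f fs N co j B hB hff jN.
  by move=> i' a lt; rewrite sf; apply: IHj => //; exact: ltn_trans lt jN.
have Bv : B (msum iota fs N (fun a => co (j :: a))) by exact: msum_mem.
have nf n : ~ c 0%N (f ^+ n).
  elim: n => [|n IHn]; first by rewrite expr0.
  rewrite exprS; apply: (primeM h0) => //; exact: srX.
move: hco; rewrite e => /c0p [||/nf//|/sub H]; [exact: srX|by sr|].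
rewrite -(addrK (f * w) (msum _ _ _ _)); apply: (idealB h c1i) => //.
by rewrite mulrC; apply: (idealM c1i).
Qed.

Lemma no_chain B d : is_subalg iota B -> (forall fs, size fs = d -> kdep iota fs) ->
  ~ exists c, krull_chain B d c.
Proof. by move=> hB hd [c /(chain_indep hB) [fs [/hd]]]. Qed.

Variable q : nat.
Hypotheses (q1 : (1 < q)%N) (fr : forall a b : K, (a + b) ^+ q = a ^+ q + b ^+ q).
Let q0 : (0 < q)%N := ltnW q1.

Definition frob_finite A := exists L, (forall l, l \in L -> A l) /\ forall z, A z -> idl (Fr q A) L z.

Lemma frob_finite_adj A t : is_subalg iota A -> frob_finite A -> frob_finite (adj A t).
Proof.
move=> [h _] [L [AL hL]]; have h' := adj_subring t h; have sub := adj_sub t h; have gen := adj_gen t h.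
have hF := Fr_ring fr h'.
exists [seq l * t ^+ j | l <- L, j <- seq.iota 0 q]; split.
  by move=> _ /allpairsPdep [l [j [/AL/sub hl _ ->]]]; sr.
set LL := [seq _ | l <- L, j <- _].
move=> _ [P hP ->]; rewrite horner_coef; apply: big_ind; [exact: idl0|by move=> x y; exact: idlD|move=> i _].
have := hL _ (hP i); move: (P`_i) => v.
apply: (idl_ind (S := [set v | idl (Fr q (adj A t)) LL (v * t ^+ i)])).
- by rewrite /= mul0r; exact: idl0.
- by move=> x y /=; rewrite mulrDl; exact: idlD.
move=> _ l [b hb <-] lL /=.
rewrite (_ : _ * _ = (b * t ^+ (i %/ q)) ^+ q * (l * t ^+ (i %% q))); last first.
  by rewrite {1}(divn_eq i q) exprD exprM exprMn; ring.
apply: idlM => //; first by exists (b * t ^+ (i %/ q)) => //; have := sub _ hb => ?; sr.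
by apply: idl_mem => //; apply/allpairsPdep; exists l, (i %% q)%N; rewrite mem_iota /= ltn_mod.
Qed.

Lemma frob_finite_gen B : fin_gen iota B -> frob_finite B.
Proof.
apply: fin_gen_ind; last exact: frob_finite_adj.
exists [:: 1]; split; first by move=> l; rewrite inE => /eqP ->; exists 1; rewrite ?rmorph1.
move=> _ [c _ <-]; have [c' e] := ct_root iota q1 c.
exists (iota c), 0; split=> //; last by rewrite mulr1 addr0.
by exists (iota c') => //; exists c'.
Qed.

Lemma frob_div A z : is_subring A -> (exists a b, [/\ A a, A b, b != 0 & z = a / b]) ->
  exists a b, [/\ A a, A b, b != 0 & z = b^-1 ^+ q * a].
Proof.
move=> h [a [b [ha hb b0 ->]]]; exists (a * b ^+ q.-1), b; split=> //; first by sr.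
rewrite -{1}(prednK q0) exprS exprVn; have bq : b ^+ q.-1 != 0 by rewrite expf_neq0.
fd.
Qed.

Lemma frob_finite_loc B p : is_subring B -> is_prime_ideal B p -> frob_finite B ->
  frob_finite (localize B p B).
Proof.
move=> h hp [L [BL hL]]; have sub := localize_sub h hp; have h' := localize_subring h hp.
have hF := Fr_ring fr h'.
exists L; split; first by move=> l /BL /sub.
move=> _ [a [s [ha hs ps ->]]]; have s0 := prime_neq0 hp ps.
have [_ _ us] : unit_of (localize B p B) s by apply/localize_unit.
rewrite (_ : a / s = s^-1 ^+ q * (a * s ^+ q.-1)); last first.
  rewrite -{1}(prednK q0) exprS exprVn; have bq : s ^+ q.-1 != 0 by rewrite expf_neq0.
  fd.
apply: idlM => //; first by exists s^-1.
apply: (idl_sub (A := Fr q B) hF) (hL _ _) => //; last by sr.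
by move=> _ [b hb <-]; exists b => //; exact: sub.
Qed.

(* Nakayama, with the superfluous generators eliminated one at a time. *)
Lemma frob_nakayama O T w1 w2 : is_local O -> max_ideal O w1 -> max_ideal O w2 ->
  frob_finite O -> (forall f, O f -> exists s g h, [/\ idl (Fr q O) T s, O g, O h &
    f = s + w1 ^+ q * g + w2 ^+ q * h]) ->
  forall f, O f -> idl (Fr q O) T f.
Proof.
move=> hl m1 m2 [L [OL hL]] hT; have h := proj1 hl; have hF := Fr_ring fr h.
have [hw1 hw2] := (max_sub m1, max_sub m2).
have {hL} : forall f, O f -> idl (Fr q O) (L ++ T) f.
  by move=> f /hL; apply: idl_sub => // l lL; rewrite mem_cat lL.
elim: L OL => // a L IH OL hL; apply: IH; first by move=> l lL; apply: OL; rewrite inE lL orbT.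
have Oa : O a by apply: OL; rewrite inE eqxx.
have ha : idl (Fr q O) (L ++ T) a.
  have [s [g [g' [hs hg hg' e]]]] := hT a Oa.
  have [_ [u [[c hc <-] hu eg]]] := hL g hg; have [_ [u' [[c' hc' <-] hu' eg']]] := hL g' hg'.
  have mz : max_ideal O (- (w1 * c + w2 * c')).
    by apply: max_idealN => //; apply: max_idealD => //; rewrite mulrC; apply: max_idealM.
  have [z0 Oz Oz'] := unitD_max hl (unit1 h) mz.
  set zz := 1 + _ in z0 Oz Oz'.
  (* Expressing g and g' through all generators moves a to both sides; since Frobenius is additive,
     the factor that collects at a is the q-th power of the unit zz. *)
  have ezz : zz ^+ q * a = s + w1 ^+ q * u + w2 ^+ q * u'.
    have -> : zz ^+ q = 1 - ((w1 * c) ^+ q + (w2 * c') ^+ q).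
      apply/eqP; rewrite eq_sym subr_eq -!fr /zz -{1}(expr1n K q); apply/eqP; congr (_ ^+ q); ring.
    rewrite !exprMn mulrBl mul1r {1}e eg eg'; ring.
  have -> : a = zz^-1 ^+ q * (s + w1 ^+ q * u + w2 ^+ q * u').
    by rewrite -ezz mulrA -exprMn mulVf // expr1n mul1r.
  apply: idlM => //; first by exists zz^-1.
  apply: idlD => //; last by apply: idlM => //; exists w2.
  apply: idlD => //; last by apply: idlM => //; exists w1.
  by apply: idl_sub hs => // t tT; rewrite mem_cat tT orbT.
move=> f /hL [b [v [hb hv ->]]]; apply: idlD => //; exact: idlM.
Qed.

Definition box x y e := [seq x ^+ i * y ^+ j | i <- seq.iota 0 q, j <- seq.iota 0 e].

(** Each application of the hypothesis gains one power of x; after q of them only monomials of the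
    box remain, with coefficients in k, which are q-th powers. *)
Lemma frob_box O x y e w : is_subalg iota O -> O x -> O y ->
  (forall f, O f -> exists (c : nat -> k) g h, [/\ O g, O h &
     f = \sum_(j < e) iota (c j) * y ^+ j + x * g + w ^+ q * h]) ->
  O w -> forall f, O f -> exists s g h, [/\ idl (Fr q O) (box x y e) s, O g, O h &
    f = s + x ^+ q * g + w ^+ q * h].
Proof.
move=> hO hx hy hR hw; have [h hc] := hO; have hF := Fr_ring fr h.
suff H n : (n <= q)%N -> forall f, O f -> exists s g h', [/\ idl (Fr q O) (box x y e) s, O g, O h' &
    f = s + x ^+ n * g + w ^+ q * h'] by exact: H.
elim: n => [|n IH] nq f form.
  exists 0, f, 0; split=> //; try sr; last by rewrite expr0; ring.
  exact: idl0.
have [s [g [h' [hs hg hh ->]]]] := IH (ltnW nq) f form.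
have [c [g1 [h1 [hg1 hh1 ->]]]] := hR g hg.
exists (s + \sum_(j < e) x ^+ n * (iota (c j) * y ^+ j)), g1, (h' + x ^+ n * h1); split=> //; try sr.
  apply: idlD => //; apply: big_ind; [exact: idl0|by move=> ? ?; exact: idlD|move=> j _].
  rewrite mulrCA; have [c' ->] := ct_root iota q1 (c j); apply: idlM => //; first by exists (iota c').
  apply: idl_mem => //; apply/allpairsPdep; exists n, (j : nat).
  by rewrite !mem_iota /= !add0n nq.
by rewrite -mulr_sumr exprSr; ring.
Qed.

Theorem frob_dependence B0 O T fs : affine_model iota B0 -> B0 `<=` O -> is_subring O ->
  (forall f, O f -> idl (Fr q O) T f) -> (size T < q ^ size fs)%N -> kdep iota fs.
Proof.
move=> hB0 sub h hT sT; have [hB0a fg frac] := hB0.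
have [L0 [_ hL0]] := frob_finite_gen fg.
apply: (frob_dep q1 fr hB0 hL0 (T := T)) => // z.
have [a [b [ha hb b0 e]]] := frac z.
have [|a' [b' [ha' hb' b0' ->]]] := @frob_div O z h.
  by exists a, b; split=> //; exact: sub.
have hK : is_subring (Fr q (@setT K)) by apply: Fr_ring.
apply: idlM => //; first by exists b'^-1.
by apply: idl_sub (hT _ ha') => // _ [u _ <-]; exists u.
Qed.

End ChainsAndFrobenius.

(** * Local parameters in positive characteristic *)

Section PositiveCharacteristic.
Context (k : closedFieldType) (K : fieldType) (iota : {rmorphism k -> K}).
Implicit Types (x y z t f g h : K) (L T fs : seq K) (la : k).
Variables (p : nat) (B0 O : set K).
Hypotheses (hp : p \in [pchar k]) (hB0 : affine_model iota B0) (SO : Spec B0 O).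
(** The transcendence degree is at least two; a chain of primes of length two supplies such a pair
    through [chain_indep]. *)
Hypothesis hpair : exists fs, size fs = 2 /\ ~ kdep iota fs.

Let hB0r : is_subring B0. Proof. by case: hB0 => -[]. Qed.
Let hl : is_local O := Spec_local hB0r SO.
Let h : is_subring O := proj1 hl.
Let sub : B0 `<=` O := Spec_sub hB0r SO.
Let hc c : O (iota c). Proof. by apply: sub; case: hB0 => -[]. Qed.
Let hO : is_subalg iota O := conj h hc.
Let p1 : (1 < p)%N. Proof. by apply: prime_gt1; move: hp => /andP[]. Qed.

Lemma frobD s (a b : K) : (a + b) ^+ (p ^ s) = a ^+ (p ^ s) + b ^+ (p ^ s).
Proof.
apply: exprDn_pchar; have hpK : p \in [pchar K] by exact: (rmorph_pchar iota).
by rewrite pnatX pnatE ?hpK //; move: hp => /andP[].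
Qed.

Let qgt s : (0 < s)%N -> (1 < p ^ s)%N.
Proof. by move=> s0; rewrite -(exp1n s) ltn_exp2r. Qed.

Lemma frob_finite_local s : (0 < s)%N -> frob_finite (p ^ s) O.
Proof.
move=> /qgt q1; have [q hq ->] := SO.
have [_ fg _] := hB0; have fB := frob_finite_gen q1 (frobD s) fg.
exact: (frob_finite_loc q1 (frobD s) hB0r hq fB).
Qed.

Definition params x y := [/\ max_ideal O x, max_ideal O y & forall f, O f ->
  exists c g h, [/\ O g, O h & f = iota c + x * g + y * h]].

Lemma params_expand x y n f : params x y -> O f -> exists (c : nat -> k) g h, [/\ O g, O h &
  f = \sum_(j < n) iota (c j) * y ^+ j + x * g + y ^+ n * h].
Proof.
move=> [mx my hR]; have [hx hy] := (max_sub mx, max_sub my).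
elim: n f => [|n IH] f form.
  exists (fun=> 0), 0, f; split=> //; first by sr.
  by rewrite big_ord0 expr0; ring.
have [c [g [h1 [hg hh1 ->]]]] := IH f form; have [c0 [g0 [h0 [hg0 hh0 ->]]]] := hR h1 hh1.
exists (fun j => if j == n then c0 else c j), (g + y ^+ n * g0), h0; split=> //; first by sr.
rewrite big_ord_recr /= eqxx exprSr.
have -> : \sum_(j < n) iota (if (j : nat) == n then c0 else c j) * y ^+ j = \sum_(j < n) iota (c j) * y ^+ j.
  by apply: eq_bigr => j _; rewrite ltn_eqF.
ring.
Qed.

Lemma box_dep x y e w s fs : params x y -> max_ideal O w -> (0 < s)%N ->
  (forall f, O f -> exists (c : nat -> k) g h, [/\ O g, O h &
     f = \sum_(j < e) iota (c j) * y ^+ j + x * g + w ^+ (p ^ s) * h]) ->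
  (forall f, O f -> idl (Fr (p ^ s) O) (box (p ^ s) x y e) f) /\
  ((p ^ s * e < (p ^ s) ^ size fs)%N -> kdep iota fs).
Proof.
move=> [mx my _] mw s0 hR; have q1 := qgt s0.
have H : forall f, O f -> idl (Fr (p ^ s) O) (box (p ^ s) x y e) f.
  apply: (frob_nakayama (frobD s) hl mx mw (frob_finite_local s0)).
  apply: (frob_box q1 (frobD s) hO) => //; exact: max_sub.
split=> // lt; apply: (frob_dependence q1 (frobD s) hB0 sub h H).
by rewrite size_allpairs !size_iota.
Qed.

Lemma no_pow x y d a : params x y -> O a -> y ^+ d <> x * a.
Proof.
move=> pr ha e; have [mx my _] := pr; have [fs [sf nd]] := hpair; apply: nd.
pose s := d.+1; have q1 : (1 < p ^ s)%N by apply: qgt.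
(* With y^d a multiple of x, the remainder y^d h is absorbed by the multiples of x, so that
   [box_dep] applies with w = 0. *)
have [|_ H] := @box_dep x y d 0 s fs pr (max_ideal0 h) isT.
  move=> f form; have [c [g [h1 [hg hh1 ->]]]] := params_expand d pr form.
  exists c, (g + a * h1), 0; split=> //; try sr.
  by rewrite e; ring.
apply: H; rewrite sf -mulnn ltn_pmul2l ?(ltnW q1) //.
exact: leq_trans (ltn_expl d p1) (leq_pexp2l (ltnW p1) (leqnSn d)).
Qed.

Lemma params_neq0 x y : params x y -> x != 0 /\ y != 0.
Proof.
move=> pr; split; apply/eqP => e.
  have [mx my hR] := pr; have pr' : params y x.
    split=> // f /hR [c [g [h1 [hg hh1 ->]]]]; exists c, h1, g; split=> //; ring.
  have := @no_pow y x 1 0 pr' (sr0 h); rewrite e expr1 mulr0; exact.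
have := @no_pow x y 1 0 pr (sr0 h); rewrite e expr1 mulr0; exact.
Qed.

Lemma M_decomp x y la n f : params x y -> M O x y n f ->
  exists a b, [/\ O a, O b & f = (x - iota la * y) * a + y ^+ n * b].
Proof.
move=> [mx my _]; have [hx hy] := (max_sub mx, max_sub my).
elim: n f => [|n IH] f /=.
  by move=> form; exists 0, f; split=> //; [sr|rewrite expr0; ring].
move=> [f1 [f2 [/[dup] /(M_O hO hx hy) hf1 /IH [a1 [b1 [? ? e1]]] /IH [a2 [b2 [? ? ->]]] ->]]].
have hla := hc la.
exists (f1 + iota la * y * a1 + y * a2), (iota la * b1 + b2); split; try sr.
by rewrite {1}(_ : x * f1 = (x - iota la * y) * f1 + iota la * y * f1); [rewrite {2}e1 exprS; ring|ring].
Qed.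

(* A relation between forms of degree d gives y^d in (x) for suitable
   coordinates; then d q monomials span K over K^q, and d q < q^2 for large q. *)
Lemma params_ind x y d (P : {poly k}) : params x y -> (size P <= d.+1)%N ->
  M O x y d.+1 (form iota d P x y) -> P = 0.
Proof.
move=> pr sP mP; have [mx my hR] := pr; have [hx hy] := (max_sub mx, max_sub my).
apply/eqP; case: eqVneq => // /closed_nonrootP [la /negP nr].
have hla := hc la; pose x' := x - iota la * y.
have pr' : params x' y.
  split=> //; first by apply: max_idealD => //; apply: max_idealN => //; apply: max_idealM.
  move=> f /hR [c [g [h1 [hg hh1 ->]]]]; exists c, g, (iota la * g + h1); split; try sr.
  by rewrite /x'; ring.
have [a [b [ha hb e]]] := M_decomp la pr mP.
have pow i : exists2 u, O u & x ^+ i = (iota la * y) ^+ i + x' * u.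
  elim: i => [|i [u hu e']]; first by exists 0; rewrite ?expr0 ?mulr0 ?addr0 //; sr.
  exists (x ^+ i + iota la * y * u); first by sr.
  by rewrite exprS -{1}(subrK (iota la * y) x) -/x' mulrDl {2}e' exprS; ring.
have [u hu eu] : exists2 u, O u & form iota d P x y = iota P.[la] * y ^+ d + x' * u.
  rewrite /form (horner_coef_wide _ sP) rmorph_sum mulr_suml.
  apply: (big_ind2 (fun a b => exists2 u, O u & a = b + x' * u)).
  - by exists 0; [sr|ring].
  - by move=> a1 b1 a2 b2 [u1 hu1 ->] [u2 hu2 ->]; exists (u1 + u2); [sr|ring].
  move=> i _; have [u hu ->] := pow i; exists (iota P`_i * u * y ^+ (d - i)).
    by have := hc P`_i => ?; sr.
  have -> : y ^+ d = y ^+ i * y ^+ (d - i) by rewrite -exprD subnKC // -ltnS.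
  by rewrite rmorphM rmorphXn exprMn; ring.
have Pu : unit_of O (iota P.[la] - y * b).
  apply: unitD_max => //; last by apply: max_idealN => //; rewrite mulrC; exact: max_idealM.
  split; rewrite ?fmorph_eq0 ?hc -?fmorphV //; apply/eqP => e0; apply: nr; exact/eqP.
have [Pu0 _ Pui] := Pu.
have ha' : O ((a - u) * (iota P.[la] - y * b)^-1) by sr.
case: (no_pow (d := d) pr' ha'); apply: (mulIf Pu0).
rewrite mulrA mulfVK //.
have := e; rewrite eu exprS => e1.
have -> : y ^+ d * (iota P.[la] - y * b) = (iota P.[la] * y ^+ d + x' * u) - y * y ^+ d * b - x' * u by ring.
by rewrite e1 /x'; ring.
Qed.

Definition exps : seq (nat * nat) := [seq (i, j) | i <- seq.iota 0 p, j <- seq.iota 0 p].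
Let mo x y (w : nat * nat) := x ^+ w.1 * y ^+ w.2.

Lemma exps_uniq : uniq exps.
Proof. by apply: allpairs_uniq; rewrite ?iota_uniq // => -[? ?] [? ?] _ _ [-> ->]. Qed.
Lemma mem_exps (w : nat * nat) : (w \in exps) = (w.1 < p)%N && (w.2 < p)%N.
Proof.
apply/allpairsPdep/andP => [[i [j [hi hj ->]]]|[w1 w2]].
  by move: hi hj; rewrite !mem_iota.
by exists w.1, w.2; rewrite !mem_iota !add0n; case: w w1 w2.
Qed.

Lemma idl_map_sum (A : set K) (I : eqType) (m : I -> K) (s : seq I) z : uniq s -> idl A (map m s) z ->
  exists c : I -> K, (forall i, i \in s -> A (c i)) /\ z = \sum_(i <- s) c i * m i.
Proof.
elim: s z => [|i s IH] z /=; first by exists (fun=> 0); rewrite big_nil.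
move=> /andP[ni us] [b [v [hb /(IH _ us) [c [hcc ->]] ->]]].
exists (fun j => if j == i then b else c j); split.
  by move=> j; rewrite inE; case: eqP => //= _; exact: hcc.
rewrite big_cons eqxx; congr (_ + _); apply: eq_big_seq => j js.
by rewrite (_ : (j == i) = false) //; apply: contraNF ni => /eqP <-.
Qed.

Lemma basis_gen x y f : params x y -> O f -> idl (Fr p O) (map (mo x y) exps) f.
Proof.
move=> pr; have [mx my _] := pr; have [hx hy] := (max_sub mx, max_sub my).
have [H _] := box_dep (e := p) (w := y) (s := 1) [::] pr my isT (fun f form => params_expand (p ^ 1) pr form).
move: f; move: H; rewrite expn1 /box => H f /H.
rewrite (_ : [seq _ | i <- _, j <- _] = map (mo x y) exps) //.
by rewrite /exps map_allpairs.
Qed.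

(** A relation would express one monomial through the other p^2 - 1, which then span K over its p-th
    powers; [frob_dep] would make every pair of functions dependent. *)
Lemma basis_indep x y (A : nat * nat -> K) : params x y ->
  \sum_(w <- exps) A w ^+ p * mo x y w = 0 -> forall w : nat * nat, w \in exps -> A w = 0.
Proof.
move=> pr e w0 w0e; apply/eqP; case: eqVneq => // A0.
have [fs [sf nd]] := hpair; case: nd.
pose T := map (mo x y) (rem w0 exps).
have [hB0a fg frac] := hB0; have fr (a b : K) : (a + b) ^+ p = a ^+ p + b ^+ p.
  by have := frobD 1 a b; rewrite expn1.
have [L0 [_ hL0]] := frob_finite_gen p1 fr fg.
have hK : is_subring (Fr p (@setT K)) by apply: Fr_ring.
apply: (frob_dep p1 fr hB0 hL0 (T := T)); last first.
  have pp : (0 < p * p)%N by rewrite muln_gt0 ltnW.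
  by rewrite size_map size_rem // size_allpairs size_iota sf -mulnn prednK.
have hm (w : nat * nat) : w \in exps -> idl (Fr p setT) T (mo x y w).
  move=> we; have [->|ne] := eqVneq w w0; last first.
    by apply: idl_mem => //; apply: map_f; rewrite mem_rem_uniq ?exps_uniq // inE ne.
  rewrite (_ : mo x y w0 = \sum_(w <- rem w0 exps) (- A w / A w0) ^+ p * mo x y w); last first.
    have Ap : A w0 ^+ p != 0 by rewrite expf_neq0.
    apply: (mulfI Ap); rewrite mulr_sumr; move: e; rewrite (perm_big _ (perm_to_rem w0e)) big_cons.
    move/eqP; rewrite addr_eq0 => /eqP ->; rewrite -sumrN; apply: eq_bigr => v _.
    have nN : (- A v) ^+ p = - A v ^+ p.
      by apply/eqP; rewrite -addr_eq0 -fr addNr expr0n gtn_eqF // ltnW.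
    by rewrite exprMn nN exprVn; fd.
  rewrite big_seq; apply: big_ind; [exact: idl0|by move=> ? ?; exact: idlD|move=> v vr].
  by apply: idlM => //; [exists (- A v / A w0)|apply: idl_mem => //; exact: map_f].
move=> z; have [a [b [ha hb b0 ez]]] := frac z.
have [|a' [b' [ha' hb' b0' ->]]] := frob_div p1 (z := z) h.
  by exists a, b; split=> //; exact: sub.
apply: idlM => //; first by exists b'^-1.
have := basis_gen pr ha'; apply: idl_ind; [exact: idl0|by move=> ? ?; exact: idlD|].
move=> _ _ [u _ <-] /mapP [w we ->]; apply: idlM => //; [by exists u|exact: hm].
Qed.

Section Derivatives.
Variables x y u v : K.
Hypothesis pr : params x y.
Let psi (w : nat * nat) := w.1%:R * u + w.2%:R * v.
(* A list of triples (a, (i, j)) stands for the sum of the a^p x^i y^j, and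
   lder applies to it the derivation D with D x = u x and D y = v y. *)
Definition lval (l : seq (K * (nat * nat))) := \sum_(b <- l) b.1 ^+ p * mo x y b.2.
Definition lder (l : seq (K * (nat * nat))) := \sum_(b <- l) b.1 ^+ p * (mo x y b.2 * psi b.2).

Let frp (a b : K) : (a + b) ^+ p = a ^+ p + b ^+ p.
Proof. by have := frobD 1 a b; rewrite expn1. Qed.
Let p0 : (0 < p)%N := ltnW p1.
Let pK : p%:R = 0 :> K.
Proof. by have : p \in [pchar K] by [exact: (rmorph_pchar iota)]; rewrite inE => /andP[_ /eqP]. Qed.

Lemma natr_modp i : i%:R = (i %% p)%N%:R :> K.
Proof. by rewrite {1}(divn_eq i p) natrD natrM pK mulr0 add0r. Qed.

(** Reducing the exponents modulo p moves p-th powers into the coefficients and leaves [psi]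
    unchanged, so both sums can be collected along the basis of monomials in [exps]. *)
Lemma lval_der0 l : lval l = 0 -> lder l = 0.
Proof.
pose red (w : nat * nat) := (w.1 %% p, w.2 %% p)%N.
pose A w := \sum_(b <- l | red b.2 == w) b.1 * (x ^+ (b.2.1 %/ p) * y ^+ (b.2.2 %/ p)).
have regroup (ph : nat * nat -> K) : (forall w, ph w = ph (red w)) ->
    \sum_(b <- l) b.1 ^+ p * (mo x y b.2 * ph b.2) = \sum_(w <- exps) A w ^+ p * (mo x y w * ph w).
  move=> hph.
  have AE w : A w ^+ p = \sum_(b <- l | red b.2 == w) (b.1 * (x ^+ (b.2.1 %/ p) * y ^+ (b.2.2 %/ p))) ^+ p.
    by apply: (big_morph (fun z => z ^+ p)); [exact: frp|rewrite expr0n gtn_eqF].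
  transitivity (\sum_(w <- exps) \sum_(b <- l | red b.2 == w)
      (b.1 * (x ^+ (b.2.1 %/ p) * y ^+ (b.2.2 %/ p))) ^+ p * (mo x y w * ph w)); last first.
    by apply: eq_bigr => w _; rewrite AE mulr_suml.
  rewrite (exchange_big_dep xpredT) //=; apply: eq_bigr => b _.
  have re : red b.2 \in exps by rewrite mem_exps /= !ltn_mod p0.
  rewrite -big_filter (_ : [seq w <- exps | red b.2 == w] = [:: red b.2]); last first.
    by rewrite (eq_filter (a2 := pred1 (red b.2))) ?filter_pred1_uniq ?exps_uniq // => w; rewrite /= eq_sym.
  rewrite big_seq1 -hph /mo /= !exprMn -!exprM {1}(divn_eq b.2.1 p) {1}(divn_eq b.2.2 p) !exprD.
  by ring.
rewrite /lval /lder => e.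
have A0 : forall w, w \in exps -> A w = 0.
  apply: (basis_indep pr); rewrite -[RHS]e.
  have := regroup (fun=> 1) (fun=> erefl) => r1.
  transitivity (\sum_(w <- exps) A w ^+ p * (mo x y w * 1)); first by apply: eq_bigr => w _; rewrite mulr1.
  by rewrite -r1; apply: eq_bigr => b _; rewrite mulr1.
rewrite (regroup psi); last by move=> w; rewrite /psi /= -!natr_modp.
by rewrite big1_seq // => w /= /A0 ->; rewrite expr0n gtn_eqF // mul0r.
Qed.

Lemma lval_ex z : exists l, lval l = z.
Proof.
have [_ _ frac] := hB0; have [a [b [ha hb b0 ez]]] := frac z.
have [|a' [b' [ha' hb' b0' ->]]] := frob_div p1 (z := z) h.
  by exists a, b; split=> //; exact: sub.
have [c [hcc ->]] := idl_map_sum exps_uniq (basis_gen pr ha').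
have hr w : exists d, w \in exps -> c w = d ^+ p.
  by have [/hcc [d _ <-]|ne] := boolP (w \in exps); [exists d|exists 0].
have [d hd] := choice hr.
exists [seq (b'^-1 * d w, w) | w <- exps]; rewrite /lval big_map mulr_sumr.
by apply: eq_big_seq => w we /=; rewrite exprMn -hd // /mo !mulrA.
Qed.

Definition rep := projT1 (choice lval_ex).
Lemma lder_rep l : lder l = lder (rep (lval l)).
Proof.
have e : lval (rep (lval l)) = lval l by exact: (projT2 (choice lval_ex)).
have nN (a : K) : (- a) ^+ p = - a ^+ p.
  by apply/eqP; rewrite -addr_eq0 -frp addNr expr0n gtn_eqF.
pose neg l' := [seq (- b.1, b.2) | b <- l'] : seq (K * (nat * nat)).
have vneg l' : lval (neg l') = - lval l'.
  by rewrite /lval big_map -sumrN; apply: eq_bigr => b _; rewrite nN mulNr.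
have dneg l' : lder (neg l') = - lder l'.
  by rewrite /lder big_map -sumrN; apply: eq_bigr => b _; rewrite nN mulNr.
have z : lval (l ++ neg (rep (lval l))) = 0.
  by have -> a b : lval (a ++ b) = lval a + lval b; [rewrite /lval big_cat|rewrite vneg e subrr].
apply/eqP; rewrite -subr_eq0 -dneg -(lval_der0 z); apply/eqP.
by have -> a b : lder (a ++ b) = lder a + lder b by rewrite /lder big_cat.
Qed.

Lemma log_derivation : exists D : derivation iota, D x = x * u /\ D y = y * v.
Proof.
have hrep z : lval (rep z) = z by exact: (projT2 (choice lval_ex)).
pose D z := lder (rep z).
have DE l : lder l = D (lval l) by exact: lder_rep.
have Dadd a b : D (a + b) = D a + D b.
  rewrite -{1}(hrep a) -{1}(hrep b) (_ : lval _ + lval _ = lval (rep a ++ rep b)) -?DE.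
    by rewrite /lder big_cat.
  by rewrite /lval big_cat.
have Dmul a b : D (a * b) = a * D b + b * D a.
  pose l := [seq (s.1 * s'.1, (s.2.1 + s'.2.1, s.2.2 + s'.2.2)%N) | s <- rep a, s' <- rep b] : seq (K * (nat * nat)).
  have el : lval l = a * b.
    transitivity (lval (rep a) * lval (rep b)); last by rewrite !hrep.
    rewrite /lval /l big_allpairs_dep mulr_suml; apply: eq_bigr => s _.
    by rewrite mulr_sumr; apply: eq_bigr => s' _; rewrite /mo /= exprMn !exprD; ring.
  rewrite -el -DE; transitivity (lval (rep a) * lder (rep b) + lder (rep a) * lval (rep b)); last by rewrite !hrep [_ * b]mulrC.
  rewrite /lder /lval !big_distrlr -big_split /=.
  rewrite /l big_allpairs_dep; apply: eq_bigr => s _; rewrite -big_split; apply: eq_bigr => s' _.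
  by rewrite /mo /psi /= exprMn !exprD !natrD; ring.
have Dc c : D (iota c) = 0.
  have [d ed] := ct_root iota p1 c.
  have e : lval [:: (iota d, (0, 0)%N)] = iota c by rewrite /lval big_seq1 /mo /= !expr0 !mulr1.
  by rewrite -e -DE /lder big_seq1 /psi /= !mul0r addr0 !mulr0.
exists (@Derivation _ _ iota D Dadd Dmul Dc); split=> /=.
  have e : lval [:: (1, (1, 0)%N)] = x by rewrite /lval big_seq1 /mo /= expr1n expr1 expr0; ring.
  by rewrite -{1}e -DE /lder big_seq1 /mo /psi /= expr1n expr1 expr0; ring.
have e : lval [:: (1, (0, 1)%N)] = y by rewrite /lval big_seq1 /mo /= expr1n expr1 expr0; ring.
by rewrite -{1}e -DE /lder big_seq1 /mo /psi /= expr1n expr1 expr0; ring.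
Qed.

End Derivatives.

Lemma derXn (D : derivation iota) z n : D (z ^+ n.+1) = n.+1%:R * z ^+ n * D z.
Proof.
elim: n => [|n IH]; first by rewrite expr1 expr0; ring.
by rewrite exprS derM IH exprS -natr1; ring.
Qed.

(** f is a combination of monomials in x and y with p-th powers as coefficients, and derivations
    kill p-th powers. *)
Lemma params_omega x y : params x y -> omega iota O x y.
Proof.
move=> pr; have [mx my _] := pr; have [hx hy] := (max_sub mx, max_sub my).
pose C := [set f | O f /\ exists f1 f2, [/\ O f1, O f2 & forall D : derivation iota, D f = f1 * D x + f2 * D y]].
have hC : is_subring C := omega_ring iota x y h.
have Cx : C x by split=> //; exists 1, 0; split; try sr; move=> D; ring.
have Cy : C y by split=> //; exists 0, 1; split; try sr; move=> D; ring.
have hpK : p \in [pchar K] by exact: (rmorph_pchar iota).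
move=> f form; suff [] : C f by [].
apply: idl_ind (basis_gen pr form); [by sr|by move=> a b; exact: srD|].
move=> _ _ [c cO <-] /mapP [w _ ->]; rewrite /mo; have C1 : C (c ^+ p); last by sr.
split; first by sr.
exists 0, 0; split; try sr; move=> D.
have pK : p%:R = 0 :> K by move: hpK; rewrite inE => /andP[_ /eqP].
have := derXn D c p.-1; rewrite (prednK (ltnW p1)) pK !mul0r => ->.
by rewrite addr0.
Qed.

Lemma mono_hom x y (c : nat * nat -> k) N : mono iota c x y (tri N.+1) =
  mono iota c x y (tri N) + form iota N (\poly_(i < N.+1) c (i, N - i)%N) x y.
Proof.
rewrite tri_S; congr (_ + _); apply: eq_bigr => i _.
by rewrite coef_poly ltn_ord mulrA.
Qed.

(** Degree by degree: once the lower coefficients vanish, the part of degree d lies in the power d +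
    1 of the ideal, and [params_ind] applies. *)
Lemma params_mono0 x y (c : nat * nat -> k) D : params x y ->
  (forall n, M O x y n (mono iota c x y (tri D))) -> forall w, w \in tri D -> c w = 0.
Proof.
move=> pr hM; have [mx my _] := pr; have [hx hy] := (max_sub mx, max_sub my).
suff H d : (d <= D)%N -> forall w, w \in tri d -> c w = 0 by exact: H.
elim: d => [|d IH] dD w; first by rewrite mem_tri.
have IH' := IH (ltnW dD).
have tail N : (d < N)%N -> M O x y d.+1 (mono iota c x y (tri N) - mono iota c x y (tri d.+1)).
  elim: N => // N IHN; rewrite ltnS leq_eqVlt => /orP[/eqP ->|lt].
    by rewrite subrr; exact: (M_0 _ _ hO).
  rewrite mono_hom addrAC; apply: (M_D hO); first exact: IHN.
  by apply: (M_le hO hx hy lt); exact: form_M.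
have z : mono iota c x y (tri d) = 0.
  by rewrite /mono big1_seq // => v /= /IH' ->; rewrite rmorph0 mul0r.
have m : M O x y d.+1 (form iota d (\poly_(i < d.+1) c (i, d - i)%N) x y).
  have := tail D dD; rewrite mono_hom z add0r => hd.
  by rewrite -(subKr (mono iota c x y (tri D)) (form _ _ _ _ _)); apply: (M_B hO).
have /polyP P0 := params_ind pr (size_poly _ _) m.
rewrite mem_tri ltnS leq_eqVlt => /orP[/eqP e|lt]; last by apply: IH'; rewrite mem_tri.
have le : (w.1 < d.+1)%N by rewrite ltnS -e leq_addr.
have := P0 w.1; rewrite coef_poly coef0 le -e addKn => <-; by case: (w).
Qed.

Lemma msum_mono x y N (c : seq nat -> k) : exists c' : nat * nat -> k,
  msum iota [:: x; y] N c = mono iota c' x y (tri (2 * N)) /\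
  forall i j, [:: i; j] \in idx 2 N -> (i, j) \in tri (2 * N) /\ c' (i, j) = c [:: i; j].
Proof.
exists (fun w => if [:: w.1; w.2] \in idx 2 N then c [:: w.1; w.2] else 0).
have inN i j : [:: i; j] \in idx 2 N -> (i < N)%N && (j < N)%N.
  move=> /allpairsPdep [i' [a [hi /allpairsPdep [j' [b [hj hb ->]]] [-> -> _]]]].
  by move: hi hj; rewrite !mem_iota !add0n /= => -> ->.
have inT i j : [:: i; j] \in idx 2 N -> (i, j) \in tri (2 * N).
  by move=> /inN /andP[]; rewrite mem_tri /=; lia.
split; last by move=> i j ij; rewrite ij; split=> //; exact: inT.
rewrite /mono (eq_bigr (fun w : nat * nat => if [:: w.1; w.2] \in idx 2 N
    then iota (c [:: w.1; w.2]) * mon [:: x; y] [:: w.1; w.2] else 0)); last first.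
  by move=> w _; case: ifP => _; rewrite ?rmorph0 ?mul0r //= mulr1.
rewrite -big_mkcond -big_filter -(big_map (fun w : nat * nat => [:: w.1; w.2]) xpredT
   (fun a => iota (c a) * mon [:: x; y] a)).
apply: perm_big; apply: uniq_perm; first exact: uniq_idx.
  rewrite map_inj_uniq ?filter_uniq ?tri_uniq //.
  by move=> [i j] [i' j'] /= [-> ->].
move=> a; apply/idP/mapP => [ha|[w]]; last by rewrite mem_filter => /andP[ha _ ->].
have := ha; rewrite /idx -/idx => /allpairsPdep [i [b [hi /allpairsPdep [j [b' [hj hb eb]]] ea]]].
have ea' : a = [:: i; j] by rewrite ea eb; move: hb; rewrite inE => /eqP ->.
by exists (i, j); rewrite // mem_filter /= -ea' ha inT // -ea'.
Qed.

(** f, x and y are algebraically dependent. The lowest nonzero coefficient of the relation in powers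
    of f is a polynomial in x and y divisible by f; if f lay in all powers of the ideal, so would
    this polynomial, and its coefficients would vanish. *)
Lemma params_sep x y f : params x y -> (forall fs, size fs = 3 -> kdep iota fs) ->
  O f -> f != 0 -> exists n, ~ M O x y n f.
Proof.
move=> pr h3 form f0; apply: contrapT => no.
have mf n : M O x y n f by apply: contrapT => nm; apply: no; exists n.
have [mx my _] := pr; have [hx hy] := (max_sub mx, max_sub my).
have [N [c [[a ha ca] e]]] := h3 [:: f; x; y] erefl.
have [i0 [b [hi hb ea]]] : exists i b, [/\ i \in seq.iota 0 N, b \in idx 2 N & a = i :: b].
  by have /allpairsPdep := ha.
pose bad i := exists2 b, b \in idx 2 N & c (i :: b) != 0.
have [|j [b1 hb1 cb1] minj] := @nat_min bad; first by exists i0, b; rewrite // -ea.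
have jN : (j < N)%N.
  apply: leq_ltn_trans (minj i0 _) _; first by exists b; rewrite // -ea.
  by move: hi; rewrite mem_iota.
have [|i b2 lt hb2|w hw ew] := @msum_lowest _ _ iota f [:: x; y] N c j O hO _ jN.
- by move=> g; rewrite !inE => /or3P[]/eqP ->.
- apply/eqP; case: eqVneq => // nz; have := minj i; rewrite leqNgt lt => H.
  by have : false by apply: H; exists b2.
have ev : msum iota [:: x; y] N (fun a => c (j :: a)) = - (w * f).
  move: e; rewrite ew => /eqP; rewrite mulf_eq0 expf_eq0 (negbTE f0) andbF /= addr_eq0 => /eqP ->.
  by rewrite mulrC.
have [c' [em hc']] := msum_mono x y N (fun a => c (j :: a)).
have mM n : M O x y n (mono iota c' x y (tri (2 * N))).
  by rewrite -em ev; apply: (M_N hO); apply: (M_mulO hO).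
have := hb1; rewrite /idx -/idx => /allpairsPdep [i [b' [_ /allpairsPdep [i' [b'' [_ hb'' eb']]] eb1]]].
have ee : b1 = [:: i; i'] by rewrite eb1 eb'; move: hb''; rewrite inE => /eqP ->.
rewrite ee in hb1 cb1; have [ht et] := hc' _ _ hb1.
by move: cb1; rewrite -et (params_mono0 pr mM ht) eqxx.
Qed.

Theorem params_regpt x y : params x y ->
  regpt iota O x y /\ forall fs, size fs = 3 -> kdep iota fs.
Proof.
move=> pr; have [mx my hR] := pr; have [hx hy] := (max_sub mx, max_sub my).
have h3 fs : size fs = 3 -> kdep iota fs.
  move=> sf; have [_ H] := box_dep (e := p) (w := y) (s := 1) fs pr my isT (fun f form => params_expand (p ^ 1) pr form).
  by apply: H; rewrite sf expn1 mulnn ltn_exp2l.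
split=> //; split=> //.
- move=> g g' hg hg'; apply: unitD_max => //; last by rewrite mulrC; apply: max_idealM.
  by apply: unitD_max => //; [exact: unit1|rewrite mulrC; apply: max_idealM].
- by move=> d P; exact: params_ind.
- by move=> f; exact: params_sep.
- by move=> z; have [_ _ frac] := hB0; have [a [b [ha hb b0 ->]]] := frac z; exists a, b; split=> //; exact: sub.
- exact: params_omega.
- have [D [Dx Dy]] := log_derivation 1 0 pr; have [D' [Dx' Dy']] := log_derivation 0 1 pr.
  exists D, D'; rewrite /dd Dx Dy Dx' Dy'; have [x0 y0] := params_neq0 pr.
  by rewrite !mulr1 !mulr0 subr0 mulf_neq0.
Qed.

End PositiveCharacteristic.

(** * Centers and stalks *)

Section SmoothPoints.
Context (k : closedFieldType) (K : fieldType) (iota : {rmorphism k -> K}).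
Implicit Types (A B C E O P Q q : set K) (X Y : set (set K)) (x y z t f g h : K).

Lemma variety_chart X P : variety iota X -> X P ->
  exists B, [/\ affine_model iota B, Spec B P & Spec B `<=` X].
Proof.
move=> [[n [B [hB eX]]] _] XP; move: (XP); rewrite {1}eX => -[i _ SP]; exists (B i); split=> //.
by move=> Q SQ; rewrite eX; exists i.
Qed.

Lemma variety_point X P : variety iota X -> X P -> is_subalg iota P /\ is_local P.
Proof.
move=> vX /(variety_chart vX) [B [[[h hc] _ _] SP _]]; have hl := Spec_local h SP.
by split=> //; split; [exact: proj1 hl|move=> c; exact: Spec_sub h SP _ (hc c)].
Qed.

(** A prime of B above that of P defines a point whose local ring lies in P; closedness makes it P
    itself, so the prime of P is maximal and the Nullstellensatz applies. *)
Lemma closed_point_residue X P : variety iota X -> closed_point X P ->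
  forall f, P f -> exists c, max_ideal P (f - iota c).
Proof.
move=> vX [XP cl]; have [B [hB [q hq eP] SX]] := variety_chart vX XP.
have [[h hc] _ _] := hB; have hl := proj2 (variety_point vX XP); have hP := proj1 hl.
have [qi _ _] := hq; have BP : B `<=` P by rewrite eP; exact: localize_sub.
have inm a : B a -> max_ideal P a <-> q a by rewrite eP; exact: localize_max.
have res : forall a, B a -> exists c, q (a - iota c).
  apply: closed_residue => // q' hq' qq' a q'a.
  have Ba := ideal_sub (prime_ideal_of hq') q'a.
  have e : localize B q' B = P.
    apply: cl; first by apply: SX; exists q'.
    by move=> _ [b [s [hb hs ns ->]]]; rewrite eP; exists b, s; split=> // /qq'.
  by apply/inm => //; rewrite -e; apply/localize_max.
move=> f; rewrite {1}eP => -[a [s [ha hs ns ef]]].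
have [ca qa] := res a ha; have [cs qs] := res s hs.
have s0 := prime_neq0 hq ns.
have cs0 : cs != 0 by apply: contra_notN ns => /eqP cs0; move: qs; rewrite cs0 rmorph0 subr0.
have ics0 : iota cs != 0 by rewrite fmorph_eq0.
have us : unit_of P s by rewrite eP; apply/localize_unit.
have Pc d : P (iota d) by apply: BP.
exists (ca / cs); rewrite fmorph_div.
rewrite (_ : f - _ = (s^-1 * iota cs^-1) * (iota cs * (a - iota ca) - iota ca * (s - iota cs))); last first.
  by rewrite ef fmorphV /=; fd.
have hcs := hc cs; have hca := hc ca.
apply: max_idealM => //; first by apply: srM => //; case: us.
apply/inm; first by sr.
by apply: (idealB h qi); apply: (idealM qi).
Qed.

Theorem smooth_point_regpt p X P : p \in [pchar k] -> smooth_surface_point iota X P ->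
  exists x y, regpt iota P x y /\ forall fs : seq K, size fs = 3 -> kdep iota fs.
Proof.
move=> hp [[vX nX] [[P2 XP2 kd2] dimX] cl [d [kd [g eg]]]].
have [XP _] := cl; have [[hP hPc] hl] := variety_point vX XP.
have d2 : (d <= 2)%N by exact: dimX XP kd.
have [x [y [mx my hxy]]] : exists x y, [/\ max_ideal P x, max_ideal P y &
    forall m, max_ideal P m -> exists a b, [/\ P a, P b & m = x * a + y * b]].
  have m0 := max_ideal0 hP.
  have mg (i : 'I_d) : max_ideal P (g i).
    rewrite eg; exists (fun j => if j == i then 1 else 0); split.
      by move=> j; case: eqP => _; sr.
    rewrite (bigD1 i) //= eqxx mul1r big1 ?addr0 // => j /negbTE ->; by rewrite mul0r.
  have hg m : max_ideal P m -> exists c : 'I_d -> K, (forall i, P (c i)) /\ m = \sum_(i < d) c i * g i.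
    by rewrite eg.
  (* Fewer than two generators are padded with zeros; [params_neq0] excludes these cases. *)
  move: g {eg kd} mg hg d2; case: d => [|[|[|//]]] g mg hg _.
  - exists 0, 0; split=> // m /hg [c [_ ->]]; exists 0, 0; split; try sr.
    by rewrite big_ord0; ring.
  - exists (g ord0), 0; split=> // m /hg [c [hcc ->]]; exists (c ord0), 0; split; try sr => //.
    by rewrite big_ord1; ring.
  exists (g ord0), (g (lift ord0 ord0)); split=> // m /hg [c [hcc ->]].
  exists (c ord0), (c (lift ord0 ord0)); split=> //.
  by rewrite big_ord_recl big_ord1; ring.
have [B [hB SP _]] := variety_chart vX XP.
(* The chain of length two may belong to another point P2; independence is a statement about the
   common function field. *)
have hpair : exists fs, size fs = 2 /\ ~ kdep iota fs.
  have [[c hch] _] := kd2; have [hP2 _] := variety_point vX XP2; exact: chain_indep hP2 hch.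
exists x, y; apply: (params_regpt hp hB SP hpair); split=> // f form.
have [c mc] := closed_point_residue vX cl form; have [a [b [ha hb e]]] := hxy _ mc.
by exists c, a, b; split=> //; rewrite -addrA -e addrC subrK.
Qed.

(** The middle prime consists of the elements vanishing to infinite order along y = 0. Its
    complement is formed by the elements with an intersection number, and these are closed under
    products by [icz_M]. *)
Lemma regpt_chain O x y : regpt iota O x y -> exists c, krull_chain O 2 c.
Proof.
move=> rp; have [h hc] := rp_alg rp; have hx := rp_x rp; have hy := rp_y rp.
have hl := rp_local rp.
pose q := [set f | O f /\ forall N, exists a b, [/\ O a, O b & f = x ^+ N * a + y * b]].
have qN f : O f -> ~ q f -> exists d, icz O x y f d.
  move=> form nq; apply: contrapT => no; apply: nq; split=> // N.
  by case: (icz_dichotomy N rp form) => // -[d _ hd]; case: no; exists d.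
have icN f d : icz O x y f d -> ~ q f.
  move=> hd [_ /(_ d.+1) [a [b [ha hb e]]]].
  by have := icz_bound rp hd ha hb e; rewrite ltnn.
have hq : is_prime_ideal O q.
  split; [split| |].
  - by move=> f [].
  - by split=> [|N]; [sr|exists 0, 0; split; try sr; ring].
  - move=> f g [form qf] [hg qg]; split=> [|N]; first by sr.
    have [a [b [ha hb ->]]] := qf N; have [a' [b' [ha' hb' ->]]] := qg N.
    by exists (a + a'), (b + b'); split; try sr; ring.
  - move=> f g form [hg qg]; split=> [|N]; first by sr.
    have [a' [b' [ha' hb' ->]]] := qg N.
    by exists (f * a'), (f * b'); split; try sr; ring.
  - by apply: (icN 1 0%N); exists 1, 0; split; [exact: unit1|sr|ring].
  - move=> f g form hg qfg; apply: contrapT => /not_orP [/(qN _ form) [d hd] /(qN _ hg) [e he]].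
    exact: icN (icz_M h hx hy hd he) qfg.
exists (fun i => if i is j.+1 then (if j is 0%N then q else max_ideal O) else [set 0]); split.
  move=> [|[|[|i]]] //= _; [exact: zero_prime|exact: max_prime_ideal].
have [qi q1 _] := hq.
move=> [|[|//]] _; split.
- by move=> _ ->; exact: ideal0 qi.
- move=> /(_ y) H; have : y = 0; last by apply/eqP; exact: (rp_y0 rp).
  by apply: H; split=> // N; exists 0, 1; split; try sr; ring.
- move=> z qz; split; first by case: qz.
  move=> [z0 _ zi]; apply: q1; rewrite -(mulVf z0); exact: (idealM qi).
- move=> /(_ x) H; apply: (icN x 1%N); first by exists 1, 0; split; [exact: unit1|sr|ring].
  by apply: H; apply/(rp_max rp); exact: (M_x _ _ (rp_alg rp)).
Qed.

(* A prime of height at least two below the origin would give a chain of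
   three. *)
Lemma center_is_point X P x y E Q : normal_variety iota X -> X P -> regpt iota P x y ->
  (~ exists c, krull_chain P 3 c) -> prime_divisor_over iota X E -> center X E Q ->
  exceptional_center Q -> P `<=` Q -> Q = P.
Proof.
move=> [vX nX] XP rp no3 [Y [nY pY YE kdE]] [XQ dQ] exc PQ.
have [B [hB SP SX]] := variety_chart vX XP; have [[h hc] fg frac] := hB.
have [hEa hE] := point_dvr nY YE kdE; have hlE := dvr_local hE.
have BP := Spec_sub h SP; have BE : B `<=` E by move=> z /BP /PQ /(dom_sub dQ).
have SQ : Spec B Q.
  have SC := Spec_ctr h hlE BE.
  rewrite (_ : Q = ctr B E) //; apply: (proj2 vX E) => //.
  - by split=> // z; exact: dvr_total.
  - exact: SX.
  - exact: ctr_dom.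
have [q1 hq1 eQ] := SQ; have [q0 hq0 eP] := SP.
have [hQa hlQ] := variety_point vX XQ; have hQ := proj1 hlQ.
have [[hP _] hlP] := variety_point vX XP.
have BQ := Spec_sub h SQ.
have q10 : q1 `<=` q0.
  move=> a q1a; have Ba := ideal_sub (prime_ideal_of hq1) q1a; apply: contrapT => nq0.
  have ua : unit_of P a by rewrite eP; apply/localize_unit.
  have : unit_of Q a by exact: unit_sub PQ ua.
  by rewrite eQ => /(localize_unit h hq1 Ba).
have [q01|nq01] := EM (q0 `<=` q1).
  by rewrite eQ eP (_ : q1 = q0) // eqEsubset.
have [[a q1a a0]|z1] := EM (exists2 a, q1 a & a != 0); last first.
  have QT z : Q z.
    rewrite eQ; have [u [v [hu hv v0 ->]]] := frac z; exists u, v; split=> // q1v.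
    by apply: z1; exists v.
  have [t [t0 mt _]] := proj2 hE.
  case: (max_nunit mt); split; [by []|exact: max_sub mt|].
  by apply: (dom_sub dQ).
(* Q has a nonzero prime, so it would be of dimension one unless it had a chain of length two. Such
   a chain, contracted to P and extended by the maximal ideal of P, has length three. *)
case: exc; split.
  exists (fun i => if i is j.+1 then max_ideal Q else [set 0]); split.
    by move=> [_|[_|//]] ; [exact: zero_prime|exact: max_prime_ideal].
  move=> [|//] _; split; first by move=> _ ->; exact: max_ideal0.
  move=> /(_ a) H; move/eqP: a0; apply; apply: H.
  by rewrite eQ; apply/localize_max => //; exact: ideal_sub (prime_ideal_of hq1) q1a.
move=> [c [cp cs]]; apply: no3.
have [z q0z nq1z] : exists2 z, q0 z & ~ q1 z.
  by apply: contrapT => no; apply: nq01 => z q0z; apply: contrapT => nz; apply: no; exists z.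
have Bz := ideal_sub (prime_ideal_of hq0) q0z.
pose co I := I `&` P.
have coP I : is_prime_ideal Q I -> is_prime_ideal P (co I).
  move=> [Ii I1 Ip]; split; [split| |].
  - by move=> u [].
  - by split; [exact: ideal0 Ii|sr].
  - by move=> u v [? ?] [? ?]; split; [exact: (idealD Ii)|sr].
  - by move=> u v hu [? ?]; split; [apply: (idealM Ii) => //; exact: PQ|sr].
  - by move=> [/I1].
  - by move=> u v hu hv [/(Ip _ _ (PQ _ hu) (PQ _ hv)) []]; [left|right].
have inmax I u : is_prime_ideal Q I -> I u -> max_ideal Q u.
  move=> [Ii I1 _] Iu; split; first exact: ideal_sub Ii Iu.
  by move=> [u0 _ ui]; apply: I1; rewrite -(mulVf u0); exact: (idealM Ii).
exists (fun i => if (i <= 2)%N then co (c i) else max_ideal P); split.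
  move=> i _; case: leqP => le; last exact: max_prime_ideal.
  by apply: coP; exact: cp.
move=> [|[|[|//]]] _ /=; last first.
  split; last first.
    move=> /(_ z) H; apply: nq1z; have [] : co (c 2%N) z.
      by apply: H; rewrite eP; apply/localize_max.
    by move=> /(inmax _ _ (cp 2%N isT)); rewrite eQ => /(localize_max h hq1 Bz).
  move=> u [cu Pu]; case: (unit_or_max Pu) => // /(unit_sub PQ) uu.
  by case: (max_nunit (inmax _ _ (cp 2%N isT) cu)).
all: have contr (i : nat) : (i < 2)%N -> co (c i) `<` co (c i.+1).
1,3: move=> lt; have [s ns] := cs i lt; split; first by move=> u [/s].
1,2: move=> H; apply: ns => u cu; have cpi := cp i (ltnW lt); have cpi1 := cp i.+1 lt.
1,2: have := ideal_sub (prime_ideal_of cpi1) cu; rewrite {1}eQ => -[b [s' [hb hs' ns' eu]]].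
1,2: have us : unit_of Q s' by rewrite eQ; apply/localize_unit.
1,2: have [s0 Qs Qsi] := us; have eb : b = s' * u by rewrite eu mulrC divfK.
1,2: have [] : co (c i) b by apply: H; split; [rewrite eb; exact: (idealM (prime_ideal_of cpi1))|exact: BP].
1,2: move=> cb _; rewrite (_ : u = s'^-1 * b); [exact: (idealM (prime_ideal_of cpi))|by rewrite eu mulrC].
all: exact: contr.
Qed.

End SmoothPoints.

(** * From multi-ideals on varieties to local data *)

Section Bridge.
Context (R : realType) (r : nat) (k : closedFieldType) (K : fieldType) (iota : {rmorphism k -> K}).
Implicit Types (B E O P Q q I : set K) (X : set (set K)) (x y z t f g h : K).
Implicit Types (a : 'I_r -> set K -> set K) (S : 'I_r -> set K) (e : 'I_r -> R) (v : 'I_r -> int).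

Definition disc O E v e : R := (logdisc iota O E)%:~R - \sum_(i < r) e i * (v i)%:~R.
Definition lc_over O S e := forall E v, reach iota E O -> (forall i, sord E (S i) (v i)) -> 0 <= disc O E v e.
Definition mld_over O S e : \bar R := ereal_inf [set z | exists E v,
  [/\ reach iota E O, forall i, sord E (S i) (v i) & z = (disc O E v e)%:E]].

Lemma ord_ideal_sord E I n : sord E I n -> ord_ideal E I = n.
Proof.
move=> hn; have [h1 [f [If f0 ef]]] := hn.
rewrite /ord_ideal; case: xgetP => [m _ [[g [Ig g0 eg]] hm]|no]; last first.
  by case: (no n); split=> //; exists f.
apply: (sord_uniq (E := E) (S := I)) => //; split=> //; by exists g.
Qed.

Lemma log_discrepancyE O E a e v : (forall i, sord E (a i O) (v i)) ->
  log_discrepancy iota O E a e = disc O E v e.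
Proof.
move=> hv; rewrite /log_discrepancy /disc /logdisc rmorphD rmorph1; congr (_ - _).
by apply: eq_bigr => i _; rewrite (ord_ideal_sord (hv i)).
Qed.

Lemma multi_ideal_stalk X a P : variety iota X -> multi_ideal iota X a -> X P ->
  forall i, is_ideal P (a i P) /\ nzset P (a i P).
Proof.
move=> vX ma XP i; have [ci [P' [x [XP' ax x0]]]] := ma i.
have [B [hB [q hq eP] SB]] := variety_chart vX XP; have [B' [hB' [q' hq' eP'] SB']] := variety_chart vX XP'.
have [I hI eI] := ci B hB SB; have [I' hI' eI'] := ci B' hB' SB'.
have [[h _] _ frac] := hB; have [[h' _] _ frac'] := hB'.
have gen (C : set K) : is_subring C -> (forall z, exists (a b : K), [/\ C a, C b, b != 0 & z = a / b]) ->
    localize C [set 0] C = setT.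
  move=> hC fC; rewrite eqEsubset; split=> // z _; have [u [v [hu hv v0 ->]]] := fC z.
  by exists u, v; split=> //; apply/eqP.
have [b I'b b0] : exists2 b, I' b & b != 0.
  move: ax; rewrite eP' (eI' _ hq') => -[b [s [Ib _ _ ex]]]; exists b => //.
  by apply: contra_neq x0 => b0; rewrite ex b0 mul0r.
have [c Ic c0] : exists2 c, I c & c != 0.
  (* Both charts contain the generic point, where the two ideals have the same stalk. *)
  have eT : localize B [set 0] I = localize B' [set 0] I'.
    rewrite -(eI _ (zero_prime h)) -(eI' _ (zero_prime h')) !gen //.
  have [_ _ hpr] := zero_prime h'.
  have : localize B' [set 0] I' b.
    by exists b, 1; split=> //; [sr|by apply/eqP; rewrite oner_eq0|rewrite divr1].
  rewrite -eT => -[c [s [Ic _ _ ec]]]; exists c => //.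
  by apply: contra_neq b0 => c0; rewrite ec c0 mul0r.
have id : is_ideal P (a i P) by rewrite eP (eI _ hq); exact: localize_ideal_ring.
split=> //; split; first by move=> z; exact: ideal_sub id.
exists c => //; rewrite eP (eI _ hq); exists c, 1; split=> //; [sr|by case: hq|by rewrite divr1].
Qed.

Lemma bridge X P a x y : normal_variety iota X -> X P -> regpt iota P x y ->
  (forall fs : seq K, size fs = 3 -> kdep iota fs) -> multi_ideal iota X a ->
  let S := fun i => a i P in
  [/\ forall i, nzset P (S i), forall i, is_ideal P (S i),
      forall e, log_canonical iota X P a e <-> lc_over P S e
    & forall e, mld iota X P a e = mld_over P S e].
Proof.
move=> nX XP rp h3 ma S; have vX := proj1 nX.
have st := multi_ideal_stalk vX ma XP.
have nz i : nzset P (S i) by case: (st i).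
have hP := rp_alg rp.
have no3 := no_chain hP h3.
have rp_div E : reach iota E P -> prime_divisor_over iota X E /\ center X E P.
  move=> rE; split; first exact: reach_prime_divisor rE nX XP.
  by split=> //; case: (reach_admissible rE).
have div_rp E : prime_divisor_over iota X E -> center X E P -> reach iota E P.
  by move=> pE [_ dE]; exact: prime_divisor_reach pE rp dE.
have sv E : reach iota E P -> exists v, forall i, sord E (S i) (v i).
  move=> /reach_admissible [[_ hE _] dE].
  have H i : exists n : int, sord E (S i) n.
    by have [n hn] := sord_ex hE (dom_sub dE) (nz i); exists n%:Z.
  by have [v hv] := choice H; exists v.
split=> //; first by move=> i; case: (st i).
- move=> e; split.
    move=> lc E v rE hv; have [pE cE] := rp_div E rE.
    rewrite -(log_discrepancyE _ hv); apply: lc => //.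
    by move=> [_ no2]; apply: no2; exact: regpt_chain rp.
  move=> lc E Q pE cE exc PQ; have eQ := center_is_point nX XP rp no3 pE cE exc PQ.
  rewrite eQ in cE *; have rE := div_rp E pE cE; have [v hv] := sv E rE.
  by rewrite (log_discrepancyE _ hv); exact: lc.
- move=> e; rewrite /mld /mld_over; congr ereal_inf; rewrite eqEsubset; split.
    move=> _ [E [pE cE] <-]; have rE := div_rp E pE cE; have [v hv] := sv E rE.
    by exists E, v; split=> //; rewrite (log_discrepancyE _ hv).
  move=> _ [E [v [rE hv ->]]]; exists E; first exact: rp_div.
  by rewrite (log_discrepancyE _ hv).
Qed.

End Bridge.

(** * The affine plane *)

Section FractionFields.
Import generic_quotient FracField.
Local Open Scope quotient_scope.

Lemma fraction_ex (D : idomainType) (z : {fraction D}) :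
  exists a b : D, b != 0 /\ z = tofrac a / tofrac b.
Proof.
elim/quotW: z => w; exists \n_w, \d_w; have d0 : \d_w != 0 by exact: denom_ratioP.
split=> //; apply: (canRL (mulfK _)); first by rewrite tofrac_eq0.
unlock tofrac; rewrite -[LHS]pi_mul /mulf; apply/eqmodP.
by rewrite /= equivfE !numden_Ratio ?mulr1 ?oner_eq0 // mulrC.
Qed.
End FractionFields.

Lemma poly_split0 (D : nzRingType) (F : {poly D}) : exists G, F = G * 'X + (F`_0)%:P.
Proof.
elim/poly_ind: F => [|G c _]; first by exists 0; rewrite mul0r coef0 polyC0 addr0.
by exists G; rewrite coefD coefMX coefC /= add0r.
Qed.

Section AffinePlane.
Context (k : closedFieldType) (K : fieldType) (iota : {rmorphism k -> K}).
Context (tf : {rmorphism {poly {poly k}} -> K}).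
Hypotheses (tfi : injective tf) (tfC : forall c, iota c = tf c%:P%:P).
Hypothesis tffr : forall z, exists a b, b != 0 /\ z = tf a / tf b.
Implicit Types (F G H s : {poly {poly k}}) (z f g u v : K) (c : k).

Let x := tf 'X%:P.
Let y := tf 'X.
Definition plane : set K := range tf.
Let B := plane.

Lemma tf_neq0 F : F != 0 -> tf F != 0.
Proof. by apply: contra_neq => e; apply: tfi; rewrite e rmorph0. Qed.

Lemma plane_alg : is_subalg iota B.
Proof.
split; last by move=> c; exists c%:P%:P.
split.
- by exists 1; rewrite ?rmorph1.
- by move=> _ _ [F _ <-] [G _ <-]; exists (F - G); rewrite ?rmorphB.
- by move=> _ _ [F _ <-] [G _ <-]; exists (F * G); rewrite ?rmorphM.
Qed.
Let h : is_subring B := proj1 plane_alg.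
Lemma plane_x : B x. Proof. by exists 'X%:P. Qed.
Lemma plane_y : B y. Proof. by exists 'X. Qed.

Lemma plane_gen C : is_subalg iota C -> C x -> C y -> B `<=` C.
Proof.
move=> [hC hCc] Cx Cy _ [F _ <-]; elim/poly_ind: F => [|F a IH]; first by rewrite rmorph0; sr.
rewrite rmorphD rmorphM; have Ca : C (tf a%:P); last by sr.
elim/poly_ind: a => [|a c IHa]; first by rewrite polyC0 rmorph0; sr.
by rewrite polyCD polyCM rmorphD rmorphM -tfC; have := hCc c => ?; sr.
Qed.

Lemma plane_affine : affine_model iota B.
Proof.
split; first exact: plane_alg.
  exists [:: x; y]; rewrite eqEsubset; split.
    move=> z Bz C [hC hs]; apply: plane_gen Bz => //; apply: hs; by rewrite !inE eqxx ?orbT.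
  move=> z; apply; split; first exact: plane_alg.
  by move=> u; rewrite !inE => /orP[]/eqP ->; [exact: plane_x|exact: plane_y].
move=> z; have [a [b [b0 ->]]] := tffr z; exists (tf a), (tf b); split; [by exists a|by exists b|exact: tf_neq0|by []].
Qed.

Lemma plane_decomp F : exists (G : {poly k}) H, F = (F`_0`_0)%:P%:P + 'X%:P * G%:P + 'X * H.
Proof.
have [H eH] := poly_split0 F; have [G eG] := poly_split0 F`_0.
exists G, H; rewrite {1}eH {1}eG polyCD polyCM; ring.
Qed.

Definition orig : set K := [set z | exists2 F : {poly {poly k}}, F`_0`_0 = 0 & z = tf F].
Lemma orig_tf F : orig (tf F) <-> F`_0`_0 = 0.
Proof. by split=> [[G G0 /tfi ->]|F0] //; exists F. Qed.
Lemma coef00M F G : (F * G)`_0`_0 = F`_0`_0 * G`_0`_0.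
Proof. by rewrite coefM big_ord1 coefM big_ord1. Qed.
Lemma orig_prime : is_prime_ideal B orig.
Proof.
split; [split| |].
- by move=> _ [F _ ->]; exists F.
- by exists 0; rewrite ?coef0 ?rmorph0.
- by move=> _ _ [F F0 ->] [G G0 ->]; exists (F + G); rewrite ?rmorphD // !coefD F0 G0 addr0.
- by move=> _ _ [F _ <-] [G G0 ->]; exists (F * G); rewrite ?rmorphM // coef00M G0 mulr0.
- by rewrite -(rmorph1 tf) orig_tf !coef1 /=; apply/eqP; rewrite oner_eq0.
- move=> _ _ [F _ <-] [G _ <-]; rewrite -rmorphM orig_tf coef00M => /eqP.
  by rewrite mulf_eq0 => /orP[]/eqP e; [left|right]; apply/orig_tf.
Qed.
Let O := localize B orig B.
Let hl : is_local O := localize_local h orig_prime.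
Let hO : is_subring O := proj1 hl.
Let BO : B `<=` O := localize_sub h orig_prime.
Let hOa : is_subalg iota O := conj hO (fun c => BO (proj2 plane_alg c)).

Definition Iord n : set {poly {poly k}} := [set F : {poly {poly k}} | forall i j, (i + j < n)%N -> F`_j`_i = 0].
Lemma Iord_le n m : (n <= m)%N -> Iord m `<=` Iord n.
Proof. by move=> le F hF i j lt; apply: hF; exact: leq_trans lt le. Qed.
Lemma IordM n m F G : Iord n F -> Iord m G -> Iord (n + m) (F * G).
Proof.
move=> hF hG i j lt; rewrite coefM coef_sum big1 // => a _; rewrite coefM big1 // => b _.
have [l1|l1] := ltnP (b + a) n; first by rewrite hF ?mul0r.
rewrite hG ?mulr0 //; have := ltn_ord a; have := ltn_ord b; lia.
Qed.
Lemma IordD n F G : Iord n F -> Iord n G -> Iord n (F + G).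
Proof. by move=> hF hG i j lt; rewrite !coefD hF ?hG ?addr0. Qed.
Lemma Iord_x : Iord 1 'X%:P.
Proof. by move=> [|i] [|j] // _; rewrite coefC /= coefX. Qed.
Lemma Iord_y : Iord 1 'X.
Proof. by move=> [|i] [|j] // _; rewrite coefX /= coef0. Qed.

(** Splitting off the nonzero constant term of s leaves a factor that raises the order by one and
    does not affect the lowest part. *)
Lemma Iord_cancel n s F : s`_0`_0 != 0 -> Iord n (s * F) -> Iord n F.
Proof.
move=> s0; elim: n => [|n IH] // hs; have {IH}hF := IH (Iord_le (leqnSn n) hs).
move=> i j; rewrite ltnS => le; pose s' := s - (s`_0`_0)%:P%:P.
have hs' : Iord 1 s'.
  by move=> [|i'] [|j'] // _; rewrite coefB coefC /= coefB coefC /= subrr.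
have := hs i j; rewrite ltnS => /(_ le).
rewrite (_ : s * F = (s`_0`_0)%:P%:P * F + s' * F); last by rewrite /s'; ring.
rewrite coefD coefD (IordM hs' hF) ?add1n ?ltnS // addr0 coefCM coefCM => /eqP.
by rewrite mulf_eq0 (negbTE s0) => /eqP.
Qed.

Lemma M_Iord n z : M O x y n z -> exists s F, [/\ s`_0`_0 != 0, tf s * z = tf F & Iord n F].
Proof.
elim: n z => [|n IH] z.
  move=> [_ [_ [[F _ <-] [s _ <-] ns ->]]]; exists s, F; split=> //.
    by apply: contra_notN ns => /eqP/orig_tf.
  by rewrite mulrCA mulfV ?mulr1 //; apply: prime_neq0 orig_prime ns.
move=> [f [g [/IH [s [F [s0 es hF]]] /IH [s' [F' [s0' es' hF']]] ->]]].
exists (s * s'), ('X%:P * (s' * F) + 'X * (s * F')); split.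
- by rewrite coef00M mulf_neq0.
- by rewrite !(rmorphD, rmorphM) -es -es' -/x -/y; ring.
- rewrite -add1n; apply: IordD; [apply: IordM Iord_x _|apply: IordM Iord_y _].
    by rewrite -[n]add0n; apply: IordM hF.
  by rewrite -[n]add0n; apply: IordM hF'.
Qed.

Lemma M_tf n F : M O x y n (tf F) -> Iord n F.
Proof.
move=> /M_Iord [s [G [s0 e hG]]]; apply: (Iord_cancel s0).
by rewrite (_ : s * F = G) //; apply: tfi; rewrite rmorphM.
Qed.

Lemma tf_form d (p : {poly k}) : form iota d p x y = tf (\poly_(j < d.+1) (p`_(d - j) *: 'X^(d - j))).
Proof.
rewrite poly_def rmorph_sum (reindex_inj rev_ord_inj) /=; apply: eq_bigr => i _.
have le : (i <= d)%N by rewrite -ltnS.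
rewrite subSS subKn // -!mul_polyC rmorphM polyCM rmorphM -tfC /x /y -!rmorphXn /=.
by rewrite polyC_exp.
Qed.

Lemma plane_ind d (p : {poly k}) : (size p <= d.+1)%N -> M O x y d.+1 (form iota d p x y) -> p = 0.
Proof.
move=> sp; rewrite tf_form => /M_tf hp; apply/polyP => i; rewrite coef0.
have [le|lt] := leqP i d; last by rewrite nth_default // (leq_trans sp).
have := hp i (d - i)%N; rewrite subnKC // ltnSn => /(_ isT).
by rewrite coef_poly ltnS leq_subr subKn // coefZ coefXn eqxx mulr1.
Qed.

Lemma plane_sep f : O f -> f != 0 -> exists n, ~ M O x y n f.
Proof.
move=> [_ [_ [[F _ <-] [s _ <-] ns ->]]] f0; apply: contrapT => no.
have s0 := prime_neq0 orig_prime ns.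
have Os : O (tf s) by apply: BO; exists s.
have hF n : Iord n F.
  apply: M_tf; rewrite -(divfK s0 (tf F)) mulrC; apply: (M_mulO hOa) => //.
  by apply: contrapT => nm; apply: no; exists n.
move/eqP: f0; apply; rewrite (_ : F = 0) ?rmorph0 ?mul0r //.
by apply/polyP => j; apply/polyP => i; rewrite !coef0; apply: (hF (i + j).+1).
Qed.

Lemma derivation_ext (d : {poly {poly k}} -> {poly {poly k}}) :
  (forall F G, d (F + G) = d F + d G) -> (forall F G, d (F * G) = F * d G + G * d F) ->
  (forall c, d c%:P%:P = 0) -> exists D : derivation iota, forall F, D (tf F) = tf (d F).
Proof.
move=> dD dM dC.
have d1 : d 1 = 0 by have := dC 1; rewrite !polyC1.
have hr z : exists ab : {poly {poly k}} * {poly {poly k}}, ab.2 != 0 /\ z = tf ab.1 / tf ab.2.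
  by have [a [b [b0 e]]] := tffr z; exists (a, b).
have [rep hrep] := choice hr.
pose qr (a b : {poly {poly k}}) : K := (tf (d a) * tf b - tf a * tf (d b)) / tf b ^+ 2.
pose D z := qr (rep z).1 (rep z).2.
have DE a b : b != 0 -> D (tf a / tf b) = qr a b.
  move=> b0; rewrite /D; have [] := hrep (tf a / tf b); case: (rep _) => a' b' /= b0' e.
  have tb := tf_neq0 b0; have tb' := tf_neq0 b0'.
  have cr : a * b' = a' * b.
    by apply: tfi; rewrite !rmorphM; apply/eqP; rewrite -eqr_div // e.
  have := congr1 (fun F => tf (d F)) cr; rewrite !dM !rmorphD !rmorphM => dcr.
  have tcr : tf a * tf b' = tf a' * tf b by rewrite -!rmorphM cr.
  rewrite /qr; apply/eqP; rewrite eqr_div ?expf_neq0 //; apply/eqP.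
  have -> : (tf (d a') * tf b' - tf a' * tf (d b')) * tf b ^+ 2 =
    (tf b * tf (d a') ) * (tf b * tf b') - (tf a' * tf b) * tf b * tf (d b') by ring.
  have -> : tf b * tf (d a') = tf a * tf (d b') + tf b' * tf (d a) - tf a' * tf (d b).
    by rewrite dcr; ring.
  rewrite -tcr.
  have -> : (tf a * tf (d b') + tf b' * tf (d a) - tf a' * tf (d b)) * (tf b * tf b') - tf a * tf b' * tf b * tf (d b')
    = tf b' * tf (d a) * (tf b * tf b') - (tf a' * tf b) * tf b' * tf (d b) by ring.
  by rewrite -tcr; ring.
have Dadd u v : D (u + v) = D u + D v.
  have [a [b [b0 ->]]] := tffr u; have [a' [b' [b0' ->]]] := tffr v.
  have tb := tf_neq0 b0; have tb' := tf_neq0 b0'.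
  rewrite addf_div // -!rmorphM -rmorphD !DE ?mulf_neq0 // /qr dD !dM !(rmorphD, rmorphM).
  by field; rewrite tb tb'.
have Dmul u v : D (u * v) = u * D v + v * D u.
  have [a [b [b0 ->]]] := tffr u; have [a' [b' [b0' ->]]] := tffr v.
  have tb := tf_neq0 b0; have tb' := tf_neq0 b0'.
  rewrite mulf_div -!rmorphM !DE ?mulf_neq0 // /qr !dM !(rmorphD, rmorphM).
  by field; rewrite tb tb'.
have Dtf F : D (tf F) = tf (d F).
  rewrite -[tf F]divr1 -(rmorph1 tf) DE ?oner_neq0 // /qr d1 rmorph0 rmorph1.
  by rewrite mulr0 subr0 mulr1 expr1n divr1.
have Dc c : D (iota c) = 0 by rewrite tfC Dtf dC rmorph0.
by exists (@Derivation _ _ iota D Dadd Dmul Dc).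
Qed.

Lemma plane_derivations : exists D D' : derivation iota, dd x y D D' != 0.
Proof.
have [|||D hD] := @derivation_ext (map_poly (@deriv k)).
- by move=> F G; rewrite raddfD.
- move=> F G; rewrite [G * _]mulrC; apply/polyP => i; rewrite coefD coef_map /= !coefM.
  rewrite raddf_sum /= -big_split /=; apply: eq_bigr => j _.
  by rewrite derivM !coef_map /= addrC.
- by move=> c; rewrite map_polyC /= derivC.
have [|||D' hD'] := @derivation_ext (@deriv {poly k}).
- exact: derivD.
- by move=> F G; rewrite derivM addrC [G * _]mulrC.
- by move=> c; rewrite derivC.
exists D, D'; rewrite /dd !hD !hD' map_polyC /= derivX derivC derivX.
have -> : map_poly (@deriv k) 'X = 0.
  by apply/polyP => i; rewrite coef_map coefX coef0; case: (i == 1%N); rewrite /= ?derivC ?polyC0 -?polyC1 ?derivC.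
by rewrite polyC1 rmorph0 rmorph1 mul1r mul0r subr0 oner_eq0.
Qed.

Lemma plane_omega : omega iota B x y.
Proof.
pose C := [set f | B f /\ exists f1 f2, [/\ B f1, B f2 & forall D : derivation iota, D f = f1 * D x + f2 * D y]].
have hx := plane_x; have hy := plane_y.
have hC : is_subring C := omega_ring iota x y h.
suff sub : B `<=` C by move=> f /sub [].
apply: plane_gen.
- split=> // c; split; first exact: (proj2 plane_alg).
  by exists 0, 0; split; try sr; move=> D; rewrite der_const; ring.
- by split=> //; exists 1, 0; split; try sr; move=> D; ring.
- by split=> //; exists 0, 1; split; try sr; move=> D; ring.
Qed.

Lemma plane_regpt : regpt iota O x y.
Proof.
have hx := plane_x; have hy := plane_y.
have mx : max_ideal O x by apply/localize_max => //; [exact: orig_prime|apply/orig_tf; rewrite coefC /= coefX].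
have my : max_ideal O y by apply/localize_max => //; [exact: orig_prime|apply/orig_tf; rewrite coefX coef0].
split=> //; try exact: BO.
- move=> f [_ [_ [[F _ <-] [s _ <-] ns ->]]].
  have s0 := prime_neq0 orig_prime ns.
  have s00 : s`_0`_0 != 0 by apply: contra_notN ns => /eqP/orig_tf.
  have [_ Os Osi] : unit_of O (tf s) by apply/localize_unit => //; [exact: orig_prime|exists s].
  have [c cs] : exists c, c * s`_0`_0 = F`_0`_0 by exists (F`_0`_0 / s`_0`_0); rewrite divfK.
  pose T := F - c%:P%:P * s.
  have T0 : T`_0`_0 = 0 by rewrite coefB coefCM coefB coefCM cs subrr.
  have [G [H eT]] := plane_decomp T.
  have OG (g : {poly {poly k}}) : O (tf g) by apply: BO; exists g.
  exists c, (tf G%:P / tf s), (tf H / tf s); split; try by apply: srM.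
  have -> : tf F = tf T + tf (c%:P%:P) * tf s by rewrite -rmorphM -rmorphD subrK.
  rewrite eT T0 !polyC0 add0r rmorphD !rmorphM -tfC -/x -/y; fd.
- move=> g g' hg hg'; apply: unitD_max => //; last by rewrite mulrC; apply: max_idealM.
  by apply: unitD_max => //; [exact: unit1|rewrite mulrC; apply: max_idealM].
- exact: plane_ind.
- exact: plane_sep.
- move=> z; have [a [b [b0 ->]]] := tffr z; exists (tf a), (tf b).
  by split; [apply: BO; exists a|apply: BO; exists b|exact: tf_neq0|].
- apply: (omega_loc hO BO _ plane_omega) => z [a [s [ha hs ns ->]]]; exists a, s; split=> //.
    exact: prime_neq0 orig_prime ns.
  by have [] : unit_of O s by apply/localize_unit => //; exact: orig_prime.
- exact: plane_derivations.
Qed.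

(* The common denominator d is spread over the box by padding each monomial to
   degree N in every element. *)
Lemma Sp_mon_den w D N d fs a : Sp iota w D d -> (forall f, f \in fs -> Sp iota w D (d * f)) ->
  a \in idx (size fs) N -> Sp iota w (D * N * size fs) (d ^+ (N * size fs) * mon fs a).
Proof.
move=> hd; elim: fs a => [|f fs IH] a form /=.
  by move=> _; rewrite !muln0 expr0 mul1r -(rmorph1 iota); exact: Sp_ct.
move=> /allpairsPdep [i [b [hi hb ->]]].
have iN : (i <= N)%N by move: hi; rewrite mem_iota add0n => /ltnW.
rewrite !mulnS exprD mulrACA; apply: SpM; last first.
  by apply: IH hb => g gf; apply: form; rewrite inE gf orbT.
rewrite (_ : d ^+ N * _ = d ^+ (N - i) * (d * f) ^+ i); last by rewrite exprMn mulrA -exprD subnK.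
rewrite (_ : (D * N = D * (N - i) + D * i)%N); last by rewrite -mulnDr subnK.
by apply: SpM; apply: SpX => //; apply: form; rewrite inE eqxx.
Qed.

Lemma plane_dep fs : size fs = 3 -> kdep iota fs.
Proof.
move=> sf; have [_ fg _] := plane_affine.
have sB z : B z -> exists n, Sp iota [:: x; y] n z.
  have hS : is_subalg iota [set z | exists n, Sp iota [:: x; y] n z].
    split; last by move=> c; exists 0%N; exact: Sp_ct.
    split; first by exists 0%N; rewrite -(rmorph1 iota); exact: Sp_ct.
    - move=> u v [n hu] [m hv]; exists (n + m)%N; apply: SpD; first by apply: Sp_le hu; exact: leq_addr.
      rewrite -mulN1r -(rmorph1 iota) -rmorphN; apply: (Sp_le (leq_addl n m)).
      by rewrite -[m]add0n; apply: SpM hv; exact: Sp_ct.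
    - by move=> u v [n hu] [m hv]; exists (n + m)%N; exact: SpM.
  by move: z; apply: (plane_gen hS); exists 1%N; apply: Sp_mem; rewrite !inE eqxx ?orbT.
have [d [d0 Bd Bdf]] : exists d, [/\ d != 0, B d & forall f, f \in fs -> B (d * f)].
  elim: (fs) => [|f l [d [d0 Bd Bl]]]; first by exists 1; split; [exact: oner_neq0|sr|].
  have [a [b [b0 ef]]] := tffr f; have tb := tf_neq0 b0.
  have Ba : B (tf a) by exists a. have Bb : B (tf b) by exists b.
  exists (d * tf b); split; [by rewrite mulf_neq0|by sr|].
  move=> g; rewrite inE => /orP[/eqP ->|/Bl hg].
    by rewrite ef (_ : _ * _ = d * tf a); [sr|fd].
  by rewrite mulrAC; sr.
have [D hD] : exists D, forall z, z \in d :: [seq d * f | f <- fs] -> Sp iota [:: x; y] D z.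
  apply: Sp_list sB _ => z; rewrite inE => /orP[/eqP ->//|/mapP [f ff ->]]; exact: Bdf.
(* The monomials in fs number N^3, and after clearing denominators they lie in a space of dimension
   (3 D N + 1)^2. For N = 16 D^2 + 2 one has N^3 = 16 (D N)^2 + 2 N^2, which is larger. *)
have key (u n : nat) : (1 < n -> (u * 3).+1 * (u * 3).+1 < 16 * (u * u) + 2 * (n * n))%N by nia.
pose N := (16 * (D * D) + 2)%N.
have [L [sL _ hL]] := Sp_span iota [:: x; y] (D * N * size fs).
have [||c [[a ha ca] e]] := @sp_dep _ _ iota _ (idx (size fs) N) (fun a => d ^+ (N * size fs) * mon fs a) L (uniq_idx _ _).
- rewrite size_idx sL sf /= -mulnn !expnS expn0 muln1.
  have -> : (N * (N * N) = 16 * ((D * N) * (D * N)) + 2 * (N * N))%N by rewrite {1}/N; ring.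
  have : (1 < N)%N by rewrite /N addn2.
  by apply: (key (D * N)%N N).
- move=> a ha; apply: hL; apply: Sp_mon_den ha; first by apply: hD; rewrite inE eqxx.
  by move=> f ff; apply: hD; rewrite inE map_f ?orbT.
exists N, c; split; first by exists a.
have dn : d ^+ (N * size fs) != 0 by rewrite expf_neq0.
apply: (mulfI dn); rewrite mulr0 -[RHS]e /msum mulr_sumr.
by apply: eq_bigr => b _; ring.
Qed.

Lemma plane_residue z : B z -> exists c, orig (z - iota c).
Proof.
move=> [F _ <-]; exists F`_0`_0; rewrite tfC -rmorphB; apply/orig_tf.
by rewrite coefB coefC coefB coefC subrr.
Qed.

(* An element integral over B is integral over k(x)[y], hence equal to F / g
   with g in k[x]: the ideal of the F such that F v^i has such a denominator
   for all i is generated, up to k[x], by an element of least degree in y. *)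
Lemma plane_integral_y v (P : {poly K}) : P \is monic -> (forall i, B P`_i) -> root P v ->
  exists (F : {poly {poly k}}) (g : {poly k}), g != 0 /\ v * tf g%:P = tf F.
Proof.
move=> mP BP rv.
pose L z := exists (F : {poly {poly k}}) (g : {poly k}), g != 0 /\ z * tf g%:P = tf F.
have LD z w : L z -> L w -> L (z + w).
  move=> [F [g [g0 e]]] [G [l [l0 e']]]; exists (F * l%:P + G * g%:P), (g * l); split; first by rewrite mulf_neq0.
  by rewrite polyCM rmorphM rmorphD !rmorphM -e -e'; ring.
have LM z w : L z -> L w -> L (z * w).
  move=> [F [g [g0 e]]] [G [l [l0 e']]]; exists (F * G), (g * l); split; first by rewrite mulf_neq0.
  by rewrite polyCM !rmorphM -e -e'; ring.
have Ltf F : L (tf F) by exists F, 1; rewrite oner_neq0 polyC1 rmorph1 mulr1.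
have Lg z (g : {poly k}) : g != 0 -> L (z * tf g%:P) -> L z.
  move=> g0 [F [l [l0 e]]]; exists F, (g * l); split; first by rewrite mulf_neq0.
  by rewrite polyCM rmorphM mulrA.
have [a [b [b0 ev]]] := tffr v; have tb := tf_neq0 b0.
pose n := (size P).-1.
have sP : size P = n.+1 by rewrite /n prednK // size_poly_gt0 monic_neq0.
have vn : v ^+ n = - \sum_(i < n) P`_i * v ^+ i.
  move: rv; rewrite rootE horner_coef sP big_ord_recr /=.
  by rewrite -[n]/(n.+1.-1) -sP -lead_coefE (monicP mP) mul1r addrC addr_eq0 => /eqP.
pose D F := forall i : nat, L (tf F * v ^+ i).
have Db : D (b ^+ n).
  move=> i; elim/ltn_ind: i => i IH; have [lt|le] := ltnP i n.
    rewrite (_ : _ * _ = tf (b ^+ (n - i) * a ^+ i)) //.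
    rewrite ev expr_div_n !(rmorphM, rmorphXn) -{1}(subnK (ltnW lt)) exprD.
    have bi : tf b ^+ i != 0 by rewrite expf_neq0.
    fd.
  rewrite -(subnK le) exprD vn mulrN mulr_sumr -sumrN mulr_sumr.
  apply: big_ind; [by rewrite -(rmorph0 tf)|exact: LD|move=> j _].
  have [Q _ eQ] := BP j.
  rewrite (_ : _ * _ = tf (- Q) * (tf (b ^+ n) * v ^+ (i - n + j))); last first.
    by rewrite rmorphN eQ exprD; ring.
  apply: LM => //; apply: IH; have := ltn_ord j; lia.
have [|m [F [DF F0] sF] mF] := @nat_min (fun m => exists2 F, D F /\ F != 0 & size F = m).
  by exists (size (b ^+ n)), (b ^+ n); rewrite // expf_neq0.
have [G [g [g0 eG]]] := DF 1%N; rewrite expr1 in eG.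
have DG : D G.
  move=> i; rewrite -eG (_ : _ * _ = tf g%:P * (tf F * v ^+ i.+1)); first by apply: LM.
  by rewrite exprS; ring.
have [A [Q [r [A0 e sr]]]] : exists (A : {poly k}) Q r, [/\ A != 0, A *: G = Q * F + r & (size r < size F)%N].
  exists (lead_coef F ^+ scalp G F), (G %/ F), (G %% F); split.
  - by rewrite expf_neq0 // lead_coef_eq0.
  - exact: Pdiv.Idomain.divp_eq.
  - exact: Pdiv.Idomain.ltn_modpN0.
have Dr : D r.
  move=> i; have -> : r = A%:P * G - Q * F by rewrite mul_polyC e addrC addKr.
  rewrite rmorphB !rmorphM mulrBl -!mulrA -mulNr -rmorphN.
  by apply: LD; apply: LM.
have r0 : r = 0.
  apply/eqP; case: eqVneq => // r0; have := mF (size r); rewrite -sF leqNgt sr => H.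
  by have : false by apply: H; exists r.
exists Q, (A * g); split; first by rewrite mulf_neq0.
apply: (mulIf (tf_neq0 F0)).
have e' : tf A%:P * tf G = tf Q * tf F by rewrite -!rmorphM mul_polyC e r0 addr0.
by rewrite -e' -eG polyCM rmorphM; ring.
Qed.

(** Evaluation at x = c maps the plane onto the domain k[y], and its kernel is generated by x -
    c. *)
Lemma plane_linear_prime c u v : B u -> B v -> (exists2 w, B w & u * v = (x - iota c) * w) ->
  (exists2 w, B w & u = (x - iota c) * w) \/ (exists2 w, B w & v = (x - iota c) * w).
Proof.
move=> [F _ <-] [G _ <-] [_ [H _ <-] e].
have ex : x - iota c = tf ('X - c%:P)%:P by rewrite tfC -rmorphB -polyCB.
have e' : F * G = ('X - c%:P)%:P * H by apply: tfi; rewrite !rmorphM e ex.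
have ker S : map_poly (horner_eval c) S = 0 -> exists2 w, B w & tf S = (x - iota c) * w.
  move=> S0; have hS j : exists T, S`_j = T * ('X - c%:P).
    have : root S`_j c by rewrite rootE -[_.[c]]/(horner_eval c _) -coef_map S0 coef0.
    by move/factor_theorem.
  have [T hT] := choice hS.
  exists (tf (\poly_(j < size S) T j)); first by exists (\poly_(j < size S) T j).
  rewrite ex -rmorphM; congr (tf _); apply/polyP => j; rewrite coefCM coef_poly.
  by case: ltnP => le; [rewrite hT mulrC|rewrite nth_default ?mulr0].
have : map_poly (horner_eval c) F * map_poly (horner_eval c) G = 0.
  rewrite -rmorphM e' rmorphM /= map_polyC /= /horner_eval hornerD hornerX hornerN hornerC subrr.
  by rewrite polyC0 mul0r.
by move/eqP; rewrite mulf_eq0 => /orP[]/eqP/ker; [left|right].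
Qed.

(** The denominator g in k[x] splits into linear factors, each prime in the plane; [integral_prime]
    removes them one by one. *)
Lemma plane_normal : integrally_closed B.
Proof.
move=> v P mP BP rv; have [F [g [g0 e]]] := plane_integral_y mP BP rv.
have [s es] := closed_field_poly_normal g.
have l0 : lead_coef g != 0 by rewrite lead_coef_eq0.
have Bc c : B (iota c) := proj2 plane_alg c.
have Bl : B (tf (\prod_(z <- s) ('X - z%:P))%:P * v).
  rewrite (_ : _ * _ = iota (lead_coef g)^-1 * tf F).
    by apply: (srM h) => //; exists F.
  have eg : tf g%:P = iota (lead_coef g) * tf (\prod_(z <- s) ('X - z%:P))%:P.
    by rewrite {1}es -mul_polyC polyCM rmorphM tfC.
  have i0 : iota (lead_coef g) != 0 by rewrite fmorph_eq0.
  by rewrite -e eg fmorphV; fd.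
elim: s {es e} v P mP BP rv Bl => [|c s IH] v P mP BP rv.
  by rewrite big_nil polyC1 rmorph1 mul1r.
rewrite big_cons polyCM rmorphM -mulrA polyCB rmorphB -tfC -/x mulrCA => Bv.
have hx := plane_x; have hcc := Bc c.
have Bxc : B (x - iota c) by sr.
have [|Q [mQ BQ rQ]] := integral_scale (u := x - iota c) h mP rv Bxc.
  by move=> i _; have := BP i => ?; sr.
have Bw : B ((x - iota c) * v) by exact: (IH _ Q mQ BQ rQ Bv).
have xc0 : x - iota c != 0.
  by rewrite tfC -rmorphB -polyCB tf_neq0 // polyC_eq0 polyXsubC_eq0.
apply: (integral_prime (y := x - iota c) (N := 1) h Bxc xc0 _ mP BP rv); last by rewrite expr1.
by move=> a b; exact: plane_linear_prime.
Qed.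

Lemma localize_normal q : is_prime_ideal B q -> integrally_closed (localize B q B).
Proof.
move=> hq v P mP BP rv; set Q := localize B q B in BP.
have hQ : is_subring Q := localize_subring h hq.
have [s [Bs ns Bsi]] : exists s : K, [/\ B s, ~ q s & forall i, B (s * P`_i)].
  have : forall n, exists s : K, [/\ B s, ~ q s & forall i, (i < n)%N -> B (s * P`_i)].
    elim=> [|n [s [Bs ns Bsi]]]; first by exists 1; split=> //; [sr|by case: hq].
    have [a [t [Ba Bt nt e]]] := BP n; exists (s * t); split; [by sr|exact: (primeM hq)|].
    move=> i; rewrite ltnS leq_eqVlt => /orP[/eqP ->|/Bsi hi]; last by rewrite mulrAC; sr.
    by rewrite e (_ : _ * _ = s * a); [sr|have t0 := prime_neq0 hq nt; fd].
  move=> /(_ (size P)) [s [Bs ns Bsi]]; exists s; split=> // i; have [/Bsi //|le] := ltnP i (size P).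
  by rewrite nth_default // mulr0; sr.
have s0 := prime_neq0 hq ns.
have [|T [mT BT rT]] := integral_scale (u := s) h mP rv Bs; first by move=> i _.
exists (s * v), s; split=> //; first exact: (plane_normal mT BT rT).
by rewrite mulrAC mulfV ?mul1r.
Qed.

Lemma plane_variety : normal_variety iota (Spec B).
Proof.
split; last by move=> P [q hq ->]; exact: localize_normal.
split.
  exists 0%N, (fun=> B); split; first by move=> _; exact: plane_affine.
  rewrite eqEsubset; split=> [P SP|P [_ _ SP]] //; by exists ord0.
move=> V P Q _ SP SQ dP dQ; by rewrite (ctr_eq h SP dP) (ctr_eq h SQ dQ).
Qed.

Lemma chain_trunc (P : set K) m (c : nat -> set K) : (3 <= m)%N -> krull_chain P m c -> krull_chain P 3 c.
Proof.
move=> le [cp cs]; split=> i lt; [apply: cp|apply: cs]; exact: leq_trans lt le.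
Qed.

Theorem plane_smooth : smooth_surface_point iota (Spec B) O.
Proof.
have SO : Spec B O by exists orig => //; exact: orig_prime.
have rp := plane_regpt.
have kd : krull_dim O 2.
  by split; [exact: regpt_chain rp|exact: (no_chain hOa plane_dep)].
split.
- exact: plane_variety.
- split; first by exists O.
  move=> P m SP [[c hch] _]; rewrite leqNgt; apply/negP => lt.
  have hP : is_subalg iota P := proj1 (variety_point (proj1 plane_variety) SP).
  by apply: (no_chain hP plane_dep); exists c; exact: chain_trunc hch.
- split=> // Q [q hq ->] sub; have hqi := prime_ideal_of hq.
  rewrite /O (_ : q = orig) // eqEsubset.
  have oq : orig `<=` q.
    move=> a oa; apply: contrapT => na; have Ba := ideal_sub (prime_ideal_of orig_prime) oa.
    have : unit_of O a by apply: unit_sub sub _; apply/localize_unit.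
    by move/(localize_unit h orig_prime Ba).
  split=> // a qa; have [c oc] := plane_residue (ideal_sub hqi qa).
  have [c0|c0] := eqVneq c 0; first by move: oc; rewrite c0 rmorph0 subr0.
  have [_ q1 _] := hq; case: q1; rewrite -(rmorph1 iota) -(mulVf c0) rmorphM.
  apply: (idealM hqi); first exact: (proj2 plane_alg).
  by rewrite -(subKr a (iota c)); apply: (idealB h hqi) => //; exact: oq.
- exists 2; split=> //; exists (fun i => if i == ord0 then x else y).
  rewrite eqEsubset; split=> z; first by move=> /(rp_max rp) [f [g [form hg ->]]];
    exists (fun i => if i == ord0 then f else g); split; [move=> i; case: ifP|rewrite big_ord_recl big_ord1 /=; ring].
  move=> [c [hcO ->]]; apply/(rp_max rp); rewrite big_ord_recl big_ord1 /=.
  by exists (c ord0), (c (lift ord0 ord0)); split; [exact: hcO|exact: hcO|ring].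
Qed.

End AffinePlane.

(** * Monomial ideals on the plane *)

Section MonomialIdeals.
Context (k : closedFieldType) (K : fieldType) (iota : {rmorphism k -> K}).
Context (x y : K).
Implicit Types (B E O P Q q I : set K) (z f g : K) (W : set (nat * nat)).

(** As a function of the ring Q this is a family of stalks. W may be infinite, whence the finite
    sublists. *)
Definition monideal W Q : set K := [set z | exists l : seq (nat * nat),
  (forall w, w \in l -> W w) /\ idl Q [seq x ^+ w.1 * y ^+ w.2 | w <- l] z].

Lemma monideal_ideal W Q : is_subring Q -> Q x -> Q y -> is_ideal Q (monideal W Q).
Proof.
move=> h hx hy; split.
- move=> z [l [_]]; apply: idl_ind; [sr|by move=> a b; exact: srD|].
  by move=> a _ ha /mapP [w _ ->]; sr.
- by exists [::].
- move=> z z' [l [hl hz]] [l' [hl' hz']]; exists (l ++ l'); split.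
    by move=> w; rewrite mem_cat => /orP[/hl|/hl'].
  rewrite map_cat; apply: idlD => //; [apply: idl_sub hz|apply: idl_sub hz'] => // u ul;
  by rewrite mem_cat ul ?orbT.
- by move=> a z ha [l [hl hz]]; exists l; split=> //; exact: idlM.
Qed.

Lemma monideal_mem W Q w : is_subring Q -> W w -> monideal W Q (x ^+ w.1 * y ^+ w.2).
Proof.
move=> h Ww; exists [:: w]; split; first by move=> v; rewrite inE => /eqP ->.
by apply: idl_mem => //; rewrite inE eqxx.
Qed.

Lemma monideal_localize W B q : is_subring B -> is_prime_ideal B q -> B x -> B y ->
  monideal W (localize B q B) = localize B q (monideal W B).
Proof.
move=> h hq hx hy; have sub := localize_sub h hq; have h' := localize_subring h hq.
have hI := localize_ideal_ring h hq (monideal_ideal W h hx hy).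
rewrite eqEsubset; split=> z.
  move=> [l [hl]]; apply: idl_in; [by move=> ? ?; exact: (idealD hI)|by move=> ? ?; exact: (idealM hI)|exact: ideal0 hI|].
  move=> _ /mapP [w /hl Ww ->]; exists (x ^+ w.1 * y ^+ w.2), 1; split; [exact: monideal_mem|by sr|by case: hq|by rewrite divr1].
move=> [a [s [[l [hl ha]] hs ns ->]]]; exists l; split=> //.
have [_ _ si] : unit_of (localize B q B) s by apply/localize_unit.
by rewrite mulrC; apply: idlM => //; apply: idl_sub ha.
Qed.

Lemma proper_in_prime B I : is_subring B -> noeth B -> is_ideal B I -> ~ I 1 ->
  exists q, is_prime_ideal B q /\ I `<=` q.
Proof.
move=> h hn hI I1.
have [|| q [[qi Iq q1] qmax]] := @noeth_max _ B [set J | [/\ is_ideal B J, I `<=` J & ~ J 1]] hn.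
- by move=> J [].
- by exists I; split.
exists q; split=> //; split=> // a b ha hb qab; apply: contrapT => /not_orP [na nb].
have big c : B c -> ~ q c -> exists u v, [/\ q u, B v & 1 = u + c * v].
  move=> hc nc; apply: contrapT => no; apply: nc.
  apply: (qmax [set z | exists u v, [/\ q u, B v & z = u + c * v]]).
  - split.
    + split.
      * by move=> _ [u [v [/(ideal_sub qi) hu hv ->]]]; sr.
      * by exists 0, 0; split; [exact: ideal0 qi|sr|ring].
      * move=> _ _ [u [v [hu hv ->]]] [u' [v' [hu' hv' ->]]]; exists (u + u'), (v + v').
        by split; [exact: (idealD qi)|sr|ring].
      * move=> d _ hd [u [v [hu hv ->]]]; exists (d * u), (d * v).
        by split; [exact: (idealM qi)|sr|ring].
    + by move=> z /Iq qz; exists z, 0; split=> //; [sr|ring].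
    + by move=> [u [v [hu hv e]]]; apply: no; exists u, v.
  - by move=> z qz; exists z, 0; split=> //; [sr|ring].
  - by exists 0, 1; split; [exact: ideal0 qi|sr|ring].
have [u [v [qu hv e]]] := big b hb nb; apply: na.
rewrite -[a]mulr1 e mulrDr mulrA; apply: (idealD qi); first exact: (idealM qi).
by rewrite mulrC; apply: (idealM qi).
Qed.

(* B' is the intersection of its localizations, and each contains B. *)
Lemma chart_contains B B' : is_subring B -> affine_model iota B' -> Spec B' `<=` Spec B -> B `<=` B'.
Proof.
move=> h hB' sub z Bz; have [[h' _] _ _] := hB'; have hn := affine_noeth hB'.
pose I := [set d | B' d /\ B' (d * z)].
have hI : is_ideal B' I.
  split.
  - by move=> d [].
  - by split; rewrite ?mul0r; sr.
  - by move=> a b [? ?] [? ?]; split; [sr|rewrite mulrDl; sr].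
  - by move=> a b ? [? ?]; split; [sr|rewrite -mulrA; sr].
have [[_ I1]|n1] := EM (I 1); first by rewrite mul1r in I1.
have [q [hq Iq]] := proper_in_prime h' hn hI n1.
have SQ : Spec B' (localize B' q B') by exists q.
have [a [s [ha hs ns ez]]] := Spec_sub h (sub _ SQ) Bz.
have s0 := prime_neq0 hq ns.
by case: ns; apply: Iq; split=> //; rewrite ez mulrC divfK.
Qed.

Lemma monideal_coherent W B : is_subring B -> B x -> B y -> coherent_ideal iota (Spec B) (monideal W).
Proof.
move=> h hx hy B' hB' sub; have BB := chart_contains h hB' sub; have [[h' _] _ _] := hB'.
exists (monideal W B'); first by apply: monideal_ideal => //; exact: BB.
by move=> q hq; apply: monideal_localize => //; exact: BB.
Qed.

Lemma monideal_multi r (W : 'I_r -> set (nat * nat)) B O : is_subring B -> B x -> B y -> Spec B O ->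
  regpt iota O x y -> (forall i, W i !=set0) -> multi_ideal iota (Spec B) (fun i => monideal (W i)).
Proof.
move=> h hx hy SO rp hW i; split; first exact: monideal_coherent.
have [w Ww] := hW i; exists O, (x ^+ w.1 * y ^+ w.2); split=> //.
  by apply: monideal_mem => //; exact: proj1 (rp_alg rp).
by rewrite mulf_neq0 // expf_neq0 // ?(rp_x0 rp) ?(rp_y0 rp).
Qed.

Definition is_minweight W (p q m : nat) := (exists2 w, W w & (p * w.1 + q * w.2)%N = m) /\
  forall w, W w -> (m <= p * w.1 + q * w.2)%N.

Lemma monideal_sord W E O (p q m : nat) : dvr E -> is_subring O -> O `<=` E -> O x -> O y -> x != 0 -> y != 0 ->
  ord E x = p%:Z -> ord E y = q%:Z -> is_minweight W p q m -> sord E (monideal W O) m%:Z.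
Proof.
move=> hE hO OE hx hy x0 y0 ex ey [[w0 Ww0 e0] hm].
have omega w : ord E (x ^+ w.1 * y ^+ w.2) = (p * w.1 + q * w.2)%N%:Z.
  by rewrite (ordM hE) ?expf_neq0 // !(ordX hE) // ex ey; lia.
split; last first.
  exists (x ^+ w0.1 * y ^+ w0.2); split; [exact: monideal_mem|by rewrite mulf_neq0 ?expf_neq0|by rewrite omega e0].
move=> f [l [hl form]] f0; pose S := [set z | z = 0 \/ z != 0 /\ m%:Z <= ord E z].
have : S f; last by case=> [e|[]//]; rewrite e eqxx in f0.
apply: idl_ind form; first by left.
  move=> a b; have [-> _ hb|a0 [//|[_ ha]]] := eqVneq a 0; first by rewrite add0r.
    by move/eqP; rewrite (negbTE a0).
  have [-> _|b0 [/eqP|[_ hb]]] := eqVneq b 0; first by rewrite addr0; right.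
    by rewrite (negbTE b0).
  have [->|ab0] := eqVneq (a + b) 0; first by left.
  by right; split=> //; apply: (ordD hE).
move=> a _ Oa /mapP [w /hl/hm lw ->]; have [->|a0] := eqVneq a 0; first by left; rewrite mul0r.
right; split; first by rewrite !mulf_neq0 ?expf_neq0.
rewrite (ordM hE) ?mulf_neq0 ?expf_neq0 // omega.
have /(ord_ge0 hE a0) : E a by exact: OE.
by move: lw; lia.
Qed.

End MonomialIdeals.

Theorem monomial_model (k : closedFieldType) r (W : 'I_r -> set (nat * nat)) :
  (forall i, W i !=set0) -> exists (K : fieldType) (iota : {rmorphism k -> K})
    (X : set (set K)) (O : set K) (x y : K),
    [/\ smooth_surface_point iota X O, multi_ideal iota X (fun i => monideal x y (W i)),
        regpt iota O x y & forall fs : seq K, size fs = 3 -> kdep iota fs].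
Proof.
move=> hW; pose K : fieldType := {fraction {poly {poly k}}}.
pose tf : {rmorphism {poly {poly k}} -> K} := @tofrac {poly {poly k}}.
pose iota : {rmorphism k -> K} := tf \o (polyC \o polyC).
have tfi : injective tf by move=> F G /eqP; rewrite tofrac_eq => /eqP.
have tfC (c : k) : iota c = tf c%:P%:P by [].
have tffr := @fraction_ex {poly {poly k}}.
have rp := plane_regpt tfi tfC tffr.
have hx := plane_x tf; have hy := plane_y tf.
have [h hc] := plane_alg tfC.
have sm := plane_smooth tfi tfC tffr; have [_ _ [SO _] _] := sm.
exists K, iota, (Spec (plane tf)), (localize (plane tf) (orig tf) (plane tf)), (tf 'X%:P), (tf 'X); split; [exact: sm| |exact: rp|exact: plane_dep tfi tfC tffr].
exact: (monideal_multi h hx hy SO rp hW).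
Qed.

(** * Comparison of characteristics *)

Section ToricData.
Context (R : realType) (r : nat).
Implicit Types (e : 'I_r -> R).

Definition minweight (W : set (nat * nat)) (p q : nat) : nat := xget 0%N [set m | is_minweight W p q m].

Lemma wmP (W : set (nat * nat)) p q : W !=set0 -> is_minweight W p q (minweight W p q).
Proof.
move=> [w0 Ww0]; rewrite /minweight; case: xgetP => // no.
have [|n [w Ww e] hn] := @nat_min (fun n => exists2 w, W w & (p * w.1 + q * w.2)%N = n).
  by exists (p * w0.1 + q * w0.2)%N, w0.
case: (no n); split; first by exists w.
by move=> v Wv; apply: hn; exists v.
Qed.

Lemma is_minweight_scale (W : set (nat * nat)) g p q m : is_minweight W p q m -> is_minweight W (g * p) (g * q) (g * m).
Proof.
move=> [[w Ww ew] hm]; split; first by exists w; rewrite // -ew mulnDr !mulnA.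
by move=> v Wv; rewrite -!mulnA -mulnDr leq_mul2l hm ?orbT.
Qed.

Definition weight (W : 'I_r -> set (nat * nat)) e p q : R :=
  (p + q)%:R - \sum_(i < r) e i * (minweight (W i) p q)%:R.

(* The discrepancies over O are computed by the weighted blow-ups, whose
   weights only depend on W. *)
Definition toric_data (k : closedFieldType) (K : fieldType) (iota : {rmorphism k -> K})
    (O : set K) (S : 'I_r -> set K) (W : 'I_r -> set (nat * nat)) e :=
  (forall p q, coprime p q -> (0 < p)%N -> (0 < q)%N -> exists E v,
    [/\ reach iota E O, forall i, sord E (S i) (v i) & disc iota O E v e = weight W e p q]) /\
  (forall E v, reach iota E O -> (forall i, sord E (S i) (v i)) -> exists p q n,
    [/\ (0 < n)%N, coprime p q, (0 < p)%N, (0 < q)%N & n%:R * weight W e p q <= disc iota O E v e]).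

Section Data.
Context (k : closedFieldType) (K : fieldType) (iota : {rmorphism k -> K}).
Context (O : set K) (S : 'I_r -> set K).

Lemma toric_lc (W : 'I_r -> set (nat * nat)) e : toric_data iota O S W e ->
  lc_over iota O S e <-> forall p q, coprime p q -> (0 < p)%N -> (0 < q)%N -> 0 <= weight W e p q.
Proof.
move=> [h1 h2]; split=> [lc p q cpq p0 q0|hw E v rE hv].
  by have [E [v [rE hv <-]]] := h1 p q cpq p0 q0; exact: lc.
have [p [q [n [n0 cpq p0 q0 le]]]] := h2 E v rE hv.
by apply: le_trans le; apply: mulr_ge0; rewrite ?ler0n // hw.
Qed.

Lemma toric_mld (W : 'I_r -> set (nat * nat)) e : toric_data iota O S W e -> lc_over iota O S e ->
  mld_over iota O S e = ereal_inf [set z | exists p q,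
    [/\ coprime p q, (0 < p)%N, (0 < q)%N & z = (weight W e p q)%:E]].
Proof.
move=> td lc; have /(toric_lc td) hw := lc; have [h1 h2] := td.
apply/eqP; rewrite eq_le; apply/andP; split; apply/ereal_infP.
  move=> _ [p [q [cpq p0 q0 ->]]]; apply: ereal_inf_lbound.
  by have [E [v [rE hv <-]]] := h1 p q cpq p0 q0; exists E, v.
move=> _ [E [v [rE hv ->]]]; have [p [q [n [n0 cpq p0 q0 le]]]] := h2 E v rE hv.
apply: (@le_trans _ _ (weight W e p q)%:E); first by apply: ereal_inf_lbound; exists p, q.
rewrite lee_fin; apply: le_trans le; rewrite -[X in X <= _]mul1r.
by apply: ler_wpM2r; [exact: hw|rewrite ler1n].
Qed.

Lemma sord_ge0 E i n : nzset O (S i) -> reach iota E O -> sord E (S i) n -> 0 <= n.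
Proof.
move=> [SO _] /reach_admissible [[_ hE _] dE] [_ [f [Sf f0 <-]]].
by apply/(ord_ge0 hE f0); apply: (dom_sub dE); exact: SO.
Qed.

Lemma lc_mono e e' : (forall i, nzset O (S i)) -> (forall i, e' i <= e i) ->
  lc_over iota O S e -> lc_over iota O S e'.
Proof.
move=> nz le lc E v rE hv; apply: le_trans (lc E v rE hv) _; rewrite /disc lerD2l lerN2.
apply: ler_sum => i _; apply: ler_wpM2r => //; rewrite ler0z.
exact: sord_ge0 rE (hv i).
Qed.

Lemma mld_infinite e : (forall i, nzset O (S i)) -> (forall i, 0 <= e i) -> ~ lc_over iota O S e ->
  mld_over iota O S e = -oo%E.
Proof.
move=> nz e0 nlc; have [E [v [rE hv neg]]] : exists E v, [/\ reach iota E O,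
    forall i, sord E (S i) (v i) & disc iota O E v e < 0].
  apply: contrapT => no; apply: nlc => E v rE hv; rewrite leNgt; apply/negP => lt.
  by apply: no; exists E, v.
apply: eq_ninfty => A; have [E' [w [rE' hw lt]]] := negative_diverges A nz e0 rE hv neg.
apply: ge_ereal_inf; exists (disc iota O E' w e)%:E; first by exists E', w.
by rewrite lee_fin ltW.
Qed.

(* Blowing up once, adjunction on the exceptional curve bounds the orders of
   suitable elements of the strict transforms. *)
Lemma small_lc x y e : regpt iota O x y -> (forall i, nzset O (S i)) -> (forall i, 0 <= e i) ->
  \sum_(i < r) e i * (smult O x y (S i))%:R <= 1 -> lc_over iota O S e.
Proof.
move=> rp nz e0 sm E v rE hv; have [aE dE] := reach_admissible rE; have [hEa hE _] := aE.
have key x' y' : regpt iota O x' y' -> dominates E (qt iota O x' y') -> 0 <= disc iota O E v e.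
  move=> rp' dq; have sm' : \sum_(i < r) e i * (smult O x' y' (S i))%:R <= 1.
    by rewrite (eq_bigr (fun i => e i * (smult O x y (S i))%:R)) // => i _; rewrite (smult_change rp rp').
  have [F [d [hF hd]]] := small_good rp' nz e0 sm'.
  have rq := regpt_qt rp'; have y0 := rp_y0 rp'.
  pose l := [seq (e i, F i, d i) | i <- index_enum 'I_r].
  have [n en] : exists n : nat, logdisc iota (qt iota O x' y') E = n%:Z.
    by have := logdisc_ge1 rq aE dq; case: (logdisc _ _ _) => // n _; exists n.
  have hl : \sum_(w <- l) w.1.1 * w.2%:R <= 1 by rewrite big_map.
  have hle : logdisc iota (qt iota O x' y') E <= n%:Z by rewrite en.
  have hic w : w \in l -> 0 <= w.1.1 /\ icz (qt iota O x' y') (x' / y') y' w.1.2 w.2.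
    by move=> /mapP [i _ ->]; split; [exact: e0|exact: (hF i).2].
  have := adjunction rq aE dq hle hic hl.
  rewrite big_map /= => adj.
  have lq := logdisc_qt rp' aE dq; rewrite /disc lq rmorphD /=.
  have yE : 0 < (ord E y')%:~R :> R.
    by rewrite ltr0z; case: (dom_ord rp' hE dE).
  have le i : e i * (v i)%:~R <= e i * (ord E (F i))%:~R + e i * (smult O x' y' (S i))%:R * (ord E y')%:~R.
    rewrite -mulrA -mulrDr; apply: ler_wpM2l => //.
    have [[f Sf ef] _] := hF i; have [hmin _] := hv i.
    have F0 := icz_neq0 rq (hF i).2.
    have f0 : f != 0 by apply: contra_neq F0 => f0; rewrite -ef f0 mul0r.
    have := hmin f Sf f0; have -> : ord E f = ord E (F i) + (smult O x' y' (S i))%:Z * ord E y'.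
      by rewrite -ef (ord_div hE) ?expf_neq0 // (ordX hE) // subrK.
    by rewrite -(ler_int R) rmorphD rmorphM.
  have le2 : \sum_(i < r) e i * (v i)%:~R <= \sum_(i < r) e i * (ord E (F i))%:~R +
      (\sum_(i < r) e i * (smult O x' y' (S i))%:R) * (ord E y')%:~R.
    by rewrite mulr_suml -big_split /=; apply: ler_sum => i _; exact: le.
  by move: le2 adj sm' yE; clear; nra.
case: (center_cases rp hEa hE dE) => [eE|[c dq]|dq].
- rewrite /disc eE (logdisc_ex rp) (eq_bigr (fun i => e i * (smult O x y (S i))%:R)).
    by rewrite subr_ge0; apply: le_trans sm _; rewrite ler1n.
  move=> i _; have h1 := hv i; rewrite eE in h1.
  by rewrite (sord_uniq h1 (sord_exc rp (nz i))).
- by apply: (key _ _ _ dq); apply: (regpt_shift rp); exact: (proj2 (rp_alg rp)).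
- by apply: (key _ _ _ dq); exact: regpt_swap.
Qed.

(** The orders of monomial ideals along E are determined by those of x and y, which are g times
    coprime weights p and q; and [logdisc_ge] bounds the log discrepancy of E by g (p + q) from
    below. *)
Lemma plane_toric_data x y (W : 'I_r -> set (nat * nat)) e : regpt iota O x y -> (forall i, W i !=set0) -> (forall i, 0 <= e i) ->
  toric_data iota O (fun i => monideal x y (W i) O) W e.
Proof.
move=> rp hW e0; have hO := proj1 (rp_alg rp).
have [hx hy] := (rp_x rp, rp_y rp); have [x0 y0] := (rp_x0 rp, rp_y0 rp).
have ms E p q i m : admissible iota E -> dominates E O -> ord E x = p%:Z -> ord E y = q%:Z ->
    is_minweight (W i) p q m -> sord E (monideal x y (W i) O) m%:Z.
  by move=> [_ hE _] dE ex ey; apply: monideal_sord => //; exact: dom_sub.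
split.
  move=> p q cpq p0 q0; have [E tE] := toric_exists rp cpq p0 q0.
  have [ex ey el _] := toric_facts tE; have rE := toric_reach tE; have [aE dE] := reach_admissible rE.
  exists E, (fun i => (minweight (W i) p q)%:Z); split=> //.
    by move=> i; apply: (ms _ p q) => //; exact: wmP.
  by rewrite /disc el /weight.
move=> E v rE hv; have [aE dE] := reach_admissible rE; have [_ hE _] := aE.
have [gx gy] := dom_ord rp hE dE.
have [a ea] : exists a : nat, ord E x = a%:Z by move: gx; case: (ord E x) => // n _; exists n.
have [b eb] : exists b : nat, ord E y = b%:Z by move: gy; case: (ord E y) => // n _; exists n.
have a0 : (0 < a)%N by move: gx; rewrite ea.
have b0 : (0 < b)%N by move: gy; rewrite eb.
pose g := gcdn a b; have g0 : (0 < g)%N by rewrite gcdn_gt0 a0.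
pose p := (a %/ g)%N; pose q := (b %/ g)%N.
have ap : a = (g * p)%N by rewrite mulnC divnK // dvdn_gcdl.
have bq : b = (g * q)%N by rewrite mulnC divnK // dvdn_gcdr.
have cpq : coprime p q by rewrite /coprime -(eqn_pmul2l g0) muln_gcdr -ap -bq muln1.
have p0 : (0 < p)%N by move: a0; rewrite ap muln_gt0 => /andP[].
have q0 : (0 < q)%N by move: b0; rewrite bq muln_gt0 => /andP[].
exists p, q, g; split=> //.
have ev i : v i = (g * minweight (W i) p q)%N%:Z.
  apply: sord_uniq (hv i) (ms E a b i _ aE dE ea eb _).
  by rewrite ap bq; apply: is_minweight_scale; exact: wmP.
rewrite /disc /weight.
have -> : \sum_(i < r) e i * (v i)%:~R = \sum_(i < r) g%:R * (e i * (minweight (W i) p q)%:R).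
  by apply: eq_bigr => i _; rewrite ev PoszM rmorphM /= mulrCA.
rewrite -mulr_sumr mulrBr lerD2r.
have := logdisc_ge R rp aE dE; rewrite ea eb -(ler_int R) => le; apply: le_trans le.
by rewrite -natrM mulnDr -ap -bq -PoszD.
Qed.

End Data.

Lemma adapted_toric_data (k : closedFieldType) (K : fieldType) (iota : {rmorphism k -> K})
    (O : set K) (S : 'I_r -> set K) x0 y0 e : (forall i, 0 < e i) -> regpt iota O x0 y0 ->
  (forall i, nzset O (S i)) -> lc_over iota O S e ->
  exists W : 'I_r -> set (nat * nat), (forall i, W i !=set0) /\ forall e', (forall i, 0 <= e' i) ->
    (forall m : 'I_r -> nat, \sum_(i < r) e i * (m i)%:R <= 1 -> \sum_(i < r) e' i * (m i)%:R <= 1) ->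
    toric_data iota O S W e'.
Proof.
move=> e0 rp0 nz lc.
have [|x [y [rp H]]] := adapted_coordinates e0 rp0 nz.
  by move=> E v aE dE hv; apply: lc => //; exact: admissible_reach rp0 aE dE.
(* All expansions of all elements contribute: [toric_ord] holds for each of them, so no canonical
   choice of coefficients is made. *)
pose W i := [set w | exists f c, [/\ S i f, f != 0, expansion iota O x y f c & c w != 0]].
have SO i f : S i f -> O f by case: (nz i) => h _; exact: h.
have tsord E p q i m : toric iota E O x y p q -> is_minweight (W i) p q m -> sord E (S i) m%:Z.
  move=> tE [[w [f [c [Sf f0 hc cw]]] ew] hm]; split.
    move=> g Sg g0; have [d hd] := expansion_ex rp (SO _ _ Sg).
    have [n [-> _ [u [du <-]]]] := toric_ord tE (SO _ _ Sg) g0 hd.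
    by rewrite lez_nat; apply: hm; exists g, d.
  exists f; split=> //; have [n [-> hn [u [du eu]]]] := toric_ord tE (SO _ _ Sf) f0 hc.
  congr Posz; apply/eqP; rewrite eqn_leq -{1}ew hn //= -eu hm //; by exists f, c.
have hW i : W i !=set0.
  have [_ [f Sf f0]] := nz i; have [c hc] := expansion_ex rp (SO _ _ Sf).
  have [E tE] := toric_exists rp (coprime1n 1) (ltnSn 0) (ltnSn 0).
  have [n [_ _ [u [du _]]]] := toric_ord tE (SO _ _ Sf) f0 hc.
  by exists u, f, c.
exists W; split=> // e' e'0 imp; split.
  move=> p q cpq p0 q0; have [E tE] := toric_exists rp cpq p0 q0.
  have [ex ey el _] := toric_facts tE.
  exists E, (fun i => (minweight (W i) p q)%:Z); split; first exact: toric_reach tE.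
    by move=> i; apply: tsord tE _; exact: wmP.
  by rewrite /disc el /weight.
move=> E v rE hv; have [aE dE] := reach_admissible rE.
have [p [q [n [N [n0 cpq tN _ hle]]]]] := H E aE dE.
have [ex ey el /andP[p0 q0]] := toric_facts tN.
exists p, q, n; split=> //.
have := hle e' v (fun i => (minweight (W i) p q)%:Z) e'0 imp hv.
by rewrite el /weight /disc; apply=> i; apply: tsord tN _; exact: wmP.
Qed.

End ToricData.

(** * Transfer of mld and lct to monomial ideals *)

Section Transfer.
Context (R : realType) (r : nat).
Context (k : closedFieldType) (K : fieldType) (iota : {rmorphism k -> K}).
Context (O : set K) (S : 'I_r -> set K) (x0 y0 : K) (e : 'I_r -> R).
Hypotheses (e0 : forall i, 0 < e i) (rp0 : regpt iota O x0 y0) (nz : forall i, nzset O (S i)).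
Implicit Types (W : 'I_r -> set (nat * nat)) (c : R).

Let ew i : 0 <= e i := ltW (e0 i).

Lemma minweight_set1 (w : nat * nat) p q : minweight [set w] p q = (p * w.1 + q * w.2)%N.
Proof. by have [|[v -> <-] _] := @wmP [set w] p q; first by exists w. Qed.

Lemma monideal_nz (k' : closedFieldType) (K' : fieldType) (iota' : {rmorphism k' -> K'}) (O' : set K') x y W :
  regpt iota' O' x y -> (forall i, W i !=set0) -> forall i, nzset O' (monideal x y (W i) O').
Proof.
move=> rp hW i; have [h _] := rp_alg rp; split.
  by move=> z; apply: ideal_sub; apply: monideal_ideal => //; [exact: rp_x rp|exact: rp_y rp].
have [w Ww] := hW i; exists (x ^+ w.1 * y ^+ w.2); first exact: monideal_mem.
by rewrite mulf_neq0 // expf_neq0 // ?(rp_x0 rp) ?(rp_y0 rp).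
Qed.

Lemma mld_transfer : exists W, (forall i, W i !=set0) /\
  forall (k' : closedFieldType) (K' : fieldType) (iota' : {rmorphism k' -> K'}) (O' : set K') x y,
    regpt iota' O' x y -> mld_over iota' O' (fun i => monideal x y (W i) O') e = mld_over iota O S e.
Proof.
have [lc|nlc] := EM (lc_over iota O S e).
  have [W [hW td]] := adapted_toric_data e0 rp0 nz lc; exists W; split=> // k' K' iota' O' x y rp.
  have tk := td e ew (fun m => id); have tp := plane_toric_data rp hW ew.
  rewrite (toric_mld tk lc) (toric_mld tp) //.
  by apply/(toric_lc tp)/(toric_lc tk).
pose mult i := smult O x0 y0 (S i).
have big : 1 < \sum_(i < r) e i * (mult i)%:R.
  by rewrite ltNge; apply/negP => le; apply: nlc; exact: small_lc le.
(* The total multiplicity exceeds 1 by [small_lc]; the factor 3 brings it above 2, the log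
   discrepancy of the ordinary blow-up, so the monomial ideals are not log canonical either. *)
exists (fun i => [set (3 * mult i, 0)%N]); split=> [i|k' K' iota' O' x y rp].
  by exists (3 * mult i, 0)%N.
have hW i : [set (3 * mult i, 0)%N] !=set0 by exists (3 * mult i, 0)%N.
rewrite (mld_infinite nz ew nlc) mld_infinite //; first exact: (monideal_nz rp hW).
move/(toric_lc (plane_toric_data rp hW ew)) => /(_ 1%N 1%N isT isT isT).
rewrite /weight (eq_bigr (fun i => 3 * (e i * (mult i)%:R))); last first.
  by move=> i _; rewrite minweight_set1 /= !mul1n addn0 natrM; ring.
by rewrite -mulr_sumr; move: big; lra.
Qed.

Lemma lct_transfer : exists W, (forall i, W i !=set0) /\
  forall (k' : closedFieldType) (K' : fieldType) (iota' : {rmorphism k' -> K'}) (O' : set K') x y,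
    regpt iota' O' x y -> forall c, 0 < c ->
    lc_over iota' O' (fun i => monideal x y (W i) O') (fun i => c * e i) <-> lc_over iota O S (fun i => c * e i).
Proof.
pose lc c := lc_over iota O S (fun i => c * e i).
have ce c : 0 < c -> forall i, 0 <= c * e i by move=> c0 i; rewrite mulr_ge0 // ltW.
have mono c c' : c' <= c -> lc c -> lc c'.
  by move=> le; apply: lc_mono => // i; rewrite ler_pM2r.
(* When no multiple fails to be log canonical, unit ideals reproduce the infinite threshold. *)
have [all|] := EM (forall c, 0 < c -> lc c).
  have hW : [set (0, 0)%N] !=set0 by exists (0, 0)%N.
  exists (fun i => [set (0, 0)%N]); split=> [i|k' K' iota' O' x y rp c c0]; first by exists (0, 0)%N.
  split=> _; first exact: all.
  apply/(toric_lc (plane_toric_data rp (fun i : 'I_r => hW) (ce c c0))) => p q _ _ _.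
  rewrite /weight big1 ?subr0 ?ler0n // => i _; by rewrite minweight_set1 /= !muln0 mulr0.
move=> /existsNP [cb /not_implyP [cb0 ncb]].
pose L := [set c | 0 < c /\ lc c].
have [cs cs0 lcs] : exists2 c, 0 < c & lc c.
  pose s := \sum_(i < r) e i * (smult O x0 y0 (S i))%:R.
  have s0 : 0 <= s by apply: sumr_ge0 => i _; rewrite mulr_ge0.
  have s1 : 0 < 1 + s by lra.
  exists (1 + s)^-1; first by rewrite invr_gt0.
  apply: (small_lc rp0 nz); first by apply: ce; rewrite invr_gt0.
  rewrite (eq_bigr (fun i => (1 + s)^-1 * (e i * (smult O x0 y0 (S i))%:R))); last by move=> i _; rewrite mulrA.
  rewrite -mulr_sumr -/s mulrC ler_pdivrMr //; lra.
have hs : has_sup L.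
  split; first by exists cs.
  exists cb => c [c0 hc]; rewrite leNgt; apply/negP => lt; apply: ncb; exact: mono (ltW lt) hc.
pose c0 := sup L.
have ubL c : L c -> c <= c0 by move=> Lc; apply: sup_upper_bound.
have c00 : 0 < c0 by exact: lt_le_trans cs0 (ubL cs (conj cs0 lcs)).
(* Every divisor imposes a linear inequality on c, so log canonicity persists at the supremum. *)
have lc0 : lc c0.
  move=> E v rE hv; rewrite leNgt; apply/negP.
  have dE c : disc iota O E v (fun i => c * e i) = (logdisc iota O E)%:~R - c * \sum_(i < r) e i * (v i)%:~R.
    by rewrite /disc mulr_sumr; congr (_ - _); apply: eq_bigr => i _; rewrite mulrA.
  rewrite dE; set s := \sum_(i < r) _; set l := _%:~R => neg.
  have l0 : 0 <= l.
    have [aE domE] := reach_admissible rE; rewrite /l ler0z; exact: le_trans (logdisc_ge1 rp0 aE domE).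
  have s0 : 0 < s.
    have : 0 < c0 * s by lra.
    by rewrite pmulr_rgt0.
  have ls : l / s < c0 by rewrite ltr_pdivrMr //; lra.
  have [|c [cp hc] lt] := @sup_adherent _ L (c0 - l / s) _ hs; first by rewrite subr_gt0.
  have := hc E v rE hv; rewrite dE -/s -/l subr_ge0 -ler_pdivlMr // leNgt => /negP; apply.
  by move: lt; rewrite -/c0 subKr.
have lcP c : 0 < c -> lc c <-> c <= c0.
  by move=> cp; split=> [hc|le]; [exact: ubL|exact: mono le lc0].
have c0e i : 0 < c0 * e i by rewrite mulr_gt0.
have [dl dl0 gap] := sum_gap c0e.
have scale c (m : 'I_r -> nat) : \sum_(i < r) c * e i * (m i)%:R = c / c0 * \sum_(i < r) c0 * e i * (m i)%:R.
  rewrite mulr_sumr; apply: eq_bigr => i _; have c0' : c0 != 0 by rewrite gt_eqF.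
  by field.
have [[mult emu]|nomu] := EM (exists m : 'I_r -> nat, \sum_(i < r) c0 * e i * (m i)%:R = 1).
  have hW i : [set (mult i, 0)%N] !=set0 by exists (mult i, 0)%N.
  exists (fun i => [set (mult i, 0)%N]); split=> // k' K' iota' O' x y rp c cp.
  apply: iff_trans (iff_sym (lcP c cp)).
  have wE p q : weight (fun i => [set (mult i, 0)%N]) (fun i => c * e i) p q = (p + q)%:R - c / c0 * p%:R.
    have -> : c / c0 = \sum_(i < r) c * e i * (mult i)%:R by rewrite scale emu mulr1.
    rewrite /weight mulr_suml; congr (_ - _).
    by apply: eq_bigr => i _; rewrite minweight_set1 /= muln0 addn0 natrM; ring.
  apply: iff_trans (toric_lc (plane_toric_data rp hW (ce c cp))) _; split=> [hw|le p q _ _ _].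
    (* For c > c0 the weights (n, 1) with n > 1 / t give the negative value 1 - t n. *)
    rewrite leNgt; apply/negP => lt; pose t := c / c0 - 1.
    have t0 : 0 < t by rewrite subr_gt0 ltr_pdivlMr // mul1r.
    have := archi_boundP (ltW (_ : 0 < t^-1)); rewrite invr_gt0 => /(_ t0).
    set n := Num.bound _ => hn.
    have n0 : (0 < n)%N by rewrite -(ltr0n R); apply: lt_trans hn; rewrite invr_gt0.
    have := hw n 1%N (coprimen1 n) n0 isT; rewrite wE natrD.
    have : 1 < t * n%:R by rewrite -ltr_pdivrMl // mulr1.
    by rewrite /t mulrBl mul1r; lra.
  rewrite wE natrD; have : c / c0 * p%:R <= p%:R.
    by rewrite ler_piMl ?ler0n // ler_pdivrMr // mul1r.
  have : 0 <= q%:R :> R by rewrite ler0n.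
  lra.
have [W [hW td]] := adapted_toric_data c0e rp0 nz lc0.
exists W; split=> // k' K' iota' O' x y rp.
(* Sums at most 1 are now at most 1 - dl, and (1 + dl) (1 - dl) <= 1, so the same coordinates serve
   up to c1. As c1 exceeds c0, failure at c1 settles all larger c by monotonicity. *)
pose c1 := c0 * (1 + dl).
have c10 : c0 < c1 by rewrite /c1 ltr_pMr // ltrDl.
have near c : 0 < c -> c <= c1 -> lc_over iota' O' (fun i => monideal x y (W i) O') (fun i => c * e i) <-> lc c.
  move=> cp le; apply: iff_trans (toric_lc (plane_toric_data rp hW (ce c cp))) _.
  apply: iff_sym; apply: toric_lc; apply: td; first exact: ce.
  move=> m sm; rewrite scale; set s := \sum_(i < r) _ in sm *.
  have s0 : 0 <= s by apply: sumr_ge0 => i _; rewrite mulr_ge0 // ltW.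
  have sdl : s <= 1 - dl.
    have [s1|] := gap m; first by case: nomu; exists m.
    by rewrite -/s ler0_norm; lra.
  have cc : c / c0 <= 1 + dl by rewrite ler_pdivrMr // mulrC.
  have : c / c0 * s <= (1 + dl) * (1 - dl).
    by apply: ler_pM => //; rewrite divr_ge0 // ltW.
  have : 0 <= dl * dl by rewrite mulr_ge0 // ltW.
  by lra.
move=> c cp; have [le|lt] := lerP c c1; first exact: near.
have c1p : 0 < c1 by exact: lt_trans c10.
split=> [hc|/(lcP c cp) le]; last by exfalso; move: le lt c10; lra.
exfalso; have : lc c1.
  apply/(near c1 c1p (lexx _)); apply: lc_mono hc; first exact: (monideal_nz rp hW).
  by move=> i; rewrite ler_pM2r // ltW.
by move/(lcP c1 c1p); move: c10; lra.
Qed.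

End Transfer.

Theorem corollary1p4 (R : realType) (k : closedFieldType) (p : nat)
    (hp : p \in [pchar k]) (r : nat) (e : 'I_r -> R)
    (he : forall i, 0 < e i) :
  mld_set k e `<=` mld_set R[i] e /\
  lct_set k e `<=` lct_set R[i] e.
Proof.
split=> _ [K [iota [A [P [a [sm ma ->]]]]]].
  have [x [y [rp h3]]] := smooth_point_regpt hp sm; have [nA _ [AP _] _] := sm.
  have [nz _ _ mE] := bridge R nA AP rp h3 ma.
  have [W [hW hmld]] := mld_transfer he rp nz.
  have [K' [iota' [X [O [x' [y' [sm' mb rp' h3']]]]]]] := @monomial_model R[i] r W hW.
  have [nX _ [XO _] _] := sm'; have [_ _ _ mE'] := bridge R nX XO rp' h3' mb.
  exists K', iota', X, O, (fun i => monideal x' y' (W i)); split=> //.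
  by rewrite mE mE' hmld.
have [x [y [rp h3]]] := smooth_point_regpt hp sm; have [nA _ [AP _] _] := sm.
have [nz _ lE _] := bridge R nA AP rp h3 ma.
have [W [hW hlct]] := lct_transfer he rp nz.
have [K' [iota' [X [O [x' [y' [sm' mb rp' h3']]]]]]] := @monomial_model R[i] r W hW.
have [nX _ [XO _] _] := sm'; have [_ _ lE' _] := bridge R nX XO rp' h3' mb.
exists K', iota', X, O, (fun i => monideal x' y' (W i)); split=> //.
rewrite /lct; congr ereal_sup; congr image.
rewrite eqEsubset; split=> c [c0 hc]; split=> //.
  by apply/lE'/(hlct _ _ _ _ _ _ rp' c c0)/lE.
by apply/lE/(hlct _ _ _ _ _ _ rp' c c0)/lE'.
Qed.
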